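(* Let $M$ be a germ of real analytic submanifold at the origin of $\mathbb C^n$, $n=2p$. Suppose that $M$ is formally equivalent to a product quadric that has distinct eigenvalues. Suppose that each hyperbolic component has an eigenvalue $\mu_h$ which is either a root of unity or satisfies the Brjuno small divisors condition. Then $M$ is holomorphically equivalent to the product quadric.
   Context: Write $z=(z',z'')\in\mathbb C^p\times\mathbb C^p$. Let $e_*,h_*,s_*\ge0$, $e_*+h_*+2s_*=p$; indices range over $1\le e\le e_*$, $e_*<h\le e_*+h_*$, $e_*+h_*<s\le p-s_*$. A product quadric is $z_{p+e}=(z_e+2\gamma_e\bar z_e)^2$, $z_{p+h}=(z_h+2\gamma_h\bar z_h)^2$, $z_{p+s}=(z_s+2\gamma_s\bar z_{s+s_*})^2$, $z_{p+s+s_*}=(z_{s+s_*}+2(1-\bar\gamma_s)\bar z_s)^2$ with $0<\gamma_e<1/2$, $1/2<\gamma_h<\infty$, $\operatorname{Re}\gamma_s>1/2$, $\operatorname{Im}\gamma_s>0$. Put $\gamma_e=(\lambda_e+\lambda_e^{-1})^{-1}$, $\lambda_e>1$; $\gamma_h=(\lambda_h+\bar\lambda_h)^{-1}$, $|\lambda_h|=1$, $\arg\lambda_h\in(0,\pi/2)$; $\gamma_s=(1+\lambda_s^{-2})^{-1}$, $|\lambda_s|>1$, $\arg\lambda_s\in(0,\pi/2)$; $\lambda_{s+s_*}=\bar\lambda_s^{-1}$; $\mu_j=\lambda_j^2$. The eigenvalues of the quadric (i.e. of its associated linear map $\sigma$) are $\mu_1,\dots,\mu_p,\mu_1^{-1},\dots,\mu_p^{-1}$;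 it has distinct eigenvalues if these $2p$ numbers are distinct. Brjuno condition for $\mu_h$: $-\sum_{k\ge1}2^{-k}\log\omega_k<\infty$, where $\omega_k=\inf\{|\mu_h^{q_1-q_2}-\mu_h^{\epsilon}|\neq0\colon q_1,q_2\in\mathbb N,\ 2\le q_1+q_2\le2^k,\ \epsilon=\pm1\}$. Formal (holomorphic) equivalence is by formal biholomorphisms (germs of biholomorphisms) of $(\mathbb C^{2p},0)$. *)

(* Defs.v *)
From HB Require Import structures.
From mathcomp Require Import all_boot all_order all_algebra.
From mathcomp Require Import all_classical all_reals all_analysis.
From mathcomp Require Import complex.

Set Implicit Arguments.
Unset Strict Implicit.
Unset Printing Implicit Defensive.

Import Order.TTheory GRing.Theory Num.Theory.
Import numFieldNormedType.Exports.

Local Open Scope classical_set_scope.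
Local Open Scope ring_scope.
Local Open Scope complex_scope.

Definition multiindex (m : nat) := {ffun 'I_m -> nat}.

Definition mi_deg m (u : multiindex m) : nat := (\sum_(i < m) u i)%N.

Definition mi_unit m (i : 'I_m) : multiindex m := [ffun k => (k == i : nat)].

(* The multi-indices with all entries < N form the finite type
   {ffun 'I_m -> 'I_N}; all sums below range over such a type. *)
Definition mi_of m N (u : {ffun 'I_m -> 'I_N}) : multiindex m :=
  [ffun i => u i : nat].

Definition fps (K : Type) (m : nat) := multiindex m -> K.

Section FormalPowerSeries.
Context {K : comPzRingType}.

Definition fps_one m : fps K m := fun u => (u == 0)%:R.

Definition fps_var m (i : 'I_m) : fps K m := fun u => (u == mi_unit i)%:R.

Definition fps_mul m (a b : fps K m) : fps K m := fun w =>
  \sum_(u : {ffun 'I_m -> 'I_(mi_deg w).+1})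
    \sum_(v : {ffun 'I_m -> 'I_(mi_deg w).+1} | mi_of u + mi_of v == w)
      a (mi_of u) * b (mi_of v).

Definition fps_monomial m k (g : 'I_k -> fps K m) (u : multiindex k) : fps K m :=
  \big[@fps_mul m / @fps_one m]_(i < k) iter (u i) (fps_mul (g i)) (@fps_one m).

(* The series f(g_1, ..., g_k), for g_1, ..., g_k without constant term: then
   g^u does not contribute to the coefficient of X^w when |u| > |w|, so the
   finite sum is the full one.  Not meaningful if some g_i has a constant
   term. *)
Definition fps_comp m k (f : fps K k) (g : 'I_k -> fps K m) : fps K m := fun w =>
  \sum_(u : {ffun 'I_k -> 'I_(mi_deg w).+1})
    f (mi_of u) * fps_monomial g (mi_of u) w.

(* [F] is a formal biholomorphism of (K^n, 0), with inverse [G]. *)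
Definition formal_automorphism n (F G : 'I_n -> fps K n) : Prop :=
  [/\ forall i, F i 0 = 0, forall i, G i 0 = 0,
      forall i, fps_comp (F i) G =1 fps_var i
    & forall i, fps_comp (G i) F =1 fps_var i].

End FormalPowerSeries.

Section Analytic.
Context {K : numFieldType}.

Definition near0 m (P : 'rV[K]_m -> Prop) : Prop :=
  \forall x \near (0 : 'rV[K]_m), P x.

(* The Cauchy estimates say that [a] converges absolutely on a polydisc around
   0, so the order of summation is immaterial. *)
Definition expands_at0 m (f : 'rV[K]_m -> K) (a : fps K m) : Prop :=
  (exists C r : K, forall u, `|a u| <= C * r ^+ mi_deg u) /\
  near0 (fun x : 'rV[K]_m =>
    (fun N : nat => \sum_(u : {ffun 'I_m -> 'I_N})
                a (mi_of u) * \prod_(i < m) x 0 i ^+ u i) @ \oo --> f x).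

(* For K = R this is real analyticity near 0, for K = R[i] holomorphy near 0. *)
Definition analytic_at0 m k (F : 'rV[K]_m -> 'rV[K]_k) : Prop :=
  forall j, exists a : fps K m, expands_at0 (fun x => F x 0 j) a.

(* [F] is a germ of analytic isomorphism of (K^n, 0), with inverse [G]. *)
Definition analytic_automorphism n (F G : 'rV[K]_n -> 'rV[K]_n) : Prop :=
  [/\ analytic_at0 F, analytic_at0 G, F 0 = 0 & G 0 = 0] /\
  (near0 (fun x => G (F x) = x) /\ near0 (fun y => F (G y) = y)).

End Analytic.

Section RealSubmanifolds.
Context {R : realType}.
Local Notation C := R[i].

(* C^n is identified with R^(2n) through (Re z, Im z). *)
Definition complexify n (x : 'rV[R]_(n + n)) : 'rV[C]_n :=
  \row_j (x 0 (lshift n j) +i* x 0 (rshift n j)).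

(* Existence of a slice chart of dimension d around 0. *)
Definition real_analytic_submanifold_at0 m (d : nat) (S : set 'rV[R]_m) : Prop :=
  (d <= m)%N /\
  exists Phi Psi : 'rV[R]_m -> 'rV[R]_m,
    analytic_automorphism Phi Psi /\
    near0 (fun x => S x <-> forall i : 'I_m, (d <= i)%N -> Phi x 0 i = 0).

Definition analytic_submanifold_germ n (M : set 'rV[C]_n) : Prop :=
  exists d, real_analytic_submanifold_at0 d (@complexify n @^-1` M).

(* Taylor series at 0 of the real analytic germs vanishing on the germ S. *)
Definition analytic_ideal m (S : set 'rV[R]_m) : set (fps R m) :=
  [set a | exists f : 'rV[R]_m -> R,
      expands_at0 f a /\ near0 (fun x => S x -> f x = 0)].

(* The ideal of R[[X]] generated by [analytic_ideal S], i.e. the ideal of the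
   formal submanifold defined by S. *)
Definition formal_ideal m (S : set 'rV[R]_m) : set (fps R m) :=
  [set b | exists k (q a : 'I_k -> fps R m),
      (forall i, analytic_ideal S (a i)) /\
      forall u, b u = \sum_(i < k) fps_mul (q i) (a i) u].

(* The formal map of R^(2n) given by (Re F(x + iy), Im F(x + iy)). *)
Definition realification n (F : 'I_n -> fps C n) :
    'I_(n + n) -> fps R (n + n) := fun j =>
  let Z (l : 'I_n) : fps C (n + n) := fun u =>
    fps_var (lshift n l) u + (0 +i* 1) * fps_var (rshift n l) u in
  match fintype.split j with
  | inl l => fun u => complex.Re (fps_comp (F l) Z u)
  | inr l => fun u => complex.Im (fps_comp (F l) Z u)
  end.

(* Pulling back by F maps the ideal of M' into that of M, and pulling back by
   F^-1 the ideal of M into that of M': thus F maps M onto M' formally. *)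
Definition formally_equivalent n (M M' : set 'rV[C]_n) : Prop :=
  exists F G : 'I_n -> fps C n,
    [/\ formal_automorphism F G,
        forall a, formal_ideal (@complexify n @^-1` M') a ->
          formal_ideal (@complexify n @^-1` M) (fps_comp a (realification F))
      & forall a, formal_ideal (@complexify n @^-1` M) a ->
          formal_ideal (@complexify n @^-1` M') (fps_comp a (realification G))].

Definition holomorphically_equivalent n (M M' : set 'rV[C]_n) : Prop :=
  exists F G : 'rV[C]_n -> 'rV[C]_n,
    analytic_automorphism F G /\
    near0 (fun z => M z <-> M' (F z)).

(* p = es + hs + (ss + ss); the coordinates z' (or z'') in C^p are ordered as
   (z_e), (z_h), (z_s), (z_{s + s_*}). *)
Section Quadric.
Variables es hs ss : nat.
Local Notation p := (es + hs + (ss + ss))%N.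

Definition idx_e (e : 'I_es) : 'I_p := lshift (ss + ss) (lshift hs e).
Definition idx_h (h : 'I_hs) : 'I_p := lshift (ss + ss) (rshift es h).
Definition idx_s (s : 'I_ss) : 'I_p := rshift (es + hs) (lshift ss s).
Definition idx_t (s : 'I_ss) : 'I_p := rshift (es + hs) (rshift ss s).

Definition product_quadric (ge : 'I_es -> R) (gh : 'I_hs -> R)
    (gs : 'I_ss -> C) : set 'rV[C]_(p + p) :=
  [set z | let z' (j : 'I_p) := z 0 (lshift p j) in
           let z'' (j : 'I_p) := z 0 (rshift p j) in
     [/\ forall e, z'' (idx_e e) =
           (z' (idx_e e) + 2 * (ge e)%:C * conjc (z' (idx_e e))) ^+ 2,
         forall h, z'' (idx_h h) =
           (z' (idx_h h) + 2 * (gh h)%:C * conjc (z' (idx_h h))) ^+ 2,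
         forall s, z'' (idx_s s) =
           (z' (idx_s s) + 2 * gs s * conjc (z' (idx_t s))) ^+ 2
       & forall s, z'' (idx_t s) =
           (z' (idx_t s) + 2 * (1 - conjc (gs s)) * conjc (z' (idx_s s))) ^+ 2]].

(* lambda_1, ..., lambda_p, where lambda_{s + s_*} = (conj lambda_s)^-1 *)
Definition quadric_lambda (le : 'I_es -> R) (lh : 'I_hs -> C)
    (ls : 'I_ss -> C) : 'rV[C]_p :=
  row_mx (row_mx (\row_e (le e)%:C) (\row_h lh h))
         (row_mx (\row_s ls s) (\row_s (conjc (ls s))^-1)).

(* mu_1, ..., mu_p, mu_1^-1, ..., mu_p^-1, where mu_j = lambda_j ^ 2 *)
Definition quadric_eigenvalues (le : 'I_es -> R) (lh : 'I_hs -> C)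
    (ls : 'I_ss -> C) : 'rV[C]_(p + p) :=
  let mu := map_mx (fun l => l ^+ 2) (quadric_lambda le lh ls) in
  row_mx mu (map_mx GRing.inv mu).

Definition distinct_eigenvalues (le : 'I_es -> R) (lh : 'I_hs -> C)
    (ls : 'I_ss -> C) : Prop :=
  injective (fun i => quadric_eigenvalues le lh ls 0 i).

End Quadric.

Definition arg_in_0_pi2 (z : C) : Prop :=
  exists theta : R, [/\ 0 < theta, theta < pi / 2
    & z = `|z| * (cos theta +i* sin theta)].

Definition is_root_of_unity (mu : C) : Prop :=
  exists k : nat, (0 < k)%N /\ mu ^+ k = 1.

Definition brjuno_omega (mu : C) (k : nat) : R :=
  inf [set d : R | exists (q1 q2 : nat) (eps : int),
    [/\ (2 <= q1 + q2 <= 2 ^ k)%N, eps = 1 \/ eps = -1,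
        d = complex.Re `|mu ^ (q1%:Z - q2%:Z) - mu ^ eps| & d != 0]].

(* The sequence omega_k is bounded above, so the series with terms
   - 2^-k ln omega_k has a limit in ]-oo, +oo]. *)
Definition brjuno (mu : C) : Prop :=
  (\sum_(1 <= k <oo) (- (2^-1 ^+ k * ln (brjuno_omega mu k)))%:E < +oo)%E.

End RealSubmanifolds.

(* Main.v *)
(** The complexified quadric is parametrised by [(xi, eta)]; over [xi + eta] it is a branched
    covering whose deck transformations are generated by linear involutions, and the antiholomorphic
    involution [rho] conjugates this group to the one of the other projection.  A formal
    equivalence with [M] yields a formal map, commuting with [rho], that conjugates these linear
    involutions to the deck transformations of the corresponding analytic map [W] attached
    to [M].  The latter are solutions of [W o T = W], and therefore converge.  So the question is
    whether a finite set of convergent involutions, formally conjugate to linear ones by a real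
    map, is conjugate to them by a convergent real map.  A Newton iteration answers it: the
    formal conjugacy shows that every resonant obstruction vanishes, distinct eigenvalues and the
    Brjuno condition bound the small divisors, and roots of unity contribute only
    finitely many nonzero divisors.  The convergent conjugacy makes [W] invariant under the linear
    involutions, so [W] descends to the sought biholomorphism of the ambient space. *)

Require Import Defs.
From HB Require Import structures.
From mathcomp Require Import all_boot all_order all_algebra all_fingroup.
From mathcomp Require Import all_classical all_reals all_analysis.
From mathcomp Require Import complex.
From mathcomp Require Import ring lra zify.

Set Implicit Arguments.
Unset Strict Implicit.
Unset Printing Implicit Defensive.

Import Order.TTheory GRing.Theory Num.Theory.
Import numFieldNormedType.Exports.

Local Open Scope ring_scope.

(** * Formal power series and substitution *)

Lemma mi_degD m (u v : multiindex m) : mi_deg (u + v) = (mi_deg u + mi_deg v)%N.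
Proof. by rewrite /mi_deg -big_split; apply: eq_bigr => i _; rewrite ffunE. Qed.

Lemma mi_deg0 m : mi_deg (0 : multiindex m) = 0%N.
Proof. by rewrite /mi_deg big1 // => i _; rewrite ffunE. Qed.

Lemma mi_deg_eq0 m (u : multiindex m) : (mi_deg u == 0%N) = (u == 0).
Proof.
rewrite /mi_deg sum_nat_eq0; apply/forallP/eqP => [h|-> i]; last by rewrite ffunE.
by apply/ffunP => i; rewrite ffunE; apply/eqP; exact: h.
Qed.

Lemma mi_deg_unit m (i : 'I_m) : mi_deg (mi_unit i) = 1%N.
Proof.
rewrite /mi_deg (bigD1 i) //= ffunE eqxx big1 ?addn0 // => j ji.
by rewrite ffunE (negbTE ji).
Qed.

Lemma mi_split m (u : multiindex m) n : mi_deg u = n.+1 ->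
  exists i v, u = mi_unit i + v.
Proof.
move=> un; have [i ui] : exists i, (0 < u i)%N.
  apply: contrapT => H; move: un; rewrite /mi_deg big1 // => i _; apply/eqP.
  by rewrite eqn0Ngt; apply/negP => ui; apply: H; exists i.
exists i, [ffun j => (u j - (j == i))%N].
apply/ffunP => j; rewrite !ffunE; case: eqP => [->|_]; first by rewrite -[LHS](subnKC ui).
by rewrite subn0 add0r.
Qed.

Lemma mi_unitP m (u : multiindex m) : mi_deg u = 1%N -> exists i, u = mi_unit i.
Proof.
move=> u1; have [i [v uv]] := mi_split u1; exists i; move: u1.
rewrite {1}uv mi_degD mi_deg_unit => -[] /eqP; rewrite mi_deg_eq0 => /eqP v0.
by rewrite uv v0 addr0.
Qed.

Lemma mi_le_deg m (u : multiindex m) i : (u i <= mi_deg u)%N.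
Proof. by rewrite /mi_deg (bigD1 i) //= leq_addr. Qed.

Lemma mi_of_inj m N : injective (@mi_of m N).
Proof. by move=> u v /ffunP h; apply/ffunP => i; apply/val_inj; move: (h i); rewrite !ffunE. Qed.

Lemma mi_ofP m N (u : multiindex m) : (forall i, u i < N)%N -> exists v, @mi_of m N v = u.
Proof.
by move=> h; exists [ffun i => Ordinal (h i)]; apply/ffunP => i; rewrite !ffunE.
Qed.

Definition mis m N : seq (multiindex m) :=
  [seq u <- [seq mi_of u | u <- enum {ffun 'I_m -> 'I_N.+1}] | (mi_deg u <= N)%N].

Lemma mis_uniq m N : uniq (mis m N).
Proof. by rewrite filter_uniq // map_inj_uniq ?enum_uniq //; exact: mi_of_inj. Qed.

Lemma mem_mis m N u : (u \in mis m N) = (mi_deg u <= N)%N.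
Proof.
rewrite mem_filter andb_idr // => h.
have [|v <-] := @mi_ofP m N.+1 u; last by rewrite map_f // mem_enum.
by move=> i; rewrite ltnS (leq_trans (mi_le_deg u i)).
Qed.

Section Sums.
Context {V : nmodType}.
Implicit Type m : nat.

Lemma sum_box m B N (F : multiindex m -> V) : (N < B)%N ->
  (forall u, (N < mi_deg u)%N -> F u = 0) ->
  \sum_(u : {ffun 'I_m -> 'I_B}) F (mi_of u) = \sum_(u <- mis m N) F u.
Proof.
move=> NB F0; rewrite -(big_map (@mi_of m B) predT F) (bigID (fun u => mi_deg u <= N)%N) /=.
rewrite [X in _ + X]big1 ?addr0; last by move=> u; rewrite -ltnNge => /F0.
rewrite -big_filter; apply: perm_big; apply: uniq_perm.
- by rewrite filter_uniq // map_inj_uniq ?index_enum_uniq //; exact: mi_of_inj.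
- exact: mis_uniq.
move=> u; rewrite mem_filter mem_mis; apply: andb_idr => uN.
have [|v <-] := @mi_ofP m B u; last by rewrite map_f // mem_index_enum.
by move=> i; rewrite (leq_trans _ NB) // ltnS (leq_trans (mi_le_deg u i)).
Qed.

Lemma sum_mis_widen m N N' (F : multiindex m -> V) : (N <= N')%N ->
  (forall u, (N < mi_deg u)%N -> F u = 0) ->
  \sum_(u <- mis m N') F u = \sum_(u <- mis m N) F u.
Proof.
move=> NN F0; rewrite (bigID (fun u => mi_deg u <= N)%N) /=.
rewrite [X in _ + X]big1 ?addr0; last by move=> u; rewrite -ltnNge => /F0.
rewrite -big_filter; apply: perm_big; apply: uniq_perm.
- by rewrite filter_uniq // mis_uniq.
- exact: mis_uniq.
by move=> u; rewrite mem_filter !mem_mis; apply: andb_idr => /leq_trans ->.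
Qed.

Lemma sum_mis_eq m N (w : multiindex m) (F : multiindex m -> V) :
  (mi_deg w <= N)%N -> \sum_(u <- mis m N | u == w) F u = F w.
Proof.
by move=> wN; rewrite -big_filter filter_pred1_uniq ?mis_uniq ?mem_mis // big_seq1.
Qed.

End Sums.

Lemma mi_addIr m (u v w : multiindex m) : u + w = v + w -> u = v.
Proof.
by move=> /ffunP h; apply/ffunP => i; move: (h i); rewrite !ffunE => /addIn.
Qed.

Section Ring.
Context {K : comNzRingType} {m : nat}.
Implicit Types a b c : fps K m.

Lemma fps_mulE N a b w : (mi_deg w <= N)%N ->
  fps_mul a b w = \sum_(u <- mis m N) \sum_(v <- mis m N | u + v == w) a u * b v.
Proof.
move=> wN; rewrite /fps_mul.
pose F u := \sum_(v : {ffun 'I_m -> 'I_(mi_deg w).+1} | u + mi_of v == w) a u * b (mi_of v).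
have F0 u : (mi_deg w < mi_deg u)%N -> F u = 0.
  move=> h; apply: big1 => v /eqP /(congr1 (@mi_deg m)); rewrite mi_degD => e.
  by have := leq_addr (mi_deg (mi_of v)) (mi_deg u); rewrite e leqNgt h.
rewrite (sum_box (F := F) (leqnn _) F0) -(sum_mis_widen wN F0).
apply: eq_bigr => u _; rewrite /F big_mkcond /= [RHS]big_mkcond /=.
pose H v := if u + v == w then a u * b v else 0.
have H0 v : (mi_deg w < mi_deg v)%N -> H v = 0.
  move=> h; rewrite /H; case: eqP => // /(congr1 (@mi_deg m)); rewrite mi_degD => e.
  by have := leq_addl (mi_deg u) (mi_deg v); rewrite e leqNgt h.
by rewrite (sum_box (F := H) (leqnn _) H0) (sum_mis_widen wN H0).
Qed.

HB.instance Definition _ := gen_eqMixin (fps K m).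
HB.instance Definition _ := gen_choiceMixin (fps K m).

Definition fps_zero : fps K m := fun=> 0.
Definition fps_add a b : fps K m := fun u => a u + b u.
Definition fps_opp a : fps K m := fun u => - a u.

Fact fps_addA : associative fps_add.
Proof. by move=> a b c; apply/funext => u; exact: addrA. Qed.
Fact fps_addC : commutative fps_add.
Proof. by move=> a b; apply/funext => u; exact: addrC. Qed.
Fact fps_add0 : left_id fps_zero fps_add.
Proof. by move=> a; apply/funext => u; exact: add0r. Qed.
Fact fps_addN : left_inverse fps_zero fps_opp fps_add.
Proof. by move=> a; apply/funext => u; exact: addNr. Qed.

HB.instance Definition _ :=
  GRing.isZmodule.Build (fps K m) fps_addA fps_addC fps_add0 fps_addN.

Lemma fps_addE a b u : (a + b) u = a u + b u. Proof. by []. Qed.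
Lemma fps_oppE a u : (- a) u = - a u. Proof. by []. Qed.
Lemma fps_subE a b u : (a - b) u = a u - b u. Proof. by []. Qed.
Lemma fps_zeroE u : (0 : fps K m) u = 0. Proof. by []. Qed.
Lemma fps_sumE I r (P : pred I) (F : I -> fps K m) u :
  (\sum_(i <- r | P i) F i) u = \sum_(i <- r | P i) F i u.
Proof. by elim/big_rec2: _ => // i x y _ <-. Qed.

Lemma fps_mulEs N a b w : (mi_deg w <= N)%N ->
  fps_mul a b w = \sum_(u <- mis m N) \sum_(v <- mis m N) (a u * b v) *+ (u + v == w).
Proof.
move=> /(fps_mulE a b) ->; apply: eq_bigr => u _; rewrite big_mkcond /=.
by apply: eq_bigr => v _; case: eqP.
Qed.

Fact fps_mulC : commutative (@fps_mul K m).
Proof.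
move=> a b; apply/funext => w; rewrite !(fps_mulEs _ _ (leqnn _)) exchange_big /=.
by apply: eq_bigr => u _; apply: eq_bigr => v _; rewrite mulrC addrC.
Qed.

Lemma fps_mul3E a b c N w : (mi_deg w <= N)%N -> fps_mul (fps_mul a b) c w =
  \sum_(u <- mis m N) \sum_(v <- mis m N) \sum_(t <- mis m N)
     (a u * b v * c t) *+ (u + v + t == w).
Proof.
move=> wN; rewrite (fps_mulEs _ _ wN).
under eq_big_seq => s; first (rewrite mem_mis => sN; under eq_bigr => t _ do
  rewrite (fps_mulEs _ _ sN) mulr_suml -sumrMnl); first over.
under eq_bigr do rewrite exchange_big.
rewrite exchange_big /=; apply: eq_bigr => u _.
under eq_bigr => s _ do under eq_bigr => t _ do rewrite mulr_suml -sumrMnl.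
under eq_bigr => s _ do rewrite exchange_big.
rewrite exchange_big /=; apply: eq_bigr => v _.
rewrite exchange_big /=; apply: eq_bigr => t _.
have [e|ne] := eqVneq (u + v + t) w; last first.
  apply: big1 => s _; have [e|] := eqVneq (u + v) s; last by rewrite mulr0n mul0r mul0rn.
  by rewrite -e (negbTE ne).
rewrite (bigID (fun s => s == u + v)) /= addrC big1 ?add0r => [|s /negbTE h].
  rewrite sum_mis_eq ?eqxx ?e ?eqxx //; apply: leq_trans wN.
  by rewrite -e [mi_deg (_ + t)]mi_degD leq_addr.
by rewrite eq_sym h mulr0n mul0r mul0rn.
Qed.

Fact fps_mulA : associative (@fps_mul K m).
Proof.
move=> a b c; apply/funext => w.
rewrite fps_mulC !(fps_mul3E _ _ _ (leqnn _)).
under eq_bigr => u _ do rewrite exchange_big /=.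
rewrite exchange_big /=; apply: eq_bigr => u _; apply: eq_bigr => v _.
by apply: eq_bigr => t _; rewrite [_ + u]addrC addrA [_ * a u]mulrC mulrA.
Qed.

Fact fps_mul1 : left_id (@fps_one K m) (@fps_mul K m).
Proof.
move=> a; apply/funext => w; rewrite (fps_mulE _ _ (leqnn _)).
rewrite (bigID (fun u => u == 0)) /= sum_mis_eq ?mi_deg0 //.
rewrite [X in _ + X]big1 ?addr0 => [|u /negbTE h]; last first.
  by apply: big1 => v _; rewrite /fps_one h mul0r.
under eq_bigl do rewrite add0r.
by rewrite sum_mis_eq // /fps_one eqxx mul1r.
Qed.

Fact fps_mulDl : left_distributive (@fps_mul K m) +%R.
Proof.
move=> a b c; apply/funext => w; rewrite fps_addE !(fps_mulE _ _ (leqnn _)).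
rewrite -big_split; apply: eq_bigr => u _; rewrite -big_split; apply: eq_bigr => v _.
by rewrite fps_addE mulrDl.
Qed.

Fact fps_one_neq0 : @fps_one K m != 0.
Proof.
apply/eqP => /(congr1 (fun a : fps K m => a 0)); rewrite /fps_one eqxx => /eqP.
by rewrite oner_eq0.
Qed.

HB.instance Definition _ := GRing.Zmodule_isComNzRing.Build (fps K m)
  fps_mulA fps_mulC fps_mul1 fps_mulDl fps_one_neq0.

Lemma fps_oneE u : (1 : fps K m) u = (u == 0)%:R. Proof. by []. Qed.

Lemma fps_mulrEs N a b w : (mi_deg w <= N)%N ->
  (a * b) w = \sum_(u <- mis m N) \sum_(v <- mis m N) (a u * b v) *+ (u + v == w).
Proof. exact: fps_mulEs. Qed.

Definition fps_C (c : K) : fps K m := fun u => if u == 0 then c else 0.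

Lemma fps_CM (c : K) a u : (fps_C c * a) u = c * a u.
Proof.
rewrite -[_ * a]/(fps_mul _ _) (fps_mulE _ _ (leqnn _)).
rewrite (bigID (fun u => u == 0)) /= sum_mis_eq ?mi_deg0 //.
rewrite [X in _ + X]big1 ?addr0 => [|v /negbTE h]; last first.
  by apply: big1 => t _; rewrite /fps_C h mul0r.
under eq_bigl do rewrite add0r.
by rewrite sum_mis_eq // /fps_C eqxx.
Qed.

Lemma fps_C_is_additive : additive fps_C.
Proof.
by move=> c d; apply/funext => u; rewrite fps_subE /fps_C; case: eqP; rewrite ?subr0.
Qed.
Lemma fps_C_is_monoid_morphism : monoid_morphism fps_C.
Proof.
split; first by apply/funext => u; rewrite /fps_C fps_oneE; case: eqP.
move=> c d; apply/funext => u; rewrite fps_CM /fps_C; case: eqP => // _.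
by rewrite mulr0.
Qed.
HB.instance Definition _ := GRing.isZmodMorphism.Build K (fps K m) fps_C fps_C_is_additive.
HB.instance Definition _ := GRing.isMonoidMorphism.Build K (fps K m) fps_C fps_C_is_monoid_morphism.

Definition fps_ord n a := forall u, (mi_deg u < n)%N -> a u = 0.

Lemma fps_ord1 a : a 0 = 0 -> fps_ord 1 a.
Proof. by move=> a0 u; rewrite ltnS leqn0 mi_deg_eq0 => /eqP->. Qed.
Lemma fps_ord1E a : fps_ord 1 a -> a 0 = 0.
Proof. by apply; rewrite mi_deg0. Qed.
Lemma fps_ordD n a b : fps_ord n a -> fps_ord n b -> fps_ord n (a + b).
Proof. by move=> ha hb u un; rewrite fps_addE ha ?hb ?addr0. Qed.
Lemma fps_ordN n a : fps_ord n a -> fps_ord n (- a).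
Proof. by move=> ha u un; rewrite fps_oppE ha ?oppr0. Qed.
Lemma fps_ordB n a b : fps_ord n a -> fps_ord n b -> fps_ord n (a - b).
Proof. by move=> ha hb; apply/fps_ordD/fps_ordN. Qed.
Lemma fps_ord_sum n I r (P : pred I) F :
  (forall i, P i -> fps_ord n (F i)) -> fps_ord n (\sum_(i <- r | P i) F i).
Proof. by move=> h; elim/big_rec: _ => // i x Pi; apply/fps_ordD/h. Qed.
Lemma fps_ordW n n' a : (n' <= n)%N -> fps_ord n a -> fps_ord n' a.
Proof. by move=> nn h u un; apply: h; apply: leq_trans nn. Qed.

Lemma fps_ordM n n' a b : fps_ord n a -> fps_ord n' b -> fps_ord (n + n') (a * b).
Proof.
move=> ha hb w wn; rewrite (fps_mulrEs _ _ (leqnn _)); apply: big1 => u _.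
apply: big1 => v _; case: eqP => // e; rewrite mulr1n.
have [un|un] := ltnP (mi_deg u) n; first by rewrite ha // mul0r.
rewrite hb ?mulr0 // -(ltn_add2l n) (leq_ltn_trans _ wn) // -e mi_degD leq_add2r.
by [].
Qed.

Lemma fps_ordMl n a b : fps_ord n b -> fps_ord n (a * b).
Proof. exact: (@fps_ordM 0 n). Qed.
Lemma fps_ordMr n a b : fps_ord n a -> fps_ord n (a * b).
Proof. by move=> h; rewrite -[n]addn0; exact: fps_ordM. Qed.

Lemma fps_ordX n a k : fps_ord n a -> fps_ord (n * k) (a ^+ k).
Proof.
by move=> h; elim: k => [|k IH]; rewrite ?muln0 // exprS mulnS; exact: fps_ordM.
Qed.

Lemma fps_ord_prod k (g : 'I_k -> fps K m) (n : 'I_k -> nat) :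
  (forall i, fps_ord (n i) (g i)) -> fps_ord (\sum_i n i)%N (\prod_i g i).
Proof.
move=> h; elim/big_rec2: _ => // i x y _; exact: fps_ordM.
Qed.

Lemma fps_ord_ext a b n : fps_ord n (a - b) <-> (forall u, (mi_deg u < n)%N -> a u = b u).
Proof.
split=> h u un; first by apply/eqP; rewrite -subr_eq0 -fps_subE h.
by rewrite fps_subE h ?subrr.
Qed.

Lemma fps_ord_eq a b n u : fps_ord n (a - b) -> (mi_deg u < n)%N -> a u = b u.
Proof. by move=> /fps_ord_ext; apply. Qed.

Lemma fps_ext a b : (forall n, fps_ord n (a - b)) -> a = b.
Proof.
by move=> h; apply/funext => u; apply/eqP; rewrite -subr_eq0 -fps_subE (h (mi_deg u).+1).
Qed.

End Ring.

Arguments fps_ord {K m}.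
Arguments fps_C {K m}.

Section Comp.
Context {K : comNzRingType} {m k : nat}.
Implicit Types (f : fps K k) (g h : 'I_k -> fps K m).

Definition nc g := forall i, g i 0 = 0.

Lemma fps_monomialE g u : fps_monomial g u = \prod_i g i ^+ u i.
Proof.
rewrite /fps_monomial; apply: eq_bigr => i _.
by elim: (u i) => //= n ->; rewrite exprS.
Qed.

Lemma fps_monomialD g u v : fps_monomial g (u + v) = fps_monomial g u * fps_monomial g v.
Proof.
by rewrite !fps_monomialE -big_split; apply: eq_bigr => i _; rewrite ffunE exprD.
Qed.

Lemma fps_monomial0 g : fps_monomial g 0 = 1.
Proof. by rewrite fps_monomialE big1 // => i _; rewrite ffunE. Qed.

Lemma fps_monomial_unit g i : fps_monomial g (mi_unit i) = g i.
Proof.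
rewrite fps_monomialE (bigD1 i) //= ffunE eqxx big1 ?mulr1 // => j ji.
by rewrite ffunE (negbTE ji).
Qed.

Lemma fps_monomial_ord n g u : (forall i, fps_ord n (g i)) ->
  fps_ord (n * mi_deg u) (fps_monomial g u).
Proof.
move=> h; rewrite fps_monomialE /mi_deg big_distrr /=.
by apply: fps_ord_prod => i; exact: fps_ordX.
Qed.

Lemma fps_monomial_vanish g u w : nc g -> (mi_deg w < mi_deg u)%N -> fps_monomial g u w = 0.
Proof.
move=> g0 wu; have := @fps_monomial_ord 1 g u; rewrite mul1n; apply => // i.
exact: fps_ord1.
Qed.

Lemma fps_compE N f g w : nc g -> (mi_deg w <= N)%N ->
  fps_comp f g w = \sum_(u <- mis k N) f u * fps_monomial g u w.
Proof.
move=> g0 wN; pose F u := f u * fps_monomial g u w.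
have F0 u : (mi_deg w < mi_deg u)%N -> F u = 0.
  by move=> h; rewrite /F fps_monomial_vanish ?mulr0.
by rewrite (sum_mis_widen wN F0) -(sum_box (leqnn _) F0).
Qed.

Lemma fps_compD f f' g : fps_comp (f + f') g = fps_comp f g + fps_comp f' g.
Proof.
apply/funext => w; rewrite fps_addE /fps_comp -big_split; apply: eq_bigr => u _.
by rewrite fps_addE mulrDl.
Qed.

Lemma fps_compN f g : fps_comp (- f) g = - fps_comp f g.
Proof.
apply/funext => w; rewrite fps_oppE /fps_comp -sumrN; apply: eq_bigr => u _.
by rewrite fps_oppE mulNr.
Qed.

Lemma fps_compB f f' g : fps_comp (f - f') g = fps_comp f g - fps_comp f' g.
Proof. by rewrite fps_compD fps_compN. Qed.

Lemma fps_comp_sum I r (P : pred I) (F : I -> fps K k) g :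
  fps_comp (\sum_(i <- r | P i) F i) g = \sum_(i <- r | P i) fps_comp (F i) g.
Proof.
elim/big_rec2: _ => [|i x y _ <-]; last exact: fps_compD.
by apply/funext => w; rewrite /fps_comp big1 // => u _; rewrite mul0r.
Qed.

Lemma fps_comp0 g : fps_comp 0 g = 0.
Proof. by apply/funext => w; rewrite /fps_comp big1 // => u _; rewrite mul0r. Qed.

Lemma fps_comp_C c g : nc g -> fps_comp (fps_C c) g = fps_C c.
Proof.
move=> g0; apply/funext => w; rewrite (fps_compE _ g0 (leqnn _)).
rewrite (bigID (fun u => u == 0)) /= sum_mis_eq ?mi_deg0 //.
rewrite [X in _ + X]big1 ?addr0 => [|v /negbTE h]; last by rewrite /fps_C h mul0r.
by rewrite fps_monomial0 /fps_C eqxx fps_oneE; case: (w == 0); rewrite ?mulr1 ?mulr0.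
Qed.

Lemma fps_comp1 g : nc g -> fps_comp 1 g = 1.
Proof. move=> g0; have e k' : fps_C 1 = 1 :> fps K k' by apply/funext => u; rewrite /fps_C fps_oneE; case: eqP.
by rewrite -!e fps_comp_C. Qed.

Lemma fps_comp_ord n d f g : fps_ord n f -> (forall i, fps_ord d (g i)) -> nc g ->
  fps_ord (d * n) (fps_comp f g).
Proof.
move=> hf hg g0 w wn; rewrite (fps_compE _ g0 (leqnn _)); apply: big1 => u _.
have [un|un] := ltnP (mi_deg u) n; first by rewrite hf // mul0r.
rewrite (fps_monomial_ord (u := u) hg) ?mulr0 // (leq_trans wn) //.
by rewrite leq_mul2l un orbT.
Qed.

Lemma fps_comp_ord1 n f g : fps_ord n f -> nc g -> fps_ord n (fps_comp f g).
Proof.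
by move=> hf g0; rewrite -[n]mul1n; apply: fps_comp_ord => // i; exact: fps_ord1.
Qed.

Lemma fps_comp_nc f g : f 0 = 0 -> nc g -> fps_comp f g 0 = 0.
Proof. by move=> f0 g0; apply/fps_ord1E/fps_comp_ord1 => //; exact: fps_ord1. Qed.

Lemma fps_comp_var i g : nc g -> fps_comp (fps_var i) g = g i.
Proof.
move=> g0; apply/funext => w; rewrite (@fps_compE (mi_deg w).+1) //.
rewrite (bigID (fun u => u == mi_unit i)) /= sum_mis_eq ?mi_deg_unit //.
rewrite big1 ?addr0 => [|u /negbTE h]; last by rewrite /fps_var h mul0r.
by rewrite /fps_var eqxx mul1r fps_monomial_unit.
Qed.

End Comp.

Section Mono.
Context {K : comNzRingType} {m : nat}.

Definition fps_mono (u : multiindex m) : fps K m := fun w => (w == u)%:R.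

Lemma fps_monoM u v : fps_mono u * fps_mono v = fps_mono (u + v).
Proof.
apply/funext => w; rewrite (@fps_mulrEs _ _ (maxn (mi_deg w) (maxn (mi_deg u) (mi_deg v)))).
  rewrite (bigID (fun s => s == u)) /= sum_mis_eq; last by rewrite !leq_max leqnn !orbT.
  rewrite [X in _ + X]big1 ?addr0 => [|s /negbTE su]; last first.
    by apply: big1 => t _; rewrite /fps_mono su mul0r mul0rn.
  rewrite (bigID (fun s => s == v)) /= sum_mis_eq; last by rewrite !leq_max leqnn !orbT.
  rewrite [X in _ + X]big1 ?addr0 => [|s /negbTE su]; last by rewrite /fps_mono su mulr0 mul0rn.
  by rewrite /fps_mono !eqxx mulr1 eq_sym.
by rewrite leq_max leqnn.
Qed.

Lemma fps_var_mono i : fps_var i = fps_mono (mi_unit i). Proof. by []. Qed.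

Definition fps_trunc N (f : fps K m) : fps K m := fun u => if (mi_deg u <= N)%N then f u else 0.

Lemma fps_truncE N f : fps_trunc N f = \sum_(u <- mis m N) fps_C (f u) * fps_mono u.
Proof.
apply/funext => w; rewrite fps_sumE /fps_trunc.
under eq_bigr do rewrite fps_CM.
case: leqP => wN.
  rewrite (bigID (fun s => s == w)) /= sum_mis_eq // /fps_mono eqxx mulr1.
  by rewrite big1 ?addr0 // => s; rewrite eq_sym => /negbTE ->; rewrite mulr0.
rewrite big1_seq // => s /andP[_]; rewrite mem_mis /fps_mono; case: eqP => [<-|_ _].
  by rewrite leqNgt wN.
by rewrite mulr0.
Qed.

Lemma fps_truncP N f : fps_ord N.+1 (f - fps_trunc N f).
Proof. by apply/fps_ord_ext => u; rewrite ltnS /fps_trunc => ->. Qed.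

End Mono.

Section CompM.
Context {K : comNzRingType} {m k : nat}.
Implicit Types (f : fps K k) (g h : 'I_k -> fps K m).

Lemma fps_comp_mono u g : nc g -> fps_comp (fps_mono u) g = fps_monomial g u.
Proof.
move=> g0; apply/funext => w; rewrite (@fps_compE _ _ _ (maxn (mi_deg u) (mi_deg w))) ?leq_maxr //.
rewrite (bigID (fun s => s == u)) /= sum_mis_eq ?leq_maxl //.
rewrite big1 ?addr0 => [|s /negbTE h]; last by rewrite /fps_mono h mul0r.
by rewrite /fps_mono eqxx mul1r.
Qed.

Lemma fps_comp_CM c f g : fps_comp (fps_C c * f) g = fps_C c * fps_comp f g.
Proof.
apply/funext => w; rewrite fps_CM /fps_comp big_distrr /=; apply: eq_bigr => u _.
by rewrite fps_CM mulrA.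
Qed.

Lemma fps_compM f f' g : nc g -> fps_comp (f * f') g = fps_comp f g * fps_comp f' g.
Proof.
move=> g0; apply: fps_ext => n.
pose t := fps_trunc n f; pose t' := fps_trunc n f'.
have tt : fps_comp (t * t') g = fps_comp t g * fps_comp t' g.
  rewrite /t /t' !fps_truncE mulr_suml !fps_comp_sum mulr_suml.
  apply: eq_bigr => u _; rewrite mulr_sumr fps_comp_sum mulr_sumr.
  apply: eq_bigr => v _; rewrite !fps_comp_CM mulrACA -rmorphM fps_comp_CM fps_monoM.
  rewrite !fps_comp_mono // fps_monomialD rmorphM -!mulrA; congr (_ * _).
  by rewrite mulrCA.
have ft : fps_ord n (f - t) by apply: (@fps_ordW _ _ n.+1) => //; exact: fps_truncP.
have ft' : fps_ord n (f' - t') by apply: (@fps_ordW _ _ n.+1) => //; exact: fps_truncP.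
have -> : f * f' = t * t' + ((f - t) * f' + t * (f' - t')) by ring.
rewrite fps_compD tt.
set a := fps_comp f g; set b := fps_comp f' g.
have -> : fps_comp t g = a - fps_comp (f - t) g by rewrite fps_compB /a; ring.
have -> : fps_comp t' g = b - fps_comp (f' - t') g by rewrite fps_compB /b; ring.
set e := fps_comp (f - t) g; set e' := fps_comp (f' - t') g; set x := fps_comp _ g.
have he : fps_ord n e by exact: fps_comp_ord1.
have he' : fps_ord n e' by exact: fps_comp_ord1.
have hx : fps_ord n x.
  by apply: fps_comp_ord1 => //; apply: fps_ordD; [exact: fps_ordMr|exact: fps_ordMl].
have -> : (a - e) * (b - e') + x - a * b = x - e * (b - e') - a * e' by ring.
apply: fps_ordB; last exact: fps_ordMl.
by apply: fps_ordB => //; exact: fps_ordMr.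
Qed.

Lemma fps_comp_prod I r (P : pred I) (F : I -> fps K k) g : nc g ->
  fps_comp (\prod_(i <- r | P i) F i) g = \prod_(i <- r | P i) fps_comp (F i) g.
Proof.
move=> g0; elim/big_rec2: _ => [|i x y _ <-]; last exact: fps_compM.
exact: fps_comp1.
Qed.

Lemma fps_compX f g n : nc g -> fps_comp (f ^+ n) g = fps_comp f g ^+ n.
Proof.
by move=> g0; elim: n => [|n IH]; rewrite ?expr0 ?fps_comp1 // !exprS fps_compM ?IH.
Qed.

End CompM.

Section CompA.
Context {K : comNzRingType}.

Definition mcomp m k l (f : 'I_l -> fps K k) (g : 'I_k -> fps K m) : 'I_l -> fps K m :=
  fun i => fps_comp (f i) g.

Lemma mcomp_nc m k l (f : 'I_l -> fps K k) (g : 'I_k -> fps K m) : nc f -> nc g -> nc (mcomp f g).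
Proof. by move=> f0 g0 i; exact: fps_comp_nc. Qed.

Lemma fps_compA m k l (f : fps K l) (g : 'I_l -> fps K k) (h : 'I_k -> fps K m) :
  nc g -> nc h -> fps_comp (fps_comp f g) h = fps_comp f (mcomp g h).
Proof.
move=> g0 h0; have gh0 := mcomp_nc g0 h0; apply: fps_ext => n.
pose t := fps_trunc n f.
have tt : fps_comp (fps_comp t g) h = fps_comp t (mcomp g h).
  rewrite /t fps_truncE !fps_comp_sum; apply: eq_bigr => u _.
  rewrite !fps_comp_CM; congr (_ * _); rewrite !fps_comp_mono // !fps_monomialE fps_comp_prod //.
  by apply: eq_bigr => i _; rewrite fps_compX.
have ft : fps_ord n (f - t) by apply: (@fps_ordW _ _ n.+1) => //; exact: fps_truncP.
have -> : fps_comp (fps_comp f g) h - fps_comp f (mcomp g h) =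
    fps_comp (fps_comp (f - t) g) h - fps_comp (f - t) (mcomp g h).
  by rewrite !fps_compB tt; ring.
by apply: fps_ordB; do !apply: fps_comp_ord1 => //.
Qed.

Lemma mcompA m k l q (f : 'I_q -> fps K l) (g : 'I_l -> fps K k) (h : 'I_k -> fps K m) :
  nc g -> nc h -> mcomp (mcomp f g) h = mcomp f (mcomp g h).
Proof. by move=> g0 h0; apply/funext => i; exact: fps_compA. Qed.

Definition mid m : 'I_m -> fps K m := @fps_var K m.

Lemma mi_unit_neq0 m (i : 'I_m) : (0 == mi_unit i) = false.
Proof. by rewrite eq_sym -mi_deg_eq0 mi_deg_unit. Qed.

Lemma mid_nc m : nc (@mid m).
Proof. by move=> i; rewrite /mid /fps_var mi_unit_neq0. Qed.

Lemma mid_ord m i : fps_ord 1 (@mid m i).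
Proof. exact/fps_ord1/mid_nc. Qed.

Lemma mcomp1l m k (g : 'I_k -> fps K m) : nc g -> mcomp (@mid k) g = g.
Proof. by move=> g0; apply/funext => i; exact: fps_comp_var. Qed.

Lemma fps_monomial_mid m u : fps_monomial (@mid m) u = fps_mono u.
Proof.
rewrite fps_monomialE; apply/esym.
have -> : u = \sum_i [ffun k => if k == i then u i else 0%N].
  apply/ffunP => k; rewrite sum_ffunE (bigD1 k) //= ffunE eqxx big1 ?addr0 // => j jk.
  by rewrite ffunE eq_sym (negbTE jk).
have e i : mid i ^+ u i = fps_mono [ffun k => if k == i then u i else 0%N].
  elim: (u i) => [|n IH].
    rewrite expr0; apply/funext => w; rewrite fps_oneE /fps_mono; congr (_ == _)%:R.
    by apply/ffunP => j; rewrite !ffunE; case: eqP.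
  rewrite exprS IH [mid i]fps_var_mono fps_monoM; congr fps_mono.
  by apply/ffunP => j; rewrite !ffunE; case: eqP.
transitivity (\prod_i (@fps_mono K m [ffun k => if k == i then u i else 0%N])).
  elim/big_rec2: _ => [|i x y _ <-]; last by rewrite fps_monoM.
  by apply/funext => w; rewrite fps_oneE.
apply: eq_bigr => i _; rewrite -e; congr (_ ^+ _).
rewrite sum_ffunE (bigD1 i) //= ffunE eqxx big1 ?addr0 // => j ji.
by rewrite ffunE eq_sym (negbTE ji).
Qed.

Lemma fps_comp_id m (f : fps K m) : fps_comp f (@mid m) = f.
Proof.
apply/funext => w; rewrite (@fps_compE _ _ _ (mi_deg w) _ _ _ (@mid_nc m)) //.
under eq_bigr do rewrite fps_monomial_mid.
rewrite (bigID (fun s => s == w)) /= sum_mis_eq // /fps_mono eqxx mulr1.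
by rewrite big1 ?addr0 // => s; rewrite eq_sym => /negbTE ->; rewrite mulr0.
Qed.

Lemma mcomp1r m k (g : 'I_k -> fps K m) : mcomp g (@mid m) = g.
Proof. by apply/funext => i; exact: fps_comp_id. Qed.

Lemma ord_subX m (a b : fps K m) d e k : fps_ord d a -> fps_ord d b -> fps_ord e (a - b) ->
  fps_ord (e + d * k) (a ^+ k.+1 - b ^+ k.+1).
Proof.
move=> ha hb hab; elim: k => [|k IH]; first by rewrite muln0 addn0 !expr1.
rewrite ![_ ^+ k.+2]exprS (_ : _ - _ = (a - b) * a ^+ k.+1 + b * (a ^+ k.+1 - b ^+ k.+1)); last by ring.
apply: fps_ordD; first by apply: fps_ordM => //; exact: fps_ordX.
by rewrite mulnS addnCA; exact: fps_ordM.
Qed.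

Lemma ord_sub_monomial m k (g h : 'I_k -> fps K m) e u : nc g -> nc h ->
  (forall i, fps_ord e (g i - h i)) ->
  fps_ord (e + (mi_deg u).-1) (fps_monomial g u - fps_monomial h u).
Proof.
move=> g0 h0 gh; have [u0|u0] := posnP (mi_deg u).
  have /eqP -> : u == 0 by rewrite -mi_deg_eq0 u0.
  by rewrite !fps_monomial0 subrr.
move: u u0; suff H n : forall u : multiindex k, mi_deg u = n.+1 ->
    fps_ord (e + n) (fps_monomial g u - fps_monomial h u).
  by move=> u u0; apply: H; rewrite prednK.
elim: n => [|n IH] u un.
  have [i ->] := mi_unitP un; by rewrite !fps_monomial_unit addn0.
have [i [v uv]] := mi_split un.
have vn : mi_deg v = n.+1 by move: un; rewrite uv mi_degD mi_deg_unit; lia.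
rewrite uv !fps_monomialD !fps_monomial_unit.
rewrite (_ : _ - _ = (g i - h i) * fps_monomial g v + h i * (fps_monomial g v - fps_monomial h v)); last by ring.
apply: fps_ordD.
  apply: fps_ordM => //; rewrite -vn -[mi_deg v]mul1n.
  by apply: fps_monomial_ord => j; exact: fps_ord1.
by rewrite addnS -add1n; apply: fps_ordM; [exact: fps_ord1|exact: IH].
Qed.

Lemma fps_comp_sub_ord m k (f : fps K k) (g h : 'I_k -> fps K m) d e : nc g -> nc h ->
  (0 < d)%N -> fps_ord d f -> (forall i, fps_ord e (g i - h i)) ->
  fps_ord (e + d.-1) (fps_comp f g - fps_comp f h).
Proof.
move=> g0 h0 d0 hf gh w wn; rewrite fps_subE.
rewrite (fps_compE _ g0 (leqnn _)) (fps_compE _ h0 (leqnn _)) -sumrB big1 // => u _.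
rewrite -mulrBr; have [ud|ud] := ltnP (mi_deg u) d; first by rewrite hf // mul0r.
rewrite -fps_subE (ord_sub_monomial (u := u) g0 h0 gh) ?mulr0 // (leq_trans wn) // leq_add2l.
by case: d d0 ud {hf wn} => // d _; case: (mi_deg u).
Qed.

Lemma fps_comp_ext m k (f : fps K k) (g h : 'I_k -> fps K m) e : nc g -> nc h ->
  (forall i, fps_ord e (g i - h i)) -> fps_ord e (fps_comp f g - fps_comp f h).
Proof.
move=> g0 h0 gh; pose f1 := f - fps_C (f 0).
have -> : fps_comp f g - fps_comp f h = fps_comp f1 g - fps_comp f1 h.
  by rewrite !fps_compB !fps_comp_C //; ring.
have := @fps_comp_sub_ord _ _ f1 g h 1 e g0 h0 isT _ gh; rewrite addn0; apply.
by apply: fps_ord1; rewrite /f1 fps_subE /fps_C eqxx subrr.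
Qed.

End CompA.

(** * Truncated l1-norms and convergence *)

Section Cabs.
Context {R : realType}.
Local Notation C := R[i].
Implicit Types x y z : C.

Definition cabs z : R := complex.Re `|z|.

Lemma cabsE z : `|z| = (cabs z)%:C%C.
Proof. by rewrite /cabs normc_def. Qed.
Lemma real_complex_inj : injective (@real_complex R).
Proof. by move=> x y []. Qed.
Lemma cabs_ge0 z : 0 <= cabs z.
Proof. by have := normr_ge0 z; rewrite cabsE lecE => /andP[]. Qed.
Lemma cabsM x y : cabs (x * y) = cabs x * cabs y.
Proof. by apply: real_complex_inj; rewrite -cabsE normrM !cabsE -rmorphM. Qed.
Lemma cabs0 : cabs 0 = 0.
Proof. by rewrite /cabs normr0. Qed.
Lemma cabs1 : cabs 1 = 1.
Proof. by rewrite /cabs normr1. Qed.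
Lemma cabsN x : cabs (- x) = cabs x.
Proof. by rewrite /cabs normrN. Qed.
Lemma cabs_eq0 x : (cabs x == 0) = (x == 0).
Proof.
apply/eqP/eqP => [h|->]; last exact: cabs0.
by apply/eqP; rewrite -normr_eq0 cabsE h.
Qed.
Lemma cabsD x y : cabs (x + y) <= cabs x + cabs y.
Proof. by have := ler_normD x y; rewrite !cabsE -rmorphD lecR. Qed.
Lemma cabsB x y : cabs (x - y) <= cabs x + cabs y.
Proof. by rewrite -(cabsN y) cabsD. Qed.
Lemma cabs_distC x y : cabs (x - y) = cabs (y - x).
Proof. by rewrite -cabsN opprB. Qed.
Lemma cabs_sum I r (P : pred I) (F : I -> C) :
  cabs (\sum_(i <- r | P i) F i) <= \sum_(i <- r | P i) cabs (F i).
Proof.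
elim/big_rec2: _ => [|i y x _ h]; first by rewrite cabs0.
by rewrite (le_trans (cabsD _ _)) // lerD2l.
Qed.
Lemma cabsX x n : cabs (x ^+ n) = cabs x ^+ n.
Proof. by elim: n => [|n IH]; rewrite ?expr0 ?cabs1 // !exprS cabsM IH. Qed.
Lemma cabsV x : cabs x^-1 = (cabs x)^-1.
Proof. by apply: real_complex_inj; rewrite -cabsE normfV cabsE -fmorphV. Qed.
Lemma cabs_conj x : cabs (conjc x) = cabs x.
Proof. by case: x => a b; rewrite /cabs !normc_def /= sqrrN. Qed.
Lemma cabs_real (x : R) : cabs x%:C%C = `|x|.
Proof. by rewrite /cabs normc_def /= expr0n addr0 sqrtr_sqr. Qed.
Lemma cabs_Re x : `|complex.Re x| <= cabs x.
Proof.
case: x => a b; rewrite /cabs normc_def /= -sqrtr_sqr ler_wsqrtr // lerDl.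
exact: sqr_ge0.
Qed.
Lemma cabs_Im x : `|complex.Im x| <= cabs x.
Proof.
case: x => a b; rewrite /cabs normc_def /= -sqrtr_sqr ler_wsqrtr // lerDr.
exact: sqr_ge0.
Qed.
Lemma cabs_le_ReIm x : cabs x <= `|complex.Re x| + `|complex.Im x|.
Proof.
rewrite [x in cabs x]complexE (le_trans (cabsD _ _)) // cabsM !cabs_real.
have -> : cabs 'i%C = 1; last by rewrite mul1r.
by rewrite /cabs normc_def /= expr0n add0r expr1n sqrtr1.
Qed.
Lemma cabs_nat n : cabs n%:R = n%:R.
Proof. by rewrite -(rmorph_nat (@real_complex R)) cabs_real ger0_norm. Qed.

End Cabs.

Lemma ler_sum_mis (R : realType) m N (F G : multiindex m -> R) :
  (forall u, (mi_deg u <= N)%N -> F u <= G u) ->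
  \sum_(u <- mis m N) F u <= \sum_(u <- mis m N) G u.
Proof.
move=> h; rewrite big_seq [leRHS]big_seq; apply: ler_sum => u; rewrite mem_mis; exact: h.
Qed.

Section Norm.
Context {R : realType}.
Local Notation C := R[i].

Definition nrm m N (r : R) (a : fps C m) : R :=
  \sum_(u <- mis m N) cabs (a u) * r ^+ mi_deg u.

Section Basic.
Context {m : nat}.
Implicit Types (a b : fps C m) (N : nat) (r s : R).

Lemma nrm_ge0 N r a : 0 <= r -> 0 <= nrm N r a.
Proof. by move=> r0; apply: sumr_ge0 => u _; rewrite mulr_ge0 ?cabs_ge0 ?exprn_ge0. Qed.

Lemma nrm_ext N r a b : (forall u, (mi_deg u <= N)%N -> a u = b u) -> nrm N r a = nrm N r b.
Proof. by move=> h; apply: eq_big_seq => u; rewrite mem_mis => /h ->. Qed.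

Lemma nrm_ext_ord N r a b : fps_ord N.+1 (a - b) -> nrm N r a = nrm N r b.
Proof. by move=> /fps_ord_ext h; apply: nrm_ext => u uN; exact: h. Qed.

Lemma nrm_leN N N' r a : 0 <= r -> (N <= N')%N -> nrm N r a <= nrm N' r a.
Proof.
move=> r0 NN; rewrite /nrm.
pose F u := if (mi_deg u <= N)%N then cabs (a u) * r ^+ mi_deg u else 0.
have -> : \sum_(u <- mis m N) cabs (a u) * r ^+ mi_deg u = \sum_(u <- mis m N) F u.
  by apply: eq_big_seq => u; rewrite mem_mis /F => ->.
rewrite -(sum_mis_widen NN) => [|u]; last by rewrite /F ltnNge; case: leqP.
apply: ler_sum => u _; rewrite /F; case: ifP => // _.
by rewrite mulr_ge0 ?cabs_ge0 ?exprn_ge0.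
Qed.

Lemma nrm_ler N r s a : 0 <= r <= s -> nrm N r a <= nrm N s a.
Proof.
move=> /andP[r0 rs]; apply: ler_sum => u _; rewrite ler_wpM2l ?cabs_ge0 //.
by rewrite lerXn2r // nnegrE // (le_trans r0).
Qed.

Lemma nrm0 N r : nrm N r (0 : fps C m) = 0.
Proof. by rewrite /nrm big1 // => u _; rewrite fps_zeroE cabs0 mul0r. Qed.

Lemma nrmD N r a b : 0 <= r -> nrm N r (a + b) <= nrm N r a + nrm N r b.
Proof.
move=> r0; rewrite /nrm -big_split; apply: ler_sum => u _; rewrite /= -mulrDl.
by rewrite ler_wpM2r ?exprn_ge0 // cabsD.
Qed.

Lemma nrmN N r a : nrm N r (- a) = nrm N r a.
Proof. by apply: eq_bigr => u _; rewrite fps_oppE cabsN. Qed.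

Lemma nrmB N r a b : 0 <= r -> nrm N r (a - b) <= nrm N r a + nrm N r b.
Proof. by move=> r0; rewrite -(nrmN _ _ b) nrmD. Qed.

Lemma nrmM N r a b : 0 <= r -> nrm N r (a * b) <= nrm N r a * nrm N r b.
Proof.
move=> r0; apply: (@le_trans _ _ (\sum_(w <- mis m N) \sum_(u <- mis m N) \sum_(v <- mis m N)
    (cabs (a u) * r ^+ mi_deg u * (cabs (b v) * r ^+ mi_deg v)) *+ (u + v == w))).
  apply: ler_sum_mis => w wN; rewrite (fps_mulrEs _ _ wN).
  rewrite (le_trans (ler_wpM2r _ (cabs_sum _ _ _))) ?exprn_ge0 // mulr_suml.
  apply: ler_sum => u _; rewrite (le_trans (ler_wpM2r _ (cabs_sum _ _ _))) ?exprn_ge0 //.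
  rewrite mulr_suml; apply: ler_sum => v _; case: eqP => [<-|_].
    by rewrite !mulr1n cabsM mi_degD exprD mulrACA.
  by rewrite !mulr0n cabs0 mul0r.
rewrite exchange_big /= mulr_suml; apply: ler_sum => u _.
rewrite exchange_big /= mulr_sumr; apply: ler_sum => v _.
set x := _ * _ * _; have x0 : 0 <= x by rewrite !mulr_ge0 ?cabs_ge0 ?exprn_ge0.
have [uv|uv] := leqP (mi_deg (u + v)) N.
  rewrite (bigID (fun w => w == u + v)) /= sum_mis_eq // eqxx big1 ?addr0 // => w.
  by rewrite eq_sym => /negbTE ->.
rewrite big1_seq // => w /andP[_]; rewrite mem_mis => wN.
by case: eqP => // e; rewrite -e leqNgt uv in wN.
Qed.

Lemma nrm_C N r (c : C) : nrm N r (fps_C c : fps C m) = cabs c.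
Proof.
rewrite /nrm (bigID (fun u => u == 0)) /= sum_mis_eq ?mi_deg0 //.
rewrite big1 ?addr0 => [|u /negbTE h]; last by rewrite /fps_C h cabs0 mul0r.
by rewrite /fps_C eqxx mulr1.
Qed.

Lemma nrm1 N r : nrm N r (1 : fps C m) = 1.
Proof.
have -> : 1 = fps_C 1 :> fps C m by apply/funext => u; rewrite /fps_C fps_oneE; case: eqP.
by rewrite nrm_C cabs1.
Qed.

Lemma nrm_mono N r w : 0 <= r -> nrm N r (fps_mono w : fps C m) <= r ^+ mi_deg w.
Proof.
move=> r0; have [wN|wN] := leqP (mi_deg w) N.
  rewrite /nrm (bigID (fun u => u == w)) /= sum_mis_eq // /fps_mono eqxx cabs1 mul1r.
  by rewrite big1 ?addr0 // => u /negbTE ->; rewrite cabs0 mul0r.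
rewrite /nrm big1_seq ?exprn_ge0 // => u /andP[_]; rewrite mem_mis => uN.
rewrite /fps_mono; case: eqP => [e|_]; last by rewrite cabs0 mul0r.
by rewrite -e ltnNge uN in wN.
Qed.

Lemma nrm_var N r i : 0 <= r -> nrm N r (fps_var i : fps C m) <= r.
Proof. by move=> r0; have := nrm_mono N (mi_unit i) r0; rewrite mi_deg_unit. Qed.

Lemma nrm_CM N r (c : C) a : nrm N r (fps_C c * a) = cabs c * nrm N r a.
Proof. by rewrite /nrm mulr_sumr; apply: eq_bigr => u _; rewrite fps_CM cabsM mulrA. Qed.

Lemma nrmX N r a n x : 0 <= r -> nrm N r a <= x -> nrm N r (a ^+ n) <= x ^+ n.
Proof.
move=> r0 ax; elim: n => [|n IH]; first by rewrite !expr0 nrm1.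
by rewrite !exprS (le_trans (nrmM _ _ _ r0)) // ler_pM // nrm_ge0.
Qed.

Lemma nrm_ord_scale N D s r a : 0 <= s <= 1 -> 0 <= r -> fps_ord D a ->
  nrm N (s * r) a <= s ^+ D * nrm N r a.
Proof.
move=> /andP[s0 s1] r0 aD; rewrite /nrm mulr_sumr; apply: ler_sum => u _.
have [uD|uD] := ltnP (mi_deg u) D; first by rewrite aD // cabs0 !mul0r mulr0.
rewrite exprMn [leRHS]mulrCA ler_wpM2l ?cabs_ge0 // ler_wpM2r ?exprn_ge0 //.
by rewrite -(subnKC uD) exprD ler_piMr ?exprn_ge0 // exprn_ile1.
Qed.

Lemma nrm_trunc N N' r a : 0 <= r -> nrm N r (fps_trunc N' a) <= nrm N' r a.
Proof.
move=> r0; have [NN|/ltnW NN] := leqP N N'.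
  apply: le_trans (nrm_leN _ r0 NN); rewrite le_eqVlt (_ : nrm _ _ _ = nrm N r a) ?eqxx //.
  by apply: nrm_ext => u uN; rewrite /fps_trunc (leq_trans uN).
rewrite /nrm (sum_mis_widen NN) => [|u].
  by apply: ler_sum_mis => u uN; rewrite /fps_trunc uN.
by rewrite /fps_trunc ltnNge; case: leqP => // _ _; rewrite cabs0 mul0r.
Qed.

Lemma cabs_le_nrm N r a u : 0 <= r -> (mi_deg u <= N)%N -> cabs (a u) * r ^+ mi_deg u <= nrm N r a.
Proof.
move=> r0 uN; rewrite /nrm (bigID (fun v => v == u)) /= sum_mis_eq // lerDl.
by apply: sumr_ge0 => v _; rewrite mulr_ge0 ?cabs_ge0 ?exprn_ge0.
Qed.

End Basic.

Lemma nrm_monomial m k N r x (g : 'I_k -> fps C m) u : 0 <= r -> 0 <= x ->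
  (forall i, nrm N r (g i) <= x) -> nrm N r (fps_monomial g u) <= x ^+ mi_deg u.
Proof.
move=> r0 x0 h; rewrite fps_monomialE /mi_deg -prodrXr.
elim/big_rec2: _ => [|i y z _ IH]; first by rewrite nrm1.
by rewrite (le_trans (nrmM _ _ _ r0)) // ler_pM ?nrm_ge0 // nrmX.
Qed.

Lemma nrm_comp m k N r x (f : fps C k) (g : 'I_k -> fps C m) : 0 <= r -> 0 <= x -> nc g ->
  (forall i, nrm N r (g i) <= x) -> nrm N r (fps_comp f g) <= nrm N x f.
Proof.
move=> r0 x0 g0 h; rewrite {1}/nrm.
apply: (@le_trans _ _ (\sum_(w <- mis m N) \sum_(u <- mis k N)
   cabs (f u) * (cabs (fps_monomial g u w) * r ^+ mi_deg w))).
  apply: ler_sum_mis => w wN; rewrite (fps_compE _ g0 wN).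
  rewrite (le_trans (ler_wpM2r _ (cabs_sum _ _ _))) ?exprn_ge0 // mulr_suml.
  by apply: ler_sum => u _; rewrite cabsM mulrA.
rewrite exchange_big; apply: ler_sum => u _; rewrite -mulr_sumr ler_wpM2l ?cabs_ge0 //.
exact: nrm_monomial.
Qed.

(* If f has no linear part, the terms of degree N+1 of f(g) involve g only up to degree N. *)
Lemma nrm_comp_ord2 m k N r x (f : fps C k) (g : 'I_k -> fps C m) : 0 <= r -> 0 <= x -> nc g ->
  fps_ord 2 f -> (forall i, nrm N r (g i) <= x) -> nrm N.+1 r (fps_comp f g) <= nrm N.+1 x f.
Proof.
move=> r0 x0 g0 f2 h; pose g' i := fps_trunc N (g i).
have g'0 : nc g' by move=> i; rewrite /g' /fps_trunc mi_deg0 g0.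
rewrite (@nrm_ext_ord _ _ _ _ (fps_comp f g')); last first.
  by rewrite -addn1; apply: (@fps_comp_sub_ord _ _ _ _ _ _ 2) => // i; exact: fps_truncP.
by apply: nrm_comp => // i; apply: le_trans (h i); exact: nrm_trunc.
Qed.

Definition cvgt m (a : fps C m) := exists r M : R, 0 < r /\ forall N, nrm N r a <= M.

Section Cvgt.
Context {m : nat}.
Implicit Types a b : fps C m.

Lemma cvgt_fam k (g : 'I_k -> fps C m) : (forall i, cvgt (g i)) ->
  exists r M : R, [/\ 0 < r, 0 < M & forall i N, nrm N r (g i) <= M].
Proof.
elim: k g => [|k IH] g h; first by exists 1, 1; split => // -[].
have [r [M [r0 M0 H]]] := IH (fun i => g (lift ord0 i)) (fun i => h _).
have [r' [M' [r'0 H']]] := h ord0.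
have r''0 : 0 < Num.min r r' by rewrite lt_min r0.
exists (Num.min r r'), (M + `|M'|); split => //; first by rewrite ltr_pwDl.
move=> i N; have [j ->|->] := unliftP ord0 i.
  apply: le_trans (nrm_ler _ _ (s := r) _) _; first by rewrite (ltW r''0) ge_min lexx.
  by rewrite (le_trans (H _ _)) // lerDl.
apply: le_trans (nrm_ler _ _ (s := r') _) _; first by rewrite (ltW r''0) ge_min lexx orbT.
by rewrite (le_trans (H' _)) // (le_trans (ler_norm _)) // lerDr ltW.
Qed.

Lemma nrm_small r M e D a : 0 < r -> 0 <= M -> (forall N, nrm N r a <= M) -> fps_ord D a ->
  0 <= e <= 1 -> forall N, nrm N (e * r) a <= e ^+ D * M.
Proof.
move=> r0 M0 H aD e01 N; apply: le_trans (nrm_ord_scale _ e01 (ltW r0) aD) _.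
by rewrite ler_wpM2l // exprn_ge0 //; case/andP: e01.
Qed.

Lemma cvgt_fam_small k (g : 'I_k -> fps C m) x : (forall i, cvgt (g i)) -> nc g -> 0 < x ->
  exists2 r, 0 < r & forall i N, nrm N r (g i) <= x.
Proof.
move=> h g0 x0; have [r [M [r0 M0 H]]] := cvgt_fam h.
pose e := Num.min 1 (x / M); have e0 : 0 < e by rewrite lt_min ltr01 divr_gt0.
exists (e * r) => [|i N]; first by rewrite mulr_gt0.
have e01 : 0 <= e <= 1 by rewrite (ltW e0) ge_min lexx.
apply: le_trans (nrm_small (D := 1) r0 (ltW M0) (H i) _ e01 N) _.
  exact/fps_ord1/g0.
by rewrite expr1 -ler_pdivlMr // ge_min lexx orbT.
Qed.

Lemma cvgt0 : cvgt (0 : fps C m).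
Proof. by exists 1, 0; split => // N; rewrite nrm0. Qed.

Lemma cvgt_C c : cvgt (fps_C c : fps C m).
Proof. by exists 1, (cabs c); split => // N; rewrite nrm_C. Qed.

Lemma cvgt_mono u : cvgt (fps_mono u : fps C m).
Proof. by exists 1, 1; split => // N; rewrite (le_trans (nrm_mono _ _ _)) // expr1n. Qed.

Lemma cvgt_var i : cvgt (fps_var i : fps C m).
Proof. exact: cvgt_mono. Qed.

Lemma cvgt2 a b : cvgt a -> cvgt b ->
  exists r M : R, [/\ 0 < r, 0 < M & forall N, nrm N r a <= M /\ nrm N r b <= M].
Proof.
move=> ha hb; have [|r [M [r0 M0 H]]] := @cvgt_fam 2 (fun i => if i == ord0 then a else b).
  by move=> i; case: ifP.
by exists r, M; split => // N; split; [exact: (H ord0)|exact: (H (lift ord0 ord0))].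
Qed.

Lemma cvgtD a b : cvgt a -> cvgt b -> cvgt (a + b).
Proof.
move=> ha hb; have [r [M [r0 M0 H]]] := cvgt2 ha hb; exists r, (M + M); split => // N.
by rewrite (le_trans (nrmD _ _ _ (ltW r0))) // lerD //; case: (H N).
Qed.

Lemma cvgtN a : cvgt a -> cvgt (- a).
Proof. by move=> [r [M [r0 H]]]; exists r, M; split => // N; rewrite nrmN. Qed.

Lemma cvgtB a b : cvgt a -> cvgt b -> cvgt (a - b).
Proof. by move=> ha hb; apply/cvgtD/cvgtN. Qed.

Lemma cvgtM a b : cvgt a -> cvgt b -> cvgt (a * b).
Proof.
move=> ha hb; have [r [M [r0 M0 H]]] := cvgt2 ha hb; exists r, (M * M); split => // N.
by rewrite (le_trans (nrmM _ _ _ (ltW r0))) // ler_pM ?nrm_ge0 ?(ltW r0) //; case: (H N).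
Qed.

Lemma cvgt_sum I s (P : pred I) (F : I -> fps C m) :
  (forall i, P i -> cvgt (F i)) -> cvgt (\sum_(i <- s | P i) F i).
Proof. by move=> h; elim/big_rec: _ => [|i x Pi]; [exact: cvgt0|apply: cvgtD; exact: h]. Qed.

Lemma cvgtX a n : cvgt a -> cvgt (a ^+ n).
Proof.
move=> h; elim: n => [|n IH]; last by rewrite exprS; exact: cvgtM.
by exists 1, 1; split => // N; rewrite expr0 nrm1.
Qed.

End Cvgt.

Lemma cvgt_comp m k (f : fps C k) (g : 'I_k -> fps C m) : cvgt f -> (forall i, cvgt (g i)) ->
  nc g -> cvgt (fps_comp f g).
Proof.
move=> [x [M [x0 H]]] hg g0; have [r r0 Hr] := cvgt_fam_small hg g0 x0.
exists r, M; split => // N; rewrite (le_trans _ (H N)) //.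
by apply: nrm_comp => //; rewrite ltW.
Qed.

Lemma cvgt_geo m (a : fps C m) : cvgt a ->
  exists M r : R, [/\ 0 < M, 0 < r & forall u, cabs (a u) <= M * r ^+ mi_deg u].
Proof.
move=> [r [M [r0 H]]]; exists (`|M| + 1), r^-1; split; rewrite ?invr_gt0 ?ltr_wpDl // => u.
rewrite exprVn ler_pdivlMr ?exprn_gt0 // (le_trans (cabs_le_nrm _ (ltW r0) (leqnn _))) //.
by rewrite (le_trans (H _)) // (le_trans (ler_norm _)) // lerDl.
Qed.

Lemma geo_sum_le m N (x : R) : 0 <= x <= 2^-1 -> \sum_(u <- mis m N) x ^+ mi_deg u <= 2 ^+ m.
Proof.
move=> /andP[x0 x1].
apply: (@le_trans _ _ (\sum_(u : {ffun 'I_m -> 'I_N.+1}) x ^+ mi_deg (mi_of u))).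
  rewrite big_filter big_map big_enum_cond /= [leRHS](bigID (fun u => mi_deg (mi_of u) <= N)%N) /=.
  by rewrite lerDl; apply: sumr_ge0 => u _; exact: exprn_ge0.
have -> : \sum_(u : {ffun 'I_m -> 'I_N.+1}) x ^+ mi_deg (mi_of u) =
    \prod_(i < m) \sum_(j < N.+1) x ^+ j.
  rewrite bigA_distr_bigA; apply: eq_bigr => u _; rewrite /mi_deg -prodrXr.
  by apply: eq_bigr => i _; rewrite ffunE.
have -> : 2 ^+ m = \prod_(i < m) 2 :> R by rewrite prodr_const card_ord.
apply: ler_prod => i _; apply/andP; split; first by apply: sumr_ge0 => j _; exact: exprn_ge0.
rewrite -(ler_pM2l (_ : 0 < 1 - x)) -?subrX1_sum; last by lra.
have -> : (1 - x) * (\sum_(j < N.+1) x ^+ j) = 1 - x ^+ N.+1.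
  by rewrite -[RHS]opprB subrX1 -mulNr opprB.
have := exprn_ge0 N.+1 x0; lra.
Qed.

Lemma geo_cvgt m (a : fps C m) (M r : R) : (forall u, cabs (a u) <= M * r ^+ mi_deg u) -> cvgt a.
Proof.
move=> h; have r1 : 0 < `|r| + 1 by rewrite ltr_wpDl.
exists ((`|r| + 1)^-1 / 2), (`|M| * 2 ^+ m); split; first by rewrite divr_gt0 ?invr_gt0.
move=> N; set x := _ / 2; pose y := `|r| * x.
have x0 : 0 <= x by rewrite divr_ge0 // invr_ge0 ltW.
have y1 : 0 <= y <= 2^-1.
  rewrite mulr_ge0 //= /y /x mulrA ler_piMl // ler_pdivrMr // mul1r lerDl //.
apply: (@le_trans _ _ (\sum_(u <- mis m N) `|M| * y ^+ mi_deg u)).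
  apply: ler_sum => u _; rewrite /y [(`|r| * x) ^+ _]exprMn [leRHS]mulrA ler_wpM2r ?exprn_ge0 //.
  by rewrite (le_trans (h u)) // (le_trans (ler_norm _)) // normrM normrX.
by rewrite -mulr_sumr ler_wpM2l // geo_sum_le.
Qed.

End Norm.

(** * Linear parts and inversion *)

Section Linear.
Context {K : comNzRingType}.

Definition lin m k (A : 'M[K]_(k, m)) : 'I_k -> fps K m :=
  fun i => \sum_j fps_C (A i j) * fps_var j.

Definition jac m k (F : 'I_k -> fps K m) : 'M[K]_(k, m) := \matrix_(i, j) F i (mi_unit j).

Lemma mi_unit_inj m : injective (@mi_unit m).
Proof.
move=> i j /ffunP /(_ i); rewrite !ffunE eqxx; case: eqP => // -> //.
Qed.

Lemma linE m k (A : 'M[K]_(k, m)) i j : lin A i (mi_unit j) = A i j.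
Proof.
rewrite /lin fps_sumE (bigD1 j) //= fps_CM /fps_var eqxx mulr1 big1 ?addr0 // => l lj.
rewrite fps_CM /fps_var; case: eqP => [/mi_unit_inj jl|_]; last by rewrite mulr0.
by rewrite jl eqxx in lj.
Qed.

Lemma jac_lin m k (A : 'M[K]_(k, m)) : jac (lin A) = A.
Proof. by apply/matrixP => i j; rewrite mxE linE. Qed.

Lemma lin_ord m k (A : 'M[K]_(k, m)) i : fps_ord 1 (lin A i).
Proof. by apply: fps_ord_sum => j _; apply/fps_ordMl/mid_ord. Qed.

Lemma lin_nc m k (A : 'M[K]_(k, m)) : nc (lin A).
Proof. by move=> i; apply/fps_ord1E/lin_ord. Qed.

Lemma lin_comp m k l (A : 'M[K]_(l, k)) (g : 'I_k -> fps K m) i : nc g ->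
  fps_comp (lin A i) g = \sum_j fps_C (A i j) * g j.
Proof.
move=> g0; rewrite fps_comp_sum; apply: eq_bigr => j _.
by rewrite fps_comp_CM fps_comp_var.
Qed.

Lemma lin_sub_jac m k (F : 'I_k -> fps K m) : nc F ->
  forall i, fps_ord 2 (F i - lin (jac F) i).
Proof.
move=> F0 i; apply/fps_ord_ext => u; rewrite ltnS leq_eqVlt => /orP[/eqP u1|]; last first.
  by rewrite ltnS leqn0 mi_deg_eq0 => /eqP ->; rewrite F0 lin_nc.
by have [j ->] := mi_unitP u1; rewrite linE mxE.
Qed.

Lemma jac_ext m k (F G : 'I_k -> fps K m) : (forall i, fps_ord 2 (F i - G i)) -> jac F = jac G.
Proof.
by move=> h; apply/matrixP => i j; rewrite !mxE; apply: fps_ord_eq (h i) _; rewrite mi_deg_unit.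
Qed.

Lemma jac_comp m k l (F : 'I_l -> fps K k) (G : 'I_k -> fps K m) : nc F -> nc G ->
  jac (mcomp F G) = jac F *m jac G.
Proof.
move=> F0 G0; rewrite (@jac_ext _ _ _ (mcomp (lin (jac F)) G)).
  apply/matrixP => i j; rewrite !mxE /mcomp lin_comp // fps_sumE; apply: eq_bigr => s _.
  by rewrite fps_CM !mxE.
move=> i; rewrite /mcomp -fps_compB; apply: fps_comp_ord1 => //; exact: lin_sub_jac.
Qed.

Lemma jac_mid m : jac (@mid K m) = 1%:M.
Proof.
apply/matrixP => i j; rewrite !mxE /mid /fps_var; congr (_ %:R).
by rewrite (inj_eq (@mi_unit_inj m)) eq_sym.
Qed.

Lemma lin1 m : lin (1%:M : 'M[K]_m) = @mid K m.
Proof.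
apply/funext => i; rewrite /lin (bigD1 i) //= big1 ?addr0 => [|j ji].
  by rewrite !mxE eqxx; apply/funext => u; rewrite fps_CM mul1r.
by rewrite !mxE eq_sym (negbTE ji) rmorph0 mul0r.
Qed.

Lemma mcomp_lin m k l (A : 'M[K]_(l, k)) (B : 'M[K]_(k, m)) :
  mcomp (lin A) (lin B) = lin (A *m B).
Proof.
apply/funext => i; rewrite /mcomp lin_comp ?lin; last exact: lin_nc.
rewrite /lin; under eq_bigr => j _ do rewrite mulr_sumr.
rewrite exchange_big; apply: eq_bigr => j _ /=.
rewrite !mxE rmorph_sum mulr_suml; apply: eq_bigr => s _.
by rewrite rmorphM mulrA.
Qed.

Definition fps_lim m (G : nat -> fps K m) : fps K m := fun u => G (mi_deg u) u.

Lemma fps_limP m (G : nat -> fps K m) : (forall n, fps_ord n.+1 (G n.+1 - G n)) ->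
  forall n, fps_ord n.+1 (fps_lim G - G n).
Proof.
move=> h n; apply/fps_ord_ext => u; rewrite ltnS /fps_lim => un.
rewrite -(subnKC un); elim: (n - _)%N => [|d IH]; first by rewrite addn0.
rewrite IH addnS; apply/esym; apply: fps_ord_eq (h _) _.
by rewrite ltnS leq_addr.
Qed.

Definition tid m (F : 'I_m -> fps K m) := forall i, fps_ord 2 (F i - mid i).

Lemma tid_nc m (F : 'I_m -> fps K m) : tid F -> nc F.
Proof.
move=> h i; have -> : F i = (F i - mid i) + mid i by ring.
by apply/fps_ord1E/fps_ordD; [apply: fps_ordW (h i)|exact: mid_ord].
Qed.

Lemma tid_mid m : tid (@mid K m).
Proof. by move=> i; rewrite subrr. Qed.

Lemma tid_comp m (F G : 'I_m -> fps K m) : tid F -> tid G -> tid (mcomp F G).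
Proof.
move=> hF hG i; have G0 := tid_nc hG.
have -> : mcomp F G i - mid i = fps_comp (F i - mid i) G + (G i - mid i).
  by rewrite fps_compB /mcomp [fps_comp (mid i) G]fps_comp_var //; ring.
by apply: fps_ordD => //; exact: fps_comp_ord1.
Qed.

Lemma tid_rinv m (F : 'I_m -> fps K m) : tid F ->
  exists2 G, tid G & mcomp F G = @mid K m.
Proof.
move=> hF; pose f i := F i - mid i.
pose G n := iter n (fun G i => mid i - fps_comp (f i) G) (@mid K m).
have GS n i : G n.+1 i = mid i - fps_comp (f i) (G n) by [].
have G0 n : tid (G n).
  elim: n => [|n IH]; first exact: tid_mid.
  move=> i; rewrite GS (_ : _ - _ = - fps_comp (f i) (G n)); last by ring.
  by apply/fps_ordN/fps_comp_ord1; [exact: hF|exact: tid_nc].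
have st n i : fps_ord n.+1 (G n.+1 i - G n i).
  elim: n i => [|n IH] i; first exact: fps_ordW (G0 1%N i).
  rewrite !GS (_ : _ - _ = fps_comp (f i) (G n) - fps_comp (f i) (G n.+1)); last by ring.
  rewrite -[n.+2]addn1; apply: (@fps_comp_sub_ord _ _ _ _ _ _ 2) => //; do ?exact: tid_nc.
  - exact: hF.
  - by move=> j; rewrite -opprB; exact/fps_ordN/IH.
pose g i := fps_lim (fun n => G n i).
have gP n i : fps_ord n.+1 (g i - G n i) by apply: fps_limP => k; exact: st.
have gt : tid g.
  move=> i; have -> : g i - mid i = (g i - G 1%N i) + (G 1%N i - mid i) by ring.
  by apply: fps_ordD; [exact: gP|exact: G0].
exists g => //; apply/funext => i; apply: fps_ext => n.
have -> : mcomp F g i - mid i = (fps_comp (f i) g - fps_comp (f i) (G n)) + (g i - G n.+1 i).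
  have -> : mcomp F g i = fps_comp (f i) g + g i.
    by rewrite /f fps_compB [fps_comp (mid i) g]fps_comp_var /mcomp; [ring|exact: tid_nc].
  by rewrite GS; ring.
apply: fps_ordD; last by apply: fps_ordW (gP _ _); rewrite !leqW.
apply: fps_ordW (leqnSn _) _; apply: fps_comp_ext; do ?exact: tid_nc.
by move=> j; exact: gP.
Qed.

Lemma tid_inv m (F : 'I_m -> fps K m) : tid F ->
  exists G, [/\ tid G, mcomp F G = @mid K m & mcomp G F = @mid K m].
Proof.
move=> hF; have [G hG FG] := tid_rinv hF; have [H hH GH] := tid_rinv hG.
exists G; split => //; suff -> : F = H by [].
by rewrite -[LHS]mcomp1r -GH -mcompA ?FG ?mcomp1l //; exact: tid_nc.
Qed.

Lemma jac_inverse m (F : 'I_m -> fps K m) (A : 'M[K]_m) : nc F ->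
  A *m jac F = 1%:M -> jac F *m A = 1%:M ->
  exists H G, [/\ H = mcomp (lin A) F, [/\ tid H, tid G & mcomp H G = @mid K m] &
    mcomp F (mcomp G (lin A)) = @mid K m /\ mcomp (mcomp G (lin A)) F = @mid K m].
Proof.
move=> F0 AJ JA; have A0 : nc (lin A) := @lin_nc _ _ _.
have B0 : nc (lin (jac F)) := @lin_nc _ _ _.
pose H := mcomp (lin A) F.
have hH : tid H.
  move=> i; rewrite -lin1 -AJ -mcomp_lin /H /mcomp !lin_comp // -sumrB.
  apply: fps_ord_sum => j _; rewrite -mulrBr; apply: fps_ordMl; exact: lin_sub_jac.
have [G [hG HG GH]] := tid_inv hH; have G0 := tid_nc hG.
exists H, G; split=> //; split.
  have {1}-> : F = mcomp (lin (jac F)) H by rewrite /H -mcompA // mcomp_lin JA lin1 mcomp1l.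
  rewrite mcompA; [|exact: tid_nc|exact: mcomp_nc].
  by rewrite -(mcompA H) // HG mcomp1l // mcomp_lin JA lin1.
by rewrite mcompA.
Qed.

Lemma tw_comp m (F F' G G' D : 'I_m -> fps K m) : nc F' -> nc G -> nc G' -> nc D ->
  mcomp F D = mcomp D F' -> mcomp G D = mcomp D G' ->
  mcomp (mcomp F G) D = mcomp D (mcomp F' G').
Proof. by move=> F'0 G0 G'0 D0 hF hG; rewrite mcompA // hG -mcompA // hF mcompA. Qed.

Lemma tw_inv m (F F' G G' D : 'I_m -> fps K m) : nc F -> nc F' -> nc G -> nc G' -> nc D ->
  mcomp G F = @mid K m -> mcomp F' G' = @mid K m ->
  mcomp F D = mcomp D F' -> mcomp G D = mcomp D G'.
Proof.
move=> F0 F'0 G0 G'0 D0 GF FG' hF.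
rewrite -[in LHS](mcomp1r D) -FG' -(mcompA D) // -hF -mcompA //; last exact: mcomp_nc.
by rewrite -(mcompA G) // GF mcomp1l.
Qed.

Lemma conj_step m (T F P Q tau : 'I_m -> fps K m) : nc T -> nc F -> nc P -> nc Q -> nc tau ->
  mcomp P Q = @mid K m -> mcomp T F = mcomp F tau ->
  mcomp (mcomp Q (mcomp T P)) (mcomp Q F) = mcomp (mcomp Q F) tau /\
  mcomp T P = mcomp P (mcomp Q (mcomp T P)).
Proof.
move=> T0 F0 P0 Q0 t0 PQ TF; have TP0 := mcomp_nc T0 P0; have QF0 := mcomp_nc Q0 F0.
split; last by rewrite -mcompA // PQ mcomp1l.
rewrite (mcompA Q TP0 QF0) (mcompA T P0 QF0) -(mcompA P Q0 F0) PQ mcomp1l //.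
by rewrite TF mcompA.
Qed.

Lemma conj_invariant m (T F P tau : 'I_m -> fps K m) : nc T -> nc F -> nc P -> nc tau ->
  mcomp T F = mcomp F tau -> mcomp P tau = mcomp tau P ->
  mcomp T (mcomp F P) = mcomp (mcomp F P) tau.
Proof.
move=> T0 F0 P0 t0 TF Pt; rewrite -(mcompA T F0 P0) TF (mcompA F t0 P0) -Pt.
by rewrite -(mcompA F P0 t0).
Qed.

End Linear.

Section ConvInverse.
Context {R : realType}.
Local Notation C := R[i].

Lemma cvgt_lin m k (A : 'M[C]_(k, m)) i : cvgt (lin A i).
Proof. by apply: cvgt_sum => j _; apply: cvgtM; [exact: cvgt_C|exact: cvgt_var]. Qed.

Lemma cvgt_mid m i : cvgt (@mid C m i).
Proof. exact: cvgt_var. Qed.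

Lemma tid_inv_cvgt m (F G : 'I_m -> fps C m) : tid F -> tid G -> mcomp F G = @mid C m ->
  (forall i, cvgt (F i)) -> forall i, cvgt (G i).
Proof.
move=> hF hG FG cF; have G0 := tid_nc hG.
pose f i := F i - mid i.
have cf i : cvgt (f i) by apply: cvgtB => //; exact: cvgt_mid.
have GE i : G i = mid i - fps_comp (f i) G.
  rewrite /f fps_compB fps_comp_var // -[fps_comp (F i) G]/(mcomp F G i) FG; ring.
have [r [M [r0 M0 H]]] := cvgt_fam cf.
pose e := Num.min 1 (r / (2 * M)).
have e0 : 0 < e by rewrite lt_min ltr01 divr_gt0 // mulr_gt0.
have e01 : 0 <= e <= 1 by rewrite (ltW e0) ge_min lexx.
pose x := e * r; have x0 : 0 < x by rewrite mulr_gt0.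
have fx i N : nrm N x (f i) <= x / 2.
  apply: le_trans (nrm_small (D := 2) r0 (ltW M0) (H i) _ e01 N) _; first exact: hF.
  rewrite /x expr2 -!mulrA ler_pM2l // ler_pdivlMr // mulrAC -ler_pdivlMr //.
  have : e <= r / (2 * M) by rewrite ge_min lexx orbT.
  by rewrite -(ler_pdivlMr _ (r / M)) // -mulrA -invfM [M * 2]mulrC.
have GN N i : nrm N (x / 2) (G i) <= x.
  elim: N i => [|N IH] i.
    rewrite /nrm big1_seq ?(ltW x0) // => u /andP[_]; rewrite mem_mis leqn0 mi_deg_eq0.
    by move=> /eqP ->; rewrite G0 cabs0 mul0r.
  rewrite GE (le_trans (nrmB _ _ _ _)) ?divr_ge0 ?(ltW x0) // [leRHS]splitr lerD //.
    by apply: nrm_var; rewrite divr_ge0 ?(ltW x0).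
  apply: le_trans (fx i N.+1).
  by apply: nrm_comp_ord2 => //; rewrite ?divr_ge0 ?(ltW x0) //; exact: hF.
by move=> i; exists (x / 2), x; split => //; rewrite divr_gt0.
Qed.

Lemma cvgt_inverse m (F : 'I_m -> fps C m) : nc F -> jac F \in unitmx ->
  (forall i, cvgt (F i)) ->
  exists G, [/\ nc G, forall i, cvgt (G i), mcomp F G = @mid C m & mcomp G F = @mid C m].
Proof.
move=> F0 JF cF.
have [H [G [HE [hH hG HG] [FG GF]]]] := jac_inverse F0 (mulVmx JF) (mulmxV JF).
have cA i : cvgt (lin (invmx (jac F)) i) by exact: cvgt_lin.
have cH i : cvgt (H i) by rewrite HE; apply: cvgt_comp.
have cG := tid_inv_cvgt hH hG HG cH.
exists (mcomp G (lin (invmx (jac F)))); split => //.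
- by apply: mcomp_nc; [exact: tid_nc|exact: lin_nc].
- by move=> i; apply: cvgt_comp => //; exact: lin_nc.
Qed.

End ConvInverse.

(** * Index permutations and real maps *)

Section MiPerm.
Context {m : nat}.
Implicit Types (s t : 'S_m) (u v : multiindex m).

Definition mi_act s u : multiindex m := [ffun d => u ((s^-1)%g d)].

Lemma mi_actM s t u : mi_act (s * t)%g u = mi_act t (mi_act s u).
Proof. by apply/ffunP => d; rewrite !ffunE invMg permM. Qed.
Lemma mi_act1 u : mi_act 1%g u = u.
Proof. by apply/ffunP => d; rewrite ffunE invg1 perm1. Qed.
Lemma mi_actK s : cancel (mi_act s) (mi_act s^-1%g).
Proof. by move=> u; rewrite -mi_actM mulgV mi_act1. Qed.
Lemma mi_actVK s : cancel (mi_act s^-1%g) (mi_act s).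
Proof. by move=> u; rewrite -mi_actM mulVg mi_act1. Qed.
Lemma mi_act_inj s : injective (mi_act s).
Proof. exact: can_inj (mi_actK s). Qed.
Lemma mi_deg_act s u : mi_deg (mi_act s u) = mi_deg u.
Proof.
rewrite /mi_deg (reindex_inj (@perm_inj _ s)); apply: eq_bigr => i _.
by rewrite ffunE permK.
Qed.

Lemma sum_mis_act (V : nmodType) N s (F : multiindex m -> V) :
  \sum_(u <- mis m N) F (mi_act s u) = \sum_(u <- mis m N) F u.
Proof.
rewrite -(big_map (mi_act s) predT F); apply: perm_big; apply: uniq_perm.
- by rewrite map_inj_uniq ?mis_uniq //; exact: mi_act_inj.
- exact: mis_uniq.
move=> u; rewrite mem_mis; apply/mapP/idP => [[v]|uN].
  by rewrite mem_mis => vN ->; rewrite mi_deg_act.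
by exists (mi_act s^-1%g u); rewrite ?mem_mis ?mi_deg_act ?mi_actVK.
Qed.

Section Perm.
Context {K : comNzRingType}.

Definition mi_pow (k : 'I_m -> K) u : K := \prod_i k i ^+ u i.

Definition plin (k : 'I_m -> K) s : 'I_m -> fps K m := fun c => fps_C (k c) * fps_var (s c).

Lemma plin_ord k s i : fps_ord 1 (plin k s i).
Proof. exact/fps_ordMl/mid_ord. Qed.
Lemma plin_nc k s : nc (plin k s).
Proof. by move=> i; exact/fps_ord1E/plin_ord. Qed.

Lemma plin_comp k s (f : fps K m) v :
  fps_comp f (plin k s) v = f (mi_act s^-1%g v) * mi_pow k (mi_act s^-1%g v).
Proof.
have mon u : fps_monomial (plin k s) u = fps_C (mi_pow k u) * fps_mono (mi_act s u).
  rewrite fps_monomialE /plin; under eq_bigr do rewrite exprMn.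
  rewrite big_split /=; congr (_ * _).
    by rewrite /mi_pow rmorph_prod; apply: eq_bigr => i _; rewrite rmorphXn.
  rewrite -fps_monomial_mid fps_monomialE [RHS](reindex_inj (@perm_inj _ s)).
  by rewrite /=; apply: eq_bigr => i _; rewrite ffunE permK.
rewrite (fps_compE _ (@plin_nc k s) (leqnn _)).
under eq_bigr do rewrite mon fps_CM.
rewrite (bigID (fun u => u == mi_act s^-1%g v)) /= sum_mis_eq ?mi_deg_act //.
rewrite /fps_mono mi_actVK eqxx mulr1 big1 ?addr0 // => u h.
case: eqP => [e|]; last by rewrite !mulr0.
by rewrite e mi_actK eqxx in h.
Qed.

Definition ptau s : 'I_m -> fps K m := fun c => mid (s c).
Lemma ptau_nc s : nc (ptau s).
Proof. by move=> i; exact: mid_nc. Qed.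

Lemma ptauE s : ptau s = plin (fun=> 1) s.
Proof. by apply/funext => c; apply/funext => u; rewrite /plin fps_CM mul1r. Qed.

Lemma ptau_comp s (f : fps K m) v : fps_comp f (ptau s) v = f (mi_act s^-1%g v).
Proof.
by rewrite ptauE plin_comp /mi_pow big1 ?mulr1 // => i _; rewrite expr1n.
Qed.

Lemma mcomp_ptaul s (f : 'I_m -> fps K m) : nc f -> mcomp (ptau s) f = f \o s.
Proof. by move=> f0; apply/funext => c; rewrite /mcomp /ptau fps_comp_var. Qed.

Lemma mcomp_plinl k s (f : 'I_m -> fps K m) c : nc f -> mcomp (plin k s) f c = fps_C (k c) * f (s c).
Proof. by move=> f0; rewrite /mcomp /plin fps_comp_CM fps_comp_var. Qed.

End Perm.
End MiPerm.

Section Conj.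
Context {R : realType}.
Local Notation C := R[i].

Definition fconj m (a : fps C m) : fps C m := fun u => conjc (a u).
Definition mconj m k (F : 'I_k -> fps C m) : 'I_k -> fps C m := fun i => fconj (F i).

Lemma fconjK m : involutive (@fconj m).
Proof. by move=> a; apply/funext => u; exact: conjcK. Qed.
Lemma mconjK m k : involutive (@mconj m k).
Proof. by move=> a; apply/funext => u; exact: fconjK. Qed.

Lemma fconj_is_additive m : additive (@fconj m).
Proof. by move=> a b; apply/funext => u; rewrite /fconj fps_subE rmorphB. Qed.
Lemma fconj_is_monoid_morphism m : monoid_morphism (@fconj m).
Proof.
split; first by apply/funext => u; rewrite /fconj fps_oneE rmorph_nat.
move=> a b; apply/funext => u; rewrite /fconj !(fps_mulrEs _ _ (leqnn _)) rmorph_sum.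
apply: eq_bigr => v _; rewrite rmorph_sum; apply: eq_bigr => t _.
by rewrite rmorphMn rmorphM.
Qed.
HB.instance Definition _ m := GRing.isZmodMorphism.Build (fps C m) (fps C m) (@fconj m)
  (@fconj_is_additive m).
HB.instance Definition _ m := GRing.isMonoidMorphism.Build (fps C m) (fps C m) (@fconj m)
  (@fconj_is_monoid_morphism m).

Lemma fconj_monomial m k (g : 'I_k -> fps C m) u :
  fconj (fps_monomial g u) = fps_monomial (mconj g) u.
Proof.
by rewrite !fps_monomialE rmorph_prod; apply: eq_bigr => i _; rewrite rmorphXn.
Qed.

Lemma mconj_nc m k (g : 'I_k -> fps C m) : nc g -> nc (mconj g).
Proof. by move=> g0 i; rewrite /mconj /fconj g0 rmorph0. Qed.

Lemma fconj_comp m k (f : fps C k) (g : 'I_k -> fps C m) : nc g ->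
  fconj (fps_comp f g) = fps_comp (fconj f) (mconj g).
Proof.
move=> g0; apply/funext => w; rewrite (fps_compE _ (mconj_nc g0) (leqnn _)).
rewrite /fconj (fps_compE _ g0 (leqnn _)) rmorph_sum; apply: eq_bigr => u _.
by rewrite rmorphM -fconj_monomial.
Qed.

Lemma mconj_comp m k l (f : 'I_l -> fps C k) (g : 'I_k -> fps C m) : nc g ->
  mconj (mcomp f g) = mcomp (mconj f) (mconj g).
Proof. by move=> g0; apply/funext => i; exact: fconj_comp. Qed.

Lemma nrm_conj m N r (a : fps C m) : nrm N r (fconj a) = nrm N r a.
Proof. by apply: eq_bigr => u _; rewrite cabs_conj. Qed.

Lemma cvgt_conj m (a : fps C m) : cvgt a -> cvgt (fconj a).
Proof. by move=> [r [M [r0 H]]]; exists r, M; split => // N; rewrite nrm_conj. Qed.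

Lemma fconj_var m i : fconj (fps_var i : fps C m) = fps_var i.
Proof. by apply/funext => u; rewrite /fconj /fps_var rmorph_nat. Qed.

Lemma mconj_mid m : mconj (@mid C m) = @mid C m.
Proof. by apply/funext => i; exact: fconj_var. Qed.

Lemma fconj_C m (c : C) : fconj (fps_C c : fps C m) = fps_C (conjc c).
Proof. by apply/funext => u; rewrite /fconj /fps_C; case: eqP => // _; rewrite rmorph0. Qed.

End Conj.

Section Real.
Context {R : realType}.
Local Notation C := R[i].
Context {m : nat}.
Variables (k : 'I_m -> C) (Rs : 'S_m).
Implicit Types F G : 'I_m -> fps C m.

(* [F] commutes with the antiholomorphic map x |-> (k_c conj x_(Rs c))_c. *)
Definition rmap F := mcomp F (plin k Rs) = mcomp (plin k Rs) (mconj F).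

Lemma rmapP F : nc F -> rmap F <->
  (forall c u, F c u * mi_pow k u = k c * conjc (F (Rs c) (mi_act Rs u))).
Proof.
move=> F0; have cF0 := mconj_nc F0; split => [h c u|h].
  have := congr1 (fun G => G c (mi_act Rs u)) h; rewrite mcomp_plinl // fps_CM.
  by rewrite /mcomp plin_comp mi_actK.
apply/funext => c; apply/funext => v; rewrite mcomp_plinl // fps_CM /mcomp plin_comp.
by rewrite h mi_actVK.
Qed.

Lemma rmap_mid : rmap (@mid C m).
Proof. by rewrite /rmap mconj_mid mcomp1r mcomp1l //; exact: plin_nc. Qed.

Lemma rmap_comp F G : nc F -> nc G -> rmap F -> rmap G -> rmap (mcomp F G).
Proof.
move=> F0 G0 hF hG; rewrite /rmap mconj_comp //.
by apply: tw_comp hF hG => //; [exact: mconj_nc|exact: mconj_nc|exact: plin_nc].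
Qed.

Lemma rmap_inv F G : nc F -> nc G -> mcomp F G = @mid C m -> mcomp G F = @mid C m ->
  rmap F -> rmap G.
Proof.
move=> F0 G0 FG GF hF; have FG' : mcomp (mconj F) (mconj G) = @mid C m.
  by rewrite -mconj_comp // FG mconj_mid.
by apply: tw_inv GF FG' hF => //; [exact: mconj_nc|exact: mconj_nc|exact: plin_nc].
Qed.

End Real.

(** * Newton iteration *)

Lemma kam_arith (R : realType) (w x e r N d : R) : 0 < w -> 0 <= r ->
  2 * N * x * e <= w * d -> 2 / w * (x * e * r * N) <= d * r.
Proof.
move=> w0 r0 h; have -> : 2 / w * (x * e * r * N) = (2 * N * x * e) / w * r by ring.
by rewrite ler_wpM2r // ler_pdivrMr // [leRHS]mulrC.
Qed.

Section Kam.
Context {R : realType}.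
Local Notation C := R[i].
Context {m : nat}.
Variables (G : {group 'S_m}) (k : 'I_m -> C) (Rs : 'S_m).
Hypothesis Rs2 : (Rs * Rs = 1)%g.
Hypothesis RsG : forall g, g \in G -> (Rs * g * Rs)%g \in G.
Hypothesis kk : forall c, k c * conjc (k (Rs c)) = 1.
Implicit Types (F : 'I_m -> fps C m) (g : 'S_m) (u : multiindex m).

Lemma k0 c : k c != 0.
Proof. by apply/eqP => h; have := kk c; rewrite h mul0r => /esym/eqP; rewrite oner_eq0. Qed.

Definition kap c u : C := mi_pow k u / k c.
Definition resonant c u := forall g, g \in G -> kap (g c) (mi_act g u) = kap c u.
Definition Dg F g c u : C := F c u - F (g c) (mi_act g u).

Lemma rmap_kap F c u : nc F -> rmap k Rs F ->
  F c u * kap c u = conjc (F (Rs c) (mi_act Rs u)).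
Proof.
move=> F0 /(rmapP _ _ F0) h; by rewrite /kap mulrA h mulrC mulKf ?k0.
Qed.

Lemma rmap_Dg F g c u : nc F -> rmap k Rs F -> g \in G ->
  F c u * (kap (g c) (mi_act g u) - kap c u) =
  kap (g c) (mi_act g u) * Dg F g c u - conjc (Dg F (Rs * g * Rs)%g (Rs c) (mi_act Rs u)).
Proof.
move=> F0 hF gG; rewrite /Dg rmorphB /= -(rmap_kap c u F0 hF).
have -> : (Rs * g * Rs)%g (Rs c) = Rs (g c).
  by rewrite -permM !mulgA Rs2 mul1g permM.
rewrite -mi_actM !mulgA Rs2 mul1g mi_actM -(rmap_kap (g c) (mi_act g u) F0 hF).
by ring.
Qed.

Definition sd (w : R) N := forall c u, (2 <= mi_deg u <= N)%N -> resonant c u \/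
  exists2 g, g \in G & w * (1 + cabs (kap (g c) (mi_act g u))) <= cabs (kap (g c) (mi_act g u) - kap c u).

Definition normalised F N := forall c u, (2 <= mi_deg u <= N)%N -> resonant c u ->
  \sum_(g in G) F (g c) (mi_act g u) = 0.

Lemma sd_est F w N c u : nc F -> rmap k Rs F -> 0 < w <= 1 -> sd w N -> normalised F N ->
  (2 <= mi_deg u <= N)%N ->
  cabs (F c u) <= w^-1 * \sum_(g in G) (cabs (Dg F g c u) + cabs (Dg F g (Rs c) (mi_act Rs u))).
Proof.
move=> F0 hF /andP[w0 w1] hsd hn uN; rewrite mulrC ler_pdivlMr //.
case: (hsd c u uN) => [res|[g gG]].
  have e : F c u *+ #|G| = \sum_(g in G) Dg F g c u.
    by rewrite sumrB sumr_const (hn c u uN res) subr0.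
  have G1 : (0 < #|G|)%N by exact: cardG_gt0.
  apply: (@le_trans _ _ (cabs (F c u *+ #|G|))).
    rewrite -mulr_natr cabsM cabs_nat ler_wpM2l ?cabs_ge0 // (le_trans w1) //.
    by rewrite ler1n.
  rewrite e (le_trans (cabs_sum _ _ _)) //; apply: ler_sum => g _.
  by rewrite lerDl cabs_ge0.
set K := kap (g c) (mi_act g u) => wk.
have K0 : 0 < 1 + cabs K by rewrite ltr_wpDr ?cabs_ge0.
have := congr1 cabs (rmap_Dg c u F0 hF gG); rewrite cabsM -/K => e.
rewrite -(ler_pM2r K0) -mulrA; apply: (@le_trans _ _ (cabs (F c u) * cabs (K - kap c u))).
  by rewrite ler_wpM2l ?cabs_ge0.
rewrite e (le_trans (cabsB _ _)) // cabs_conj cabsM.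
set S := \sum_(h in G) _; have S1 h : h \in G ->
    cabs (Dg F h c u) + cabs (Dg F h (Rs c) (mi_act Rs u)) <= S.
  move=> hG; rewrite /S (bigD1 h) //= lerDl; apply: sumr_ge0 => i _.
  by rewrite addr_ge0 ?cabs_ge0.
have a1 : cabs (Dg F g c u) <= S by apply: le_trans (S1 g gG); rewrite lerDl cabs_ge0.
have a2 : cabs (Dg F (Rs * g * Rs)%g (Rs c) (mi_act Rs u)) <= S.
  by apply: le_trans (S1 _ (RsG gG)); rewrite lerDr cabs_ge0.
rewrite mulrDr mulr1 addrC lerD // mulrC ler_wpM2r ?cabs_ge0 //.
Qed.

Definition conjg_eq (T : 'S_m -> 'I_m -> fps C m) F :=
  forall g, g \in G -> mcomp (T g) F = mcomp F (ptau g).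

Lemma Dg_comp T F g c u : nc F -> conjg_eq T F -> g \in G ->
  fps_comp (T g c - ptau g c) F (mi_act g u) = Dg F g c u.
Proof.
move=> F0 hT gG; rewrite fps_compB fps_subE -[fps_comp (T g c) F]/(mcomp (T g) F c) hT //.
by rewrite /mcomp ptau_comp mi_actK /ptau fps_comp_var.
Qed.

Lemma mid_ge2 c u : (2 <= mi_deg u)%N -> @mid C m c u = 0.
Proof. by rewrite /mid /fps_var; case: eqP => // ->; rewrite mi_deg_unit. Qed.

Lemma lin_est T F w N r : tid F -> rmap k Rs F -> 0 < w <= 1 -> sd w N -> normalised F N ->
  conjg_eq T F -> 0 <= r ->
  \sum_c nrm N r (F c - mid c) <=
    2 / w * \sum_(g in G) \sum_c nrm N r (fps_comp (T g c - ptau g c) F).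
Proof.
move=> tF hF w01 hsd hn hT r0; have F0 := tid_nc tF.
have e g c : g \in G -> nrm N r (fps_comp (T g c - ptau g c) F) =
    \sum_(u <- mis m N) cabs (Dg F g c u) * r ^+ mi_deg u.
  move=> gG; rewrite /nrm -(sum_mis_act N g); apply: eq_bigr => u _.
  by rewrite (Dg_comp c u F0 hT gG) mi_deg_act.
have w0 : 0 <= w^-1 by rewrite invr_ge0; case/andP: w01 => /ltW.
apply: (@le_trans _ _ (\sum_c \sum_(u <- mis m N) w^-1 * ((\sum_(g in G)
    (cabs (Dg F g c u) + cabs (Dg F g (Rs c) (mi_act Rs u)))) * r ^+ mi_deg u))).
  apply: ler_sum => c _; apply: ler_sum_mis => u uN.
  rewrite mulrA ler_wpM2r ?exprn_ge0 //.
  have [u2|u2] := ltnP (mi_deg u) 2.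
    rewrite tF // cabs0 mulr_ge0 //; apply: sumr_ge0 => g _.
    by rewrite addr_ge0 ?cabs_ge0.
  by rewrite fps_subE mid_ge2 // subr0; apply: (sd_est c F0 hF w01 hsd hn); rewrite u2.
under eq_bigr => c _.
  rewrite -mulr_sumr; under eq_bigr => u _ do rewrite mulr_suml.
  rewrite exchange_big /=; over.
rewrite /= -mulr_sumr exchange_big /= [2 / w]mulrC -mulrA ler_wpM2l //.
rewrite mulr_sumr; apply: ler_sum => g gG.
under [X in _ <= 2 * X]eq_bigr do rewrite e //.
under eq_bigr => c _ do under eq_bigr => u _ do rewrite mulrDl.
under eq_bigr => c _ do rewrite big_split.
rewrite big_split /= mulr2n mulrDl !mul1r lerD2l.
rewrite [leRHS](reindex_inj (@perm_inj _ Rs)) /=; apply: ler_sum => c _.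
rewrite -(sum_mis_act N Rs (fun u => cabs (Dg F g (Rs c) u) * r ^+ mi_deg u)).
by apply: ler_sum => u _; rewrite mi_deg_act.
Qed.

Lemma order_est T F w N D : tid F -> rmap k Rs F -> 0 < w <= 1 -> sd w N -> normalised F N ->
  conjg_eq T F -> (D <= N.+1)%N ->
  (forall g c, g \in G -> fps_ord D (T g c - ptau g c)) -> forall c, fps_ord D (F c - mid c).
Proof.
move=> tF hF w01 hsd hn hT DN tD c u uD; have F0 := tid_nc tF.
have [u2|u2] := ltnP (mi_deg u) 2; first exact: tF.
rewrite fps_subE mid_ge2 // subr0; apply/eqP; rewrite -cabs_eq0 eq_le cabs_ge0 andbT.
have u2N : (2 <= mi_deg u <= N)%N by rewrite u2 -ltnS (leq_trans uD).
apply: le_trans (sd_est c F0 hF w01 hsd hn u2N) _.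
rewrite big1 ?mulr0 // => g gG.
have z c' u' : (mi_deg u' < D)%N -> Dg F g c' u' = 0.
  move=> u'D; rewrite -(Dg_comp c' u' F0 hT gG) (fps_comp_ord1 (n := D)) ?mi_deg_act //.
  exact: tD.
by rewrite !z ?mi_deg_act // cabs0 addr0.
Qed.

Lemma kap_act c u g : resonant c u -> g \in G -> resonant (g c) (mi_act g u).
Proof.
move=> h gG g' g'G; rewrite -permM -mi_actM; rewrite [LHS]h ?groupM //.
by rewrite h.
Qed.

Lemma resonant_act c u g : g \in G -> (resonant (g c) (mi_act g u)) = (resonant c u).
Proof.
move=> gG; apply/propext; split => [h|]; last by move=> h; exact: kap_act.
by have := kap_act h (groupVr gG); rewrite permK mi_actK.
Qed.

Lemma kap_Rs c u : kap (Rs c) (mi_act Rs u) = (conjc (kap c u))^-1.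
Proof.
have RV : (Rs^-1 = Rs)%g by rewrite -[RHS]mulg1 -(mulgV Rs) mulgA Rs2 mul1g.
have ckk c' : conjc (k c') * k (Rs c') = 1.
  by rewrite -(conjcK (k (Rs c'))) -rmorphM kk rmorph1.
have e c' : k (Rs c') = (conjc (k c'))^-1.
  by rewrite -[LHS](mulKf (_ : conjc (k c') != 0)) ?ckk ?mulr1 // conjc_eq0 k0.
rewrite /kap rmorphM fmorphV invfM invrK e invrK; congr (_ * _).
rewrite /mi_pow rmorph_prod -prodfV (reindex_inj (@perm_inj _ Rs)) /=.
by apply: eq_bigr => i _; rewrite ffunE permK e rmorphXn exprVn.
Qed.

Lemma perm_RsE c g : g (Rs c) = Rs ((Rs * g * Rs)%g c).
Proof. by rewrite -!permM -!mulgA Rs2 mulg1. Qed.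
Lemma mi_act_RsE u g : mi_act g (mi_act Rs u) = mi_act Rs (mi_act (Rs * g * Rs)%g u).
Proof. by rewrite -!mi_actM -!mulgA Rs2 mulg1. Qed.

Lemma resonant_Rs c u : resonant c u -> resonant (Rs c) (mi_act Rs u).
Proof.
by move=> h g gG; rewrite perm_RsE mi_act_RsE !kap_Rs h ?RsG.
Qed.

Lemma resonant_RsE c u : resonant (Rs c) (mi_act Rs u) = resonant c u.
Proof.
apply/propext; split => [/resonant_Rs|]; last exact: resonant_Rs.
by rewrite -permM -mi_actM Rs2 perm1 mi_act1.
Qed.

Definition Gsum F c u := \sum_(g in G) F (g c) (mi_act g u).

Lemma Gsum_act F g c u : g \in G -> Gsum F (g c) (mi_act g u) = Gsum F c u.
Proof.
move=> gG; rewrite /Gsum [RHS](reindex_inj (mulgI g)) /=.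
apply: eq_big => [h|h _]; first by rewrite groupMl.
by rewrite permM mi_actM.
Qed.

Lemma Gsum_Rs F c u : nc F -> rmap k Rs F -> resonant c u ->
  Gsum F c u * kap c u = conjc (Gsum F (Rs c) (mi_act Rs u)).
Proof.
move=> F0 hF hr; rewrite /Gsum rmorph_sum mulr_suml.
have RR g : (Rs * (Rs * g * Rs) * Rs = g)%g by rewrite !mulgA Rs2 mul1g -mulgA Rs2 mulg1.
rewrite [RHS](reindex_inj (h := fun g => (Rs * g * Rs)%g)) /=; last first.
  by move=> g h e; rewrite -[g]RR e RR.
apply: eq_big => [g|g gG].
  by apply/idP/idP => [/RsG|/RsG]; rewrite ?RR.
by rewrite perm_RsE mi_act_RsE RR -(hr g gG) (rmap_kap _ _ F0 hF).
Qed.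

Definition normal_corr F n : 'I_m -> fps C m := fun c u =>
  if (mi_deg u == n) && `[< resonant c u >] then - (#|G|%:R)^-1 * Gsum F c u else 0.

Lemma normal_corr_act F n g c u : g \in G ->
  normal_corr F n (g c) (mi_act g u) = normal_corr F n c u.
Proof. by move=> gG; rewrite /normal_corr mi_deg_act resonant_act // Gsum_act. Qed.

Lemma normal_corr_ord F n c : fps_ord n (normal_corr F n c).
Proof. by move=> u un; rewrite /normal_corr ltn_eqF. Qed.

Lemma normal_corr_rmap F n c u : nc F -> rmap k Rs F ->
  normal_corr F n c u * kap c u = conjc (normal_corr F n (Rs c) (mi_act Rs u)).
Proof.
move=> F0 hF; rewrite /normal_corr mi_deg_act resonant_RsE.
case: ifP => [/andP[_ /asboolP hr]|_]; last by rewrite mul0r rmorph0.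
by rewrite -mulrA Gsum_Rs // rmorphM rmorphN fmorphV rmorph_nat.
Qed.

Lemma normalise F N : tid F -> rmap k Rs F -> exists K, [/\ tid K, rmap k Rs K,
  (forall g, g \in G -> mcomp K (ptau g) = mcomp (ptau g) K) & normalised (mcomp F K) N].
Proof.
move=> tF hF; elim: N => [|N [K [tK hK cK nK]]].
  exists (@mid C m); split; [exact: tid_mid|exact: rmap_mid| |by move=> c u; case: (mi_deg u) => [|[|]]].
  by move=> g gG; rewrite mcomp1r mcomp1l //; exact: ptau_nc.
have [N1|N1] := leqP 2 N.+1; last first.
  by exists K; split => // c u /andP[u2 uN]; have := leq_trans u2 uN; rewrite leqNgt N1.
pose F1 := mcomp F K; pose L : 'I_m -> fps C m := fun c => mid c + normal_corr F1 N.+1 c.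
have F0 := tid_nc tF; have K0 := tid_nc tK.
have tF1 : tid F1 by exact: tid_comp.
have F10 := tid_nc tF1.
have hF1 : rmap k Rs F1 by exact: rmap_comp.
have tL : tid L.
  move=> c; rewrite /L addrC addKr; apply: fps_ordW (normal_corr_ord _ _).
  exact: N1.
have L0 := tid_nc tL.
have hL : rmap k Rs L.
  apply/(rmapP k Rs L0) => c u; rewrite /L !fps_addE mulrDl rmorphD mulrDr.
  congr (_ + _); first by apply: (rmapP k Rs (@mid_nc _ m)).1; exact: rmap_mid.
  transitivity (k c * conjc (normal_corr F1 N.+1 (Rs c) (mi_act Rs u))); last by [].
  have := normal_corr_rmap N.+1 c u F10 hF1; rewrite /kap mulrA => <-.
  by rewrite [RHS]mulrC divfK ?k0.
have cL g : g \in G -> mcomp L (ptau g) = mcomp (ptau g) L.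
  move=> gG; rewrite mcomp_ptaul //; apply/funext => c; apply/funext => v.
  rewrite /mcomp /L fps_compD !fps_addE /= fps_comp_var; last exact: ptau_nc.
  congr (_ + _); rewrite ptau_comp -(normal_corr_act _ _ c (mi_act g^-1%g v) gG).
  by rewrite mi_actVK.
exists (mcomp K L); split.
- exact: tid_comp.
- exact: rmap_comp.
- move=> g gG; have p0 := @ptau_nc m C g.
  by apply: tw_comp (cK g gG) (cL g gG).
move=> c u /andP[u2 uN] res.
have key c' u' : (mi_deg u' <= N.+1)%N -> (2 <= mi_deg u')%N ->
    mcomp F (mcomp K L) c' u' = F1 c' u' + normal_corr F1 N.+1 c' u'.
  move=> u'N u'2; rewrite -mcompA // -/F1.
  have -> : mcomp F1 L c' = L c' + fps_comp (F1 c' - mid c') L.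
    by rewrite fps_compB fps_comp_var // addrC subrK.
  have o : fps_ord (N.+1 + 1) (fps_comp (F1 c' - mid c') L - fps_comp (F1 c' - mid c') (@mid C m)).
    apply: (@fps_comp_sub_ord _ _ _ _ _ _ 2) => //; first exact: mid_nc.
    by move=> i; rewrite /L addrC addKr; exact: normal_corr_ord.
  rewrite fps_addE (fps_ord_eq o) ?addn1 // fps_comp_id fps_subE.
  by rewrite /L fps_addE mid_ge2 // add0r subr0 addrC.
have G1 : (#|G|%:R : C) != 0 by rewrite pnatr_eq0 -lt0n cardG_gt0.
under eq_bigr => g gG do rewrite key ?mi_deg_act // normal_corr_act //.
rewrite big_split /= sumr_const; have [uN1|uN1] := eqVneq (mi_deg u) N.+1.
  rewrite /normal_corr uN1 eqxx /=; case: asboolP => // _.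
  by rewrite -[_ *+ #|G|]mulr_natr mulrAC mulNr mulVf // mulN1r subrr.
rewrite {1}/normal_corr (negbTE uN1) mul0rn addr0; apply: nK => //.
by rewrite u2 -ltnS ltn_neqAle uN1.
Qed.


Definition tau_ord D (T : 'S_m -> 'I_m -> fps C m) :=
  forall g c, g \in G -> fps_ord D (T g c - ptau g c).
Definition tau_bnd r x (T : 'S_m -> 'I_m -> fps C m) :=
  forall g c N, g \in G -> nrm N r (T g c - ptau g c) <= x.

(* One step of the iteration: conjugating by P = truncation of a normalised F doubles the order
   of the deviation of T from the linear action.  The bounds come from the order of the deviation
   together with the shrinking factor [s]. *)
Lemma kam_step F T n (w s r e0 de r' : R) : tid F -> rmap k Rs F -> conjg_eq T F ->
  (forall g, g \in G -> nc (T g)) ->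
  (0 < n)%N -> tau_ord n.+1 T -> 0 < r -> 0 <= e0 -> tau_bnd r (e0 * r) T ->
  0 < w <= 1 -> sd w n.*2 -> 0 < s <= 1 -> 0 < de <= 5^-1 ->
  2 * (#|G| * m)%:R * s ^+ n * e0 <= w * de -> s ^+ n * e0 <= de ->
  0 < r' -> r' * (1 + 4 * de) <= s * r ->
  exists F' T' P, [/\ [/\ tid F', rmap k Rs F', conjg_eq T' F' & forall g, g \in G -> nc (T' g)],
    [/\ tid P, rmap k Rs P, (forall c, fps_ord n.+1 (P c - mid c)) &
      forall g, g \in G -> mcomp (T g) P = mcomp P (T' g)],
    tau_ord n.*2.+1 T', tau_bnd r' (4 * de * r') T' &
    forall c N, nrm N r' (P c) <= s * r].
Proof.
move=> tF hF hT nT n0 oT r0 e00 bT w01 hsd /andP[s0 s1] /andP[de0 de5] c1 c2 r'0 c3.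
pose D := n.+1; have D2 : (2 <= D)%N by [].
pose N := n.*2; have N1 : N.+1 = (D + n)%N by rewrite addSn addnn.
have DN : (D <= N.+1)%N by rewrite N1 leq_addr.
have [K [tK hK cK nK]] := normalise N tF hF.
pose F1 := mcomp F K; have F0 := tid_nc tF; have K0 := tid_nc tK.
have tF1 : tid F1 by exact: tid_comp.
have F10 := tid_nc tF1.
have hF1 : rmap k Rs F1 by exact: rmap_comp.
have hT1 : conjg_eq T F1.
  move=> g gG; apply: conj_invariant (hT g gG) (cK g gG) => //; first exact: nT.
  exact: ptau_nc.
have oF1 := order_est tF1 hF1 w01 hsd nK hT1 DN oT.
pose th c := fps_trunc N (F1 c - mid c); pose P : 'I_m -> fps C m := fun c => mid c + th c.
have oth c : fps_ord D (th c) by move=> u uD; rewrite /th /fps_trunc oF1 // if_same.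
have Pth c : P c - mid c = th c by rewrite /P addrC addKr.
have oP c : fps_ord D (P c - mid c) by rewrite Pth.
have tP : tid P by move=> c; exact: fps_ordW (oP c).
have P0 := tid_nc tP.
have PF1 c : fps_ord N.+1 (F1 c - P c).
  have -> : F1 c - P c = (F1 c - mid c) - th c by rewrite /P; ring.
  exact: fps_truncP.
have hP : rmap k Rs P.
  apply/(rmapP k Rs P0) => c u; have [uN|uN] := leqP (mi_deg u) N.
    rewrite -(fps_ord_eq (PF1 c)) // -(fps_ord_eq (PF1 (Rs c))) ?mi_deg_act //.
    exact: (rmapP k Rs F10).1.
  have z c' u' : mi_deg u' = mi_deg u -> P c' u' = 0.
    move=> e; rewrite /P fps_addE mid_ge2 ?add0r; last by rewrite e (leq_ltn_trans _ uN) // /N -addnn addn_gt0 n0.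
    by rewrite /th /fps_trunc e leqNgt uN.
  by rewrite !z ?mi_deg_act // mul0r rmorph0 mulr0.
have [Q [tQ PQ QP]] := tid_inv tP; have Q0 := tid_nc tQ.
have hQ : rmap k Rs Q by apply: rmap_inv hP.
pose F' := mcomp Q F1; pose T' g := mcomp Q (mcomp (T g) P).
have tF' : tid F' by exact: tid_comp.
have F'0 := tid_nc tF'.
have cs g (gG : g \in G) := conj_step (nT g gG) F10 P0 Q0 (@ptau_nc _ _ g) PQ (hT1 g gG).
have hT' : conjg_eq T' F' by move=> g gG; case: (cs g gG).
have TPT g : g \in G -> mcomp (T g) P = mcomp P (T' g) by move=> gG; case: (cs g gG).
have T'0 g : g \in G -> nc (T' g).
  by move=> gG; do 2!apply: mcomp_nc => //; exact: nT.
have oF' c : fps_ord N.+1 (F' c - mid c).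
  by rewrite -QP; apply: fps_comp_ext => // i; exact: PF1.
have [F'i [tF'i FF'i F'iF]] := tid_inv tF'; have F'i0 := tid_nc tF'i.
have oT' : tau_ord n.*2.+1 T'.
  move=> g c gG; have p0 := @ptau_nc m C g;   have e : T' g c - ptau g c = fps_comp (fps_comp (F' c - mid c) (ptau g) - (F' (g c) - mid (g c))) F'i.
    have e1 : fps_comp (T' g c - ptau g c) F' = fps_comp (F' c - mid c) (ptau g) - (F' (g c) - mid (g c)).
      rewrite !fps_compB -[fps_comp (T' g c) F']/(mcomp (T' g) F' c) hT' // /mcomp.
      by rewrite !fps_comp_var // /ptau; ring.
    rewrite -e1 fps_compA // FF'i fps_comp_id //.
  rewrite e; apply: fps_comp_ord1 => //; apply: fps_ordB; last exact: oF'.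
  by apply: fps_comp_ord1 => //; exact: oF'.
pose r1 := s * r; have r10 : 0 < r1 by rewrite mulr_gt0.
have bT1 g c M : g \in G -> nrm M r1 (T g c - ptau g c) <= s ^+ n * e0 * r1.
  move=> gG; apply: le_trans (nrm_ord_scale M _ (ltW r0) (oT g c gG)) _.
    by rewrite (ltW s0).
  rewrite exprS.
  rewrite /r1 [leRHS]mulrCA -!mulrA ler_pM2l // ler_wpM2l ?exprn_ge0 ?(ltW s0) //.
  exact: bT.
have bth c M : nrm M r1 (th c) <= de * r1.
  apply: le_trans (nrm_trunc _ _ _ (ltW r10)) _.
  have := lin_est tF1 hF1 w01 hsd nK hT1 (ltW r10).
  rewrite (bigD1 c) //= => h; apply: le_trans (le_trans _ h) _.
    by rewrite lerDl; apply: sumr_ge0 => i _; exact: nrm_ge0 (ltW r10).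
  have w0 : 0 < w by case/andP: w01.
  apply: (@le_trans _ _ (2 / w * \sum_(g in G) \sum_(c < m) (s ^+ n * e0 * r1))).
    rewrite ler_wpM2l ?divr_ge0 ?(ltW w0) //.
    apply: ler_sum => g gG; apply: ler_sum => c' _.
    rewrite (@nrm_ext_ord _ _ _ _ _ (T g c' - ptau g c')); first exact: bT1.
    rewrite -{2}(fps_comp_id (T g c' - ptau g c')).
    by rewrite N1; apply: (@fps_comp_sub_ord _ _ _ _ _ _ D) => //; [exact: mid_nc|exact: oT].
  under eq_bigr => g _ do rewrite sumr_const card_ord.
  rewrite sumr_const -mulrnA mulnC -(mulr_natr (s ^+ n * e0 * r1)).
  move: ((#|G| * m)%:R : R) c1 => NN c1.
  exact: kam_arith (ltW r10) c1.
have shrink a q x M : fps_ord 1 a -> nrm M r1 a <= q * r1 -> 0 <= x <= r1 -> nrm M x a <= q * x.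
  move=> a1 h /andP[x0 x1].
  have y01 : 0 <= x / r1 <= 1 by rewrite divr_ge0 ?(ltW r10) //= ler_pdivrMr // mul1r.
  have {1}-> : x = x / r1 * r1 by rewrite divfK // gt_eqF.
  apply: le_trans (nrm_ord_scale M y01 (ltW r10) a1) _.
  rewrite expr1 mulrAC ler_pdivrMr // mulrC -mulrA [x * r1]mulrC mulrA ler_wpM2r //.
have r'1 : r' * (1 + de) <= r1.
  by apply: le_trans c3; rewrite ler_pM2l // lerD2l ler_peMl ?(ltW de0) // ler1n.
have r'r1 : 0 <= r' <= r1.
  by rewrite (ltW r'0) (le_trans _ r'1) // ler_peMr ?(ltW r'0) // lerDl ltW.
have oth1 c : fps_ord 1 (th c) by apply: fps_ordW (oth c); exact: leq_trans D2.
have bP c M : nrm M r' (P c) <= r' * (1 + de).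
  rewrite /P (le_trans (nrmD _ _ _ (ltW r'0))) // mulrDr mulr1 lerD //.
    exact: nrm_var (ltW r'0).
  by rewrite mulrC; apply: shrink.
have hF' : rmap k Rs F' by exact: rmap_comp.
exists F', T', P; split; [by split|by split|by []| |].
  move=> g c M gG; have p0 := @ptau_nc m C g.
  elim: M c => [|M IH] c.
    rewrite /nrm big1_seq ?mulr_ge0 ?(ltW de0) ?(ltW r'0) // => u /andP[_].
    rewrite mem_mis leqn0 mi_deg_eq0 => /eqP ->.
    by rewrite fps_subE T'0 // p0 subr0 cabs0 mul0r.
  have -> : T' g c - ptau g c =
      th (g c) + fps_comp (T g c - ptau g c) P - fps_comp (th c) (T' g).
    have := congr1 (fun H => H c) (TPT g gG); rewrite /mcomp.
    rewrite [in RHS]/P fps_compD fps_comp_var; last exact: T'0.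
    rewrite fps_compB => ->; rewrite /ptau fps_comp_var // /P; ring.
  rewrite (le_trans (nrmB _ _ _ (ltW r'0))) //.
  apply: (@le_trans _ _ (de * r' + de * (r' * (1 + de)) + de * (r' * (1 + 4 * de)))); last first.
    rewrite -subr_ge0.
    have -> : 4 * de * r' - (de * r' + de * (r' * (1 + de)) + de * (r' * (1 + 4 * de))) =
      de * r' * (1 - 5 * de) by ring.
    rewrite mulr_ge0 ?mulr_ge0 ?(ltW de0) ?(ltW r'0) //; lra.
  rewrite lerD //; first (rewrite (le_trans (nrmD _ _ _ (ltW r'0))) // lerD //).
  - exact: shrink.
  - apply: le_trans (nrm_comp (x := r' * (1 + de)) _ _ _ _ _) _ => //; first exact: ltW.
      by rewrite mulr_ge0 ?(ltW r'0) // addr_ge0 // ltW.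
    apply: shrink; first by apply: fps_ordW (oT g c gG); exact: leq_trans D2.
      by apply: le_trans (bT1 _ _ _ gG) _; rewrite ler_wpM2r // ltW.
    by rewrite r'1 mulr_ge0 ?(ltW r'0) // addr_ge0 // ltW.
  - have x0 : 0 <= r' * (1 + 4 * de) by rewrite mulr_ge0 ?(ltW r'0) // addr_ge0 // mulr_ge0 // ltW.
    apply: le_trans (nrm_comp_ord2 (x := r' * (1 + 4 * de)) _ _ _ _ _) _ => //; first exact: ltW.
    + exact: T'0.
    + exact: fps_ordW (oth c).
    + move=> i; have -> : T' g i = ptau g i + (T' g i - ptau g i) by ring.
      rewrite (le_trans (nrmD _ _ _ (ltW r'0))) // mulrDr mulr1 lerD //.
        exact: nrm_var (ltW r'0).
      by rewrite mulrC; exact: IH.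
    + by apply: shrink => //; rewrite x0.
by move=> c M; apply: le_trans (bP c M) r'1.
Qed.

End Kam.

Lemma cvgt_finfam (R : realType) m (I : finType) (g : I -> fps R[i] m) : (forall i, cvgt (g i)) ->
  exists r M : R, [/\ 0 < r, 0 < M & forall i N, nrm N r (g i) <= M].
Proof.
move=> h; have [r [M [r0 M0 H]]] := cvgt_fam (g := fun j : 'I_#|I| => g (enum_val j)) (fun j => h _).
by exists r, M; split=> // i N; rewrite -(enum_rankK i).
Qed.

Lemma prod_geo_le3 (R : realType) n : \prod_(i < n) (1 + 2^-1 ^+ i / 2) <= 3 :> R.
Proof.
case: n => [|n]; first by rewrite big_ord0; lra.
suff : \prod_(i < n.+1) (1 + 2^-1 ^+ i / 2) <= 3 * (1 - 2^-1 ^+ n.+1) :> R.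
  by move/le_trans; apply; rewrite mulrBr mulr1 gerBl mulr_ge0 // exprn_ge0.
elim: n => [|n IH]; first by rewrite big_ord1 expr0 expr1; lra.
rewrite big_ord_recr /=.
set y := 2^-1 ^+ n.+1 in IH *; have y0 : 0 <= y by exact: exprn_ge0.
apply: le_trans (ler_wpM2r _ IH) _; first by lra.
rewrite [2^-1 ^+ n.+2]exprS -/y; nra.
Qed.

Lemma conj_chain (K : comNzRingType) m (T T1 T2 S P : 'I_m -> fps K m) :
  nc T -> nc T1 -> nc T2 -> nc S -> nc P ->
  mcomp T S = mcomp S T1 -> mcomp T1 P = mcomp P T2 ->
  mcomp T (mcomp S P) = mcomp (mcomp S P) T2.
Proof.
move=> T0 T10 T20 S0 P0 TS TP.
by rewrite -(mcompA T S0 P0) TS (mcompA S T10 P0) TP -(mcompA S P0 T20).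
Qed.

Section Kam.
Context {R : realType}.
Local Notation C := R[i].
Context {m : nat}.
Variables (G : {group 'S_m}) (k : 'I_m -> C) (Rs : 'S_m).
Hypothesis Rs2 : (Rs * Rs = 1)%g.
Hypothesis RsG : forall g, g \in G -> (Rs * g * Rs)%g \in G.
Hypothesis kk : forall c, k c * conjc (k (Rs c)) = 1.
Implicit Types (F : 'I_m -> fps C m) (g : 'S_m).

Lemma conjg_tau_ord2 F T : tid F -> conjg_eq G T F -> tau_ord G 2 T.
Proof.
move=> tF hT g c gG; have F0 := tid_nc tF; have p0 := @ptau_nc m C g.
have [Fi [tFi FFi FiF]] := tid_inv tF; have Fi0 := tid_nc tFi.
have e1 : fps_comp (T g c - ptau g c) F = fps_comp (F c - mid c) (ptau g) - (F (g c) - mid (g c)).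
  rewrite !fps_compB -[fps_comp (T g c) F]/(mcomp (T g) F c) hT // /mcomp.
  by rewrite !fps_comp_var // /ptau; ring.
have -> : T g c - ptau g c = fps_comp (fps_comp (T g c - ptau g c) F) Fi.
  by rewrite fps_compA // FFi fps_comp_id.
apply: fps_comp_ord1 => //; rewrite e1; apply: fps_ordB; last exact: tF.
by apply: fps_comp_ord1 => //; exact: tF.
Qed.

Lemma kam F T (w s : nat -> R) (sig : R) : tid F -> rmap k Rs F -> conjg_eq G T F ->
  (forall g, g \in G -> nc (T g)) -> (forall g c, g \in G -> cvgt (T g c)) ->
  (forall n, 0 < w n <= 1) -> (forall n, sd G k (w n) (2 ^ n).*2) ->
  (forall n, 0 < s n <= 1) ->
  (forall n, 16 * (#|G| * m).+1%:R * s n ^+ (2 ^ n) <= w n) ->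
  0 < sig -> (forall n, sig <= \prod_(i < n) s i) ->
  exists S, [/\ tid S, rmap k Rs S, forall c, cvgt (S c) &
     forall g, g \in G -> mcomp (T g) S = mcomp S (ptau g)].
Proof.
move=> tF hF hT nT cT w01 hsd s01 sw sig0 sigs.
have oT := conjg_tau_ord2 tF hT.
have [r0 r00 bT] : exists2 r, 0 < r & tau_bnd G r r T.
  have [|r [M [r0 M0 H]]] := @cvgt_finfam R m ('S_m * 'I_m)%type
      (fun x => if x.1 \in G then T x.1 x.2 - ptau x.1 x.2 else 0).
    move=> [g c] /=; case: ifP => gG; last exact: cvgt0.
    by apply: cvgtB; [exact: cT|exact: cvgt_mid].
  pose e := Num.min 1 (r / M); have e0 : 0 < e by rewrite lt_min ltr01 divr_gt0.
  have e01 : 0 <= e <= 1 by rewrite (ltW e0) ge_min lexx.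
  exists (e * r); first by rewrite mulr_gt0.
  move=> g c N gG; have Hg M' : nrm M' r (T g c - ptau g c) <= M.
    by have := H (g, c) M'; rewrite /= gG.
  apply: le_trans (nrm_small (D := 2) r0 (ltW M0) Hg _ e01 N) _; first exact: oT.
  rewrite expr2 -mulrA ler_pM2l // -ler_pdivlMr //.
  by rewrite ge_min lexx orbT.
pose q n : R := s n / (1 + 2^-1 ^+ n / 2).
have h0 n : 0 < (2^-1 : R) ^+ n by rewrite exprn_gt0.
have h1 n : (2^-1 : R) ^+ n <= 1 by rewrite exprn_ile1 //; lra.
have q0 n : 0 < q n.
  have := h0 n; have /andP[? _] := s01 n => ?; rewrite divr_gt0 //; lra.
pose r n := r0 * \prod_(i < n) q i.
have r_gt0 n : 0 < r n by rewrite mulr_gt0 // prodr_gt0.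
have rS n : r n.+1 = r n * q n by rewrite /r big_ord_recr /= mulrA.
pose rinf := r0 * sig / 3; have rinf0 : 0 < rinf by rewrite divr_gt0 // mulr_gt0.
have rinf_le n : rinf <= r n.
  rewrite /rinf /r -mulrA ler_pM2l // /q prodf_div.
  have p0 : 0 < \prod_(i < n) (1 + 2^-1 ^+ i / 2) :> R.
    by apply: prodr_gt0 => i _; rewrite addr_gt0 // divr_gt0.
  rewrite ler_pM ?(ltW sig0) ?invr_ge0 // lef_pV2 ?posrE //.
  exact: prod_geo_le3.
pose inv n (x : ('I_m -> fps C m) * ('S_m -> 'I_m -> fps C m) * ('I_m -> fps C m)) :=
  [/\ [/\ tid x.1.1, rmap k Rs x.1.1, conjg_eq G x.1.2 x.1.1 & forall g, g \in G -> nc (x.1.2 g)],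
      tau_ord G (2 ^ n).+1 x.1.2 /\ tau_bnd G (r n) (2^-1 ^+ n * r n) x.1.2,
      tid x.2 /\ rmap k Rs x.2,
      forall g, g \in G -> mcomp (T g) x.2 = mcomp x.2 (x.1.2 g) &
      forall c N, nrm N (r n) (x.2 c) <= r0].
have init : inv 0%N (F, T, @mid C m).
  split => //=.
  - by split=> //; rewrite /r big_ord0 expr0 mul1r mulr1.
  - by split; [exact: tid_mid|exact: rmap_mid].
  - by move=> g gG; rewrite mcomp1r mcomp1l //; exact: nT.
  - by move=> c N; rewrite /r big_ord0 mulr1; apply: nrm_var; exact: ltW.
have step n (x : {x | inv n x}) : {y : {y | inv n.+1 y} |
    forall c, fps_ord n.+1 ((sval y).2 c - (sval x).2 c)}.
  apply: cid; case: x => -[[F1 T1] S1] /= [/= [tF1 hF1 hT1 nT1] [oT1 bT1] [tS1 hS1] cS1 bS1].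
  pose de : R := 2^-1 ^+ n / 8.
  have de0 : 0 < de by rewrite divr_gt0.
  have de5 : de <= 5^-1.
    by rewrite ler_pdivrMr // (le_trans (h1 n)) //; lra.
  have [sn0 sn1] := andP (s01 n); have [wn0 wn1] := andP (w01 n).
  have sx0 : 0 <= s n ^+ (2 ^ n) by rewrite exprn_ge0 // ltW.
  have NN : (#|G| * m)%:R <= (#|G| * m).+1%:R :> R by rewrite ler_nat.
  have NN0 : 0 <= (#|G| * m)%:R :> R by [].
  have NN1 : 1 <= (#|G| * m).+1%:R :> R by rewrite ler1n.
  have sw' := sw n.
  have c1 : 2 * (#|G| * m)%:R * s n ^+ (2 ^ n) * 2^-1 ^+ n <= w n * de.
    rewrite /de mulrA -[w n * _ / 8]mulrAC ler_wpM2r ?(ltW (h0 n)) //.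
    rewrite ler_pdivlMr //; apply: le_trans sw'.
    by have := ler_wpM2r sx0 NN; lra.
  have c2 : s n ^+ (2 ^ n) * 2^-1 ^+ n <= de.
    rewrite /de mulrC ler_wpM2l ?(ltW (h0 n)) // -[8^-1]mul1r ler_pdivlMr // mulrC.
    apply: le_trans wn1; apply: le_trans sw'; rewrite ler_wpM2r //; lra.
  have c3 : r n.+1 * (1 + 4 * de) <= s n * r n.
    rewrite rS /q /de (_ : 4 * (2^-1 ^+ n / 8) = 2^-1 ^+ n / 2); last by field.
    by rewrite -mulrA divfK ?[s n * _]mulrC // gt_eqF // addr_gt0 // divr_gt0.
  have n20 : (0 < 2 ^ n)%N by rewrite expn_gt0.
  have [F2 [T2 [P [A1 [tP hP oP TP] oT2 bT2 bP]]]] := kam_step Rs2 RsG kk tF1 hF1 hT1 nT1 n20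
    oT1 (r_gt0 n) (ltW (h0 n)) bT1 (w01 n) (hsd n) (s01 n) (introT andP (conj de0 de5)) c1 c2
    (r_gt0 n.+1) c3.
  have S10 := tid_nc tS1; have P0 := tid_nc tP.
  have iv : inv n.+1 (F2, T2, mcomp S1 P).
    split => //=.
    - split; first by rewrite expnS mul2n.
      move=> g c N gG; apply: le_trans (bT2 g c N gG) _.
      by rewrite ler_wpM2r ?(ltW (r_gt0 _)) // /de exprS; lra.
    - by split; [exact: tid_comp|exact: rmap_comp].
    - move=> g gG; have T20 : nc (T2 g) by case: A1 => _ _ _; apply.
      by apply: conj_chain (cS1 g gG) (TP g gG) => //; [exact: nT|exact: nT1].
    - move=> c N; apply: le_trans (nrm_comp (x := s n * r n) _ _ _ _ _) _.
      + exact: ltW.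
      + by rewrite mulr_ge0 // ltW.
      + exact: P0.
      + by move=> i; exact: bP.
      + apply: le_trans (bS1 c N); apply: nrm_ler; rewrite mulr_ge0 ?(ltW sn0) ?(ltW (r_gt0 n)) //=.
        by rewrite ler_piMl // ltW.
  exists (exist _ _ iv) => c /=; rewrite /mcomp -[X in _ - X]fps_comp_id.
  apply: fps_comp_ext => //; first exact: mid_nc.
  by move=> i; apply: fps_ordW (oP i); rewrite ltnS ltnW // ltn_expl.
have [x [xS xI]] : exists x : nat -> _,
    (forall n c, fps_ord n.+1 ((x n.+1).2 c - (x n).2 c)) /\ forall n, inv n (x n).
  pose f := nat_rect (fun n => {x | inv n x}) (exist _ _ init) (fun n x => sval (step n x)).
  by exists (fun n => sval (f n)); split=> n; [exact: (svalP (step n (f n)))|exact: svalP].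
pose S c := fps_lim (fun n => (x n).2 c).
have SP n c : fps_ord n.+1 (S c - (x n).2 c) by apply: fps_limP => j; exact: xS.
have tS : tid S.
  move=> c; have -> : S c - mid c = (S c - (x 1%N).2 c) + ((x 1%N).2 c - mid c) by ring.
  by apply: fps_ordD; [exact: SP|case: (xI 1%N) => _ _ [+ _] _ _; apply].
have S0 := tid_nc tS.
have xn0 n : nc (x n).2 by case: (xI n) => _ _ [/tid_nc].
exists S; split => //.
- apply/(rmapP k Rs S0) => c u; rewrite !(fps_ord_eq (SP (mi_deg u) _)) ?mi_deg_act //.
  by apply: (rmapP k Rs (xn0 _)).1; case: (xI (mi_deg u)) => _ _ [].
- move=> c; exists rinf, r0; split => // N; rewrite (nrm_ext_ord _ (SP N c)).
  case: (xI N) => _ _ _ _ h; apply: le_trans (h c N); apply: nrm_ler.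
  by rewrite (ltW rinf0) rinf_le.
- move=> g gG; have p0 := @ptau_nc m C g; have Tg0 := nT g gG; apply/funext => c.
  apply: fps_ext => n; have [[_ _ _ /(_ g gG) Tn0] [oTn _] _ hn _] := xI n.
  have -> : mcomp (T g) S c - mcomp S (ptau g) c =
     (fps_comp (T g c) S - fps_comp (T g c) (x n).2) +
     (fps_comp ((x n).2 c) ((x n).1.2 g) - fps_comp ((x n).2 c) (ptau g)) -
     (fps_comp (S c - (x n).2 c) (ptau g)).
    have := congr1 (fun H => H c) (hn g gG); rewrite /mcomp fps_compB => ->; ring.
  apply: fps_ordB; [apply: fps_ordD|].
  + by apply: fps_comp_ext => // i; exact: fps_ordW (SP n i).
  + apply: fps_comp_ext => // i; apply: fps_ordW (oTn g i gG).
    by rewrite ltnW // ltnW // ltnS ltn_expl.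
  + by apply: fps_comp_ord1 => //; exact: fps_ordW (SP n c).
Qed.

End Kam.

(** * Convergence of formal deck transformations *)

Lemma fps_monoE (K : comNzRingType) m (v u : multiindex m) (a : fps K m) :
  (fps_mono v * a) (v + u) = a u.
Proof.
rewrite (fps_mulrEs _ _ (leqnn _)) (bigID (fun s => s == v)) /= sum_mis_eq; last first.
  by rewrite mi_degD leq_addr.
rewrite [X in _ + X]big1 ?addr0 => [|s /negbTE sv]; last first.
  by apply: big1 => t _; rewrite /fps_mono sv mul0r mul0rn.
rewrite (bigID (fun s => s == u)) /= sum_mis_eq; last by rewrite mi_degD leq_addl.
rewrite /fps_mono !eqxx mul1r mulr1n big1 ?addr0 // => t tu; case: eqP => // e.
by move: tu; rewrite (@mi_addIr _ t u v) ?eqxx // addrC e addrC.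
Qed.

Section Deck.
Context {R : realType}.
Local Notation C := R[i].

Lemma nrm_varM m N r i (a : fps C m) : 0 <= r -> r * nrm N r a <= nrm N.+1 r (fps_var i * a).
Proof.
move=> r0; rewrite /nrm mulr_sumr.
pose H w := cabs ((fps_var i * a) w) * r ^+ mi_deg w.
have H0 w : 0 <= H w by rewrite mulr_ge0 ?cabs_ge0 ?exprn_ge0.
apply: (@le_trans _ _ (\sum_(u <- mis m N) H (mi_unit i + u))).
  apply: ler_sum => u _; rewrite /H fps_monoE mi_degD mi_deg_unit add1n exprS.
  by rewrite mulrCA.
rewrite -(big_map (fun u => mi_unit i + u) predT H) /=.
set s := [seq _ | _ <- _].
have us : uniq s by rewrite map_inj_uniq ?mis_uniq // => u v e; apply: (@mi_addIr _ u v (mi_unit i)); rewrite addrC e addrC.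
rewrite [leRHS](bigID (fun w => w \in s)) /=.
rewrite -[X in _ <= X + _]big_filter [X in _ <= X + _](perm_big s) /=.
  by rewrite lerDl; apply: sumr_ge0 => w _; exact: H0.
apply: uniq_perm => //; first by rewrite filter_uniq // mis_uniq.
move=> w; rewrite mem_filter; apply/andb_idr => /mapP[u]; rewrite !mem_mis => uN ->.
by rewrite mi_degD mi_deg_unit add1n.
Qed.

Lemma nrm_comp_ord3 m k N r x (f : fps C k) (g : 'I_k -> fps C m) : 0 <= r -> 0 <= x -> nc g ->
  fps_ord 3 f -> (forall i, nrm N r (g i) <= x) -> nrm N.+2 r (fps_comp f g) <= nrm N.+2 x f.
Proof.
move=> r0 x0 g0 f3 h; pose g' i := fps_trunc N (g i).
have g'0 : nc g' by move=> i; rewrite /g' /fps_trunc mi_deg0 g0.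
rewrite (@nrm_ext_ord _ _ _ _ _ (fps_comp f g')); last first.
  by rewrite -addn2; apply: (@fps_comp_sub_ord _ _ _ _ _ _ 3) => // i; exact: fps_truncP.
by apply: nrm_comp => // i; apply: le_trans (h i); exact: nrm_trunc.
Qed.

Lemma nrm_sqr_ord2 m N r x (a : fps C m) : 0 <= r -> fps_ord 2 a -> nrm N r a <= x ->
  nrm N.+2 r (a ^+ 2) <= x ^+ 2.
Proof.
move=> r0 a2 h; pose b := fps_trunc N a.
have b2 : fps_ord 2 b by move=> u u2; rewrite /b /fps_trunc a2 ?if_same.
rewrite (@nrm_ext_ord _ _ _ _ _ (b ^+ 2)); last first.
  by have := ord_subX (k := 1) a2 b2 (@fps_truncP _ _ N a); rewrite muln1 addn2.
by apply: nrmX => //; apply: le_trans h; exact: nrm_trunc.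
Qed.

(* A formal deck transformation T of the analytic map W = (x + g, l^2 + f) converges: comparing
   coefficients in W o T = W gives t_x = g - g(T) and 2 e l t_l = f - f(T) - t_l^2, and
   multiplication by the variable l_j is isometric for the l1-norms. *)
Lemma deck_cvgt p (e : 'I_p -> C) (T W : 'I_(p + p) -> fps C (p + p)) :
  (forall j, e j ^+ 2 = 1) ->
  (forall j, fps_ord 2 (T (lshift p j) - fps_var (lshift p j))) ->
  (forall j, fps_ord 2 (T (rshift p j) - fps_C (e j) * fps_var (rshift p j))) ->
  (forall j, fps_ord 2 (W (lshift p j) - fps_var (lshift p j))) ->
  (forall j, fps_ord 3 (W (rshift p j) - fps_var (rshift p j) ^+ 2)) ->
  (forall i, cvgt (W i)) -> mcomp W T = W -> forall i, cvgt (T i).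
Proof.
move=> e2 T1 T2 W1 W2 cW WT.
have e1 j : cabs (e j) = 1.
  have /eqP := congr1 cabs (e2 j); rewrite cabsX cabs1 -subr_eq0 subr_sqr_1 mulf_eq0.
  rewrite subr_eq0 => /orP[/eqP //|]; rewrite addr_eq0 => /eqP h.
  by have := cabs_ge0 (e j); rewrite h; lra.
pose tau i : fps C (p + p) := match fintype.split i with
  | inl j => fps_var (lshift p j) | inr j => fps_C (e j) * fps_var (rshift p j) end.
have tl j : tau (lshift p j) = fps_var (lshift p j) by rewrite /tau (unsplitK (inl j)).
have tr j : tau (rshift p j) = fps_C (e j) * fps_var (rshift p j) by rewrite /tau (unsplitK (inr j)).
pose t i := T i - tau i.
have t2 i : fps_ord 2 (t i).
  by rewrite -(splitK i) /t; case: (fintype.split i) => j /=; rewrite ?tl ?tr; [exact: T1|exact: T2].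
have TE i : T i = tau i + t i by rewrite /t addrC subrK.
have tau1 i : fps_ord 1 (tau i).
  by rewrite -(splitK i); case: (fintype.split i) => j /=; rewrite ?tl ?tr; do ?apply: fps_ordMl; exact: mid_ord.
have T0 : nc T.
  by move=> i; apply: fps_ord1E; rewrite TE; apply: fps_ordD => //; exact: fps_ordW (t2 i).
pose g j := W (lshift p j) - fps_var (lshift p j).
pose f j := W (rshift p j) - fps_var (rshift p j) ^+ 2.
have gE j : t (lshift p j) = g j - fps_comp (g j) T.
  rewrite /g fps_compB -[fps_comp (W _) T]/(mcomp W T _) WT fps_comp_var // /t tl; ring.
have fE j : fps_C (2 * e j) * (fps_var (rshift p j) * t (rshift p j)) =
    f j - fps_comp (f j) T - t (rshift p j) ^+ 2.
  rewrite /f fps_compB -[fps_comp (W _) T]/(mcomp W T _) WT fps_compX // fps_comp_var //.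
  have E2 : fps_C (e j) ^+ 2 = 1 :> fps C (p + p) by rewrite -rmorphXn e2 rmorph1.
  have -> : fps_C (2 * e j) = 2 * fps_C (e j) :> fps C (p + p) by rewrite rmorphM rmorph_nat.
  rewrite TE tr; move: (t _) (W _) (fps_var _) E2 => t' W' V.
  move: (fps_C _ : fps C (p + p)) => E E2.
  transitivity (W' - V ^+ 2 - (W' - (E ^+ 2 * V ^+ 2 + 2 * E * V * t' + t' ^+ 2)) - t' ^+ 2).
    by rewrite E2; ring.
  by ring.
pose h i := match fintype.split i with inl j => g j | inr j => f j end.
have hl j : h (lshift p j) = g j by rewrite /h (unsplitK (inl j)).
have hr j : h (rshift p j) = f j by rewrite /h (unsplitK (inr j)).
have ch i : cvgt (h i).
  rewrite -(splitK i); case: (fintype.split i) => j /=; rewrite ?hl ?hr.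
    by apply: cvgtB => //; exact: cvgt_var.
  by apply: cvgtB => //; apply: cvgtX; exact: cvgt_var.
have [r0 [M [r00 M0 H]]] := cvgt_fam ch.
pose d := Num.min 1 (Num.min (r0 / (4 * M)) (r0 ^+ 2 / (8 * M))).
have d0 : 0 < d by rewrite !lt_min ltr01 !divr_gt0 ?mulr_gt0 ?exprn_gt0.
have d01 : 0 <= d <= 1 by rewrite (ltW d0) ge_min lexx.
pose X := d * r0; have X0 : 0 < X by rewrite mulr_gt0.
have bg j N : nrm N X (g j) <= X / 4.
  apply: le_trans (nrm_small (D := 2) r00 (ltW M0) _ _ d01 N) _; last 1 first.
  - have : d <= r0 / (4 * M) by rewrite !ge_min lexx !orbT.
    rewrite ler_pdivlMr ?mulr_gt0 // => dd.
    rewrite ler_pdivlMr // expr2 -!mulrA ler_pM2l // mulrC [M * 4]mulrC.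
    by rewrite mulrC in dd *; rewrite mulrC [_ * M in X in X <= _]mulrC; lra.
  - by move=> M'; rewrite -hl.
  - exact: W1.
have bf j N : nrm N X (f j) <= X ^+ 2 / 8.
  apply: le_trans (nrm_small (D := 3) r00 (ltW M0) _ _ d01 N) _; last 1 first.
  - have : d <= r0 ^+ 2 / (8 * M) by rewrite !ge_min lexx !orbT.
    rewrite ler_pdivlMr ?mulr_gt0 // => dd.
    have d2 : 0 <= d ^+ 2 by exact: exprn_ge0 (ltW d0).
    have := ler_wpM2l d2 dd; rewrite /X exprMn ler_pdivlMr //.
    by rewrite [d ^+ 3]exprS; lra.
  - by move=> M'; rewrite -hr.
  - exact: W2.
pose r := X / 2; have r_gt0 : 0 < r by rewrite divr_gt0.
have rX : 0 <= r <= X by rewrite (ltW r_gt0) /r; lra.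
have btau N i : nrm N r (tau i) <= r.
  rewrite -(splitK i); case: (fintype.split i) => j /=; rewrite ?tl ?tr.
    exact: nrm_var (ltW r_gt0).
  by rewrite nrm_CM e1 mul1r; exact: nrm_var (ltW r_gt0).
have key N i : nrm N r (t i) <= r.
  elim: N i => [|N IH] i.
    rewrite /nrm big1_seq ?(ltW r_gt0) // => u /andP[_]; rewrite mem_mis leqn0 => /eqP u0.
    by rewrite t2 ?u0 // cabs0 mul0r.
  have bT j : nrm N r (T j) <= X.
    rewrite TE (le_trans (nrmD _ _ _ (ltW r_gt0))) //.
    by have := btau N j; have := IH j; rewrite /r; lra.
  rewrite -(splitK i); case: (fintype.split i) => j /=.
    rewrite gE (le_trans (nrmB _ _ _ (ltW r_gt0))) //.
    have := nrm_comp_ord2 (ltW r_gt0) (ltW X0) T0 (W1 j) bT.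
    have := bg j N.+1; have := nrm_ler N.+1 (g j) rX; rewrite -/(g j) /r; lra.
  have := nrm_comp_ord3 (ltW r_gt0) (ltW X0) T0 (W2 j) bT; rewrite -/(f j) => b1.
  have b2 := nrm_sqr_ord2 (ltW r_gt0) (t2 (rshift p j)) (IH (rshift p j)).
  have b3 := nrm_ler N.+2 (f j) rX; have b4 := bf j N.+2.
  have b5 := nrm_varM N.+1 (rshift p j) (t (rshift p j)) (ltW r_gt0).
  have := nrm_CM N.+2 r (2 * e j) (fps_var (rshift p j) * t (rshift p j)).
  rewrite fE cabsM e1 mulr1 (cabs_nat 2) => b6.
  have b7 := nrmB N.+2 (f j - fps_comp (f j) T) (t (rshift p j) ^+ 2) (ltW r_gt0).
  have b8 := nrmB N.+2 (f j) (fps_comp (f j) T) (ltW r_gt0).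
  rewrite -(ler_pM2l r_gt0) (le_trans b5) //.
  have -> : r * r = X ^+ 2 / 4 by rewrite /r; field.
  have r2 : r ^+ 2 = X ^+ 2 / 4 by rewrite /r; field.
  rewrite r2 in b2; lra.
move=> i; exists r, X; split => // N; rewrite TE (le_trans (nrmD _ _ _ (ltW r_gt0))) //.
by have := btau N i; have := key N i; rewrite /r; lra.
Qed.

End Deck.

(** * Branched coverings invariant under sign changes *)

Definition csplit (T : Type) p q (f : 'I_p -> T) (g : 'I_q -> T) (i : 'I_(p + q)) : T :=
  match fintype.split i with inl j => f j | inr j => g j end.

Lemma csplitl T p q (f : 'I_p -> T) (g : 'I_q -> T) j : csplit f g (lshift q j) = f j.
Proof. by rewrite /csplit (unsplitK (inl j)). Qed.
Lemma csplitr T p q (f : 'I_p -> T) (g : 'I_q -> T) j : csplit f g (rshift p j) = g j.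
Proof. by rewrite /csplit (unsplitK (inr j)). Qed.
Definition csplitE := (csplitl, csplitr).

Lemma all_split p q (P : 'I_(p + q) -> Prop) :
  (forall j, P (lshift q j)) -> (forall j, P (rshift p j)) -> forall i, P i.
Proof. by move=> hl hr i; rewrite -(splitK i); case: (fintype.split i) => j /=. Qed.

Lemma tid_jac (K : comNzRingType) m (F : 'I_m -> fps K m) : nc F -> jac F = 1%:M -> tid F.
Proof. by move=> F0 J i; have := lin_sub_jac F0 i; rewrite J lin1. Qed.

Section Squares.
Context {K : comNzRingType} {p : nat}.
Local Notation X := (@fps_var K (p + p)).

Definition sqm : 'I_(p + p) -> fps K (p + p) :=
  csplit (fun j => X (lshift p j)) (fun j => X (rshift p j) ^+ 2).

Definition sgn (e : 'I_p -> K) : 'I_(p + p) -> K := csplit (fun _ : 'I_p => 1) e.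
Definition sgnm (e : 'I_p -> K) : 'I_(p + p) -> fps K (p + p) := plin (sgn e) 1%g.

Definition mi_dbl (u : multiindex (p + p)) : multiindex (p + p) :=
  [ffun i => csplit (fun j => u (lshift p j)) (fun j => (u (rshift p j)).*2) i].

Lemma sqm_nc : nc sqm.
Proof.
apply: all_split => j; rewrite /sqm csplitE; first exact: mid_nc.
by apply: fps_ord1E; rewrite expr2; apply: fps_ordMl; exact: mid_ord.
Qed.

Lemma sgnm_nc e : nc (sgnm e). Proof. exact: plin_nc. Qed.

Lemma sgnmE e i : sgnm e i = fps_C (sgn e i) * X i.
Proof. by rewrite /sgnm /plin perm1. Qed.

Lemma sqm_monomial u : fps_monomial sqm u = fps_mono (mi_dbl u).
Proof.
rewrite -fps_monomial_mid !fps_monomialE; apply: eq_bigr => i _; rewrite ffunE.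
elim/all_split: i => j; rewrite /sqm !csplitE //.
by rewrite -exprM mul2n.
Qed.

Lemma mi_dbl_inj : injective mi_dbl.
Proof.
move=> u v /ffunP e; apply/ffunP => i; have := e i; rewrite !ffunE.
by elim/all_split: i => j; rewrite !csplitE // => /double_inj.
Qed.

Lemma mi_deg_dbl u : (mi_deg u <= mi_deg (mi_dbl u))%N.
Proof.
rewrite /mi_deg; apply: leq_sum => i _; rewrite ffunE.
by elim/all_split: i => j; rewrite !csplitE // -addnn leq_addr.
Qed.

Lemma sqm_comp f u : fps_comp f sqm (mi_dbl u) = f u.
Proof.
rewrite (fps_compE _ sqm_nc (leqnn _)); under eq_bigr do rewrite sqm_monomial.
rewrite (bigID (fun v => v == u)) /= sum_mis_eq ?mi_deg_dbl // /fps_mono eqxx mulr1.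
by rewrite big1 ?addr0 // => v vu; rewrite (inj_eq mi_dbl_inj) eq_sym (negbTE vu) mulr0.
Qed.

Lemma sqm_comp0 f w : (forall u, w != mi_dbl u) -> fps_comp f sqm w = 0.
Proof.
move=> h; rewrite (fps_compE _ sqm_nc (leqnn _)); apply: big1 => u _.
by rewrite sqm_monomial /fps_mono (negbTE (h u)) mulr0.
Qed.

Lemma sgnm_comp e (f : fps K (p + p)) u : fps_comp f (sgnm e) u = f u * mi_pow (sgn e) u.
Proof. by rewrite /sgnm plin_comp invg1 mi_act1. Qed.

Definition undbl (h : fps K (p + p)) : fps K (p + p) := fun u => h (mi_dbl u).

Lemma mi_dblP (w : multiindex (p + p)) : (forall j, ~~ odd (w (rshift p j))) ->
  exists u, w = mi_dbl u.
Proof.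
move=> h; exists [ffun i => csplit (fun j => w (lshift p j)) (fun j => (w (rshift p j))./2) i].
apply/ffunP => i; rewrite !ffunE; elim/all_split: i => j; rewrite !csplitE ffunE csplitE //.
by have := odd_double_half (w (rshift p j)); rewrite (negbTE (h j)).
Qed.

Lemma undblK (h : fps K (p + p)) : (forall x : K, x = - x -> x = 0) ->
  (forall e : 'I_p -> K, (forall j, e j ^+ 2 = 1) -> fps_comp h (sgnm e) = h) ->
  fps_comp (undbl h) sqm = h.
Proof.
move=> char2 inv; apply/funext => w.
have [ev|] := pselect (forall j, ~~ odd (w (rshift p j))).
  by have [u ->] := mi_dblP ev; rewrite sqm_comp.
move=> /existsNP[j] /negP; rewrite negbK => oj.
rewrite sqm_comp0 => [|u]; last first.
  apply/eqP => e; move: oj; rewrite e ffunE csplitE odd_double //.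
apply/esym/char2; pose e i : K := if i == j then -1 else 1.
have e2 i : e i ^+ 2 = 1 by rewrite /e; case: eqP => _; rewrite ?expr1n // sqrrN expr1n.
rewrite -{1}(inv e e2) sgnm_comp /mi_pow (bigD1 (rshift p j)) //= /sgn csplitE /e eqxx.
rewrite -signr_odd oj expr1 big1 ?mulr1 ?mulrN1 // => i ij.
elim/all_split: i ij => i ij; rewrite csplitE ?expr1n //.
case: eqP => [eij|_]; last exact: expr1n.
by rewrite eij eqxx in ij.
Qed.

Lemma sqm_sgnm e : (forall j, e j ^+ 2 = 1) -> mcomp sqm (sgnm e) = sqm.
Proof.
move=> e2; have s0 := @sgnm_nc e; apply/funext; apply: all_split => j; rewrite /mcomp /sqm !csplitE.
  by rewrite fps_comp_var // sgnmE /sgn csplitE rmorph1 mul1r.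
rewrite fps_compX // fps_comp_var // sgnmE /sgn csplitE exprMn_comm; last exact: mulrC.
by rewrite -rmorphXn e2 rmorph1 mul1r.
Qed.

(* Terms of order 2 in z' are subtracted from the z''-components. *)
Definition zquad (f : fps K (p + p)) : fps K (p + p) := fun u =>
  if (mi_deg u == 2%N) && [forall j, u (rshift p j) == 0%N] then f u else 0.

Lemma zquad_ord f : fps_ord 2 (zquad f).
Proof. by move=> u u2; rewrite /zquad ltn_eqF. Qed.

Lemma sub_zquad_ord f j : fps_ord 2 (f - X (rshift p j)) ->
  fps_ord 3 (fps_comp (f - X (rshift p j) - zquad f) sqm).
Proof.
move=> f2 w w3; rewrite (fps_compE _ sqm_nc (leqnn _)); apply: big1 => u _.
rewrite sqm_monomial /fps_mono; case: eqP => [e|_]; last by rewrite mulr0.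
rewrite mulr1 fps_subE; have [u2|u2] := ltnP (mi_deg u) 2.
  by rewrite f2 // zquad_ord // subr0.
have du : mi_deg u = 2%N by have := mi_deg_dbl u; rewrite -e; move: w3 u2; lia.
have z i : u (rshift p i) == 0%N.
  rewrite eqn0Ngt; apply/negP => ui.
  have : (mi_deg u < mi_deg (mi_dbl u))%N.
    rewrite /mi_deg (bigD1 (rshift p i)) //= [X in (_ < X)%N](bigD1 (rshift p i)) //= -addSn.
    apply: leq_add; first by rewrite ffunE csplitE -addnn -[X in (X < _)%N]addn0 ltn_add2l.
    apply: leq_sum => l _; rewrite ffunE.
    by elim/all_split: l => l; rewrite !csplitE // -addnn leq_addr.
  by rewrite -e du ltnNge -ltnS w3.
rewrite fps_subE /zquad du eqxx /= (introT forallP z).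
rewrite /fps_var (_ : (u == _) = false) ?subr0 ?subrr //.
by apply/eqP => h; move: du; rewrite h mi_deg_unit.
Qed.

End Squares.

Section NormalForm.
Context {K : comNzRingType} {p : nat}.
Local Notation X := (@fps_var K (p + p)).
Implicit Types W Th Ga : 'I_(p + p) -> fps K (p + p).

Definition flatten_quad Ga W : 'I_(p + p) -> fps K (p + p) :=
  csplit (fun j => W (lshift p j))
         (fun j => W (rshift p j) - fps_comp (zquad (Ga (rshift p j))) W).

Lemma flatten_quad_nc Ga W : nc W -> nc (flatten_quad Ga W).
Proof.
move=> W0; apply: all_split => j; rewrite /flatten_quad csplitE //.
by rewrite fps_subE W0 fps_comp_nc ?subrr // zquad_ord ?mi_deg0.
Qed.

Lemma flatten_quad_comp Ga W V : nc W -> nc V ->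
  mcomp (flatten_quad Ga W) V = flatten_quad Ga (mcomp W V).
Proof.
move=> W0 V0; apply/funext; apply: all_split => j; rewrite /mcomp /flatten_quad !csplitE //.
by rewrite fps_compB fps_compA.
Qed.

Lemma tid_expand Th (f g : fps K (p + p)) n : tid Th -> fps_ord n (fps_comp f Th - g) ->
  forall Ti, tid Ti -> mcomp Th Ti = @mid K (p + p) -> fps_ord n (f - fps_comp g Ti).
Proof.
move=> tTh h Ti tTi TTi; have Th0 := tid_nc tTh; have Ti0 := tid_nc tTi.
have -> : f - fps_comp g Ti = fps_comp (fps_comp f Th - g) Ti.
  by rewrite fps_compB fps_compA // TTi fps_comp_id.
exact: fps_comp_ord1.
Qed.

Lemma ord_sqr_sub (a : fps K (p + p)) i : fps_ord 2 (a - X i) -> fps_ord 3 (a ^+ 2 - X i ^+ 2).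
Proof.
move=> h; have x1 : fps_ord 1 (X i) by exact: mid_ord.
have a1 : fps_ord 1 a.
  by rewrite -(subrK (X i) a); apply: fps_ordD => //; exact: fps_ordW h.
exact: (ord_subX (k := 1) a1 x1 h).
Qed.

Lemma flatten_quad_ord Ga W Th : nc W -> tid Th -> tid Ga -> mcomp W Th = mcomp Ga sqm ->
  (forall j, fps_ord 2 (flatten_quad Ga W (lshift p j) - X (lshift p j))) /\
  (forall j, fps_ord 3 (flatten_quad Ga W (rshift p j) - X (rshift p j) ^+ 2)).
Proof.
move=> W0 tTh tGa WTh; have Th0 := tid_nc tTh; have Ga0 := tid_nc tGa; have s0 := @sqm_nc K p.
have [Ti [tTi TTi TiT]] := tid_inv tTh; have Ti0 := tid_nc tTi.
have e i : fps_comp (flatten_quad Ga W i) Th = fps_comp (flatten_quad Ga Ga i) sqm.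
  rewrite -[LHS]/(mcomp _ _ i) flatten_quad_comp // WTh.
  by rewrite -[RHS]/(mcomp _ _ i) flatten_quad_comp.
split=> j.
  have h : fps_ord 2 (fps_comp (flatten_quad Ga W (lshift p j)) Th - X (lshift p j)).
    rewrite e /flatten_quad csplitE.
    have -> : X (lshift p j) = fps_comp (X (lshift p j)) sqm by rewrite fps_comp_var // /sqm csplitE.
    by rewrite -fps_compB; apply: fps_comp_ord1 => //; exact: tGa.
  have := tid_expand tTh h tTi TTi; rewrite fps_comp_var // => h1.
  rewrite (_ : _ - _ = (flatten_quad Ga W (lshift p j) - Ti (lshift p j)) + (Ti (lshift p j) - X (lshift p j))); last by ring.
  by apply: fps_ordD => //; exact: tTi.
have h : fps_ord 3 (fps_comp (flatten_quad Ga W (rshift p j)) Th - X (rshift p j) ^+ 2).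
  rewrite e /flatten_quad csplitE.
  have -> : X (rshift p j) ^+ 2 = fps_comp (X (rshift p j)) sqm by rewrite fps_comp_var // /sqm csplitE.
  set f := Ga _; set q := zquad f.
  rewrite (_ : _ - _ = fps_comp (f - X (rshift p j) - q) sqm - fps_comp (fps_comp q Ga - fps_comp q (@mid K _)) sqm); last first.
    by rewrite fps_comp_id !fps_compB; ring.
  apply: fps_ordB; first by apply: sub_zquad_ord; exact: tGa.
  apply: fps_comp_ord1 => //.
  apply: (@fps_comp_sub_ord _ _ _ _ _ _ 2 2) => //; first exact: mid_nc.
    exact: zquad_ord.
have := tid_expand tTh h tTi TTi; rewrite fps_compX // fps_comp_var // => h1.
rewrite (_ : _ - _ = (flatten_quad Ga W (rshift p j) - Ti (rshift p j) ^+ 2) + (Ti (rshift p j) ^+ 2 - X (rshift p j) ^+ 2)); last by ring.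
by apply: fps_ordD => //; apply: ord_sqr_sub; exact: tTi.
Qed.

Lemma conj_tid_ord Th Ti t T i : tid Th -> tid Ti -> nc t -> mcomp Th Ti = @mid K (p + p) ->
  T = mcomp (mcomp Th t) Ti -> (forall i, fps_ord 2 (fps_comp (t i) Ti - t i)) ->
  fps_ord 2 (T i - t i).
Proof.
move=> tTh tTi t0 TTi -> h; have Ti0 := tid_nc tTi; have Th0 := tid_nc tTh.
rewrite (_ : _ - _ = fps_comp (fps_comp (Th i - mid i) t) Ti + (fps_comp (t i) Ti - t i)).
  apply: fps_ordD => //; do 2!apply: fps_comp_ord1 => //; exact: tTh.
by rewrite /mcomp fps_compB fps_comp_var // fps_compB; ring.
Qed.

End NormalForm.

Section DeckXL.
Context {R : realType} {p : nat}.
Local Notation C := R[i].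
Local Notation X := (@fps_var C (p + p)).
Implicit Types W Th Ga : 'I_(p + p) -> fps C (p + p).

Lemma cvgt_trunc m N (a : fps C m) : cvgt (fps_trunc N a).
Proof.
by rewrite fps_truncE; apply: cvgt_sum => u _; apply: cvgtM; [exact: cvgt_C|exact: cvgt_mono].
Qed.

Lemma cvgt_zquad (f : fps C (p + p)) : cvgt (zquad f).
Proof.
have -> : zquad f = fps_trunc 2 (zquad f); last exact: cvgt_trunc.
apply/funext => u; rewrite /fps_trunc; case: leqP => // u2.
by rewrite /zquad gtn_eqF.
Qed.

Lemma flatten_quad_cvgt Ga W : nc W -> (forall i, cvgt (W i)) ->
  forall i, cvgt (flatten_quad Ga W i).
Proof.
move=> W0 cW; apply: all_split => j; rewrite /flatten_quad csplitE //.
by apply: cvgtB => //; apply: cvgt_comp => //; exact: cvgt_zquad.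
Qed.

Lemma deck_cvgt_tid W Th Ga Ti e : nc W -> (forall i, cvgt (W i)) -> tid Th -> tid Ga ->
  mcomp W Th = mcomp Ga sqm -> tid Ti -> mcomp Th Ti = @mid C (p + p) ->
  (forall j, e j ^+ 2 = 1) -> forall i, cvgt (mcomp (mcomp Th (sgnm e)) Ti i).
Proof.
move=> W0 cW tTh tGa WTh tTi TTi e2.
have Th0 := tid_nc tTh; have Ti0 := tid_nc tTi; have Ga0 := tid_nc tGa.
have s0 := @sqm_nc C p; have g0 := @sgnm_nc C p e.
pose T := mcomp (mcomp Th (sgnm e)) Ti.
have WT : mcomp W T = W.
  have Tg0 : nc (mcomp Th (sgnm e)) by exact: mcomp_nc.
  rewrite /T -(mcompA W Tg0 Ti0) -(mcompA W Th0 g0) WTh (mcompA Ga s0 g0) sqm_sgnm //.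
  by rewrite -WTh (mcompA W Th0 Ti0) TTi mcomp1r.
have V0 := flatten_quad_nc Ga W0.
have [q1 q2] := flatten_quad_ord W0 tTh tGa WTh.
have T0 : nc T by do 2!apply: mcomp_nc => //.
have oT i : fps_ord 2 (T i - sgnm e i).
  apply: (conj_tid_ord (Th := Th) (Ti := Ti)) => // j.
  by rewrite sgnmE fps_comp_CM fps_comp_var // -mulrBr; apply: fps_ordMl; exact: tTi.
apply: (deck_cvgt (e := e) (W := flatten_quad Ga W)) => //.
- by move=> j; have := oT (lshift p j); rewrite sgnmE /sgn csplitE rmorph1 mul1r.
- by move=> j; have := oT (rshift p j); rewrite sgnmE /sgn csplitE.
- exact: flatten_quad_cvgt.
- by rewrite flatten_quad_comp // WT.
Qed.

End DeckXL.

Section JacSqm.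
Context {K : fieldType} {p : nat}.
Local Notation X := (@fps_var K (p + p)).
Implicit Types H Ga Xi : 'I_(p + p) -> fps K (p + p).

Lemma mi_dbl_unitl (j : 'I_p) : mi_dbl (mi_unit (lshift p j)) = mi_unit (lshift p j).
Proof.
apply/ffunP => i; rewrite !ffunE; elim/all_split: i => i; rewrite !csplitE !ffunE //.
by rewrite eq_rlshift.
Qed.

Lemma mi_deg_dbl_unitr (j : 'I_p) : mi_deg (mi_dbl (mi_unit (rshift p j))) = 2%N.
Proof.
rewrite /mi_deg (bigD1 (rshift p j)) //= ffunE csplitE ffunE eqxx big1 // => i ij.
rewrite ffunE; elim/all_split: i ij => i ij; rewrite csplitE ffunE.
  by rewrite eq_lrshift.
by rewrite (negbTE ij).
Qed.

Lemma jac_sqm_unit H Ga Xi : nc H -> tid Ga -> tid Xi ->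
  mcomp H sqm = mcomp Ga (mcomp sqm Xi) -> jac H \in unitmx.
Proof.
move=> H0 tGa tXi e; have s0 := @sqm_nc K p; have Ga0 := tid_nc tGa; have Xi0 := tid_nc tXi.
have jt (F : 'I_(p + p) -> fps K (p + p)) : tid F -> jac F = 1%:M.
  by move=> tF; rewrite (jac_ext tF) jac_mid.
have jl i j : jac H i (lshift p j) = (i == lshift p j)%:R.
  transitivity (jac (@sqm K p) i (lshift p j)).
    have je : jac (mcomp H sqm) = jac sqm.
      have sX0 : nc (mcomp sqm Xi) by exact: mcomp_nc.
      by rewrite e jac_comp // jac_comp // (jt _ tGa) (jt _ tXi) mul1mx mulmx1.
    by rewrite -je !mxE /mcomp -[in RHS]mi_dbl_unitl sqm_comp.
  rewrite mxE; elim/all_split: i => i; rewrite /sqm csplitE.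
    by rewrite /fps_var (inj_eq (@mi_unit_inj _)) eq_sym.
  rewrite eq_rlshift expr2 (fps_ordM (n := 1) (n' := 1)) ?mi_deg_unit //; exact: mid_ord.
have jr i j : jac H (rshift p i) (rshift p j) = (i == j)%:R.
  rewrite mxE -(sqm_comp (H (rshift p i))) -[fps_comp _ _]/(mcomp H sqm _) e.
  have o3 : fps_ord 3 (fps_comp (Ga (rshift p i)) (mcomp sqm Xi) - fps_comp (Ga (rshift p i)) sqm).
    set f := Ga _; pose s := f - X (rshift p i).
    have sX0 : nc (mcomp sqm Xi) by exact: mcomp_nc.
    have -> : fps_comp f (mcomp sqm Xi) - fps_comp f sqm =
        (fps_comp s (mcomp sqm Xi) - fps_comp s sqm) + (Xi (rshift p i) ^+ 2 - X (rshift p i) ^+ 2).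
      have e1 : mcomp sqm Xi (rshift p i) = Xi (rshift p i) ^+ 2.
        by rewrite /mcomp /sqm csplitE fps_compX // fps_comp_var.
      have e2 : @sqm K p (rshift p i) = X (rshift p i) ^+ 2 by rewrite /sqm csplitE.
      by rewrite /s !fps_compB !fps_comp_var // e1 e2; ring.
    apply: fps_ordD; last by apply: ord_sqr_sub; exact: tXi.
    apply: (@fps_comp_sub_ord _ _ _ _ _ _ 2 2) => //; first exact: tGa.
    have el l : mcomp sqm Xi (lshift p l) = Xi (lshift p l).
      by rewrite /mcomp /sqm csplitE fps_comp_var.
    have er l : mcomp sqm Xi (rshift p l) = Xi (rshift p l) ^+ 2.
      by rewrite /mcomp /sqm csplitE fps_compX // fps_comp_var.
    apply: all_split => l; rewrite ?el ?er /sqm csplitE; first exact: tXi.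
    by apply: fps_ordW (ord_sqr_sub (tXi _)).
  rewrite /mcomp -/(mcomp sqm Xi) (fps_ord_eq o3) ?mi_deg_dbl_unitr // sqm_comp.
  rewrite (fps_ord_eq (tGa _)) ?mi_deg_unit // /mid /fps_var (inj_eq (@mi_unit_inj _)) eq_rshift.
  by rewrite eq_sym.
rewrite -[jac H]submxK.
have -> : ulsubmx (jac H) = 1%:M.
  by apply/matrixP => i j; rewrite 2!mxE jl eq_lshift [in RHS]mxE.
have -> : dlsubmx (jac H) = 0.
  by apply/matrixP => i j; rewrite 2!mxE jl eq_rlshift [in RHS]mxE.
have -> : drsubmx (jac H) = 1%:M.
  by apply/matrixP => i j; rewrite 2!mxE jr [in RHS]mxE.
by rewrite unitmxE det_ublock !det1 mulr1 unitr1.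
Qed.

End JacSqm.

Section Swap.
Context {p : nat}.
Implicit Types A B : {set 'I_p}.

Definition swapf A : 'I_(p + p) -> 'I_(p + p) :=
  csplit (fun j => if j \in A then rshift p j else lshift p j)
         (fun j => if j \in A then lshift p j else rshift p j).

Lemma swapfK A : involutive (swapf A).
Proof.
by apply: all_split => j; rewrite /swapf csplitE; case: ifP => jA; rewrite csplitE jA.
Qed.

Definition swp A : 'S_(p + p) := perm (inv_inj (swapfK A)).

Lemma swpl A j : swp A (lshift p j) = if j \in A then rshift p j else lshift p j.
Proof. by rewrite permE /swapf csplitE. Qed.
Lemma swpr A j : swp A (rshift p j) = if j \in A then lshift p j else rshift p j.
Proof. by rewrite permE /swapf csplitE. Qed.
Definition swpE := (swpl, swpr).

Lemma swpV A : ((swp A)^-1 = swp A)%g.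
Proof.
apply/eqP; rewrite eq_invg_mul; apply/eqP/permP => i.
by rewrite permM perm1 !permE swapfK.
Qed.

Lemma swpM A B : (swp A * swp B = swp ((A :\: B) :|: (B :\: A)))%g.
Proof.
apply/permP; apply: all_split => j; rewrite permM !swpE !inE;
  by case: (j \in A); rewrite swpE; case: (j \in B).
Qed.

Definition swp_set : {set 'S_(p + p)} := [set swp A | A : {set 'I_p}].

Lemma swp_group_set : group_set swp_set.
Proof.
apply/group_setP; split.
  apply/imsetP; exists finset.set0 => //; apply/permP; apply: all_split => j.
    by rewrite perm1 swpE inE.
  by rewrite perm1 swpE inE.
by move=> _ _ /imsetP[A _ ->] /imsetP[B _ ->]; rewrite swpM; exact: imset_f.
Qed.

Canonical swp_group := Group swp_group_set.

Lemma swp_groupP g : reflect (exists A, g = swp A) (g \in swp_group).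
Proof.
apply: (iffP imsetP) => [[A _ ->]|[A ->]]; first by exists A.
by exists A.
Qed.

End Swap.

Section Core.
Context {R : realType} {p : nat}.
Local Notation C := R[i].
Local Notation X := (@fps_var C (p + p)).
Implicit Types W Th Ga : 'I_(p + p) -> fps C (p + p).

Definition xl : 'I_(p + p) -> fps C (p + p) :=
  csplit (fun j => X (lshift p j) + X (rshift p j)) (fun j => X (lshift p j) - X (rshift p j)).
Definition xlV : 'I_(p + p) -> fps C (p + p) :=
  csplit (fun j => fps_C 2^-1 * (X (lshift p j) + X (rshift p j)))
         (fun j => fps_C 2^-1 * (X (lshift p j) - X (rshift p j))).

Lemma xl_nc : nc xl.
Proof.
by apply: all_split => j; rewrite /xl csplitE; apply: fps_ord1E;
  [apply: fps_ordD|apply: fps_ordB]; exact: mid_ord.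
Qed.
Lemma xlV_nc : nc xlV.
Proof.
by apply: all_split => j; rewrite /xlV csplitE; apply: fps_ord1E; apply: fps_ordMl;
  [apply: fps_ordD|apply: fps_ordB]; exact: mid_ord.
Qed.
Lemma cvgt_xl i : cvgt (xl i).
Proof.
by elim/all_split: i => j; rewrite /xl csplitE; [apply: cvgtD|apply: cvgtB]; exact: cvgt_var.
Qed.
Lemma cvgt_xlV i : cvgt (xlV i).
Proof.
by elim/all_split: i => j; rewrite /xlV csplitE; apply: cvgtM; do ?[exact: cvgt_C];
  [apply: cvgtD|apply: cvgtB]; exact: cvgt_var.
Qed.

Lemma fps_half (a : fps C (p + p)) : fps_C 2^-1 * a + fps_C 2^-1 * a = a.
Proof.
rewrite -mulrDl -rmorphD /=; have -> : 2^-1 + 2^-1 = 1 :> C by rewrite [RHS]splitr !mul1r.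
by rewrite rmorph1 mul1r.
Qed.

Lemma xlK : mcomp xl xlV = @mid C (p + p).
Proof.
have v0 := xlV_nc; apply/funext; apply: all_split => j; rewrite /mcomp {1}/xl csplitE.
  rewrite fps_compD !fps_comp_var // /xlV !csplitE mulrDr mulrBr /mid.
  by rewrite addrACA subrr addr0 fps_half.
rewrite fps_compB !fps_comp_var // /xlV !csplitE mulrDr mulrBr /mid.
by rewrite -[RHS]fps_half; ring.
Qed.

Lemma xlVK : mcomp xlV xl = @mid C (p + p).
Proof.
have v0 := xl_nc; apply/funext; apply: all_split => j; rewrite /mcomp {1}/xlV csplitE fps_comp_CM.
  rewrite fps_compD !fps_comp_var // /xl !csplitE /mid addrACA subrr addr0 mulrDr.
  exact: fps_half.
rewrite fps_compB !fps_comp_var // /xl !csplitE /mid -[RHS]fps_half -mulrDr; congr (_ * _).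
by ring.
Qed.

Definition esgn (A : {set 'I_p}) (j : 'I_p) : C := if j \in A then -1 else 1.

Lemma esgn2 A j : esgn A j ^+ 2 = 1.
Proof. by rewrite /esgn; case: ifP => _; rewrite ?sqrrN expr1n. Qed.

Lemma xl_swp A : mcomp xl (ptau (swp A)) = mcomp (sgnm (esgn A)) xl.
Proof.
have t0 := @ptau_nc (p + p) C (swp A); have v0 := xl_nc.
have sE i : mcomp (sgnm (esgn A)) xl i = fps_C (sgn (esgn A) i) * xl i.
  by rewrite /mcomp sgnmE fps_comp_CM fps_comp_var.
apply/funext => i; rewrite sE; elim/all_split: i => j; rewrite /mcomp /xl /sgn !csplitE.
  rewrite fps_compD !fps_comp_var // /ptau !swpE rmorph1 mul1r /mid.
  by case: ifP => // _; rewrite addrC.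
rewrite fps_compB !fps_comp_var // /ptau !swpE /esgn /mid.
by case: ifP => _; rewrite ?rmorphN rmorph1 ?mulN1r ?mul1r ?opprB.
Qed.

Lemma cvgt_undbl (h : fps C (p + p)) : cvgt h -> cvgt (undbl h).
Proof.
move=> /cvgt_geo[M [r [M0 r0 H]]]; pose r1 := Num.max 1 r.
apply: (@geo_cvgt _ _ _ M (r1 ^+ 2)) => u; apply: le_trans (H _) _.
rewrite ler_wpM2l ?(ltW M0) // -exprM.
have r11 : 1 <= r1 by rewrite le_max lexx.
apply: (@le_trans _ _ (r1 ^+ mi_deg (mi_dbl u))).
  by apply: lerXn2r; rewrite ?nnegrE ?(ltW r0) ?(le_trans ler01 r11) // le_max lexx orbT.
apply: ler_weXn2l => //; rewrite /mi_deg big_distrr /=; apply: leq_sum => i _; rewrite ffunE.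
by elim/all_split: i => i; rewrite csplitE ?mul2n // -addnn leq_addr.
Qed.

Lemma C_char2 (x : C) : x = - x -> x = 0.
Proof.
by move=> /eqP; rewrite -subr_eq0 opprK -mulr2n mulrn_eq0 /= => /eqP.
Qed.

Lemma esgnP (e : 'I_p -> C) : (forall j, e j ^+ 2 = 1) -> exists A, e = esgn A.
Proof.
move=> e2; exists [set j | e j == -1]%SET; apply/funext => j; rewrite /esgn inE.
case: eqP => // h; have /eqP := e2 j.
by rewrite -subr_eq0 subr_sqr_1 mulf_eq0 subr_eq0 addr_eq0 => /orP[/eqP|/eqP].
Qed.

Lemma xl_conj (F : 'I_(p + p) -> fps C (p + p)) : tid F -> tid (mcomp (mcomp xl F) xlV).
Proof.
move=> tF; have v0 := xlV_nc; have F0 := tid_nc tF; have x0 := xl_nc => i.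
have -> : mid i = mcomp xl xlV i by rewrite xlK.
rewrite /mcomp -fps_compB; apply: fps_comp_ord1 => //.
rewrite -{2}(fps_comp_id (xl i)) -[2%N]addn0.
by apply: (@fps_comp_sub_ord _ _ _ _ _ _ 1) => //; [exact: mid_nc|apply/fps_ord1/xl_nc].
Qed.

End Core.

Section Mono.
Context {K : comNzRingType} {m : nat}.
Implicit Types F A B : 'I_m -> fps K m.

Lemma conj_mcomp A B F Ga : nc A -> nc B -> nc F -> nc Ga -> mcomp B A = @mid K m ->
  mcomp (mcomp (mcomp A F) B) (mcomp (mcomp A Ga) B) = mcomp (mcomp A (mcomp F Ga)) B.
Proof.
move=> A0 B0 F0 G0 BA; have AG0 := mcomp_nc A0 G0; have AGB0 := mcomp_nc AG0 B0.
have FG0 := mcomp_nc F0 G0; have AF0 := mcomp_nc A0 F0.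
rewrite (mcompA _ B0 AGB0) -(mcompA _ AG0 B0) -(mcompA _ A0 G0) BA mcomp1l //.
by rewrite -(mcompA _ G0 B0) (mcompA _ F0 G0) .
Qed.

Lemma conj_mid A B : nc A -> mcomp A B = @mid K m -> mcomp (mcomp A (@mid K m)) B = @mid K m.
Proof. by move=> A0 AB; rewrite mcomp1r. Qed.

Lemma unconj_mcomp A B F : nc A -> nc B -> nc F -> mcomp B A = @mid K m ->
  mcomp (mcomp B (mcomp (mcomp A F) B)) A = F.
Proof.
move=> A0 B0 F0 BA; have AF0 := mcomp_nc A0 F0; have AFB := mcomp_nc AF0 B0.
by rewrite (mcompA B AFB A0) (mcompA _ B0 A0) BA mcomp1r -(mcompA B A0 F0) BA mcomp1l.
Qed.

End Mono.

Lemma mcompA4 (K : comNzRingType) m (A B D E : 'I_m -> fps K m) : nc B -> nc D -> nc E ->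
  mcomp (mcomp A (mcomp B D)) E = mcomp A (mcomp B (mcomp D E)).
Proof.
by move=> B0 D0 E0; rewrite (mcompA A (mcomp_nc B0 D0) E0) (mcompA B D0 E0).
Qed.

Lemma lin_cancel (K : comNzRingType) m (A B : 'M[K]_m) (W S H q : 'I_m -> fps K m) :
  B *m A = 1%:M -> nc W -> nc S -> nc H -> nc q ->
  mcomp (mcomp (lin A) W) S = mcomp H q -> mcomp W S = mcomp (mcomp (lin B) H) q.
Proof.
move=> BA W0 S0 H0 q0 e; have l0 := lin_nc A; have WS0 := mcomp_nc W0 S0.
rewrite (mcompA (lin B) H0 q0) -e (mcompA (lin A) W0 S0) -(mcompA (lin B) l0 WS0).
by rewrite mcomp_lin BA lin1 mcomp1l.
Qed.

Section Core.
Context {R : realType} {p : nat}.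
Local Notation C := R[i].
Variables (k : 'I_(p + p) -> C) (Rs : 'S_(p + p)).
Hypothesis Rs2 : (Rs * Rs = 1)%g.
Hypothesis RsG : forall g, g \in @swp_group p -> (Rs * g * Rs)%g \in @swp_group p.
Hypothesis kk : forall c, k c * conjc (k (Rs c)) = 1.
Variables (w s : nat -> R) (sig : R).
Hypothesis w01 : forall n, 0 < w n <= 1.
Hypothesis hsd : forall n, sd (@swp_group p) k (w n) (2 ^ n).*2.
Hypothesis s01 : forall n, 0 < s n <= 1.
Hypothesis sw : forall n, 16 * (#|@swp_group p| * (p + p)).+1%:R * s n ^+ (2 ^ n) <= w n.
Hypothesis sig0 : 0 < sig.
Hypothesis sigs : forall n, sig <= \prod_(i < n) s i.
Implicit Types W Th Ga : 'I_(p + p) -> fps C (p + p).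

Local Notation xl := (@xl R p).
Local Notation xlV := (@xlV R p).
Local Notation sqm := (@sqm C p).

Lemma swp_conj A : mcomp (mcomp xl (ptau (swp A))) xlV = sgnm (esgn A).
Proof.
have x0 := @xl_nc R p; have v0 := @xlV_nc R p; have g0 := @sgnm_nc C p (esgn A).
by rewrite xl_swp (mcompA _ x0 v0) xlK mcomp1r.
Qed.

Lemma core_normal W Th Ga : nc W -> (forall i, cvgt (W i)) -> tid Th -> rmap k Rs Th ->
  tid Ga -> mcomp W Th = mcomp Ga (mcomp sqm xl) ->
  exists S H, [/\ [/\ tid S, rmap k Rs S & forall i, cvgt (S i)],
    [/\ nc H, jac H \in unitmx & forall i, cvgt (H i)] &
    mcomp W S = mcomp H (mcomp sqm xl)].
Proof.
move=> W0 cW tTh hTh tGa WTh.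
have x0 := @xl_nc R p; have v0 := @xlV_nc R p; have q0 := @sqm_nc C p.
have VX := @xlVK R p; have XV := @xlK R p.
have Th0 := tid_nc tTh; have Ga0 := tid_nc tGa.
have [Ti [tTi TTi TiT]] := tid_inv tTh; have Ti0 := tid_nc tTi.
pose cj F := mcomp (mcomp xl F) xlV.
have tcTh : tid (cj Th) := xl_conj tTh; have tcTi : tid (cj Ti) := xl_conj tTi.
have qx0 : nc (mcomp sqm xl) by exact: mcomp_nc.
have WV0 : nc (mcomp W xlV) by exact: mcomp_nc.
have cWV i : cvgt (mcomp W xlV i) by apply: cvgt_comp => // j; exact: cvgt_xlV.
have cjTTi : mcomp (cj Th) (cj Ti) = @mid C (p + p) by rewrite /cj conj_mcomp // TTi conj_mid.
have WVT : mcomp (mcomp W xlV) (cj Th) = mcomp Ga sqm.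
  have xT0 : nc (mcomp xl Th) by exact: mcomp_nc.
  have xTV0 : nc (mcomp (mcomp xl Th) xlV) by exact: mcomp_nc.
  rewrite (mcompA W v0 xTV0) -(mcompA xlV xT0 v0) -(mcompA xlV x0 Th0) VX mcomp1l //.
  by rewrite -(mcompA W Th0 v0) WTh (mcompA Ga qx0 v0) (mcompA sqm x0 v0) XV mcomp1r.
pose T (g : 'S_(p + p)) := mcomp (mcomp Th (ptau g)) Ti.
have T0 g : nc (T g) by do 2!apply: mcomp_nc => //; exact: ptau_nc.
have cT g c : g \in @swp_group p -> cvgt (T g c).
  move=> /swp_groupP[A ->]; have p0 := @ptau_nc _ C (swp A).
  have Tp0 : nc (mcomp Th (ptau (swp A))) by exact: mcomp_nc.
  have e : cj (T (swp A)) = mcomp (mcomp (cj Th) (sgnm (esgn A))) (cj Ti).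
    by rewrite /T /cj -swp_conj (conj_mcomp x0 v0 Th0 p0 VX) (conj_mcomp x0 v0 Tp0 Ti0 VX).
  have cc i : cvgt (cj (T (swp A)) i).
    by rewrite e; apply: (deck_cvgt_tid WV0 cWV tcTh tGa WVT tcTi cjTTi (esgn2 A)).
  rewrite -[T _](unconj_mcomp x0 v0 (T0 _) VX) -/(cj _).
  have cj0 : nc (cj (T (swp A))) by do 2!apply: mcomp_nc => //.
  apply: cvgt_comp => //; last by move=> j; exact: cvgt_xl.
  by apply: cvgt_comp => //; exact: cvgt_xlV.
have hT : conjg_eq (@swp_group p) T Th.
  move=> g gG; have p0 := @ptau_nc _ C g; have Tp0 : nc (mcomp Th (ptau g)) by exact: mcomp_nc.
  by rewrite /T (mcompA _ Ti0 Th0) TiT mcomp1r.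
have [S [tS hS cS TS]] := kam Rs2 RsG kk tTh hTh hT (fun g _ => T0 g) cT w01 hsd s01 sw sig0 sigs.
have S0 := tid_nc tS.
pose h := mcomp (mcomp W S) xlV.
have WS0 : nc (mcomp W S) by exact: mcomp_nc.
have hinv (e : 'I_p -> C) : (forall j, e j ^+ 2 = 1) -> mcomp h (sgnm e) = h.
  move=> /esgnP[A ->]; have p0 := @ptau_nc _ C (swp A); have g0 := @sgnm_nc C p (esgn A).
  have gG : swp A \in @swp_group p by apply/swp_groupP; exists A.
  have WT : mcomp W (T (swp A)) = W.
    have Tp0 : nc (mcomp Th (ptau (swp A))) by exact: mcomp_nc.
    rewrite /T -(mcompA W Tp0 Ti0) -(mcompA W Th0 p0) WTh.
    rewrite (mcompA Ga qx0 p0) (mcompA sqm x0 p0) xl_swp -(mcompA sqm g0 x0).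
    by rewrite sqm_sgnm; [rewrite -WTh (mcompA W Th0 Ti0) TTi mcomp1r|exact: esgn2].
  have e1 : mcomp (mcomp W S) (ptau (swp A)) = mcomp W S.
    by rewrite (mcompA W S0 p0) -TS // -(mcompA W (T0 _) S0) WT.
  have xp0 : nc (mcomp xl (ptau (swp A))) by exact: mcomp_nc.
  rewrite -swp_conj /h (mcompA _ v0 (mcomp_nc xp0 v0)) -(mcompA xlV xp0 v0).
  by rewrite -(mcompA xlV x0 p0) VX mcomp1l // -(mcompA _ p0 v0) e1.
pose H i := undbl (h i).
have h0 : nc h by exact: mcomp_nc.
have ch i : cvgt (h i).
  apply: cvgt_comp => //; last by move=> j; exact: cvgt_xlV.
  exact: cvgt_comp.
have Hh : mcomp H sqm = h.
  apply/funext => i; apply: undblK; first exact: C_char2.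
  by move=> e e2; rewrite -[LHS]/(mcomp h (sgnm e) i) hinv.
have H0 : nc H.
  move=> i; rewrite /H /undbl (_ : mi_dbl 0 = 0) ?h0 //.
  apply/ffunP => l; rewrite !ffunE; elim/all_split: l => l; rewrite csplitE ffunE //.
exists S, H; split; first by split.
- split=> //; last by move=> i; exact: cvgt_undbl.
  pose Xi := cj (mcomp Ti S).
  have TiS0 : nc (mcomp Ti S) by exact: mcomp_nc.
  have tXi : tid Xi by apply: xl_conj; exact: tid_comp.
  apply: (jac_sqm_unit H0 tGa tXi); rewrite Hh /h /Xi /cj.
  have -> : mcomp W S = mcomp Ga (mcomp sqm (mcomp xl (mcomp Ti S))).
    rewrite -(mcompA sqm x0 TiS0) -(mcompA Ga qx0 TiS0) -WTh (mcompA W Th0 TiS0).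
    by rewrite -(mcompA Th Ti0 S0) TTi mcomp1l.
  have xTS0 : nc (mcomp xl (mcomp Ti S)) by exact: mcomp_nc.
  exact: mcompA4.
- rewrite -(mcompA H q0 x0) Hh /h (mcompA _ v0 x0) VX mcomp1r //.
Qed.

Lemma core W Th Ga : nc W -> (forall i, cvgt (W i)) -> tid Th -> rmap k Rs Th ->
  nc Ga -> jac Ga \in unitmx -> mcomp W Th = mcomp Ga (mcomp sqm xl) ->
  exists S H, [/\ [/\ tid S, rmap k Rs S & forall i, cvgt (S i)],
    [/\ nc H, jac H \in unitmx & forall i, cvgt (H i)] &
    mcomp W S = mcomp H (mcomp sqm xl)].
Proof.
move=> W0 cW tTh hTh Ga0 Ju WTh; set J := jac Ga in Ju *.
have x0 := @xl_nc R p; have q0 := @sqm_nc C p; have Th0 := tid_nc tTh.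
have l0 := @lin_nc C _ _ (invmx J); have m0 := @lin_nc C _ _ J.
have qx0 : nc (mcomp sqm xl) by exact: mcomp_nc.
have tG1 : tid (mcomp (lin (invmx J)) Ga).
  by apply: tid_jac; [exact: mcomp_nc|rewrite jac_comp // jac_lin mulVmx].
have W10 : nc (mcomp (lin (invmx J)) W) by exact: mcomp_nc.
have cW1 i : cvgt (mcomp (lin (invmx J)) W i) by apply: cvgt_comp => //; exact: cvgt_lin.
have e1 : mcomp (mcomp (lin (invmx J)) W) Th = mcomp (mcomp (lin (invmx J)) Ga) (mcomp sqm xl).
  by rewrite (mcompA _ W0 Th0) WTh (mcompA _ Ga0 qx0).
have [S [H [[tS hS cS] [H0 jH cH] e]]] := core_normal W10 cW1 tTh hTh tG1 e1.
have S0 := tid_nc tS.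
exists S, (mcomp (lin J) H); split; first by split.
- split; first exact: mcomp_nc.
    by rewrite jac_comp // jac_lin unitmx_mul Ju jH.
  by move=> i; apply: cvgt_comp => //; exact: cvgt_lin.
- exact: lin_cancel (mulmxV Ju) W0 S0 H0 qx0 e.
Qed.

End Core.

(** * Small divisors and the Brjuno condition *)

Section SmallDivisors.
Context {R : realType} {p : nat}.
Local Notation C := R[i].
Variable lam : 'I_p -> C.
Hypothesis lam0 : forall j, lam j != 0.

Definition klam : 'I_(p + p) -> C := csplit (fun j => - lam j) (fun j => - (lam j)^-1).

(* exponent of lam_j in the multiplier of the vector monomial x^u d/dx_c *)
Definition vexp (c : 'I_(p + p)) (u : multiindex (p + p)) (j : 'I_p) : int :=
  (u (lshift p j))%:Z - (u (rshift p j))%:Z - (c == lshift p j)%:Z + (c == rshift p j)%:Z.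

Lemma prod_vexp_unit c :
  \prod_j lam j ^ (- (c == lshift p j)%:Z + (c == rshift p j)%:Z) = - (klam c)^-1.
Proof.
elim/all_split: c => i; rewrite /klam csplitE invrN opprK (bigD1 i) //= big1.
- by rewrite eqxx eq_lrshift addr0 exprN1 mulr1.
- move=> j ji; rewrite eq_lshift eq_lrshift eq_sym (negbTE ji) //.
- by rewrite eqxx eq_rlshift oppr0 add0r expr1z mulr1 invrK.
- by move=> j ji; rewrite eq_rshift eq_rlshift eq_sym (negbTE ji).
Qed.

Lemma kapE c u : kap klam c u = (-1) ^+ (mi_deg u).+1 * \prod_j lam j ^ vexp c u j.
Proof.
have e1 : mi_pow klam u = (-1) ^+ mi_deg u * \prod_j lam j ^ ((u (lshift p j))%:Z - (u (rshift p j))%:Z).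
  pose q : 'I_(p + p) -> C := csplit lam (fun j => (lam j)^-1).
  have kq i : klam i = -1 * q i.
    by rewrite /klam /q; elim/all_split: i => j; rewrite !csplitE mulN1r.
  rewrite /mi_pow; under eq_bigr do rewrite kq exprMn.
  rewrite big_split prodrXr /=; congr (_ * _).
  rewrite big_split_ord /= -big_split /=; apply: eq_bigr => j _.
  by rewrite /q !csplitE expfzDr // -exprnP -exprnN exprVn.
have -> : kap klam c u = mi_pow klam u * (klam c)^-1 by [].
have -> : (klam c)^-1 = - \prod_j lam j ^ (- (c == lshift p j)%:Z + (c == rshift p j)%:Z).
  by rewrite prod_vexp_unit opprK.
rewrite e1 exprS mulN1r mulrN mulNr -mulrA -big_split /=; congr (- (_ * _)).
by apply: eq_bigr => j _; rewrite -expfzDr // /vexp !addrA.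
Qed.

Lemma vexp_swp A c u j : vexp (swp A c) (mi_act (swp A) u) j =
  if j \in A then - vexp c u j else vexp c u j.
Proof.
have e (i : 'I_(p + p)) : (swp A c == i) = (c == swp A i).
  by rewrite -(inj_eq (@perm_inj _ (swp A))) -permM -{2}swpV mulgV perm1.
rewrite /vexp !e !ffunE swpV !swpE; case: ifP => // _; ring.
Qed.

Lemma vexp_bound c u j : (absz (vexp c u j) <= (mi_deg u).+1)%N.
Proof.
have h : (u (lshift p j) + u (rshift p j) <= mi_deg u)%N.
  rewrite /mi_deg big_split_ord /= (bigD1 j) //= [X in (_ <= _ + X)%N](bigD1 j) //=.
  by rewrite addnACA leq_addr.
rewrite /vexp; move: h; do 2?case: eqP => _; lia.
Qed.

Let a c u j : R := cabs (lam j ^ vexp c u j).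

Lemma cabs_prod I r (P : pred I) (F : I -> C) :
  cabs (\prod_(i <- r | P i) F i) = \prod_(i <- r | P i) cabs (F i).
Proof. by elim/big_rec2: _ => [|i x y _ <-]; rewrite ?cabs1 ?cabsM. Qed.

Lemma cabs_kap c u : cabs (kap klam c u) = \prod_j a c u j.
Proof.
by rewrite kapE cabsM cabsX cabsN cabs1 expr1n mul1r cabs_prod.
Qed.

Lemma a_gt0 c u j : 0 < a c u j.
Proof. by rewrite lt_def cabs_ge0 cabs_eq0 expfz_neq0. Qed.

Lemma a_swp A c u j : a (swp A c) (mi_act (swp A) u) j = if j \in A then (a c u j)^-1 else a c u j.
Proof. by rewrite /a vexp_swp; case: ifP => // _; rewrite -invr_expz cabsV. Qed.

Lemma prod_ge1 I r (P : pred I) (F : I -> R) : (forall i, P i -> 1 <= F i) ->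
  1 <= \prod_(i <- r | P i) F i.
Proof.
move=> h; elim/big_rec: _ => // i x Pi x1; rewrite -[1]mulr1.
by rewrite ler_pM // h.
Qed.

Lemma sd_lam (w rho : R) N : 0 <= rho < 1 ->
  (forall j (n : int), cabs (lam j ^ n) < 1 -> cabs (lam j ^ n) ^+ 2 <= rho) ->
  0 < w <= (1 - rho) / 2 ->
  (forall j (n : int), cabs (lam j) = 1 -> (absz n <= N.+1)%N ->
     lam j ^ (n * 2) = 1 \/ 2 * w <= cabs (lam j ^ (n * 2) - 1)) ->
  (forall j (n : int), cabs (lam j ^ n) = 1 -> cabs (lam j) = 1 \/ n = 0) ->
  sd (@swp_group p) klam w N.
Proof.
move=> /andP[rho0 rho1] hrho /andP[w0 wr] hw h1 c u /andP[u2 uN].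
have hw1 x y : 1 <= y -> x <= y * rho -> w * (1 + y) <= y - x.
  move=> y1 xy; have w1 : w * (1 + y) <= (1 - rho) / 2 * (1 + y) by rewrite ler_wpM2r //; lra.
  by apply: le_trans w1 _; nra.
have cdist (x y : C) : cabs y - cabs x <= cabs (y - x).
  by rewrite lerBlDr; have := cabsD (y - x) x; rewrite subrK.
have [/existsP[j0 aj0]|/existsPn aE] := boolP [exists j, a c u j < 1].
  right; pose A := [set j | a c u j < 1]%SET; exists (swp A); first by apply/swp_groupP; exists A.
  set y := kap _ (swp A c) _; set x := kap _ c u.
  have y1 : 1 <= cabs y.
    rewrite cabs_kap; apply: prod_ge1 => j _; rewrite a_swp inE.
    by case: ifP => [h|/negbT]; rewrite ?invr_ge1 ?unitf_gt0 ?a_gt0 ?(ltW h) // -leNgt.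
  have xy : cabs x <= cabs y * rho.
    rewrite !cabs_kap (bigD1 j0) //= [X in _ <= X * _](bigD1 j0) //= a_swp inE aj0.
    rewrite [leRHS]mulrAC; apply: ler_pM.
    - exact: ltW (a_gt0 _ _ _).
    - by apply: prodr_ge0 => j _; exact: ltW (a_gt0 _ _ _).
    - by rewrite ler_pdivlMl ?a_gt0 // -expr2; exact: hrho.
    apply: ler_prod => j _; rewrite ltW ?a_gt0 //= a_swp inE; case: ifP => // h.
    by rewrite (le_trans (ltW h)) // invr_ge1 ?unitf_gt0 ?a_gt0 // ltW.
  by apply: le_trans (cdist _ _); exact: hw1.
have a1 j : 1 <= a c u j by rewrite leNgt aE.
have [/existsP[j0 aj0]|/existsPn aE'] := boolP [exists j, 1 < a c u j].
  right; exists (swp [set j0]%SET); first by apply/swp_groupP; exists [set j0]%SET.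
  set y := kap _ (swp _ c) _; set x := kap _ c u.
  have x1 : 1 <= cabs x by rewrite cabs_kap; apply: prod_ge1 => j _.
  have yx : cabs y <= cabs x * rho.
    rewrite !cabs_kap (bigD1 j0) //= [X in _ <= X * _](bigD1 j0) //= a_swp inE eqxx.
    rewrite [leRHS]mulrAC; apply: ler_pM.
    - by rewrite invr_ge0; exact: ltW (a_gt0 _ _ _).
    - by apply: prodr_ge0 => j _; exact: ltW (a_gt0 _ _ _).
    - have : cabs (lam j0 ^ (- vexp c u j0)) ^+ 2 <= rho.
        by apply: hrho; rewrite -invr_expz cabsV invf_lt1 // a_gt0.
      rewrite -invr_expz cabsV -/(a c u j0) => h.
      have a0 := a_gt0 c u j0; have := ler_wpM2l (ltW a0) h.
      by rewrite expr2 mulVKf // gt_eqF.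
    rewrite le_eqVlt; apply/orP; left; apply/eqP; apply: eq_bigr => j jj0.
    by rewrite a_swp inE (negbTE jj0).
  have := cdist y x; rewrite cabs_distC; apply: le_trans.
  have := hw1 _ _ x1 yx; apply: le_trans.
  rewrite ler_wpM2l ?(ltW w0) // lerD2l (le_trans yx) // ler_piMr ?ltW //.
  exact: lt_le_trans x1.
have aj j : a c u j = 1 by apply/eqP; rewrite eq_le a1 leNgt aE'.
have [/existsP[j0 aj0]|/existsPn aE2] := boolP [exists j, lam j ^ (vexp c u j * 2) != 1].
  right; exists (swp [set j0]%SET); first by apply/swp_groupP; exists [set j0]%SET.
  have k1 c' u' : (forall j, a c' u' j = 1) -> cabs (kap klam c' u') = 1.
    by move=> h; rewrite cabs_kap big1.
  have l1 : cabs (lam j0) = 1.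
    by have [//|v0] := h1 _ _ (aj j0); rewrite v0 mul0r expr0z eqxx in aj0.
  have vN : (absz (vexp c u j0) <= N.+1)%N by rewrite (leq_trans (vexp_bound _ _ _)).
  have [e|h] := hw _ _ l1 vN; first by rewrite e eqxx in aj0.
  rewrite k1 => [|j]; last by rewrite a_swp aj invr1 if_same.
  apply: le_trans (le_trans _ h) _; first by rewrite mulrC.
  rewrite !kapE mi_deg_act -mulrBr cabsM cabsX cabsN cabs1 expr1n mul1r.
  rewrite [X in _ <= cabs (X - _)](bigD1 j0) //= [X in _ <= cabs (_ - X)](bigD1 j0) //= vexp_swp inE eqxx.
  rewrite (eq_bigr (fun j => lam j ^ vexp c u j)) => [|j jj0]; last first.
    by rewrite vexp_swp inE (negbTE jj0).
  rewrite -mulrBl cabsM cabs_prod big1 ?mulr1 => [|j _]; last exact: aj.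
  have -> : lam j0 ^ (vexp c u j0 * 2) = lam j0 ^ vexp c u j0 * lam j0 ^ vexp c u j0.
    by rewrite -expfzDr // mulr_natr.
  have -> : lam j0 ^ vexp c u j0 * lam j0 ^ vexp c u j0 - 1 =
     - lam j0 ^ vexp c u j0 * (lam j0 ^ (- vexp c u j0) - lam j0 ^ vexp c u j0).
    by rewrite mulrBr mulNr -invr_expz divff ?expfz_neq0 // mulNr opprK addrC.
  by rewrite cabsM cabsN -/(a c u j0) aj mul1r.
left => g /swp_groupP[A ->]; rewrite !kapE mi_deg_act; congr (_ * _).
apply: eq_bigr => j _; rewrite vexp_swp; case: ifP => // _.
have /negbNE/eqP e := aE2 j; rewrite -[LHS]mul1r -e -expfzDr //; congr (_ ^ _); ring.
Qed.

End SmallDivisors.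

Section Brjuno.
Context {R : realType}.
Implicit Types d : nat -> R.

(* the decay of [d] can be absorbed by radii s_0 s_1 ... s_n bounded away from 0 *)
Definition brj d := (forall n, 0 < d n <= 1) /\
  exists s (sig : R), [/\ 0 < sig, forall n, 0 < s n <= 1, forall n, s n ^+ (2 ^ n) <= d n
    & forall n, sig <= \prod_(i < n) s i].

Lemma brjM d d' : brj d -> brj d' -> brj (fun n => d n * d' n).
Proof.
move=> [d01 [s [g [g0 s01 sd sg]]]] [d'01 [s' [g' [g'0 s'01 s'd s'g]]]].
have pos (x y : R) : 0 < x <= 1 -> 0 < y <= 1 -> 0 < x * y <= 1.
  by move=> /andP[x0 x1] /andP[y0 y1]; rewrite mulr_gt0 //= mulr_ile1 // ltW.
split; first by move=> n; exact: pos.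
exists (fun n => s n * s' n), (g * g'); split => [|n|n|n]; first exact: mulr_gt0.
- exact: pos.
- rewrite exprMn; apply: ler_pM => //; apply: exprn_ge0; apply: ltW.
    by case/andP: (s01 n).
  by case/andP: (s'01 n).
- by rewrite big_split /=; apply: ler_pM; [exact: ltW|exact: ltW|exact: sg|exact: s'g].
Qed.

Lemma brj_sum d B : (forall n, 0 < d n <= 1) ->
  (forall N, \sum_(n < N) 2^-1 ^+ n * - ln (d n) <= B) -> brj d.
Proof.
move=> d01 dB; split=> //; exists (fun n => expR (2^-1 ^+ n * ln (d n))), (expR (- B)).
have ld n : ln (d n) <= 0 by rewrite -ln1; case/andP: (d01 n) => d0 d1; rewrite ler_ln ?posrE.
split=> [|n|n|N]; first exact: expR_gt0.
- by rewrite expR_gt0 /= -expR0 ler_expR mulr_ge0_le0 // exprn_ge0.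
- rewrite -expRM_natl natrX mulrA -exprMn mulfV ?pnatr_eq0 // expr1n mul1r lnK //.
  by rewrite posrE; case/andP: (d01 n).
- rewrite -expR_sum ler_expR -lerN2 opprK; apply: le_trans (dB N).
  by rewrite -sumrN; apply: ler_sum => n _; rewrite mulrN.
Qed.

Lemma half_sum N : \sum_(n < N) 2^-1 ^+ n <= 2 :> R.
Proof.
suff -> : \sum_(n < N) 2^-1 ^+ n = 2 * (1 - 2^-1 ^+ N) :> R.
  by rewrite mulrBr mulr1 gerBl mulr_ge0 // exprn_ge0.
elim: N => [|N IH]; first by rewrite big_ord0 expr0 subrr mulr0.
by rewrite big_ord_recr /= IH exprS; field.
Qed.

Lemma half_sum1 N : \sum_(1 <= k < N) 2^-1 ^+ k <= 2 :> R.
Proof.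
apply: le_trans (half_sum N); rewrite -(big_mkord predT (fun k => 2^-1 ^+ k)).
case: N => [|N]; first by rewrite !big_geq.
by rewrite [leRHS]big_ltn // lerDr exprn_ge0.
Qed.

Lemma brj_cst c : 0 < c <= 1 -> brj (fun=> c).
Proof.
move=> c01; apply: (@brj_sum _ (2 * - ln c)) => // N.
rewrite -mulr_suml ler_wpM2r ?half_sum // oppr_ge0 -ln1.
by case/andP: c01 => c0 c1; rewrite ler_ln ?posrE.
Qed.

Lemma brj_prod I (r : seq I) (P : pred I) (d : I -> nat -> R) :
  (forall i, P i -> brj (d i)) -> brj (fun n => \prod_(i <- r | P i) d i n).
Proof.
move=> h; elim: r => [|i r IH].
  under [X in brj X]eq_fun do rewrite big_nil; apply: brj_cst; by rewrite ltr01 lexx.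
under [X in brj X]eq_fun do rewrite big_cons.
by case Pi: (P i) => //; apply: brjM => //; exact: h.
Qed.

Section Omega.
Variable mu : R[i].
Hypothesis mu1 : cabs mu = 1.
Hypothesis mun1 : mu != 1.

Let dset k : set R := [set d : R | exists (q1 q2 : nat) (eps : int),
    [/\ (2 <= q1 + q2 <= 2 ^ k)%N, eps = 1 \/ eps = -1,
        d = complex.Re `|mu ^ (q1%:Z - q2%:Z) - mu ^ eps| & d != 0]].

Lemma mu_neq0 : mu != 0.
Proof. by rewrite -cabs_eq0 mu1 oner_eq0. Qed.

Lemma omega_le k (d : R) : dset k d -> brjuno_omega mu k <= d.
Proof.
move=> kd; apply: ge_inf => //; exists 0 => _ [q1 [q2 [eps [_ _ -> _]]]].
exact: cabs_ge0.
Qed.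

Lemma dset1 k : (0 < k)%N -> dset k (cabs (1 - mu)).
Proof.
move=> k0; exists 1%N, 1%N, 1; split; [|by left|by rewrite subrr expr0z expr1z|].
  by rewrite /= -[X in (X <= _)%N](expn1 2) leq_exp2l.
by rewrite cabs_eq0 subr_eq0 eq_sym.
Qed.

Lemma omega_gt0 k : (0 < k)%N -> 0 < brjuno_omega mu k.
Proof.
move=> k0; pose v (x : 'I_(2 ^ k).+1 * 'I_(2 ^ k).+1 * bool) : R :=
  cabs (mu ^ ((x.1.1 : nat)%:Z - (x.1.2 : nat)%:Z) - mu ^ (if x.2 then 1 else -1)).
pose c : R := \big[Num.min/1]_(x | v x != 0) v x.
have c0 : 0 < c.
  rewrite /c; elim/big_rec: _ => // x y vx y0; rewrite lt_min y0 andbT lt_def vx.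
  exact: cabs_ge0.
apply: lt_le_trans c0 _; apply: lb_le_inf; first by exists (cabs (1 - mu)); exact: dset1.
move=> d [q1 [q2 [eps [/andP[q12 q2k] he dE d0]]]].
have q1k : (q1 < (2 ^ k).+1)%N by rewrite ltnS (leq_trans (leq_addr _ _) q2k).
have q2k' : (q2 < (2 ^ k).+1)%N by rewrite ltnS (leq_trans (leq_addl _ _) q2k).
pose x := (Ordinal q1k, Ordinal q2k', (eps == 1) : bool).
have vx : v x = d.
  by rewrite dE /v /x /=; case: he => -> /=.
by rewrite -vx; apply: bigmin_le_cond; rewrite vx.
Qed.

Lemma omega_le2 k : (0 < k)%N -> brjuno_omega mu k <= 2.
Proof.
move=> k0; apply: le_trans (omega_le (dset1 k0)) _; apply: le_trans (cabsB _ _) _.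
by rewrite cabs1 mu1; lra.
Qed.

Lemma omega_bound k (n : int) : (absz n + 2 <= 2 ^ k)%N -> mu ^ n != 1 ->
  brjuno_omega mu k <= cabs (mu ^ n - 1).
Proof.
move=> nk n1; apply: omega_le.
have e : cabs (mu ^ n - 1) = cabs (mu ^ (n + 1) - mu ^ (1 : int)).
  have -> : mu ^ (n + 1) - mu ^ (1 : int) = (mu ^ n - 1) * mu.
    by rewrite expfzDr ?mu_neq0 // expr1z mulrBl mul1r.
  by rewrite cabsM mu1 mulr1.
have d0 : cabs (mu ^ n - 1) != 0 by rewrite cabs_eq0 subr_eq0.
have [q1 [q2 [q12 nq]]] : exists q1 q2 : nat, (2 <= q1 + q2 <= 2 ^ k)%N /\ n + 1 = q1%:Z - q2%:Z.
  case: n nk n1 {e d0} => [[|n]|[|n]] /= nk n1.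
  - by rewrite expr0z eqxx in n1.
  - by exists n.+2, 0%N; split; lia.
  - by exists 1%N, 1%N; split; lia.
  - by exists 1%N, n.+2; split; lia.
by exists q1, q2, 1; split => //; [left|rewrite e nq].
Qed.

Let v k : R := 2^-1 ^+ k * (- ln (brjuno_omega mu k) + ln 2).

Lemma v_ge0 k : (0 < k)%N -> 0 <= v k.
Proof.
move=> k0; rewrite mulr_ge0 ?exprn_ge0 // addrC subr_ge0 ler_ln ?posrE ?omega_gt0 //.
exact: omega_le2.
Qed.

Lemma brjuno_bound : brjuno mu -> exists B, forall M, \sum_(1 <= k < M) v k <= B.
Proof.
move=> hb; apply: contrapT => /forallNP nb.
pose u k : R := - (2^-1 ^+ k * ln (brjuno_omega mu k)).
have vu k : v k = u k + 2^-1 ^+ k * ln 2 by rewrite /v /u mulrDr mulrN.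
suff : ((fun n => \sum_(1 <= k < n) u k) @ \oo --> +oo%R)%classic.
  move/cvgeryP => h; move: hb; rewrite /brjuno => /=.
  suff -> : (\sum_(1 <= k <oo) (u k)%:E)%E = +oo%E by rewrite ltxx.
  apply/cvg_lim => //; apply: cvg_trans h; apply: near_eq_cvg; near=> n.
  by rewrite sumEFin.
apply/cvgryPge => A.
have [M /negP] : exists M, ~ (\sum_(1 <= k < M) v k <= A + 2 * ln 2).
  by apply/existsNP; exact: nb.
rewrite -ltNge => hM; near=> n.
have l2 : 0 <= ln 2 :> R by rewrite ln_ge0 // ler1n.
have nM : (M <= n)%N by near: n; exists M.
have e1 : \sum_(1 <= k < M) v k <= \sum_(1 <= k < n) v k.
  have [M0|M0] := posnP M.
    by rewrite M0 big_geq // big_nat; apply: sumr_ge0 => k /andP[? _]; exact: v_ge0.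
  rewrite [leRHS](@big_cat_nat _ _ _ M) //= lerDl big_nat; apply: sumr_ge0 => k /andP[kM _].
  by apply: v_ge0; exact: leq_trans M0 kM.
have e2 : \sum_(1 <= k < n) v k = \sum_(1 <= k < n) u k + (\sum_(1 <= k < n) 2^-1 ^+ k) * ln 2.
  by rewrite mulr_suml -big_split /=; apply: eq_bigr => k _; exact: vu.
have e3 : \sum_(1 <= k < n) 2^-1 ^+ k <= 2 :> R.
  exact: half_sum1.
have := ler_wpM2r l2 e3; lra.
Unshelve. all: by end_near.
Qed.

Lemma brj_omega : brjuno mu -> brj (fun n => Num.min 1 (brjuno_omega mu n.+3)).
Proof.
move=> /brjuno_bound[B hB]; apply: (@brj_sum _ (8 * B)) => [n|N].
  by rewrite lt_min ltr01 omega_gt0 //= ge_min lexx.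
apply: le_trans (ler_wpM2l _ (hB N.+3)) => //.
rewrite (@big_cat_nat _ _ _ 3) //= mulrDr ler_wpDl //.
  rewrite mulr_ge0 // big_nat; apply: sumr_ge0 => k /andP[k0 _]; exact: v_ge0.
have -> : \sum_(3 <= k < N.+3) v k = \sum_(n < N) v n.+3.
  rewrite -[3%N]add0n big_addn -[N.+3]addn3 addnK big_mkord.
  by apply: eq_bigr => n _; rewrite addn3.
rewrite mulr_sumr; apply: ler_sum => n _.
have -> : 8 * v n.+3 = 2^-1 ^+ n * (- ln (brjuno_omega mu n.+3) + ln 2).
  by rewrite /v !exprS; field.
rewrite ler_wpM2l ?exprn_ge0 //; have w0 := omega_gt0 (isT : (0 < n.+3)%N).
have l2 : 0 <= ln 2 :> R by rewrite ln_ge0 // ler1n.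
have w2 := v_ge0 (isT : (0 < n.+3)%N).
case: (leP 1 (brjuno_omega mu n.+3)) => [w1|/ltW w1].
  rewrite ln1 oppr0 addrC subr_ge0 ler_ln ?posrE //; exact: omega_le2.
by rewrite lerDl.
Qed.

End Omega.

Lemma root_of_unity_gap (mu : R[i]) : is_root_of_unity mu ->
  exists2 c : R, 0 < c <= 1 & forall n : int, mu ^ n = 1 \/ c <= cabs (mu ^ n - 1).
Proof.
move=> [k [k0 mk]]; pose v (i : 'I_k) : R := cabs (mu ^+ i - 1).
pose c : R := \big[Num.min/1]_(i | v i != 0) v i.
have mu0 : mu != 0 by apply/eqP => h; move: mk => /eqP; rewrite h expr0n gtn_eqF // eq_sym oner_eq0.
exists c.
  apply/andP; split; last exact: bigmin_le_id.
  rewrite /c; elim/big_rec: _ => // x y vx y0; rewrite lt_min y0 andbT lt_def vx.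
  exact: cabs_ge0.
move=> n; have nE := divz_eq n k.
have r0 : (0 <= (n %% k)%Z) by rewrite modz_ge0 // -lt0n.
have rk : (`|(n %% k)%Z|%N < k)%N.
  by rewrite -ltz_nat gez0_abs // ltz_pmod.
have e : mu ^ n = mu ^+ (Ordinal rk).
  rewrite {1}nE expfzDr // mulrC [X in _ * X = _](_ : _ = 1) ?mulr1.
    by rewrite /= -[in LHS](gez0_abs r0) -exprnP.
  by rewrite mulrC -exprz_exp -exprnP mk exp1rz.
have [/eqP|v0] := boolP (v (Ordinal rk) == 0).
  by move/eqP; rewrite /v cabs_eq0 subr_eq0 -e => /eqP; left.
by right; rewrite e; exact: bigmin_le_cond.
Qed.

End Brjuno.

Section Sequences.
Context {R : realType} {p : nat}.
Local Notation C := R[i].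
Variable lam : 'I_p -> C.
Hypothesis lam0 : forall j, lam j != 0.
Hypothesis lam_sd : forall j, cabs (lam j) = 1 ->
  lam j ^+ 2 != 1 /\ (is_root_of_unity (lam j ^+ 2) \/ brjuno (lam j ^+ 2)).

Lemma cabs_expz (x : C) (n : int) : cabs (x ^ n) = cabs x ^ n.
Proof. by case: n => n; [rewrite -!exprnP cabsX|rewrite NegzE -!exprnN cabsV cabsX]. Qed.

Lemma expz_lt1 (x : R) (n : int) : 0 < x -> x ^ n < 1 -> x ^ n <= Num.min x x^-1.
Proof.
move=> x0; case: n => [[|n]|n]; first by rewrite expr0z ltxx.
  rewrite -exprnP => h; have x1 : x < 1 by rewrite -(@expr_lt1 _ n.+1) // ltW.
  by rewrite le_min ler_iXnr // ?(ltW x0) ?(ltW x1) //= (le_trans (ltW h)) // invr_ge1 ?unitf_gt0 // ltW.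
rewrite NegzE -exprnN -exprVn => h; have y0 : 0 < x^-1 by rewrite invr_gt0.
have x1 : x^-1 < 1 by rewrite -(@expr_lt1 _ n.+1) // ltW.
rewrite le_min andbC ler_iXnr // ?(ltW y0) ?(ltW x1) //= (le_trans (ltW h)) //.
by rewrite ltW // -invf_lt1.
Qed.

Lemma gap j : exists2 d : nat -> R, brj d & cabs (lam j) = 1 ->
  forall n (m : int), (absz m + 2 <= 2 ^ n.+3)%N ->
    lam j ^ (m * 2) = 1 \/ d n <= cabs (lam j ^ (m * 2) - 1).
Proof.
have [l1|l1] := eqVneq (cabs (lam j)) 1; last first.
  by exists (fun=> 1) => [|h]; [apply: brj_cst; rewrite ltr01 lexx|rewrite h eqxx in l1].
have e (m : int) : lam j ^ (m * 2) = (lam j ^+ 2) ^ m by rewrite mulrC -exprz_exp.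
have [mu1 [/root_of_unity_gap[c c01 hc]|hb]] := lam_sd l1.
  by exists (fun=> c) => [|_ n m _]; [exact: brj_cst|rewrite e].
have m1 : cabs (lam j ^+ 2) = 1 by rewrite cabsX l1 expr1n.
exists (fun n => Num.min 1 (brjuno_omega (lam j ^+ 2) n.+3)); first exact: brj_omega.
move=> _ n m mn; rewrite e.
have [->|h] := eqVneq ((lam j ^+ 2) ^ m) 1; first by left.
by right; rewrite ge_min (omega_bound m1 mu1 mn h) orbT.
Qed.

Lemma sd_sequences : exists (w s : nat -> R) (sig : R), [/\ forall n, 0 < w n <= 1,
  forall n, sd (@swp_group p) (klam lam) (w n) (2 ^ n).*2, forall n, 0 < s n <= 1,
  forall n, 16 * (#|@swp_group p| * (p + p)).+1%:R * s n ^+ (2 ^ n) <= w n &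
  0 < sig /\ forall n, sig <= \prod_(i < n) s i].
Proof.
have l0 j : 0 < cabs (lam j) by rewrite lt_def cabs_ge0 cabs_eq0 lam0.
have [d hd hgap] : exists2 d : 'I_p -> nat -> R, forall j, brj (d j) &
    forall j, cabs (lam j) = 1 -> forall n (m : int), (absz m + 2 <= 2 ^ n.+3)%N ->
    lam j ^ (m * 2) = 1 \/ d j n <= cabs (lam j ^ (m * 2) - 1).
  have /fin_all_exists2[d h1 h2] := gap; by exists d.
pose b j := Num.min (cabs (lam j)) (cabs (lam j))^-1.
pose rho := \big[Num.max/0]_(j | b j < 1) b j ^+ 2.
have b0 j : 0 < b j by rewrite lt_min l0 invr_gt0 l0.
have rho0 : 0 <= rho by exact: bigmax_ge_id.
have rho1 : rho < 1.
  rewrite /rho; elim/big_rec: _ => // j x bj x1; rewrite gt_max x1 andbT.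
  by rewrite exprn_ilt1 // ltW.
pose c := (1 - rho) / 4; pose q : R := (16 * (#|@swp_group p| * (p + p)).+1%:R)^-1.
have c0 : 0 < c by rewrite /c; lra.
have c1 : c <= 1 by rewrite /c; lra.
have q0 : 0 < q by rewrite invr_gt0 mulr_gt0.
have q1 : q <= 1.
  rewrite invf_le1 ?mulr_gt0 //; apply: (@le_trans _ _ (1 * 1)); [by rewrite mul1r|by rewrite ler_pM ?ler1n].
have D01 n : 0 < \prod_j d j n <= 1.
  apply/andP; split; first by apply: prodr_gt0 => j _; case: (hd j) => /(_ n)/andP[].
  by apply: prodr_ile1 => j _; case: (hd j) => /(_ n)/andP[/ltW -> ->].
have [_ [s [sig [sig0 s01 sd_ sigs]]]] : brj (fun n => q * (c * \prod_j d j n)).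
  apply: (brjM (brj_cst _)); first by rewrite q0 q1.
  by apply: (brjM (brj_cst _)); [rewrite c0 c1|apply: brj_prod => j _; exact: hd].
have w0 n : 0 < c * \prod_j d j n by rewrite mulr_gt0 //; case/andP: (D01 n).
have wc n : c * \prod_j d j n <= c.
  by rewrite ger_pMr //; case/andP: (D01 n).
exists (fun n => c * \prod_j d j n), s, sig; split=> // n.
- by rewrite w0 (le_trans (wc n)).
- apply: (@sd_lam _ _ lam lam0 _ rho).
  + by rewrite rho0.
  + move=> j m; rewrite cabs_expz => h; have h1 := expz_lt1 (l0 j) h.
    have bj : b j < 1.
      rewrite gt_min; case: (ltrgtP (cabs (lam j)) 1) h => //= [l1 _|->]; last by rewrite exp1rz ltxx.
      by rewrite invf_lt1.
    apply: (@le_trans _ _ (b j ^+ 2)); last exact: (le_bigmax_cond _ (fun j => b j ^+ 2)).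
    by rewrite lerXn2r ?nnegrE ?(ltW (b0 j)) // exprz_ge0 // ltW.
  + by rewrite w0 (le_trans (wc n)) // /c; lra.
  + move=> j m l1 mn; have hm : (absz m + 2 <= 2 ^ n.+3)%N.
      by rewrite !expnS; move: mn (expn_gt0 2 n) => /=; set x := (2 ^ n)%N; lia.
    have [e|h] := hgap j l1 n m hm; [by left|right]; apply: le_trans h.
    rewrite (bigD1 j) //=; set P := \prod_(i < p | _) _.
    have P01 : 0 <= P <= 1.
      apply/andP; split; first by apply: prodr_ge0 => i _; case: (hd i) => /(_ n)/andP[/ltW].
      by apply: prodr_ile1 => i _; case: (hd i) => /(_ n)/andP[/ltW -> ->].
    have [/andP[P0 P1] [/(_ n)/andP[dj _] _]] := (P01, hd j).
    have c2 : 2 * c <= 1 by rewrite /c; lra.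
    rewrite mulrA mulrA [2 * c * _]mulrC -mulrA ger_pMr // mulr_ile1 //.
    by rewrite mulr_ge0 // ltW.
  + move=> j m; rewrite cabs_expz => h; have [l1|l1] := eqVneq (cabs (lam j)) 1; [by left|right].
    by apply/eqP; move: h => /eqP; rewrite pexprz_eq1 ?cabs_ge0 // (negbTE l1) orbF.
- have := sd_ n; rewrite /q => h.
  by rewrite mulrC -ler_pdivlMr ?mulr_gt0 // mulrC.
Qed.

End Sequences.

(** * Evaluation of convergent series *)

Section GeometricLimits.
Context {R : realType}.
Local Notation C := R[i].

Lemma geo_limit (u : nat -> R) c :
  (forall N N', (N <= N')%N -> `|u N' - u N| <= c * 2^-1 ^+ N) ->
  exists l, forall N, `|u N - l| <= c * 2^-1 ^+ N.
Proof.
move=> h; pose A : set R := [set x | exists N, x = u N - c * 2^-1 ^+ N]%classic.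
have ub N N' : u N - c * 2^-1 ^+ N <= u N' + c * 2^-1 ^+ N'.
  have [/h|/ltnW /h] := leqP N N'; rewrite ler_distlC => /andP[h1 h2].
    have : 0 <= c * 2^-1 ^+ N' by apply: le_trans (normr_ge0 _) (h _ _ (leqnn _)).
    by lra.
  have : 0 <= c * 2^-1 ^+ N by apply: le_trans (normr_ge0 _) (h _ _ (leqnn _)).
  by lra.
have A0 : (A !=set0)%classic by exists (u 0%N - c * 2^-1 ^+ 0), 0%N.
exists (sup A) => N; rewrite ler_distlC; apply/andP; split.
  rewrite lerBlDr -lerBlDr; apply: ub_le_sup; last by exists N.
  by exists (u 0%N + c * 2^-1 ^+ 0) => _ [k ->].
by apply: ge_sup => // _ [k ->].
Qed.

Lemma geo_small (c x : R) : (forall N, x <= c * 2^-1 ^+ N) -> x <= 0.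
Proof.
move=> h; rewrite leNgt; apply/negP => x0.
have c0 : 0 < c by apply: lt_le_trans x0 _; have := h 0%N; rewrite expr0 mulr1.
have [N hN] : exists N, c / x < N%:R by exists (Num.bound (c / x)); apply: archi_boundP; rewrite ltW ?divr_gt0.
have := h N; rewrite leNgt => /negP; apply.
have N2 : N%:R <= 2 ^+ N :> R by rewrite -natrX ler_nat ltnW // ltn_expl.
rewrite exprVn ltr_pdivrMr ?exprn_gt0 // mulrC -ltr_pdivrMr //.
exact: lt_le_trans N2.
Qed.

Lemma cabs_geo_eq (c : R) (z z' : C) : (forall N, cabs (z - z') <= c * 2^-1 ^+ N) -> z = z'.
Proof.
move/geo_small => h; apply/eqP; rewrite -subr_eq0 -cabs_eq0.
by rewrite eq_le h cabs_ge0.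
Qed.

Lemma geo_limitC (u : nat -> C) c :
  (forall N N', (N <= N')%N -> cabs (u N' - u N) <= c * 2^-1 ^+ N) ->
  exists l, forall N, cabs (l - u N) <= 2 * c * 2^-1 ^+ N.
Proof.
move=> h.
have [x hx] : exists l, forall N, `|complex.Re (u N) - l| <= c * 2^-1 ^+ N.
  apply: geo_limit => N N' NN; apply: le_trans (h _ _ NN).
  by rewrite -raddfB; exact: cabs_Re.
have [y hy] : exists l, forall N, `|complex.Im (u N) - l| <= c * 2^-1 ^+ N.
  apply: geo_limit => N N' NN; apply: le_trans (h _ _ NN).
  by rewrite -raddfB; exact: cabs_Im.
exists (Complex x y) => N; rewrite cabs_distC; apply: le_trans (cabs_le_ReIm _) _.
rewrite !raddfB /= -mulrA mulr_natl mulr2n; exact: lerD.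
Qed.

End GeometricLimits.

Section Evaluation.
Context {R : realType}.
Local Notation C := R[i].

Section Partial.
Context {m : nat}.
Implicit Types (a b : fps C m) (x : 'I_m -> C).

Definition evN N x a : C := \sum_(u <- mis m N) a u * mi_pow x u.

Lemma cabs_mi_pow r x u : 0 <= r -> (forall i, cabs (x i) <= r) -> cabs (mi_pow x u) <= r ^+ mi_deg u.
Proof.
move=> r0 xr; rewrite /mi_pow /mi_deg -prodrXr.
elim/big_rec2: _ => [|i y z _ yz]; first by rewrite cabs1.
rewrite cabsM cabsX; apply: ler_pM => //; try exact: exprn_ge0 (cabs_ge0 _).
  exact: cabs_ge0.
by rewrite lerXn2r ?nnegrE ?cabs_ge0.
Qed.

Lemma evN_bound N r x a : 0 <= r -> (forall i, cabs (x i) <= r) -> cabs (evN N x a) <= nrm N r a.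
Proof.
move=> r0 xr; apply: le_trans (cabs_sum _ _ _) _; apply: ler_sum => u _.
by rewrite cabsM ler_wpM2l ?cabs_ge0 // cabs_mi_pow.
Qed.

Lemma evN_ext N x a b : fps_ord N.+1 (a - b) -> evN N x a = evN N x b.
Proof.
move=> h; apply: eq_big_seq => u; rewrite mem_mis => uN.
by rewrite (fps_ord_eq h).
Qed.

Lemma evND N x a b : evN N x (a + b) = evN N x a + evN N x b.
Proof. by rewrite /evN -big_split; apply: eq_bigr => u _; rewrite fps_addE mulrDl. Qed.
Lemma evNN N x a : evN N x (- a) = - evN N x a.
Proof. by rewrite /evN -sumrN; apply: eq_bigr => u _; rewrite fps_oppE mulNr. Qed.
Lemma evN_CM N x c a : evN N x (fps_C c * a) = c * evN N x a.
Proof. by rewrite /evN mulr_sumr; apply: eq_bigr => u _; rewrite fps_CM mulrA. Qed.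
Lemma evN_sum N x I s (P : pred I) (F : I -> fps C m) :
  evN N x (\sum_(i <- s | P i) F i) = \sum_(i <- s | P i) evN N x (F i).
Proof.
elim/big_rec2: _ => [|i y z _ <-]; last exact: evND.
by apply: big1 => u _; rewrite mul0r.
Qed.

Lemma evN_mono N x u : (mi_deg u <= N)%N -> evN N x (fps_mono u) = mi_pow x u.
Proof.
move=> uN; rewrite /evN (bigID (fun v => v == u)) /= sum_mis_eq // /fps_mono eqxx mul1r.
by rewrite big1 ?addr0 // => v /negbTE ->; rewrite mul0r.
Qed.

Lemma mi_powD x u v : mi_pow x (u + v) = mi_pow x u * mi_pow x v.
Proof. by rewrite /mi_pow -big_split; apply: eq_bigr => i _; rewrite ffunE exprD. Qed.

Lemma evN_truncM N x a b : evN (N + N) x (fps_trunc N a * fps_trunc N b) = evN N x a * evN N x b.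
Proof.
rewrite !fps_truncE big_distrl evN_sum [RHS]big_distrl /=; apply: eq_big_seq => u.
rewrite mem_mis => uN; rewrite big_distrr evN_sum [RHS]big_distrr /=; apply: eq_big_seq => v.
rewrite mem_mis => vN; rewrite mulrACA -rmorphM evN_CM fps_monoM evN_mono ?mi_degD ?leq_add //.
by rewrite mi_powD; ring.
Qed.

Lemma nrm_tail N N' r a : 0 <= r -> nrm N r (a - fps_trunc N' a) <= nrm N r a.
Proof.
move=> r0; apply: ler_sum => u _; rewrite fps_subE /fps_trunc; case: ifP => _.
  by rewrite subrr cabs0 mul0r mulr_ge0 ?cabs_ge0 ?exprn_ge0.
by rewrite subr0.
Qed.

Lemma evN_tail N N' r x a : 0 <= r -> (forall i, 2 * cabs (x i) <= r) -> (N <= N')%N ->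
  cabs (evN N' x a - evN N x a) <= 2^-1 ^+ N.+1 * nrm N' r a.
Proof.
move=> r0 xr NN.
have -> : evN N x a = evN N' x (fps_trunc N a).
  rewrite /evN (@sum_mis_widen _ _ N N' (fun u => fps_trunc N a u * mi_pow x u)) //.
    by apply: eq_big_seq => u; rewrite mem_mis /fps_trunc => ->.
  by move=> u; rewrite /fps_trunc ltnNge => /negbTE ->; rewrite mul0r.
rewrite -evNN -evND; apply: le_trans (@evN_bound _ (2^-1 * r) _ _ _ _) _ => [|i|].
- by rewrite mulr_ge0.
- by have := xr i; lra.
apply: (@le_trans _ _ (2^-1 ^+ N.+1 * nrm N' r (a - fps_trunc N a))).
  by apply: nrm_ord_scale => //; [lra|exact: fps_truncP].
by rewrite ler_wpM2l ?exprn_ge0 // nrm_tail.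
Qed.

End Partial.

Definition ev m (x : 'I_m -> C) (a : fps C m) : C :=
  xget 0 [set z | exists M, forall N, cabs (z - evN N x a) <= M * 2^-1 ^+ N]%classic.

Lemma evE m (x : 'I_m -> C) a z M : (forall N, cabs (z - evN N x a) <= M * 2^-1 ^+ N) -> ev x a = z.
Proof.
move=> h; rewrite /ev; case: xgetP => [y _ [M' h']|/(_ z)]; last by case; exists M.
apply: (@cabs_geo_eq _ (M' + M)) => N; rewrite mulrDl.
have -> : y - z = (y - evN N x a) - (z - evN N x a) by ring.
by apply: le_trans (cabsB _ _) _; exact: lerD.
Qed.

(* Half the radius, so that series with [nrm] bounded at radius r converge geometrically. *)
Definition pdisc m (r : R) (x : 'I_m -> C) := forall i, 2 * cabs (x i) <= r.
Definition bd m (r : R) (a : fps C m) := exists M, forall N, nrm N r a <= M.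

Lemma ev_approx m (x : 'I_m -> C) r a M : 0 <= r -> pdisc r x -> (forall N, nrm N r a <= M) ->
  forall N, cabs (ev x a - evN N x a) <= 2 * M * 2^-1 ^+ N.
Proof.
move=> r0 xr aM.
have M0 : 0 <= M by apply: le_trans (nrm_ge0 0%N _ r0) (aM 0%N).
have [N N' NN|l hl] := @geo_limitC R (fun N => evN N x a) M.
  apply: le_trans (evN_tail _ r0 xr NN) _; rewrite mulrC exprS.
  apply: ler_pM => //; rewrite ?nrm_ge0 ?mulr_ge0 ?exprn_ge0 //.
  by rewrite ler_piMl ?exprn_ge0 // invf_le1 // ler1n.
by rewrite (evE hl).
Qed.

Section Disc.
Context {m : nat}.
Variables (r : R) (x : 'I_m -> C).
Hypotheses (r0 : 0 <= r) (xr : pdisc r x).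
Implicit Types a b : fps C m.

Lemma bd_approx a : bd r a -> exists2 M, 0 <= M & forall N, cabs (ev x a - evN N x a) <= M * 2^-1 ^+ N.
Proof.
move=> [M aM]; exists (2 * M); last exact: ev_approx r0 xr aM.
by rewrite mulr_ge0 // (le_trans (nrm_ge0 0%N a r0)).
Qed.

Lemma bdD a b : bd r a -> bd r b -> bd r (a + b).
Proof. by move=> [M aM] [M' bM]; exists (M + M') => N; rewrite (le_trans (nrmD _ _ _ r0)) ?lerD. Qed.
Lemma bdN a : bd r a -> bd r (- a).
Proof. by move=> [M aM]; exists M => N; rewrite nrmN. Qed.
Lemma bdM a b : bd r a -> bd r b -> bd r (a * b).
Proof.
move=> [M aM] [M' bM]; exists (M * M') => N; rewrite (le_trans (nrmM _ _ _ r0)) //.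
by rewrite ler_pM ?nrm_ge0.
Qed.
Lemma bd_C c : bd r (fps_C c : fps C m).
Proof. by exists (cabs c) => N; rewrite nrm_C. Qed.
Lemma bd_var i : bd r (fps_var i : fps C m).
Proof. by exists r => N; exact: nrm_var. Qed.
Lemma bdX a n : bd r a -> bd r (a ^+ n).
Proof.
move=> h; elim: n => [|n IH]; first by exists 1 => N; rewrite expr0 nrm1.
by rewrite exprS; exact: bdM.
Qed.

Lemma evD a b : bd r a -> bd r b -> ev x (a + b) = ev x a + ev x b.
Proof.
move=> /bd_approx[M M0 hM] /bd_approx[M' M'0 hM']; apply: (@evE _ _ _ _ (M + M')) => N.
rewrite evND mulrDl opprD addrACA; apply: le_trans (cabsD _ _) _; exact: lerD.
Qed.
Lemma evN_ a : bd r a -> ev x (- a) = - ev x a.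
Proof.
move=> /bd_approx[M M0 hM]; apply: (@evE _ _ _ _ M) => N.
by rewrite evNN -opprD cabsN.
Qed.
Lemma evB a b : bd r a -> bd r b -> ev x (a - b) = ev x a - ev x b.
Proof. by move=> ha hb; rewrite evD ?evN_ //; exact: bdN. Qed.
Lemma ev_sum I s (P : pred I) (F : I -> fps C m) : (forall i, P i -> bd r (F i)) ->
  ev x (\sum_(i <- s | P i) F i) = \sum_(i <- s | P i) ev x (F i).
Proof.
move=> h; suff [] : bd r (\sum_(i <- s | P i) F i) /\
  ev x (\sum_(i <- s | P i) F i) = \sum_(i <- s | P i) ev x (F i) by [].
elim/big_rec2: _ => [|i y z Pi [hz <-]]; last by split; [apply: bdD|rewrite evD] => //; exact: h.
split; first by exists 0 => N; rewrite nrm0.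
by apply: (@evE _ _ _ _ 0) => N; rewrite /evN big1 ?subr0 ?cabs0 ?mul0r // => u _; rewrite mul0r.
Qed.

Lemma ev_C c : ev x (fps_C c : fps C m) = c.
Proof.
apply: (@evE _ _ _ _ 0) => N; rewrite mul0r -[fps_C c]mulr1 evN_CM.
rewrite (_ : 1 = fps_mono 0); last by apply/funext => u; rewrite fps_oneE.
by rewrite evN_mono ?mi_deg0 // /mi_pow big1 ?mulr1 ?subrr ?cabs0 // => i _; rewrite ffunE.
Qed.

Lemma ev1 : ev x (1 : fps C m) = 1.
Proof. by rewrite -[X in ev x X](rmorph1 (@fps_C C m)) ev_C. Qed.

Lemma mi_pow_unit i : mi_pow x (mi_unit i) = x i.
Proof.
rewrite /mi_pow (bigD1 i) //= ffunE eqxx big1 ?mulr1 // => j ji.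
by rewrite ffunE (negbTE ji).
Qed.

Lemma ev_var i : ev x (fps_var i) = x i.
Proof.
have h := ev_approx r0 xr (fun N => nrm_var N i r0).
apply: (@evE _ _ _ _ (cabs (x i))) => -[|N].
  rewrite /evN big1_seq ?subr0 ?mulr1 // => u; rewrite mem_mis leqn0 mi_deg_eq0 => /eqP ->.
  by rewrite /fps_var mi_unit_neq0 mul0r.
rewrite -[fps_var i]/(fps_mono (mi_unit i)) evN_mono ?mi_deg_unit //.
by rewrite mi_pow_unit subrr cabs0 mulr_ge0 ?cabs_ge0 ?exprn_ge0.
Qed.

Lemma ev_le a M : (forall N, nrm N r a <= M) -> cabs (ev x a) <= M.
Proof.
move=> aM; rewrite -subr_le0; apply: (@geo_small _ (2 * M)) => N.
have h := ev_approx r0 xr aM N.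
have h1 : cabs (evN N x a) <= M.
  apply: le_trans (evN_bound _ _ r0 _) (aM N) => i; have := xr i; have := cabs_ge0 (x i); lra.
have := cabsD (ev x a - evN N x a) (evN N x a); rewrite subrK; lra.
Qed.

Lemma evM a b : bd r a -> bd r b -> ev x (a * b) = ev x a * ev x b.
Proof.
move=> [Ma hMa] [Mb hMb]; have ea := ev_approx r0 xr hMa; have eb := ev_approx r0 xr hMb.
have Ma0 : 0 <= Ma by exact: le_trans (nrm_ge0 0%N a r0) (hMa _).
have Mb0 : 0 <= Mb by exact: le_trans (nrm_ge0 0%N b r0) (hMb _).
apply: (@evE _ _ _ _ (Ma * (2 * Mb) + 2 * Ma * Mb + Ma * Mb)) => N; set e := 2^-1 ^+ N.
have e0 : 0 <= e by exact: exprn_ge0.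
have la : cabs (ev x a) <= Ma by exact: ev_le.
have lb : cabs (evN N x b) <= Mb.
  apply: le_trans (evN_bound _ _ r0 _) (hMb N) => i; have := xr i; have := cabs_ge0 (x i); lra.
pose c := fps_trunc N a * fps_trunc N b.
have cM : nrm (N + N) r c <= Ma * Mb.
  apply: le_trans (nrmM _ _ _ r0) _; apply: ler_pM; rewrite ?nrm_ge0 //.
    exact: le_trans (nrm_trunc _ _ _ r0) (hMa _).
  exact: le_trans (nrm_trunc _ _ _ r0) (hMb _).
have ec : evN N x (a * b) = evN N x c.
  apply: evN_ext; have -> : a * b - c = (a - fps_trunc N a) * b + fps_trunc N a * (b - fps_trunc N b).
    by rewrite /c; ring.
  by apply: fps_ordD; [apply: fps_ordMr|apply: fps_ordMl]; exact: fps_truncP.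
have -> : ev x a * ev x b - evN N x (a * b) = ev x a * (ev x b - evN N x b) +
    (ev x a - evN N x a) * evN N x b + (evN (N + N) x c - evN N x c).
  by rewrite evN_truncM ec; ring.
apply: le_trans (cabsD _ _) _; rewrite [leRHS]mulrDl; apply: lerD.
  apply: le_trans (cabsD _ _) _; rewrite [leRHS]mulrDl !cabsM; apply: lerD.
    by rewrite -[leRHS]mulrA ler_pM ?cabs_ge0.
  by rewrite -[leRHS]mulrA [Mb * e]mulrC mulrA ler_pM ?cabs_ge0.
apply: le_trans (evN_tail _ r0 xr (leq_addr _ _)) _; rewrite mulrC.
apply: ler_pM => //; rewrite ?nrm_ge0 ?exprn_ge0 // exprS ler_piMl //.
by rewrite invf_le1 // ler1n.
Qed.

Lemma evX a n : bd r a -> ev x (a ^+ n) = ev x a ^+ n.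
Proof.
move=> h; elim: n => [|n IH]; first by rewrite !expr0 ev1.
by rewrite !exprS evM ?IH //; exact: bdX.
Qed.

Lemma bd_prod I s (P : pred I) (F : I -> fps C m) : (forall i, P i -> bd r (F i)) ->
  bd r (\prod_(i <- s | P i) F i) /\
  ev x (\prod_(i <- s | P i) F i) = \prod_(i <- s | P i) ev x (F i).
Proof.
move=> h; elim/big_rec2: _ => [|i y z Pi [hz <-]]; last by split; [apply: bdM|rewrite evM] => //; exact: h.
by rewrite ev1; split=> //; exists 1 => N; rewrite nrm1.
Qed.

Section Comp.
Context {k : nat}.
Variables (f : fps C k) (g : 'I_k -> fps C m) (q : R).
Hypotheses (g0 : nc g) (q0 : 0 <= q) (gq : forall i N, nrm N r (g i) <= q) (fq : bd q f).

Lemma ev_pdisc : pdisc q (fun i => ev x (g i)).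
Proof.
move=> i; rewrite -ler_pdivlMl // mulrC; set y := ev x (g i).
rewrite -subr_le0; apply: (@geo_small _ (2 * q)) => N.
have h := ev_approx r0 xr (gq i) N; rewrite -/y in h.
have h1 : cabs (evN N x (g i)) <= 2^-1 * q.
  apply: le_trans (@evN_bound _ N (2^-1 * r) _ _ _ _) _ => [|j|]; first by rewrite mulr_ge0.
    by have := xr j; lra.
  apply: le_trans (nrm_ord_scale (D := 1) _ _ _ _) _ => //; first by lra.
    exact: fps_ord1.
  by rewrite expr1 ler_wpM2l.
have := cabsD (y - evN N x (g i)) (evN N x (g i)); rewrite subrK; lra.
Qed.

Lemma ev_comp : ev x (fps_comp f g) = ev (fun i => ev x (g i)) f.
Proof.
have [M hM] := fq; pose y i := ev x (g i); have yq : pdisc q y := ev_pdisc.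
have ey := ev_approx q0 yq hM; rewrite -/y.
apply: (@evE _ _ _ _ (2 * M + 2 * M)) => N; rewrite mulrDl.
pose fN := fps_trunc N f.
have -> : evN N x (fps_comp f g) = evN N x (fps_comp fN g).
  by apply: evN_ext; rewrite -fps_compB; apply: fps_comp_ord1 => //; exact: fps_truncP.
have bg i : bd r (g i) by exists q => n; exact: gq.
have e1 : ev x (fps_comp fN g) = evN N y f.
  rewrite /fN fps_truncE fps_comp_sum ev_sum => [|u _]; last first.
    rewrite fps_comp_CM fps_comp_mono // fps_monomialE; apply: bdM; first exact: bd_C.
    by apply: (bd_prod _ _).1 => i _; exact: bdX.
  apply: eq_bigr => u _; rewrite fps_comp_CM fps_comp_mono // fps_monomialE.
  have [b1 e] := @bd_prod _ (index_enum 'I_k) predT (fun i => g i ^+ u i) (fun i _ => bdX _ (bg i)).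
  rewrite evM ?ev_C ?e //; last exact: bd_C.
  by congr (_ * _); apply: eq_bigr => i _; rewrite evX.
have b2 n : nrm n r (fps_comp fN g) <= M.
  apply: le_trans (nrm_comp _ r0 q0 g0 (fun i => gq i n)) _.
  exact: le_trans (nrm_trunc _ _ _ q0) (hM _).
have := ev_approx r0 xr b2 N; rewrite e1 => h.
have -> : ev y f - evN N x (fps_comp fN g) = (ev y f - evN N y f) + (evN N y f - evN N x (fps_comp fN g)).
  by ring.
by apply: le_trans (cabsD _ _) _; exact: lerD.
Qed.

End Comp.
End Disc.

Lemma ev_conj m (x : 'I_m -> C) r a : 0 <= r -> pdisc r x -> bd r a ->
  ev (fun i => conjc (x i)) (fconj a) = conjc (ev x a).
Proof.
move=> r0 xr ba; have [M M0 hM] := bd_approx r0 xr ba; apply: (@evE _ _ _ _ M) => N.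
have -> : evN N (fun i => conjc (x i)) (fconj a) = conjc (evN N x a).
  rewrite /evN rmorph_sum; apply: eq_bigr => u _; rewrite rmorphM rmorph_prod; congr (_ * _).
  by apply: eq_bigr => i _; rewrite rmorphXn.
by rewrite -rmorphB cabs_conj.
Qed.

End Evaluation.

(** * Germs of expansions *)

Section Germs.
Context {R : realType}.
Local Notation C := R[i].

Lemma near0P (K : numFieldType) m (P : 'rV[K]_m -> Prop) : near0 P <->
  exists2 e : K, 0 < e & forall x : 'rV[K]_m, (forall i, `|x 0 i| < e) -> P x.
Proof.
rewrite /near0; split.
  move/nbhs_ballP => [e /= e0 h]; exists e => // x xe; apply: h.
  by split=> // i j; rewrite mxE ord1 /= /ball /= /ball_ sub0r normrN.
move=> [e e0 h]; apply/nbhs_ballP; exists e => // x xe; apply: h => i.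
by have := xe.2 0 i; rewrite mxE /= /ball /= /ball_ sub0r normrN.
Qed.

Lemma cabs_lt (z : C) (e : R) : (`|z| < (e%:C)%C) = (cabs z < e).
Proof. by rewrite cabsE ltcR. Qed.

Lemma near0CP m (P : 'rV[C]_m -> Prop) : near0 P <->
  exists2 e : R, 0 < e & forall x : 'rV[C]_m, (forall i, cabs (x 0 i) < e) -> P x.
Proof.
rewrite near0P; split=> -[e e0 h].
  have eE : e = ((complex.Re e)%:C)%C.
    by case: e e0 {h} => a b; rewrite ltcE /= => /andP[/eqP -> _].
  exists (complex.Re e) => [|x xe]; first by move: e0; rewrite eE ltcR.
  by apply: h => i; rewrite eE cabs_lt.
by exists ((e%:C)%C) => [|x xe]; [rewrite ltcR|apply: h => i; rewrite -cabs_lt].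
Qed.

Definition cfps m (a : fps R m) : fps C m := fun u => ((a u)%:C)%C.

Definition box m N : seq (multiindex m) := [seq mi_of u | u <- enum {ffun 'I_m -> 'I_N}].

Lemma mem_box m N (u : multiindex m) : (u \in box m N) = [forall i, (u i < N)%N].
Proof.
apply/mapP/forallP => [[v _ ->] i|h]; first by rewrite ffunE.
by have [v <-] := mi_ofP h; exists v; rewrite ?mem_enum.
Qed.

Lemma sum_boxE (V : nmodType) m N K (F : multiindex m -> V) : (m * N <= K)%N ->
  \sum_(u : {ffun 'I_m -> 'I_N}) F (mi_of u) = \sum_(u <- mis m K | u \in box m N) F u.
Proof.
move=> mK; rewrite -[RHS]big_filter.
rewrite -big_enum /= -(big_map (@mi_of m N) predT F).
apply: perm_big; apply: uniq_perm => [||u].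
- by rewrite map_inj_uniq ?enum_uniq //; exact: mi_of_inj.
- exact: filter_uniq (mis_uniq _ _).
rewrite mem_filter mem_mis -/(box m N) andb_idr // mem_box => /forallP h.
apply: leq_trans mK; rewrite /mi_deg -[X in (X * _)%N]card_ord -sum_nat_const.
by apply: leq_sum => i _; exact: ltnW.
Qed.

Lemma box_approx m (x : 'I_m -> C) r a M N : 0 <= r -> pdisc r x -> (forall N, nrm N r a <= M) ->
  cabs (ev x a - \sum_(u : {ffun 'I_m -> 'I_N}) a (mi_of u) * \prod_(i < m) x i ^+ u i)
    <= 3 * M * 2^-1 ^+ N.
Proof.
move=> r0 xr aM.
have M0 : 0 <= M by apply: le_trans (nrm_ge0 0%N a r0) (aM 0%N).
pose b : fps C m := fun u => if u \in box m N then a u else 0.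
pose K := (m * N + N)%N.
have -> : \sum_(u : {ffun 'I_m -> 'I_N}) a (mi_of u) * \prod_(i < m) x i ^+ u i = evN K x b.
  transitivity (\sum_(u : {ffun 'I_m -> 'I_N}) a (mi_of u) * mi_pow x (mi_of u)).
    by apply: eq_bigr => u _; congr (_ * _); apply: eq_bigr => i _; rewrite ffunE.
  rewrite (@sum_boxE _ _ _ K (fun u => a u * mi_pow x u)) ?leq_addr // big_mkcond /=.
  by apply: eq_bigr => u _; rewrite /b; case: ifP => // _; rewrite mul0r.
have oab : fps_ord N (a - b).
  move=> u uN; rewrite fps_subE /b mem_box; case: ifP => [_|/forallP]; first by rewrite subrr.
  by case=> i; apply: leq_ltn_trans uN; exact: mi_le_deg.
have nab n : nrm n r (a - b) <= M.
  apply: le_trans (aM n); apply: ler_sum => u _; rewrite fps_subE /b; case: ifP => _.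
    by rewrite subrr cabs0 mul0r mulr_ge0 ?cabs_ge0 ?exprn_ge0.
  by rewrite subr0.
have -> : ev x a - evN K x b = (ev x a - evN K x a) + evN K x (a - b) by rewrite evND evNN; ring.
have -> : 3 * M = 2 * M + M by ring.
rewrite mulrDl; apply: le_trans (cabsD _ _) _; apply: lerD.
  apply: le_trans (ev_approx r0 xr aM K) _; rewrite ler_wpM2l ?mulr_ge0 //.
  by rewrite ler_wiXn2l ?leq_addl // invf_le1 // ler1n.
apply: le_trans (@evN_bound _ _ K (2^-1 * r) _ _ _ _) _ => [|i|]; first by rewrite mulr_ge0.
  by have := xr i; lra.
apply: (@le_trans _ _ (2^-1 ^+ N * nrm K r (a - b))); first by apply: nrm_ord_scale => //; lra.
by rewrite mulrC ler_wpM2r ?exprn_ge0.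
Qed.

Lemma geo_eventually (c e : R) : 0 < e -> exists N0, forall N, (N0 <= N)%N -> c * 2^-1 ^+ N <= e.
Proof.
move=> e0; have [c0|c0] := leP c 0.
  by exists 0%N => N _; rewrite (le_trans _ (ltW e0)) // mulr_le0_ge0 // exprn_ge0.
apply: contrapT => /forallNP h; have := c0; rewrite ltNge => /negP; apply.
have h2 N : e <= c * 2^-1 ^+ N.
  have /existsNP[N' /not_implyP[NN /negP]] := h N; rewrite -ltNge => /ltW /le_trans; apply.
  by rewrite ler_wpM2l ?(ltW c0) // ler_wiXn2l // invf_le1 // ler1n.
by have := lt_le_trans e0 (geo_small h2); rewrite ltxx.
Qed.

Lemma cvgt_bd m (a : fps C m) : cvgt a -> exists2 r, 0 < r & bd r a.
Proof. by move=> [r [M [r0 h]]]; exists r => //; exists M. Qed.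

Lemma geo_bound_real m (a : fps R m) (c r : R) : (forall u, `|a u| <= c * r ^+ mi_deg u) -> cvgt (cfps a).
Proof. by move=> h; apply: (@geo_cvgt _ _ _ c r) => u; rewrite /cfps cabs_real. Qed.

Lemma small_pdisc m (r : R) (x : 'I_m -> C) : (forall i, cabs (x i) < 2^-1 * r) -> pdisc r x.
Proof. by move=> h i; have := h i; lra. Qed.

Lemma expands_real m (f : 'rV[R]_m -> R) a : expands_at0 f a -> cvgt (cfps a) /\
  near0 (fun x => ev (fun i => ((x 0 i)%:C)%C) (cfps a) = ((f x)%:C)%C).
Proof.
move=> [[c [q hq]] /near0P[e e0 he]]; have ca := geo_bound_real hq; split=> //.
have [r [M [r0 aM]]] := ca.
apply/near0P; exists (Num.min e (2^-1 * r)) => [|x xe]; first by rewrite lt_min e0 mulr_gt0.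
have xr : pdisc r (fun i => ((x 0 i)%:C)%C).
  by apply: small_pdisc => i; rewrite cabs_real; have := xe i; rewrite lt_min => /andP[].
have {he} hf := he x; set z := ev _ _.
pose S N := \sum_(u : {ffun 'I_m -> 'I_N}) a (mi_of u) * \prod_(i < m) x 0 i ^+ u i.
have hS N : cabs (z - ((S N)%:C)%C) <= 3 * M * 2^-1 ^+ N.
  have := box_approx N (ltW r0) xr aM; congr (cabs (_ - _) <= _); rewrite rmorph_sum.
  apply: eq_bigr => u _; rewrite rmorphM rmorph_prod; congr (_ * _).
  by apply: eq_bigr => i _; rewrite rmorphXn.
have zi : complex.Im z = 0.
  apply/eqP; rewrite -normr_eq0 eq_le normr_ge0 andbT; apply: (@geo_small _ (3 * M)) => N.
  apply: le_trans (hS N); apply: le_trans (cabs_Im _).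
  by rewrite raddfB /= subr0.
suff : f x = complex.Re z by move=> ->; case: (z) zi => y1 y2 /= ->.
have Sf : (S @ \oo --> f x)%classic by apply: hf => i; have := xe i; rewrite lt_min => /andP[].
apply: (cvg_unique _ Sf) => //; apply/cvgrPdist_le => d d0.
have [N0 hN0] := geo_eventually (3 * M) d0; exists N0 => // N NN.
apply: le_trans (hN0 N NN); apply: le_trans (hS N); apply: le_trans (cabs_Re _).
by rewrite raddfB.
Qed.

Lemma expands_complex m (a : fps C m) : cvgt a -> expands_at0 (fun x : 'rV[C]_m => ev (fun i => x 0 i) a) a.
Proof.
move=> ca; split.
  have [M [q [_ _ h]]] := cvgt_geo ca; exists ((M%:C)%C), ((q%:C)%C) => u.
  by rewrite cabsE -rmorphXn -rmorphM lecR.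
have [r [M [r0 aM]]] := ca.
apply/near0CP; exists (2^-1 * r); first by rewrite mulr_gt0.
move=> x xr; apply/cvgrPdist_le => d d0.
have dE : d = ((complex.Re d)%:C)%C.
  by case: d d0 => y z; rewrite ltcE /= => /andP[/eqP -> _].
have d0' : 0 < complex.Re d by move: d0; rewrite {1}dE ltcR.
have [N0 hN0] := geo_eventually (3 * M) d0'; exists N0 => // N NN.
rewrite cabsE dE lecR; apply: le_trans (hN0 N NN).
exact: (box_approx N (ltW r0) (small_pdisc xr) aM).
Qed.

Definition rpart m (a : fps C m) : fps R m := fun u => complex.Re (a u).

Lemma expands_Re m (a : fps C m) : cvgt a ->
  expands_at0 (fun x : 'rV[R]_m => complex.Re (ev (fun i => ((x 0 i)%:C)%C) a)) (rpart a).
Proof.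
move=> ca; split.
  have [M [q [_ _ h]]] := cvgt_geo ca; exists M, q => u; apply: le_trans (h u); exact: cabs_Re.
have [r [M [r0 aM]]] := ca.
apply/near0P; exists (2^-1 * r); first by rewrite mulr_gt0.
move=> x xr; apply/cvgrPdist_le => d d0.
have [N0 hN0] := geo_eventually (3 * M) d0; exists N0 => // N NN.
apply: le_trans (hN0 N NN).
have xp : pdisc r (fun i => ((x 0 i)%:C)%C).
  by apply: small_pdisc => i; rewrite cabs_real; exact: xr.
apply: le_trans (box_approx N (ltW r0) xp aM); apply: le_trans (cabs_Re _).
rewrite [in leRHS]raddfB [in leRHS]raddf_sum le_eqVlt; apply/orP; left; apply/eqP.
congr (`|_ - _|); apply: eq_bigr => u _.
rewrite (_ : \prod_(i < m) ((x 0 i)%:C)%C ^+ u i = ((\prod_(i < m) x 0 i ^+ u i)%:C)%C); last first.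
  by rewrite rmorph_prod; apply: eq_bigr => i _; rewrite rmorphXn.
by rewrite /rpart; case: (a _) => y z /=; rewrite mulr0 subr0.
Qed.

End Germs.

Section NearC.
Context {R : realType}.
Local Notation C := R[i].

Definition nearC m (P : ('I_m -> C) -> Prop) := exists2 e : R, 0 < e & forall x, (forall i, cabs (x i) < e) -> P x.

Lemma nearC_and m (P Q : ('I_m -> C) -> Prop) : nearC P -> nearC Q -> nearC (fun x => P x /\ Q x).
Proof.
move=> [e e0 h] [d d0 k]; exists (Num.min e d) => [|x xe]; first by rewrite lt_min e0.
by split; [apply: h|apply: k] => i; have := xe i; rewrite lt_min => /andP[].
Qed.

Lemma nearC_all m (I : finType) (P : I -> ('I_m -> C) -> Prop) : (forall i, nearC (P i)) ->
  nearC (fun x => forall i, P i x).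
Proof.
move=> h; have [e e0 he] := fin_all_exists2 h.
exists (\big[Num.min/1]_i e i) => [|x xe i].
  by elim/big_rec: _ => // i y _ y0; rewrite lt_min e0.
apply: he => j; apply: lt_le_trans (xe j) _; exact: bigmin_le.
Qed.

Lemma nearCW m (P Q : ('I_m -> C) -> Prop) : (forall x, P x -> Q x) -> nearC P -> nearC Q.
Proof. by move=> PQ [e e0 h]; exists e => // x xe; apply: PQ; exact: h. Qed.

Lemma near_ev_small m k (g : 'I_k -> fps C m) e : (forall i, cvgt (g i)) -> nc g -> 0 < e ->
  nearC (fun x => forall i, cabs (ev x (g i)) < e).
Proof.
move=> cg g0 e0; have e2 : 0 < 2^-1 * e by rewrite mulr_gt0.
have [r r0 hr] := cvgt_fam_small cg g0 e2.
exists (2^-1 * r) => [|x xr i]; first by rewrite mulr_gt0.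
have h := ev_le (ltW r0) (small_pdisc xr) (hr i); lra.
Qed.

Lemma near_pull m k (g : 'I_k -> fps C m) (P : ('I_k -> C) -> Prop) : (forall i, cvgt (g i)) -> nc g ->
  nearC P -> nearC (fun x => P (fun i => ev x (g i))).
Proof.
by move=> cg g0 [e e0 h]; apply: nearCW (near_ev_small cg g0 e0) => x; exact: h.
Qed.

Lemma near_ev_comp m k (f : fps C k) (g : 'I_k -> fps C m) : cvgt f -> (forall i, cvgt (g i)) -> nc g ->
  nearC (fun x => ev x (fps_comp f g) = ev (fun i => ev x (g i)) f).
Proof.
move=> [q [M [q0 fM]]] cg g0; have [r r0 hr] := cvgt_fam_small cg g0 q0.
exists (2^-1 * r) => [|x xr]; first by rewrite mulr_gt0.
have fq : bd q f by exists M.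
exact: (ev_comp (ltW r0) (small_pdisc xr) g0 (ltW q0) hr fq).
Qed.

Lemma near_ev_mcomp m k l (f : 'I_l -> fps C k) (g : 'I_k -> fps C m) : (forall i, cvgt (f i)) ->
  (forall i, cvgt (g i)) -> nc g ->
  nearC (fun x => forall j, ev x (mcomp f g j) = ev (fun i => ev x (g i)) (f j)).
Proof. by move=> cf cg g0; apply: nearC_all => j; exact: near_ev_comp. Qed.

Lemma pdisc_ex m (x : 'I_m -> C) : exists2 r, 0 <= r & pdisc r x.
Proof.
exists (2 * \sum_i cabs (x i)); first by rewrite mulr_ge0 // sumr_ge0 // => i _; exact: cabs_ge0.
move=> i; rewrite ler_wpM2l // (bigD1 i) //= lerDl sumr_ge0 // => j _; exact: cabs_ge0.
Qed.

Lemma ev_mid m (x : 'I_m -> C) i : ev x (mid i) = x i.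
Proof. by have [r r0 xr] := pdisc_ex x; exact: ev_var r0 xr _. Qed.

Lemma near_ev_conj m (a : fps C m) : cvgt a ->
  nearC (fun x => ev (fun i => conjc (x i)) (fconj a) = conjc (ev x a)).
Proof.
move=> /cvgt_bd[r r0 ra]; exists (2^-1 * r) => [|x xr]; first by rewrite mulr_gt0.
exact: ev_conj (ltW r0) (small_pdisc xr) ra.
Qed.

Definition nearR m (P : ('I_m -> R) -> Prop) := exists2 e : R, 0 < e & forall x, (forall i, `|x i| < e) -> P x.

Lemma nearR_and m (P Q : ('I_m -> R) -> Prop) : nearR P -> nearR Q -> nearR (fun x => P x /\ Q x).
Proof.
move=> [e e0 h] [d d0 k]; exists (Num.min e d) => [|x xe]; first by rewrite lt_min e0.
by split; [apply: h|apply: k] => i; have := xe i; rewrite lt_min => /andP[].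
Qed.

Lemma nearRW m (P Q : ('I_m -> R) -> Prop) : (forall x, P x -> Q x) -> nearR P -> nearR Q.
Proof. by move=> PQ [e e0 h]; exists e => // x xe; apply: PQ; exact: h. Qed.

Definition toC m (x : 'I_m -> R) : 'I_m -> C := fun i => ((x i)%:C)%C.

Lemma nearCR m (P : ('I_m -> C) -> Prop) : nearC P -> nearR (fun x => P (toC x)).
Proof. by move=> [e e0 h]; exists e => // x xe; apply: h => i; rewrite cabs_real. Qed.

End NearC.

Section Identity.
Context {R : realType} {m : nat}.
Local Notation C := R[i].

Definition hpart n (a : fps C m) : fps C m := fun u => if mi_deg u == n then a u else 0.

(* base-(n+1) digits: distinct multi-indices of degree at most n get distinct codes *)
Definition code n (u : multiindex m) : nat := (\sum_(i < m) u i * n.+1 ^ i)%N.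

Lemma modnDl_mull d a b : (a + b * d = a %[mod d])%N.
Proof. by rewrite addnC modnMDl. Qed.

Lemma code_inj n (u v : multiindex m) : (mi_deg u <= n)%N -> (mi_deg v <= n)%N ->
  code n u = code n v -> u = v.
Proof.
move=> un vn; have {un}hu i : (u i <= n)%N by apply: leq_trans un; exact: mi_le_deg.
have {vn}hv i : (v i <= n)%N by apply: leq_trans vn; exact: mi_le_deg.
rewrite /code => e; apply/ffunP => i.
suff : forall k, (k <= m)%N -> forall f g : nat -> nat, (forall i, f i <= n)%N -> (forall i, g i <= n)%N ->
   (\sum_(i < k) f i * n.+1 ^ i)%N = (\sum_(i < k) g i * n.+1 ^ i)%N -> forall i, (i < k)%N -> f i = g i.
  pose ex (w : multiindex m) j := if insub j is Some j' then w j' else 0%N.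
  have exE w (j : 'I_m) : ex w j = w j by rewrite /ex valK.
  have ex_le (w : multiindex m) : (forall i, w i <= n)%N -> forall j, (ex w j <= n)%N.
    by move=> h j; rewrite /ex; case: insubP.
  move=> /(_ m (leqnn _) (ex u) (ex v) (ex_le _ hu) (ex_le _ hv)).
  under eq_bigr do rewrite exE; under [X in _ = X -> _]eq_bigr do rewrite exE.
  by move=> /(_ e i (ltn_ord i)); rewrite !exE.
elim=> [//|k IH] km f g hf hg; rewrite !big_ord_recl !muln1 => h.
have {}h : (f 0 + (\sum_(i < k) f i.+1 * n.+1 ^ i) * n.+1 = g 0 + (\sum_(i < k) g i.+1 * n.+1 ^ i) * n.+1)%N.
  rewrite !big_distrl /= in h *; move: h.
  by under eq_bigr do rewrite /bump /= add1n expnSr mulnA;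
     under [X in _ = (_ + X)%N -> _]eq_bigr do rewrite /bump /= add1n expnSr mulnA.
have f0 : f 0%N = g 0%N.
  by have := congr1 (modn^~ n.+1) h; rewrite /= !modnDl_mull !modn_small ?ltnS.
move: h; rewrite f0 => /eqP; rewrite eqn_add2l eqn_pmul2r // => /eqP h.
by case=> [_ //|j] jk; exact: (IH (ltnW km) (fun i => f i.+1) (fun i => g i.+1)).
Qed.

Lemma hom_vanish n (a : fps C m) : (forall t : R, 0 < t < 1 ->
  \sum_(u <- mis m n | mi_deg u == n) a u * mi_pow (fun i : 'I_m => ((t ^+ (n.+1 ^ i))%:C)%C) u = 0) ->
  forall u, mi_deg u = n -> a u = 0.
Proof.
move=> h u un.
pose q : {poly C} := \sum_(v <- mis m n | mi_deg v == n) a v *: 'X^(code n v).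
have q0 : q = 0.
  pose s N : seq C := [seq ((j.+2%:R^-1)%:C)%C | j <- iota 0 N].
  apply: (@roots_geq_poly_eq0 _ _ (s (size q))).
  - apply/allP => _ /mapP[j _ ->]; rewrite /root horner_sum; apply/eqP.
    have j01 : 0 < (j.+2%:R^-1 : R) < 1 by rewrite invr_gt0 ltr0n invf_lt1 ?ltr1n ?ltr0n.
    rewrite -[RHS](h _ j01); apply: eq_bigr => v _; rewrite hornerZ hornerXn; congr (_ * _).
    rewrite /mi_pow /code -prodrXr; apply: eq_bigr => i _.
    by rewrite rmorphXn -exprM mulnC.
  - rewrite map_inj_uniq ?iota_uniq // => i j /real_complex_inj /invr_inj /eqP.
    by rewrite eqr_nat => /eqP[].
  - by rewrite size_map size_iota.
have := congr1 (fun q : {poly C} => q`_(code n u)) q0; rewrite coef0 coef_sum.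
rewrite (bigID (fun v => v == u)) /= [X in _ + X]big1_seq ?addr0 => [|v]; last first.
  case/andP => /andP[/eqP vn vu]; rewrite mem_mis => vm; rewrite coefZ coefXn.
  case: eqP => [e|]; last by rewrite mulr0.
  by rewrite (code_inj _ _ e) ?un ?eqxx // in vu.
rewrite (eq_bigl (fun v => v == u)) => [|v]; last by rewrite andb_idl // => /eqP ->; rewrite un.
by rewrite sum_mis_eq ?un // coefZ coefXn eqxx mulr1.
Qed.

Lemma mi_pow_scale (s : C) (x : 'I_m -> C) u : mi_pow (fun i => s * x i) u = s ^+ mi_deg u * mi_pow x u.
Proof.
rewrite /mi_pow /mi_deg -prodrXr -big_split; apply: eq_bigr => i _; exact: exprMn.
Qed.

Lemma real_identity (a : fps C m) : cvgt a -> nearR (fun x => ev (toC x) a = 0) -> a = 0.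
Proof.
move=> [r [M [r0 aM]]] [e e0 he]; apply/funext => u.
have [n] := ubnP (mi_deg u); elim: n u => // n IH u; rewrite ltnS leq_eqVlt => /predU1P[|]; last exact: IH.
apply: hom_vanish => t /andP[t0 t1]; pose x (i : 'I_m) : R := t ^+ (n.+1 ^ i).
rewrite -/(toC x); set P := \sum_(v <- _ | _) _.
have M0 : 0 <= M by apply: le_trans (nrm_ge0 0%N a (ltW r0)) (aM 0%N).
have x01 i : 0 <= x i <= 1 by rewrite exprn_ge0 ?exprn_ile1 // ltW.
have ao : fps_ord n a by move=> v; exact: IH.
have [q [q0 qe qr]] : exists q : R, [/\ 0 < q, q < e & 2 * q <= r].
  exists (Num.min e r / 2); have h : Num.min e r <= e by rewrite ge_min lexx.
  have h' : Num.min e r <= r by rewrite ge_min lexx orbT.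
  have h0 : 0 < Num.min e r by rewrite lt_min e0.
  by split; lra.
pose T : R := M / q ^+ n.
have main k : cabs P <= 2 * T * 2^-1 ^+ k.
  pose s : R := 2^-1 ^+ k; have s0 : 0 < s by exact: exprn_gt0.
  have s1 : s <= 1 by rewrite exprn_ile1 // invf_le1 // ler1n.
  pose y := toC (fun i => s * (q * x i)).
  have xq i : 0 <= s * (q * x i) <= s * q.
    have /andP[x0 x1] := x01 i; rewrite !mulr_ge0 ?(ltW s0) ?(ltW q0) //=.
    by rewrite ler_pM2l // ler_piMr // ltW.
  have sq : s * q <= q by rewrite ler_piMl // ltW.
  have ey : ev y a = 0.
    apply: he => j; have /andP[? ?] := xq j; rewrite ger0_norm //; lra.
  have sr0 : 0 <= s * r by rewrite mulr_ge0 ?ltW.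
  have yr : pdisc (s * r) y.
    move=> i; have /andP[? ?] := xq i; rewrite /y /toC cabs_real ger0_norm //.
    by have := ler_wpM2l (ltW s0) qr; lra.
  have bM N : nrm N (s * r) (a - hpart n a) <= s ^+ n.+1 * M.
    apply: (@nrm_small _ _ r M s n.+1 (a - hpart n a)) => // [N'||].
    - apply: le_trans (aM N'); apply: ler_sum => v _; rewrite fps_subE /hpart; case: ifP => _.
        by rewrite subrr cabs0 mul0r mulr_ge0 ?cabs_ge0 ?exprn_ge0 // ltW.
      by rewrite subr0.
    - move=> v; rewrite ltnS leq_eqVlt fps_subE /hpart; case: eqP => [_ _|_ /= vn]; first by rewrite subrr.
      by rewrite ao ?subr0.
    - by rewrite (ltW s0).
  have bh : bd (s * r) (hpart n a).
    exists M => N; apply: le_trans (aM N); apply: ler_sum => v _; rewrite /hpart.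
    case: ifP => _; last by rewrite cabs0 mul0r mulr_ge0 ?cabs_ge0 ?exprn_ge0 // ltW.
    rewrite ler_wpM2l ?cabs_ge0 // lerXn2r ?nnegrE //; first exact: ltW.
    by rewrite ler_piMl // ltW.
  have e1 : ev y a = ev y (a - hpart n a) + ev y (hpart n a).
    by rewrite -(evD sr0 yr) ?subrK //; exists (s ^+ n.+1 * M).
  have e2 : ev y (hpart n a) = ((s ^+ n * q ^+ n)%:C)%C * P.
    apply: (@evE _ _ _ _ _ (cabs (((s ^+ n * q ^+ n)%:C)%C * P) * 2 ^+ n)) => N.
    have [nN|Nn] := leqP n N.
      have -> : evN N y (hpart n a) = ((s ^+ n * q ^+ n)%:C)%C * P.
        rewrite /evN (@sum_mis_widen _ _ n N (fun v => hpart n a v * mi_pow y v)) //; last first.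
          by move=> v vn; rewrite /hpart gtn_eqF ?mul0r.
        rewrite /P mulr_sumr [RHS]big_mkcond; apply: eq_bigr => v _; rewrite /hpart.
        case: eqP => [vn|_]; last by rewrite mul0r.
        have -> : y = (fun i => ((s * q)%:C)%C * toC x i).
          by apply/funext => i; rewrite /y /toC -rmorphM mulrA.
        rewrite mi_pow_scale vn -exprMn rmorphXn; ring.
      by rewrite subrr cabs0 !mulr_ge0 ?cabs_ge0 ?exprn_ge0.
    have -> : evN N y (hpart n a) = 0.
      rewrite /evN big1_seq // => v /=; rewrite mem_mis /hpart => vN.
      by rewrite ltn_eqF ?mul0r //; exact: leq_ltn_trans Nn.
    rewrite subr0 -mulrA ler_peMr ?cabs_ge0 // exprVn -[n in 2 ^+ n](subnK (ltnW Nn)) exprD mulfK ?expf_neq0 //.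
    by rewrite exprn_ege1 // ler1n.
  have h := ev_le sr0 yr bM.
  have : cabs (((s ^+ n * q ^+ n)%:C)%C * P) <= s ^+ n.+1 * M.
    by rewrite -e2; have := e1; rewrite ey => /esym/eqP; rewrite addrC addr_eq0 => /eqP ->; rewrite cabsN.
  have sq0 : 0 <= s ^+ n * q ^+ n by apply: mulr_ge0; apply: exprn_ge0; exact: ltW.
  rewrite cabsM cabs_real (ger0_norm sq0).
  rewrite exprSr -!mulrA ler_pM2l ?exprn_gt0 // -ler_pdivlMl ?exprn_gt0 // => h2.
  apply: le_trans h2 _; rewrite /T -/s [leLHS](_ : _ = M / q ^+ n * s); last by ring.
  have z0 : 0 <= M / q ^+ n * s.
    by apply: mulr_ge0; [apply: divr_ge0 => //; apply: exprn_ge0|]; exact: ltW.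
  lra.
by apply/eqP; rewrite -cabs_eq0 eq_le cabs_ge0 andbT; exact: geo_small main.
Qed.

End Identity.

(** * From a formal to an analytic equivalence *)

Section Csplit.
Context {K : comNzRingType}.

Lemma mcomp_csplit m k p q (f : 'I_p -> fps K k) (g : 'I_q -> fps K k) (h : 'I_k -> fps K m) :
  mcomp (csplit f g) h = csplit (mcomp f h) (mcomp g h).
Proof. by apply/funext; apply: all_split => j; rewrite /mcomp !csplitE. Qed.

Lemma csplit_nc m p q (f : 'I_p -> fps K m) (g : 'I_q -> fps K m) : nc f -> nc g -> nc (csplit f g).
Proof. by move=> f0 g0; apply: all_split => j; rewrite csplitE. Qed.

Lemma csplit_eta m p q (f : 'I_(p + q) -> fps K m) :
  csplit (fun j => f (lshift q j)) (fun j => f (rshift p j)) = f.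
Proof. by apply/funext; apply: all_split => j; rewrite csplitE. Qed.

End Csplit.

Section RealCoordinates.
Context {R : realType}.
Local Notation C := R[i].

Lemma csplit_cvgt m p q (f : 'I_p -> fps C m) (g : 'I_q -> fps C m) : (forall i, cvgt (f i)) ->
  (forall i, cvgt (g i)) -> forall i, cvgt (csplit f g i).
Proof. by move=> cf cg; apply: all_split => j; rewrite csplitE. Qed.

Lemma mconj_csplit m p q (f : 'I_p -> fps C m) (g : 'I_q -> fps C m) :
  mconj (csplit f g) = csplit (mconj f) (mconj g).
Proof. by apply/funext; apply: all_split => j; rewrite /mconj !csplitE. Qed.

Context {n : nat}.
Local Notation X := (@fps_var C (n + n)).
Local Notation Ci := (Complex 0 1 : C).

Definition cx : 'I_(n + n) -> fps C (n + n) :=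
  csplit (fun l => X (lshift n l) + fps_C Ci * X (rshift n l))
         (fun l => X (lshift n l) - fps_C Ci * X (rshift n l)).
Definition rx : 'I_(n + n) -> fps C (n + n) :=
  csplit (fun l => fps_C 2^-1 * (X (lshift n l) + X (rshift n l)))
         (fun l => fps_C (2 * Ci)^-1 * (X (lshift n l) - X (rshift n l))).

Lemma cx_comp m (g : 'I_(n + n) -> fps C m) : nc g -> mcomp cx g =
  csplit (fun l => g (lshift n l) + fps_C Ci * g (rshift n l))
         (fun l => g (lshift n l) - fps_C Ci * g (rshift n l)).
Proof.
move=> g0; apply/funext; apply: all_split => l; rewrite /mcomp /cx !csplitE.
  by rewrite fps_compD fps_comp_CM !fps_comp_var.
by rewrite fps_compB fps_comp_CM !fps_comp_var.
Qed.

Lemma rx_comp m (g : 'I_(n + n) -> fps C m) : nc g -> mcomp rx g =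
  csplit (fun l => fps_C 2^-1 * (g (lshift n l) + g (rshift n l)))
         (fun l => fps_C (2 * Ci)^-1 * (g (lshift n l) - g (rshift n l))).
Proof.
move=> g0; apply/funext; apply: all_split => l; rewrite /mcomp /rx !csplitE.
  by rewrite fps_comp_CM fps_compD !fps_comp_var.
by rewrite fps_comp_CM fps_compB !fps_comp_var.
Qed.

Lemma cx_nc : nc cx.
Proof.
apply: all_split => l; rewrite /cx csplitE.
  by rewrite fps_addE fps_CM /fps_var !mi_unit_neq0 mulr0 addr0.
by rewrite fps_subE fps_CM /fps_var !mi_unit_neq0 mulr0 subr0.
Qed.

Lemma rx_nc : nc rx.
Proof.
apply: all_split => l; rewrite /rx csplitE fps_CM.
  by rewrite fps_addE /fps_var !mi_unit_neq0 addr0 mulr0.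
by rewrite fps_subE /fps_var !mi_unit_neq0 subr0 mulr0.
Qed.

Lemma cvgt_cx i : cvgt (cx i).
Proof.
elim/all_split: i => l; rewrite /cx csplitE; [apply: cvgtD|apply: cvgtB];
  rewrite ?cvgtM //; try exact: cvgt_var; apply: cvgtM; [exact: cvgt_C|exact: cvgt_var|exact: cvgt_C|exact: cvgt_var].
Qed.

Lemma cvgt_rx i : cvgt (rx i).
Proof.
elim/all_split: i => l; rewrite /rx csplitE; apply: cvgtM; try exact: cvgt_C.
  by apply: cvgtD; exact: cvgt_var.
by apply: cvgtB; exact: cvgt_var.
Qed.

Lemma Ci_neq0 : Ci != 0.
Proof. by apply/eqP => -[/eqP]; rewrite oner_eq0. Qed.

Lemma Ci_conj : conjc Ci = - Ci.
Proof. by apply/eqP; rewrite eq_complex /= oppr0 !eqxx. Qed.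

Lemma two_neq0 : (2 : C) != 0.
Proof. by rewrite pnatr_eq0. Qed.

Lemma cxK : mcomp cx rx = @mid C (n + n).
Proof.
rewrite (cx_comp rx_nc) -[RHS]csplit_eta; congr csplit; apply/funext => l.
  rewrite /rx !csplitE mulrA -rmorphM invfM mulrCA divff ?Ci_neq0 // mulr1.
  by rewrite -mulrDr addrACA subrr addr0 mulrDr fps_half.
rewrite /rx !csplitE mulrA -rmorphM invfM mulrCA divff ?Ci_neq0 // mulr1.
rewrite -mulrBr opprB addrC addrA addrNK mulrDr fps_half //.
Qed.

Lemma rxK : mcomp rx cx = @mid C (n + n).
Proof.
rewrite (rx_comp cx_nc) -[RHS]csplit_eta; congr csplit; apply/funext => l.
  by rewrite /cx !csplitE addrACA subrr addr0 mulrDr fps_half.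
rewrite /cx !csplitE opprB addrC addrA addrNK mulrDr !mulrA -!rmorphM.
by rewrite invfM -mulrA mulVf ?Ci_neq0 // mulr1 fps_half.
Qed.

(* F as a map of C^n and its conjugate, on the complexification C^n x C^n *)
Definition dbl (F : 'I_n -> fps C n) : 'I_(n + n) -> fps C (n + n) :=
  csplit (fun l => fps_comp (F l) (fun i => X (lshift n i)))
         (fun l => fps_comp (fconj (F l)) (fun i => X (rshift n i))).

Lemma dbl_nc F : nc F -> nc (dbl F).
Proof.
move=> F0; apply: csplit_nc => l; apply: fps_comp_nc; rewrite ?F0 ?/fconj ?F0 ?rmorph0 //;
  by move=> i; exact: mid_nc.
Qed.

Lemma dbl_comp F m (A B : 'I_n -> fps C m) : nc A -> nc B ->
  mcomp (dbl F) (csplit A B) = csplit (mcomp F A) (mcomp (mconj F) B).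
Proof.
move=> A0 B0; have AB0 := csplit_nc A0 B0; rewrite mcomp_csplit; congr csplit; apply/funext => l.
  rewrite /mcomp fps_compA // => [|i]; last exact: mid_nc.
  by congr fps_comp; apply/funext => i; rewrite /mcomp fps_comp_var // csplitE.
rewrite /mcomp fps_compA // => [|i]; last exact: mid_nc.
by congr fps_comp; apply/funext => i; rewrite /mcomp fps_comp_var // csplitE.
Qed.

Lemma fconjD m (a b : fps C m) : fconj (a + b) = fconj a + fconj b.
Proof. exact: rmorphD. Qed.
Lemma fconjB m (a b : fps C m) : fconj (a - b) = fconj a - fconj b.
Proof. exact: rmorphB. Qed.
Lemma fconjM m (a b : fps C m) : fconj (a * b) = fconj a * fconj b.
Proof. exact: rmorphM. Qed.

Lemma conj_rx m (A B : 'I_n -> fps C m) : nc A -> nc B ->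
  mconj (mcomp rx (csplit A B)) = mcomp rx (csplit (mconj B) (mconj A)).
Proof.
move=> A0 B0; have AB0 := csplit_nc A0 B0.
rewrite !rx_comp ?mconj_csplit //; last by apply: csplit_nc; exact: mconj_nc.
congr csplit; apply/funext => l; rewrite /mconj !csplitE fconjM fconj_C conjc_inv.
  by rewrite fconjD [X in _ * X]addrC rmorph_nat.
have -> : conjc (2 * Ci) = - (2 * Ci).
  by apply/eqP; rewrite eq_complex /=; apply/andP; split; apply/eqP; ring.
by rewrite fconjB invrN rmorphN mulNr -mulrN opprB.
Qed.

Lemma fconj_cfps m (a : fps R m) : fconj (cfps a) = cfps a.
Proof. by apply/funext => u; exact: conjc_real. Qed.

Lemma cfps_is_additive m : additive (@cfps R m).
Proof. by move=> a b; apply/funext => u; rewrite /cfps !fps_subE rmorphB. Qed.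
Lemma cfps_is_monoid_morphism m : monoid_morphism (@cfps R m).
Proof.
split; first by apply/funext => u; rewrite /cfps !fps_oneE rmorph_nat.
move=> a b; apply/funext => u; rewrite /cfps !(fps_mulrEs _ _ (leqnn _)) rmorph_sum.
apply: eq_bigr => v _; rewrite rmorph_sum; apply: eq_bigr => t _.
by rewrite rmorphMn rmorphM.
Qed.
HB.instance Definition _ m := GRing.isZmodMorphism.Build (fps R m) (fps C m) (@cfps R m)
  (@cfps_is_additive m).
HB.instance Definition _ m := GRing.isMonoidMorphism.Build (fps R m) (fps C m) (@cfps R m)
  (@cfps_is_monoid_morphism m).

Lemma cfps_comp m k (f : fps R k) (g : 'I_k -> fps R m) : nc g ->
  cfps (fps_comp f g) = fps_comp (cfps f) (fun i => cfps (g i)).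
Proof.
move=> g0; have cg0 : nc (fun i => cfps (g i)) by move=> i; rewrite /cfps g0.
apply/funext => w; rewrite (fps_compE _ cg0 (leqnn _)).
rewrite /cfps (fps_compE _ g0 (leqnn _)) rmorph_sum; apply: eq_bigr => u _.
rewrite rmorphM; congr (_ * _); rewrite -[LHS]/(cfps (fps_monomial g u) w) !fps_monomialE rmorph_prod.
by congr (_ w); apply: eq_bigr => i _; rewrite rmorphXn.
Qed.

Definition creal (F : 'I_n -> fps C n) (j : 'I_(n + n)) : fps C (n + n) := cfps (realification F j).

Lemma fps_ReIm m (a : fps C m) :
  cfps (fun u => complex.Re (a u)) + fps_C Ci * cfps (fun u => complex.Im (a u)) = a.
Proof.
apply/funext => u; rewrite fps_addE fps_CM /cfps; case: (a u) => x y.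
by apply/eqP; rewrite eq_complex /=; apply/andP; split; apply/eqP; ring.
Qed.

Lemma fps_ReIm_conj m (a : fps C m) :
  cfps (fun u => complex.Re (a u)) - fps_C Ci * cfps (fun u => complex.Im (a u)) = fconj a.
Proof.
rewrite -[in RHS](fps_ReIm a) fconjD fconjM fconj_C !fconj_cfps Ci_conj rmorphN.
by rewrite mulNr.
Qed.

Let Z (l : 'I_n) := cx (lshift n l).

Lemma crealS F : creal F = csplit (fun l => cfps (fun u => complex.Re (fps_comp (F l) Z u)))
  (fun l => cfps (fun u => complex.Im (fps_comp (F l) Z u))).
Proof.
have ZE : (fun l u => fps_var (lshift n l) u + Ci * fps_var (rshift n l) u) = Z.
  by apply/funext => l; apply/funext => u; rewrite /Z /cx csplitE fps_addE fps_CM.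
by apply/funext => j; rewrite /creal /realification /csplit ZE; case: (fintype.split j).
Qed.

Lemma creal_nc F : nc F -> nc (creal F).
Proof.
move=> F0; have Z0 : nc Z by move=> l; exact: cx_nc.
by rewrite crealS; apply: csplit_nc => l; rewrite /cfps (fps_comp_nc (F0 l) Z0).
Qed.

Lemma cx_csplit : cx = csplit Z (mconj Z).
Proof.
apply/funext; apply: all_split => l; rewrite csplitE // /mconj /Z /cx !csplitE.
by rewrite fconjD fconjM fconj_C !fconj_var Ci_conj rmorphN mulNr.
Qed.

Lemma crealE F : nc F -> mcomp cx (creal F) = mcomp (dbl F) cx.
Proof.
move=> F0; have Z0 : nc Z by move=> l; exact: cx_nc.
rewrite (cx_comp (creal_nc F0)) cx_csplit dbl_comp //; last exact: mconj_nc.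
congr csplit; apply/funext => l; rewrite crealS !csplitE; first exact: fps_ReIm.
by rewrite fps_ReIm_conj fconj_comp.
Qed.

Lemma mcompKl m k (A B : 'I_k -> fps C k) (U V : 'I_k -> fps C m) : nc A -> nc B -> nc U ->
  mcomp B A = @mid C k -> mcomp A U = V -> U = mcomp B V.
Proof. by move=> A0 B0 U0 BA <-; rewrite -(mcompA B A0 U0) BA mcomp1l. Qed.

Lemma creal_rx F : nc F -> creal F = mcomp rx (mcomp (dbl F) cx).
Proof.
move=> F0; apply: (mcompKl cx_nc rx_nc (creal_nc F0) rxK); exact: crealE.
Qed.

End RealCoordinates.

Section FormalParametrisation.
Context {R : realType} {n q d : nat}.
Local Notation C := R[i].
Variables (k : 'I_q -> C) (Rs : 'S_q).
Variables (phi psi : 'I_(n + n) -> fps C (n + n)) (F G : 'I_n -> fps C n).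
Hypotheses (phi0 : nc phi) (psi0 : nc psi) (F0 : nc F) (G0 : nc G).
Hypotheses (phipsi : mcomp phi psi = @mid C (n + n)) (psiphi : mcomp psi phi = @mid C (n + n)).
Hypotheses (phiR : mconj phi = phi) (psiR : mconj psi = psi).
Hypotheses (FG : mcomp F G = @mid C n) (GF : mcomp G F = @mid C n).
Hypothesis dm : (d <= n + n)%N.
Variables (PI PIc : 'I_n -> fps C q) (ell : 'I_q -> fps C (n + n)).
Hypotheses (PI0 : nc PI) (PIc0 : nc PIc) (ell0 : nc ell).
Let PQ := csplit PI PIc.
Hypothesis ellPQ : mcomp ell PQ = @mid C q.
Hypothesis PIR : mcomp PI (plin k Rs) = mconj PIc.
Hypothesis PIcR : mcomp PIc (plin k Rs) = mconj PI.

Definition cincl : 'I_(n + n) -> fps C d := fun j => if insub (j : nat) is Some t then fps_var t else 0.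
Definition proj : 'I_d -> fps C (n + n) := fun t => fps_var (widen_ord dm t).
Let W := mcomp (fun l => cx (lshift n l)) (mcomp psi cincl).

Lemma incl_nc : nc cincl.
Proof. by move=> j; rewrite /cincl; case: insub => [t|] //; exact: mid_nc. Qed.

Hypothesis phiQ : forall i : 'I_(n + n), (d <= i)%N ->
  fps_comp (phi i) (mcomp rx (mcomp (dbl G) PQ)) = 0.
Let al := mcomp ell (csplit (mcomp F W) (mcomp (mconj F) (mconj W))).
Hypothesis PQal : mcomp PQ al = csplit (mcomp F W) (mcomp (mconj F) (mconj W)).

Definition param : 'I_d -> fps C q :=
  mcomp proj (mcomp phi (mcomp rx (mcomp (dbl G) PQ))).

Let PQ0 : nc PQ. Proof. exact: csplit_nc. Qed.
Let GPQ0 : nc (mcomp (dbl G) PQ). Proof. by apply: mcomp_nc => //; exact: dbl_nc. Qed.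
Let rGPQ0 : nc (mcomp rx (mcomp (dbl G) PQ)). Proof. by apply: mcomp_nc => //; exact: rx_nc. Qed.
Let in0 := incl_nc.
Let psin0 : nc (mcomp psi cincl). Proof. exact: mcomp_nc. Qed.
Let Z0 : nc (fun l : 'I_n => @cx R n (lshift n l)). Proof. by move=> l; exact: cx_nc. Qed.
Let W0 : nc W. Proof. exact: mcomp_nc. Qed.
Let FW0 : nc (csplit (mcomp F W) (mcomp (mconj F) (mconj W))).
Proof. by apply: csplit_nc; apply: mcomp_nc => //; exact: mconj_nc. Qed.
Let al0 : nc al. Proof. exact: mcomp_nc. Qed.
Let proj0 : nc proj. Proof. by move=> t; exact: mid_nc. Qed.

Lemma param_nc : nc param.
Proof. by apply: mcomp_nc => //; exact: mcomp_nc. Qed.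

Lemma incl_proj m (g : 'I_(n + n) -> fps C m) : nc g -> (forall i : 'I_(n + n), (d <= i)%N -> g i = 0) ->
  mcomp cincl (mcomp proj g) = g.
Proof.
move=> g0 gd; apply/funext => j; rewrite /mcomp /cincl; case: insubP => [t td tj|].
  rewrite fps_comp_var; last exact: mcomp_nc.
  by rewrite /proj fps_comp_var //; congr (g _); apply: val_inj.
by rewrite -leqNgt => dj; rewrite fps_comp0 gd.
Qed.

Lemma proj_incl : mcomp proj cincl = @mid C d.
Proof.
apply/funext => t; rewrite /mcomp /proj fps_comp_var // /cincl.
by case: insubP => [t' _ e|]; [congr fps_var; exact: val_inj|rewrite /= ltn_ord].
Qed.

Lemma incl_param : mcomp cincl param = mcomp phi (mcomp rx (mcomp (dbl G) PQ)).
Proof. by apply: incl_proj; [exact: mcomp_nc|exact: phiQ]. Qed.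

Lemma psi_param : mcomp (mcomp psi cincl) param = mcomp rx (mcomp (dbl G) PQ).
Proof.
rewrite (mcompA psi in0 param_nc) incl_param -(mcompA psi phi0 rGPQ0) psiphi.
by rewrite mcomp1l.
Qed.

Lemma cxrx m (g : 'I_(n + n) -> fps C m) : nc g -> mcomp cx (mcomp rx g) = g.
Proof. by move=> g0; rewrite -(mcompA _ (@rx_nc R n) g0) cxK mcomp1l. Qed.

Lemma rxcx m (g : 'I_(n + n) -> fps C m) : nc g -> mcomp rx (mcomp cx g) = g.
Proof. by move=> g0; rewrite -(mcompA _ (@cx_nc R n) g0) rxK mcomp1l. Qed.

Lemma W_param : mcomp W param = mcomp G PI.
Proof.
have h := cxrx GPQ0; rewrite /W (mcompA _ psin0 param_nc) psi_param.
rewrite dbl_comp // in h *; apply/funext => l.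
by have := congr1 (fun f => f (lshift n l)) h; rewrite csplitE.
Qed.

Lemma mconj_incl : mconj cincl = cincl.
Proof.
apply/funext => j; rewrite /mconj /cincl; case: insub => [t|]; first exact: fconj_var.
by apply/funext => u; rewrite /fconj rmorph0.
Qed.

Lemma cx_psi : mcomp cx (mcomp psi cincl) = csplit W (mconj W).
Proof.
rewrite {1}cx_csplit mcomp_csplit; congr csplit; rewrite /W mconj_comp // mconj_comp //.
by rewrite psiR mconj_incl.
Qed.

Lemma mconj_param0 : mcomp (mcomp rx (mcomp (dbl G) PQ)) (plin k Rs) = mconj (mcomp rx (mcomp (dbl G) PQ)).
Proof.
have l0 := @plin_nc _ _ k Rs; have cPI0 := mconj_nc PI0; have cPIc0 := mconj_nc PIc0.
have cG0 := mconj_nc G0.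
have GPI0 : nc (mcomp G PI) by exact: mcomp_nc.
have cGP0 : nc (mcomp (mconj G) PIc) by exact: mcomp_nc.
rewrite (mcompA _ GPQ0 l0) (mcompA (dbl G) PQ0 l0) (mcomp_csplit PI PIc) PIR PIcR.
by rewrite !dbl_comp // conj_rx // !mconj_comp // mconjK.
Qed.

Lemma mconj_proj : mconj proj = proj.
Proof. by apply/funext => t; exact: fconj_var. Qed.

Lemma param_real : mcomp param (plin k Rs) = mconj param.
Proof.
have l0 := @plin_nc _ _ k Rs.
have phir0 : nc (mcomp phi (mcomp rx (mcomp (dbl G) PQ))) by exact: mcomp_nc.
rewrite /param (mcompA proj phir0 l0) (mcompA phi rGPQ0 l0) mconj_param0.
by rewrite (mconj_comp proj phir0) mconj_proj (mconj_comp phi rGPQ0) phiR.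
Qed.

Lemma al_param : mcomp al param = @mid C q.
Proof.
have p0 := param_nc; have cW0 := mconj_nc W0; have cF0 := mconj_nc F0; have cG0 := mconj_nc G0.
have h : mcomp (csplit W (mconj W)) param = csplit (mcomp G PI) (mcomp (mconj G) PIc).
  by rewrite -cx_psi (mcompA _ psin0 p0) psi_param cxrx // dbl_comp.
have hc : mcomp (mconj W) param = mcomp (mconj G) PIc.
  apply/funext => l; have := congr1 (fun f => f (rshift n l)) h.
  by rewrite mcomp_csplit !csplitE.
rewrite /al (mcompA ell FW0 p0) mcomp_csplit (mcompA F W0 p0) (mcompA _ cW0 p0) W_param hc.
rewrite -(mcompA F G0 PI0) -(mcompA _ cG0 PIc0) -mconj_comp // FG mconj_mid !mcomp1l //.
Qed.

Lemma param_al : mcomp param al = @mid C d.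
Proof.
have cW0 := mconj_nc W0; have cF0 := mconj_nc F0; have cG0 := mconj_nc G0; have r0 := @rx_nc R n.
have phir0 : nc (mcomp phi (mcomp rx (mcomp (dbl G) PQ))) by exact: mcomp_nc.
have FW10 : nc (mcomp F W) by exact: mcomp_nc.
have FW20 : nc (mcomp (mconj F) (mconj W)) by exact: mcomp_nc.
rewrite /param (mcompA proj phir0 al0) (mcompA phi rGPQ0 al0) (mcompA rx GPQ0 al0).
rewrite (mcompA (dbl G) PQ0 al0) PQal dbl_comp // -(mcompA G F0 W0) -(mcompA _ cF0 cW0).
rewrite -mconj_comp // GF mconj_mid !mcomp1l // -cx_psi rxcx // -(mcompA phi psi0 in0) phipsi.
by rewrite mcomp1l // proj_incl.
Qed.

Lemma param_dim : d = q.
Proof.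
have p0 := param_nc.
have h1 := congr1 (@jac _ _ _) al_param; have h2 := congr1 (@jac _ _ _) param_al.
rewrite jac_comp // jac_mid in h1; rewrite jac_comp // jac_mid in h2.
apply/eqP; rewrite eqn_leq; apply/andP; split.
  have := mulmx_max_rank (jac param) (jac al); rewrite h2 mxrank1 //.
by have := mulmx_max_rank (jac al) (jac param); rewrite h1 mxrank1.
Qed.

End FormalParametrisation.

Lemma lin_shift (K : comNzRingType) m (W S H q : 'I_m -> fps K m) (L D E : 'M[K]_m) :
  nc S -> nc q -> E *m D = 1%:M -> mcomp (mcomp W (lin L)) S = mcomp H q ->
  mcomp W (mcomp (lin L) S) = mcomp (mcomp H (lin E)) (mcomp (lin D) q).
Proof.
move=> S0 q0 ED e; have lL0 := lin_nc L; have lD0 := lin_nc D; have lE0 := lin_nc E.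
rewrite -(mcompA W lL0 S0) e (mcompA H lE0 (mcomp_nc lD0 q0)) -(mcompA _ lD0 q0).
by rewrite mcomp_lin ED lin1 (mcomp1l q0).
Qed.

Section LinComp.
Context {R : realType} {m : nat}.
Local Notation C := R[i].
Implicit Types (S F G : 'I_m -> fps C m) (A : 'M[C]_m).

Lemma cvgt_mcomp k l (F : 'I_l -> fps C k) (G : 'I_k -> fps C m) : (forall i, cvgt (F i)) ->
  (forall i, cvgt (G i)) -> nc G -> forall i, cvgt (mcomp F G i).
Proof. by move=> cF cG G0 i; exact: cvgt_comp. Qed.

Lemma jac_unit_comp F G : nc F -> nc G -> jac F \in unitmx -> jac G \in unitmx ->
  jac (mcomp F G) \in unitmx.
Proof. by move=> F0 G0 uF uG; rewrite (jac_comp F0 G0) unitmx_mul uF. Qed.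

Lemma jac_unit_lin A : A \in unitmx -> jac (lin A) \in unitmx.
Proof. by rewrite jac_lin. Qed.

Lemma jac_unit_tid F : tid F -> jac F \in unitmx.
Proof. by move=> tF; rewrite (jac_ext tF) jac_mid unitmx1. Qed.

Lemma lin_conj A : mconj (lin A) = lin (map_mx (@conjc R) A).
Proof.
apply/funext => c; apply/funext => u; rewrite /mconj /fconj /lin !fps_sumE rmorph_sum.
by apply: eq_bigr => j _; rewrite !fps_CM !mxE rmorphM /fps_var rmorph_nat.
Qed.

Lemma plin_lin (k : 'I_m -> C) s : plin k s = lin (jac (plin k s)).
Proof.
apply/funext => c; apply/funext => u; rewrite /lin fps_sumE.
under eq_bigr do rewrite fps_CM.
rewrite /plin fps_CM (bigD1 (s c)) //= mxE fps_CM /fps_var eqxx mulr1.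
rewrite big1 ?addr0 // => j jc; rewrite mxE fps_CM /fps_var.
by rewrite (inj_eq (@mi_unit_inj _)) (negbTE jc) mulr0 mul0r.
Qed.

Lemma jac_mconj F : jac (mconj F) = map_mx (@conjc R) (jac F).
Proof. by apply/matrixP => i j; rewrite !mxE. Qed.

Lemma lin_jac_real k s F : nc F -> mcomp F (plin k s) = mconj F ->
  mcomp (lin (jac F)) (plin k s) = mconj (lin (jac F)).
Proof.
move=> F0 FR; have k0 := @plin_nc _ C k s; have := congr1 (@jac _ _ _) FR.
by rewrite (jac_comp F0 k0) jac_mconj plin_lin mcomp_lin jac_lin => ->; rewrite lin_conj.
Qed.

Lemma real_normalise k s F A : nc F -> A *m jac F = 1%:M -> mcomp F (plin k s) = mconj F ->
  [/\ tid (mcomp (lin A) F), rmap k s (mcomp (lin A) F) & mcomp (lin (jac F)) (mcomp (lin A) F) = F].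
Proof.
move=> F0 AL FR; set L := jac F in AL *; have LA : L *m A = 1%:M by exact: mulmx1C AL.
have lA0 := lin_nc A; have lL0 := lin_nc L; have k0 := @plin_nc _ C k s.
have cA0 := mconj_nc lA0; have cL0 := mconj_nc lL0; have cF0 := mconj_nc F0.
have LR := lin_jac_real F0 FR; rewrite -/L in LR.
have AF0 : nc (mcomp (lin A) F) by exact: mcomp_nc.
split.
- by apply: (tid_jac AF0); rewrite (jac_comp lA0 F0) jac_lin.
- have PA : mcomp (plin k s) (mconj (lin A)) = lin A.
    have e := congr1 (fun f => mcomp (mcomp (lin A) f) (mconj (lin A))) LR.
    move: e; rewrite /= -(mcompA (lin A) lL0 k0) mcomp_lin AL lin1 (mcomp1l k0) => ->.
    by rewrite (mcompA (lin A) cL0 cA0) -(mconj_comp _ lA0) mcomp_lin LA lin1 mconj_mid mcomp1r.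
  by rewrite /rmap (mcompA _ F0 k0) FR (mconj_comp _ F0) -(mcompA _ cA0 cF0) PA.
- by rewrite -(mcompA _ lA0 F0) mcomp_lin LA lin1 mcomp1l.
Qed.

End LinComp.

Section AnalyticFromFormal.
Context {R : realType} {p : nat}.
Local Notation C := R[i].
Variables (lam : 'I_p -> C) (Rs : 'S_(p + p)).
Hypothesis lam0 : forall j, lam j != 0.
Hypothesis lam_sd : forall j, cabs (lam j) = 1 ->
  lam j ^+ 2 != 1 /\ (is_root_of_unity (lam j ^+ 2) \/ brjuno (lam j ^+ 2)).
Hypothesis Rs2 : (Rs * Rs = 1)%g.
Hypothesis RsG : forall g, g \in @swp_group p -> (Rs * g * Rs)%g \in @swp_group p.
Let k := klam lam.
Hypothesis kk : forall c, k c * conjc (k (Rs c)) = 1.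

Lemma analytic_from_formal (D : 'M[C]_(p + p)) (W Th G : 'I_(p + p) -> fps C (p + p)) :
  D \in unitmx -> nc W -> (forall i, cvgt (W i)) -> nc Th -> jac Th \in unitmx ->
  mcomp Th (plin k Rs) = mconj Th -> nc G -> jac G \in unitmx ->
  mcomp W Th = mcomp G (mcomp (lin D) (mcomp sqm xl)) ->
  exists S Si H Hi, [/\ [/\ nc S, nc Si, nc H & nc Hi],
   [/\ forall i, cvgt (S i), forall i, cvgt (Si i), forall i, cvgt (H i) & forall i, cvgt (Hi i)],
   [/\ mcomp S Si = @mid C (p + p), mcomp Si S = @mid C (p + p),
       mcomp H Hi = @mid C (p + p) & mcomp Hi H = @mid C (p + p)] &
   mcomp S (plin k Rs) = mconj S /\ mcomp W S = mcomp H (mcomp (lin D) (mcomp sqm xl))].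
Proof.
move=> Du W0 cW Th0 Lu ThR G0 Gu WTh; set L := jac Th in Lu.
have x0 := @xl_nc R p; have q0 := @sqm_nc C p; have k0 := @plin_nc _ C k Rs.
have lD0 := lin_nc D; have lL0 := lin_nc L; have lLi0 := lin_nc (invmx L).
have lDi0 := lin_nc (invmx D).
have qx0 : nc (mcomp sqm (@xl R p)) by exact: mcomp_nc.
have [tTh1 rTh1 LTh] := real_normalise Th0 (mulVmx Lu) ThR; rewrite -/L in tTh1 rTh1 LTh.
have LTh0 := tid_nc tTh1.
have WL0 : nc (mcomp W (lin L)) by exact: mcomp_nc.
have cWL := cvgt_mcomp cW (cvgt_lin L) lL0.
have GD0 : nc (mcomp G (lin D)) by exact: mcomp_nc.
have e1 : mcomp (mcomp W (lin L)) (mcomp (lin (invmx L)) Th) = mcomp (mcomp G (lin D)) (mcomp sqm (@xl R p)).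
  by rewrite (mcompA W lL0 LTh0) LTh WTh (mcompA G lD0 qx0).
have GDu := jac_unit_comp G0 lD0 Gu (jac_unit_lin Du).
have [w [s [sig [w01 hsd s01 sw [sig0 sigs]]]]] := sd_sequences lam0 lam_sd.
have [S [H [[tS rS cS] [H0 Hu cH] e2]]] :=
  core Rs2 RsG kk w01 hsd s01 sw sig0 sigs WL0 cWL tTh1 rTh1 GD0 GDu e1.
clear e1 LTh WTh rTh1 tTh1 LTh0 GDu hsd.
have S0 := tid_nc tS; have cS0 := mconj_nc S0.
have T0 : nc (mcomp (lin L) S) by exact: mcomp_nc.
have H10 : nc (mcomp H (lin (invmx D))) by exact: mcomp_nc.
have cT := cvgt_mcomp (cvgt_lin L) cS S0; have cH1 := cvgt_mcomp cH (cvgt_lin (invmx D)) lDi0.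
have uT := jac_unit_comp lL0 S0 (jac_unit_lin Lu) (jac_unit_tid tS).
have uDi : invmx D \in unitmx by rewrite unitmx_inv.
have uH1 := jac_unit_comp H0 lDi0 Hu (jac_unit_lin uDi).
have [Ti [Ti0 cTi TTi TiT]] := cvgt_inverse T0 uT cT.
have [Hi [Hi0 cHi HHi HiH]] := cvgt_inverse H10 uH1 cH1.
have TR : mcomp (mcomp (lin L) S) (plin k Rs) = mconj (mcomp (lin L) S).
  rewrite (mcompA _ S0 k0) rS (mconj_comp _ S0) -(mcompA _ k0 cS0).
  by rewrite (lin_jac_real Th0 ThR).
have WT : mcomp W (mcomp (lin L) S) = mcomp (mcomp H (lin (invmx D))) (mcomp (lin D) (mcomp sqm (@xl R p))).
  exact: lin_shift S0 qx0 (mulVmx Du) e2.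
exists (mcomp (lin L) S), Ti, (mcomp H (lin (invmx D))), Hi.
exact: (And4 (And4 T0 Ti0 H10 Hi0) (And4 cT cTi cH1 cHi) (And4 TTi TiT HHi HiH) (conj TR WT)).
Qed.

End AnalyticFromFormal.

Section Bridge.
Context {R : realType}.
Local Notation C := R[i].
Local Notation Ci := (Complex 0 1 : C).

Definition vR m (x : 'rV[R]_m) : 'I_m -> C := toC (fun i => x 0 i).

Lemma near0_nearR m (P : 'rV[R]_m -> Prop) : near0 P <-> nearR (fun t => P (\row_i t i)).
Proof.
rewrite near0P; split=> -[e e0 h]; exists e => // x xe.
  by apply: h => i; rewrite mxE.
have -> : x = \row_i x 0 i by apply/rowP => i; rewrite mxE.
exact: h.
Qed.

Lemma vR_row m (t : 'I_m -> R) : vR (\row_i t i) = toC t.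
Proof. by apply/funext => i; rewrite /vR /toC mxE. Qed.

Lemma ev_at0 m (a : fps C m) : cvgt a -> ev (fun=> 0) a = a 0.
Proof.
move=> [r [M [r0 aM]]]; apply: (@evE _ _ _ _ _ 0) => N; rewrite mul0r.
rewrite /evN (bigID (fun u => u == 0)) /= sum_mis_eq ?mi_deg0 //.
rewrite big1 => [|u u0]; last first.
  have [i ui] : exists i, u i != 0%N.
    by apply/existsP; apply: contraNT u0 => /existsPn h; apply/eqP/ffunP => i; rewrite ffunE; apply/eqP; have := h i; rewrite negbK.
  by rewrite /mi_pow (bigD1 i) //= expr0n (negbTE ui) mul0r mulr0.
rewrite addr0 /mi_pow big1 ?mulr1 ?subrr ?cabs0 // => i _; rewrite ffunE expr0 //.
Qed.

Lemma analytic_series m k (P : 'rV[R]_m -> 'rV[R]_k) : analytic_at0 P -> P 0 = 0 ->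
  exists a : 'I_k -> fps R m, [/\ forall j, expands_at0 (fun x => P x 0 j) (a j),
    nc (fun j => cfps (a j)), forall j, cvgt (cfps (a j)) &
    nearR (fun t => forall j, ev (toC t) (cfps (a j)) = ((P (\row_i t i) 0 j)%:C)%C)].
Proof.
move=> /fin_all_exists[a ha] P0; exists a.
have ca j := (expands_real (ha j)).1.
have na : nearR (fun t => forall j, ev (toC t) (cfps (a j)) = ((P (\row_i t i) 0 j)%:C)%C).
  have h j : nearR (fun t => ev (toC t) (cfps (a j)) = ((P (\row_i t i) 0 j)%:C)%C).
    have /near0_nearR := (expands_real (ha j)).2; apply: nearRW => t /=.
    have -> : toC t = (fun i => ((\row_i t i) 0 i)%:C)%C by apply/funext => i; rewrite mxE.
    exact.
  have [e e0 he] := fin_all_exists2 h.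
  exists (\big[Num.min/1]_i e i) => [|x xe i].
    by elim/big_rec: _ => // i y _ y0; rewrite lt_min e0.
  apply: he => j; apply: lt_le_trans (xe j) _; exact: bigmin_le.
split=> // j; have [e e0 he] := na; have := he (fun=> 0) _ j.
rewrite (_ : \row_i 0 = 0) ?P0 ?mxE => [|]; last by apply/rowP => i; rewrite !mxE.
rewrite [toC _](_ : _ = (fun=> 0)) ?ev_at0 //; by apply=> i; rewrite normr0.
Qed.

Lemma series_comp_id m (P Q : 'rV[R]_m -> 'rV[R]_m) (a b : 'I_m -> fps C m) :
  nc a -> nc b -> (forall j, cvgt (a j)) -> (forall j, cvgt (b j)) ->
  nearR (fun t => forall j, ev (toC t) (a j) = ((P (\row_i t i) 0 j)%:C)%C) ->
  nearR (fun t => forall j, ev (toC t) (b j) = ((Q (\row_i t i) 0 j)%:C)%C) ->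
  near0 (fun x => P (Q x) = x) -> mcomp a b = @mid C m.
Proof.
move=> a0 b0 ca cb ha hb /near0_nearR PQ; apply/funext => j; apply/eqP; rewrite -subr_eq0; apply/eqP.
have cab : cvgt (mcomp a b j) by exact: cvgt_comp.
have cabm : cvgt (mcomp a b j - mid j) by apply: cvgtB => //; exact: cvgt_mid.
apply: real_identity => //.
have hab := near_ev_comp (ca j) cb b0.
have hsm : nearR (fun t => ev (toC (fun i => Q (\row_i t i) 0 i)) (a j) = ((P (Q (\row_i t i)) 0 j)%:C)%C).
  case: ha => e e0 he; have := nearCR (near_ev_small cb b0 e0) => hs.
  apply: nearRW (nearR_and hs hb) => t [h1 h2].
  have := he (fun i => Q (\row_i t i) 0 i) _ j.
  rewrite [\row_i Q _ 0 i](_ : _ = Q (\row_i t i)); last by apply/rowP => i; rewrite mxE.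
  by apply=> i; have := h1 i; rewrite h2 cabs_real.
have hB : nearC (fun x => ev x (mcomp a b j - mid j) = ev x (mcomp a b j) - x j).
  have [r r0 rb] := cvgt_bd cab; exists (2^-1 * r) => [|x xr]; first by rewrite mulr_gt0.
  rewrite (evB (ltW r0) (small_pdisc xr)) //; last by apply: bd_var; exact: ltW.
  by rewrite ev_mid.
apply: nearRW (nearR_and (nearR_and (nearCR hab) (nearCR hB)) (nearR_and (nearR_and hsm hb) PQ)).
move=> t [[h1 ->] [[h2 h3] h4]]; rewrite [ev _ _]h1.
rewrite [(fun i => ev (toC t) (b i))](_ : _ = toC (fun i => Q (\row_i t i) 0 i)); last first.
  by apply/funext => i; exact: h3.
by rewrite h2 h4 mxE subrr.
Qed.

Lemma analytic_ideal_comp m q (S : set 'rV[R]_m) a (g : 'I_m -> fps C q) :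
  analytic_ideal S a -> nc g -> (forall i, cvgt (g i)) ->
  nearR (fun t => exists2 x : 'rV[R]_m, S x & forall j, ev (toC t) (g j) = ((x 0 j)%:C)%C) ->
  fps_comp (cfps a) g = 0.
Proof.
move=> [f [/expands_real[ca hf] Sf]] g0 cg hS.
apply: real_identity; first exact: cvgt_comp.
pose P (y : 'I_m -> C) := forall x : 'rV[R]_m, y = vR x -> S x -> ev y (cfps a) = 0.
have nP : nearC P.
  move: hf Sf => /near0P[e e0 he] /near0P[e' e'0 he'].
  exists (Num.min e e') => [|y ye x yx Sx]; first by rewrite lt_min e0.
  have xe i : `|x 0 i| < Num.min e e' by have := ye i; rewrite yx cabs_real.
  rewrite yx he => [|i]; last by have := xe i; rewrite lt_min => /andP[].
  by rewrite he' // => i; have := xe i; rewrite lt_min => /andP[].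
have h1 := nearCR (near_ev_comp ca cg g0); have h2 := nearCR (near_pull cg g0 nP).
apply: nearRW (nearR_and (nearR_and h1 h2) hS) => t [[-> h] [x Sx hx]].
by apply: (h x) => //; apply/funext => j; exact: hx.
Qed.

Lemma formal_ideal_comp m q (S : set 'rV[R]_m) b (g : 'I_m -> fps C q) :
  formal_ideal S b -> nc g -> (forall i, cvgt (g i)) ->
  nearR (fun t => exists2 x : 'rV[R]_m, S x & forall j, ev (toC t) (g j) = ((x 0 j)%:C)%C) ->
  fps_comp (cfps b) g = 0.
Proof.
move=> [k [c [a [ha hb]]]] g0 cg hS.
have -> : b = \sum_(i < k) c i * a i by apply/funext => u; rewrite hb fps_sumE.
rewrite rmorph_sum fps_comp_sum big1 // => i _.
by rewrite rmorphM fps_compM // (analytic_ideal_comp (ha i) g0 cg hS) mulr0.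
Qed.

Lemma ev_cx n (z : 'I_(n + n) -> C) j : ev z (cx j) =
  csplit (fun l => z (lshift n l) + Ci * z (rshift n l)) (fun l => z (lshift n l) - Ci * z (rshift n l)) j.
Proof.
have [r r0 zr] := pdisc_ex z; have bv i := @bd_var R (n + n) r r0 i; have bc := @bd_C R (n + n) r Ci.
elim/all_split: j => l; rewrite /cx !csplitE.
  by rewrite (evD r0 zr) ?(evM r0 zr) ?ev_C ?(ev_var r0 zr) //; apply: bdM.
by rewrite (evB r0 zr) ?(evM r0 zr) ?ev_C ?(ev_var r0 zr) //; apply: bdM.
Qed.

Section Twisted.
Context {q : nat}.
Variables (k : 'I_q -> C) (Rs : 'S_q).
Hypothesis Rs2 : (Rs * Rs = 1)%g.
Hypothesis kk : forall c, k c * conjc (k (Rs c)) = 1.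

Lemma RsK c : Rs (Rs c) = c.
Proof. by rewrite -permM Rs2 perm1. Qed.

Definition rho_fixed (v : 'I_q -> C) := forall c, v c = k c * conjc (v (Rs c)).

(* u + rho(u), as a linear map in the real coordinates of u *)
Definition sym : 'I_q -> fps C (q + q) := fun c => cx (lshift q c) + fps_C (k c) * cx (rshift q (Rs c)).

Lemma sym_nc : nc sym.
Proof. by move=> c; rewrite /sym fps_addE fps_CM !cx_nc mulr0 addr0. Qed.

Lemma cvgt_sym c : cvgt (sym c).
Proof. by apply: cvgtD; [exact: cvgt_cx|apply: cvgtM; [exact: cvgt_C|exact: cvgt_cx]]. Qed.

Lemma ev_sym z c : ev z (sym c) = ev z (cx (lshift q c)) + k c * ev z (cx (rshift q (Rs c))).
Proof.
have [r r0 zr] := pdisc_ex z; have bv i := @bd_var R (q + q) r r0 i; have bc d := @bd_C R (q + q) r d.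
have bcx j : bd r (@cx R q j).
  by elim/all_split: j => l; rewrite /cx csplitE; apply: bdD => //; rewrite ?mulNr; try apply: bdN; apply: bdM.
by rewrite /sym (evD r0 zr) ?(evM r0 zr) ?ev_C //; apply: bdM.
Qed.

Lemma conj_Ci (x y : R) : conjc ((x%:C)%C + Ci * (y%:C)%C) = (x%:C)%C - Ci * (y%:C)%C.
Proof. by apply/eqP; rewrite eq_complex /=; apply/andP; split; apply/eqP; ring. Qed.

Lemma sym_fixed t : rho_fixed (fun c => ev (toC t) (sym c)).
Proof.
have e c : ev (toC t) (cx (rshift q c)) = conjc (ev (toC t) (cx (lshift q c))).
  by rewrite !ev_cx !csplitE /toC conj_Ci.
move=> c; rewrite !ev_sym !e RsK; set x := ev _ _; set y := ev _ (cx (lshift q (Rs c))).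
have -> : conjc (y + k (Rs c) * conjc x) = conjc y + conjc (k (Rs c)) * conjc (conjc x).
  by rewrite rmorphD rmorphM.
by rewrite conjcK mulrDr mulrA kk mul1r addrC.
Qed.

Lemma sym_section : mcomp sym (mcomp rx (csplit (@mid C q) (fun=> 0))) = @mid C q.
Proof.
have B0 : nc (csplit (@mid C q) (fun _ : 'I_q => 0)) by apply: csplit_nc => // i; exact: mid_nc.
have h := cxrx B0; have rB0 := mcomp_nc (@rx_nc R q) B0; apply/funext => c.
transitivity (mcomp cx (mcomp rx (csplit (@mid C q) (fun=> 0))) (lshift q c) +
  fps_C (k c) * mcomp cx (mcomp rx (csplit (@mid C q) (fun=> 0))) (rshift q (Rs c))).
  by rewrite /mcomp /sym fps_compD fps_comp_CM.
by rewrite h !csplitE mulr0 addr0.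
Qed.

Lemma formal_ideal_twisted m (S : set 'rV[R]_m) b (g : 'I_m -> fps C q) :
  formal_ideal S b -> nc g -> (forall i, cvgt (g i)) ->
  nearC (fun v => rho_fixed v -> exists2 x : 'rV[R]_m, S x & forall j, ev v (g j) = ((x 0 j)%:C)%C) ->
  fps_comp (cfps b) g = 0.
Proof.
move=> Sb g0 cg hS; have s0 := sym_nc; have cs := cvgt_sym.
have gs0 : nc (mcomp g sym) by exact: mcomp_nc.
have cgs i : cvgt (mcomp g sym i) by exact: cvgt_comp.
have e : fps_comp (cfps b) (mcomp g sym) = 0.
  apply: (formal_ideal_comp Sb gs0 cgs).
  have h1 := nearCR (near_ev_mcomp cg cs s0); have h2 := nearCR (near_pull cs s0 hS).
  apply: nearRW (nearR_and h1 h2) => t [e1 /(_ (@sym_fixed t))[x Sx hx]].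
  by exists x => // j; rewrite e1.
have rB0 : nc (mcomp rx (csplit (@mid C q) (fun _ : 'I_q => 0))).
  by apply: mcomp_nc; [exact: rx_nc|apply: csplit_nc => // i; exact: mid_nc].
rewrite -[g](mcomp1r g) -sym_section -(mcompA g s0 rB0) -(fps_compA _ gs0 rB0) e.
exact: fps_comp0.
Qed.

End Twisted.

Lemma ideal_ReIm m (S : set 'rV[R]_m) (g : fps C m) : cvgt g ->
  near0 (fun x => S x -> ev (vR x) g = 0) ->
  formal_ideal S (fun u => complex.Re (g u)) /\ formal_ideal S (fun u => complex.Im (g u)).
Proof.
move=> cg Sg.
have sub (a : fps R m) : analytic_ideal S a -> formal_ideal S a.
  move=> Sa; exists 1%N, (fun=> 1), (fun=> a); split=> // u.
  by rewrite big_ord1 -[fps_mul _ _]/(1 * a) mul1r.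
split; apply: sub.
  exists (fun x => complex.Re (ev (vR x) g)); split; first exact: expands_Re.
  by move: Sg => /near0P[e e0 h]; apply/near0P; exists e => // x xe Sx; rewrite h.
have cig : cvgt (fps_C (- Ci) * g) by apply: cvgtM => //; exact: cvgt_C.
exists (fun x => complex.Re (ev (vR x) (fps_C (- Ci) * g))); split.
  have := expands_Re cig; congr (expands_at0 _ _); apply/funext => u.
  by rewrite /rpart fps_CM; case: (g u) => x y /=; ring.
have [r r0 rb] := cvgt_bd cg.
move: Sg => /near0P[e e0 h]; apply/near0P; exists (Num.min e (2^-1 * r)).
  by rewrite lt_min e0 mulr_gt0.
move=> x xe Sx; have xr : pdisc r (vR x).
  by apply: small_pdisc => i; rewrite cabs_real; have := xe i; rewrite lt_min => /andP[].
rewrite (evM (ltW r0) xr) // ?h ?mulr0 //; last exact: bd_C.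
by move=> i; have := xe i; rewrite lt_min => /andP[].
Qed.

End Bridge.

(** * Quadrics with paired planes *)

Section Quad.
Context {R : realType} {p : nat}.
Local Notation C := R[i].
Variables (lam a sg : 'I_p -> C) (st : 'I_p -> 'I_p) (Rs : 'S_(p + p)).
Definition qmu j := lam j ^+ 2.
Definition qta j := sg j / (a j * (1 + qmu j)).
Definition qd j := sg j * (qmu j - 1) / (1 + qmu j).
Local Notation mu := qmu.
Local Notation ta := qta.
Local Notation k := (klam lam).
Local Notation lsh := (@lshift p p).
Local Notation rsh := (@rshift p p).

(* The involution Rs is compatible with the pairing st, so that the conjugate of
   z'_(st j) is the linear form -ta_j (xi_j + mu_j eta_j) on the fixed points of
   v |-> (k_c conj v_(Rs c)). *)
Record quad_data : Prop := QuadData {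
  qd_lam0 : forall j, lam j != 0;
  qd_a0 : forall j, a j != 0;
  qd_sg0 : forall j, sg j != 0;
  qd_mu1 : forall j, mu j != 1;
  qd_mup : forall j, 1 + mu j != 0;
  qd_stK : involutive st;
  qd_Rs2 : (Rs * Rs = 1)%g;
  qd_kk : forall c, k c * conjc (k (Rs c)) = 1;
  qd_pair : forall j,
    [/\ Rs (lsh (st j)) = lsh j, Rs (rsh (st j)) = rsh j,
        conjc (sg (st j)) * conjc (k (lsh (st j))) = - ta j &
        conjc (sg (st j)) * conjc (k (rsh (st j))) = - (ta j * mu j)] \/
    [/\ Rs (lsh (st j)) = rsh j, Rs (rsh (st j)) = lsh j,
        conjc (sg (st j)) * conjc (k (lsh (st j))) = - (ta j * mu j) &
        conjc (sg (st j)) * conjc (k (rsh (st j))) = - ta j] }.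

Hypothesis Q : quad_data.

Lemma qta0 j : ta j != 0.
Proof. by rewrite mulf_neq0 ?invr_neq0 ?mulf_neq0 ?(qd_sg0 Q) ?(qd_a0 Q) ?(qd_mup Q). Qed.

Lemma qd_conjk c : conjc (k c) * k (Rs c) = 1.
Proof. by have := qd_kk Q (Rs c); rewrite (RsK (qd_Rs2 Q)) mulrC. Qed.

Section Algebra.
Variables (A : comNzRingType) (io : {rmorphism C -> A}) (si : {rmorphism A -> A}).
Hypothesis si_io : forall c, si (io c) = io (conjc c).
Hypothesis siK : involutive si.
Implicit Type v : 'I_(p + p) -> A.

Lemma ioM c d : io (c * d) = io c * io d. Proof. exact: rmorphM. Qed.
Lemma siM x y : si (x * y) = si x * si y. Proof. exact: rmorphM. Qed.
Lemma siD x y : si (x + y) = si x + si y. Proof. exact: rmorphD. Qed.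

Definition zf v j := io (sg j) * (v (lsh j) + v (rsh j)).
Definition yf v j := - io (ta j) * (v (lsh j) + io (mu j) * v (rsh j)).
Definition eta_of (x y : 'I_p -> A) j :=
  io (mu j - 1)^-1 * (- io (ta j)^-1 * y j - io (sg j)^-1 * x j).
Definition solve (x y : 'I_p -> A) : 'I_(p + p) -> A :=
  csplit (fun j => io (sg j)^-1 * x j - eta_of x y j) (eta_of x y).

Lemma ioV c : c != 0 -> io c * io c^-1 = 1.
Proof. by move=> c0; rewrite -rmorphM divff // rmorph1. Qed.

Lemma zf_solve x y j : zf (solve x y) j = x j.
Proof. by rewrite /zf /solve !csplitE subrK mulrA ioV ?mul1r ?(qd_sg0 Q). Qed.

Lemma yf_solve x y j : yf (solve x y) j = y j.
Proof.
rewrite /yf /solve !csplitE; set e := eta_of x y j.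
have -> : io (sg j)^-1 * x j - e + io (mu j) * e = io (sg j)^-1 * x j + io (mu j - 1) * e.
  by rewrite rmorphB rmorph1; ring.
rewrite {}/e /eta_of mulrA ioV ?mul1r ?subr_eq0 ?(qd_mu1 Q) //.
rewrite addrC subrK mulNr mulNr mulrN opprK mulrA ioV ?mul1r // qta0 //.
Qed.

Lemma form_inj v v' : (forall j, zf v j = zf v' j) -> (forall j, yf v j = yf v' j) -> v = v'.
Proof.
move=> hz hy.
have io_inj c (x y : A) : c != 0 -> io c * x = io c * y -> x = y.
  by move=> c0 h; rewrite -[x]mul1r -(ioV c0) mulrAC h mulrAC ioV // mul1r.
have hs j : v (lsh j) + v (rsh j) = v' (lsh j) + v' (rsh j).
  exact: io_inj (qd_sg0 Q j) (hz j).
have hm j : v (lsh j) + io (mu j) * v (rsh j) = v' (lsh j) + io (mu j) * v' (rsh j).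
  by apply: io_inj (qta0 j) _; apply: oppr_inj; rewrite -!mulNr; exact: hy.
have hr j : v (rsh j) = v' (rsh j).
  apply: (io_inj (mu j - 1)); first by rewrite subr_eq0 (qd_mu1 Q).
  have := congr2 (fun s t => s - t) (hm j) (hs j); rewrite rmorphB rmorph1 => h.
  rewrite [LHS](_ : _ = v (lsh j) + io (mu j) * v (rsh j) - (v (lsh j) + v (rsh j))); last by ring.
  by rewrite h; ring.
apply/funext; apply: all_split => j //; apply: (@addIr _ (v (rsh j))).
by rewrite hs hr.
Qed.

Lemma solve_forms v : solve (zf v) (yf v) = v.
Proof. by apply: form_inj => j; rewrite ?zf_solve ?yf_solve. Qed.

Lemma yfE v j : io (conjc (sg (st j))) * (io (conjc (k (lsh (st j)))) * v (Rs (lsh (st j))) +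
  io (conjc (k (rsh (st j)))) * v (Rs (rsh (st j)))) = yf v j.
Proof.
rewrite mulrDr !mulrA -!ioM.
case: (qd_pair Q j) => -[-> -> -> ->]; rewrite /yf;
  by move: (ta j) (mu j) => t m; rewrite !rmorphN ioM; ring.
Qed.

Lemma yf_real v j : (forall c, v c = io (k c) * si (v (Rs c))) -> yf v j = si (zf v (st j)).
Proof.
move=> hv; rewrite -yfE /zf rmorphM si_io; congr (_ * _); rewrite rmorphD.
by rewrite (hv (lsh (st j))) (hv (rsh (st j))) !rmorphM !si_io !siK.
Qed.

Lemma solve_real x : let v := solve x (fun j => si (x (st j))) in
  forall c, v c = io (k c) * si (v (Rs c)).
Proof.
move=> v; pose v' c := io (k c) * si (v (Rs c)).
suff e : v = v' by move=> c; exact: (congr1 (fun f => f c) e).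
have z' j : zf v' (st j) = x (st j).
  have := yfE v j; rewrite yf_solve => /(congr1 si); rewrite siK => <-.
  by rewrite siM siD !siM !si_io !conjcK.
apply: form_inj => j; first by rewrite zf_solve -[j](qd_stK Q) z'.
rewrite yf_solve -yfE /v' !(RsK (qd_Rs2 Q)) -[x (st j)](zf_solve x (fun j => si (x (st j)))).
rewrite /zf siM siD si_io; congr (_ * _).
have kc c : io (conjc (k c)) * (io (k (Rs c)) * si (v c)) = si (v c).
  by rewrite mulrA -ioM qd_conjk rmorph1 mul1r.
by rewrite !kc.
Qed.

Lemma quad_form v j : zf v j + 2 * io (a j) * yf v j = io (qd j) * (v (lsh j) - v (rsh j)).
Proof.
have e1 : a j * ta j = sg j / (1 + mu j).
  by rewrite /qta invfM; have := qd_a0 Q j => a0; field; rewrite a0 (qd_mup Q).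
rewrite /zf /yf; have -> : 2 * io (a j) * (- io (ta j) * (v (lsh j) + io (mu j) * v (rsh j))) =
   - (2 * (io (a j) * io (ta j)) * (v (lsh j) + io (mu j) * v (rsh j))) by ring.
have -> : sg j = (sg j / (1 + mu j)) * (1 + mu j) by rewrite mulfVK // (qd_mup Q).
have -> : qd j = (sg j / (1 + mu j)) * (mu j - 1) by rewrite /qd mulrAC.
rewrite -ioM e1; move: (sg j / (1 + mu j)) (mu j) => t m.
by rewrite !ioM rmorphB rmorphD rmorph1; ring.
Qed.

Lemma zf_quad_real v j : (forall c, v c = io (k c) * si (v (Rs c))) ->
  zf v j + 2 * io (a j) * si (zf v (st j)) = io (qd j) * (v (lsh j) - v (rsh j)).
Proof. by move=> hv; rewrite -yf_real // quad_form. Qed.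

End Algebra.

Section Series.
Local Notation X := (@fps_var C (p + p)).
Local Notation Y := (@fps_var C ((p + p) + (p + p))).

Definition qPI : 'I_(p + p) -> fps C (p + p) :=
  csplit (zf fps_C (@mid C (p + p))) (fun j => (fps_C (qd j) * (X (lsh j) - X (rsh j))) ^+ 2).
Definition qPIc := mconj (mcomp qPI (plin k Rs)).
Definition qell : 'I_(p + p) -> fps C ((p + p) + (p + p)) :=
  solve fps_C (fun j => Y (lshift _ (lsh j))) (fun j => Y (rshift _ (lsh (st j)))).

Definition qD : 'M[C]_(p + p) := diag_mx (\row_c csplit sg (fun j => qd j ^+ 2) c).

Lemma qd_neq0 j : qd j != 0.
Proof.
by rewrite /qd !mulf_neq0 ?invr_neq0 ?(qd_sg0 Q) ?subr_eq0 ?(qd_mu1 Q) ?(qd_mup Q).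
Qed.

Lemma qD_unit : qD \in unitmx.
Proof.
rewrite unitmxE det_diag unitfE; apply/prodf_neq0; elim/all_split => j _; rewrite mxE csplitE.
  exact: qd_sg0 Q j.
by rewrite expf_neq0 // qd_neq0.
Qed.

Lemma qPI_lin : qPI = mcomp (lin qD) (mcomp sqm xl).
Proof.
have x0 := @xl_nc R p; have q0 := @sqm_nc C p; have qx0 := mcomp_nc q0 x0.
apply/funext => c; rewrite [RHS](lin_comp _ _ qx0) (bigD1 c) //= big1 => [|j jc]; last first.
  by rewrite mxE eq_sym (negbTE jc) mulr0n rmorph0 mul0r.
rewrite addr0 mxE eqxx mulr1n mxE; elim/all_split: c => j; rewrite /qPI /mcomp /sqm /xl !csplitE.
  by rewrite fps_comp_var // csplitE.
by rewrite fps_compX // fps_comp_var // csplitE exprMn rmorphXn.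
Qed.

Lemma qPI_nc : nc qPI.
Proof. by rewrite qPI_lin; apply: mcomp_nc; [exact: lin_nc|apply: mcomp_nc; [exact: sqm_nc|exact: xl_nc]]. Qed.

Lemma cvgt_sqm i : cvgt (@sqm C p i).
Proof. by elim/all_split: i => j; rewrite /sqm csplitE; [|apply: cvgtX]; exact: cvgt_var. Qed.

Lemma cvgt_qPI i : cvgt (qPI i).
Proof.
rewrite qPI_lin; apply: cvgt_mcomp; [exact: cvgt_lin| |apply: mcomp_nc; [exact: sqm_nc|exact: xl_nc]].
exact: cvgt_mcomp cvgt_sqm (@cvgt_xl R p) (@xl_nc R p).
Qed.

Lemma cvgt_plin m (kc : 'I_m -> C) s i : cvgt (plin kc s i).
Proof. by rewrite plin_lin; exact: cvgt_lin. Qed.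

Lemma qPIc_nc : nc qPIc.
Proof. by apply: mconj_nc; apply: mcomp_nc; [exact: qPI_nc|exact: plin_nc]. Qed.

Lemma cvgt_qPIc i : cvgt (qPIc i).
Proof.
apply: cvgt_conj; apply: cvgt_mcomp; [exact: cvgt_qPI|exact: cvgt_plin|exact: plin_nc].
Qed.

Lemma solve_comp m l (x y : 'I_p -> fps C l) (g : 'I_l -> fps C m) c : nc g ->
  fps_comp (solve fps_C x y c) g = solve fps_C (fun j => fps_comp (x j) g) (fun j => fps_comp (y j) g) c.
Proof.
move=> g0.
have e j : fps_comp (eta_of fps_C x y j) g =
    eta_of fps_C (fun j => fps_comp (x j) g) (fun j => fps_comp (y j) g) j.
  by rewrite /eta_of fps_comp_CM fps_compB !mulNr fps_compN !fps_comp_CM.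
by elim/all_split: c => j; rewrite /solve !csplitE // fps_compB fps_comp_CM e.
Qed.

Lemma solve_nc m (x y : 'I_p -> fps C m) : nc x -> nc y -> nc (solve fps_C x y).
Proof.
move=> x0 y0; have e j : eta_of fps_C x y j 0 = 0.
  by rewrite /eta_of fps_CM fps_subE mulNr fps_oppE !fps_CM x0 y0 !mulr0 oppr0 addr0 mulr0.
by elim/all_split => j; rewrite /solve csplitE // fps_subE fps_CM x0 e mulr0 subr0.
Qed.

Lemma qell_nc : nc qell.
Proof. by apply: solve_nc => j; exact: mid_nc. Qed.

Lemma plin_conjK : mcomp (plin k Rs) (mconj (plin k Rs)) = @mid C (p + p).
Proof.
have c0 := mconj_nc (@plin_nc _ C k Rs); apply/funext => c; rewrite (mcomp_plinl _ _ _ c0).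
rewrite /mconj /plin fconjM fconj_C fconj_var mulrA -rmorphM (qd_kk Q) rmorph1 mul1r.
by rewrite (RsK (qd_Rs2 Q)).
Qed.

Lemma qPIR : mcomp qPI (plin k Rs) = mconj qPIc.
Proof. by rewrite /qPIc mconjK. Qed.

Lemma qPIcR : mcomp qPIc (plin k Rs) = mconj qPI.
Proof.
have k0 := @plin_nc _ C k Rs; have c0 := mconj_nc k0; have P0 := qPI_nc.
have Pk0 := mcomp_nc P0 k0; rewrite -[LHS]mconjK; congr mconj.
by rewrite (mconj_comp _ k0) /qPIc mconjK (mcompA qPI k0 c0) plin_conjK mcomp1r.
Qed.

Lemma qPIc_forms j : qPIc (lsh (st j)) = yf fps_C (@mid C (p + p)) j.
Proof.
have k0 := @plin_nc _ C k Rs; rewrite -yfE /qPIc /mconj /mcomp /qPI csplitE /zf.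
rewrite fps_comp_CM fps_compD !fps_comp_var // fconjM fconj_C fconjD /plin !fconjM !fconj_C.
by rewrite !fconj_var.
Qed.

Lemma ellPQ : mcomp qell (csplit qPI qPIc) = @mid C (p + p).
Proof.
have PQ0 : nc (csplit qPI qPIc) by apply: csplit_nc; [exact: qPI_nc|exact: qPIc_nc].
apply/funext => c; rewrite /mcomp /qell solve_comp //.
rewrite -[in RHS](solve_forms fps_C (@mid C (p + p))); congr (solve _ _ _ c); apply/funext => j.
  by rewrite fps_comp_var // csplitE /qPI csplitE.
by rewrite fps_comp_var // csplitE qPIc_forms.
Qed.

Lemma PQ_ell d (A : 'I_(p + p) -> fps C d) : nc A ->
  (forall j, A (rsh j) = (A (lsh j) + fps_C (2 * a j) * fconj (A (lsh (st j)))) ^+ 2) ->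
  mcomp (csplit qPI qPIc) (mcomp qell (csplit A (mconj A))) = csplit A (mconj A).
Proof.
move=> A0 AQ; have cA0 := mconj_nc A0; have AA0 := csplit_nc A0 cA0.
set al := mcomp qell _; have al0 : nc al by apply: mcomp_nc => //; exact: qell_nc.
have alE : al = solve fps_C (fun j => A (lsh j)) (fun j => fconj (A (lsh (st j)))).
  apply/funext => c; rewrite /al /mcomp /qell solve_comp //; congr (solve _ _ _ c);
    by apply/funext => j; rewrite fps_comp_var // csplitE.
have z j : zf fps_C al j = A (lsh j) by rewrite alE zf_solve.
have si_io c : fconj (fps_C c : fps C d) = fps_C (conjc c) by exact: fconj_C.
have alR : mcomp (plin k Rs) (mconj al) = al.
  have cal0 := mconj_nc al0; apply/funext => c; rewrite /mcomp /plin fps_comp_CM (fps_comp_var _ cal0).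
  have := solve_real si_io (@fconjK R d) (fun j => A (lsh j)) c.
  by rewrite -alE => /esym.
have PIal : mcomp qPI al = A.
  apply/funext; apply: all_split => j; rewrite /mcomp /qPI csplitE.
    by rewrite /zf fps_comp_CM fps_compD !fps_comp_var // -[RHS]z.
  rewrite fps_compX // fps_comp_CM fps_compB !fps_comp_var // AQ; congr (_ ^+ 2).
  have y : yf fps_C al j = fconj (A (lsh (st j))) by rewrite alE yf_solve.
  by rewrite -quad_form z y rmorphM rmorph_nat.
rewrite mcomp_csplit PIal; congr csplit.
have k0 := @plin_nc _ C k Rs; have cal0 := mconj_nc al0.
rewrite -[LHS]mconjK; congr mconj; rewrite (mconj_comp _ al0) /qPIc mconjK.
by rewrite (mcompA qPI k0 cal0) alR PIal.
Qed.

Definition quad_set (z : 'I_(p + p) -> C) :=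
  forall j, z (rsh j) = (z (lsh j) + 2 * a j * conjc (z (lsh (st j)))) ^+ 2.

Definition qrel j : fps C ((p + p) + (p + p)) :=
  Y (lshift _ (rsh j)) - (Y (lshift _ (lsh j)) + fps_C (2 * a j) * Y (rshift _ (lsh (st j)))) ^+ 2.

Lemma cvgt_qrel j : cvgt (qrel j).
Proof.
apply: cvgtB; first exact: cvgt_var; apply: cvgtX; apply: cvgtD; first exact: cvgt_var.
by apply: cvgtM; [exact: cvgt_C|exact: cvgt_var].
Qed.

Lemma ev_qrel w j : ev w (qrel j) =
  w (lshift _ (rsh j)) - (w (lshift _ (lsh j)) + 2 * a j * w (rshift _ (lsh (st j)))) ^+ 2.
Proof.
have [r r0 wr] := pdisc_ex w; have bv i := @bd_var R ((p + p) + (p + p)) r r0 i; have bc d := @bd_C R ((p + p) + (p + p)) r d.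
have b1 i : bd r (fps_C (2 * a j) * Y i) by apply: bdM; [|exact: bc|exact: bv].
have b2 i i' : bd r (Y i + fps_C (2 * a j) * Y i') by apply: bdD; [|exact: bv|exact: b1].
rewrite /qrel (evB r0 wr) //; last exact: bdX.
by rewrite (evX r0 wr) // (evD r0 wr) // (evM r0 wr) // ev_C !(ev_var r0 wr).
Qed.

Lemma qrel_comp d (A B : 'I_(p + p) -> fps C d) j : nc A -> nc B ->
  fps_comp (qrel j) (csplit A B) = 0 ->
  A (rsh j) = (A (lsh j) + fps_C (2 * a j) * B (lsh (st j))) ^+ 2.
Proof.
move=> A0 B0; have AB0 := csplit_nc A0 B0.
rewrite /qrel fps_compB fps_compX // fps_compD fps_comp_CM !fps_comp_var // !csplitE.
by move/eqP; rewrite subr_eq0 => /eqP.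
Qed.

Lemma ev_qPI v : (forall j, ev v (qPI (lsh j)) = sg j * (v (lsh j) + v (rsh j))) /\
  (forall j, ev v (qPI (rsh j)) = (qd j * (v (lsh j) - v (rsh j))) ^+ 2).
Proof.
have [r r0 vr] := pdisc_ex v; have bv i := @bd_var R (p + p) r r0 i; have bc d := @bd_C R (p + p) r d.
split=> j; rewrite /qPI csplitE.
  have b1 : bd r (X (lsh j) + X (rsh j)) by apply: bdD; [|exact: bv|exact: bv].
  by rewrite /zf /mid (evM r0 vr) ?ev_C ?(evD r0 vr) ?(ev_var r0 vr) //; exact: bc.
have b1 : bd r (X (lsh j) - X (rsh j)) by apply: bdD => //; exact: bdN.
rewrite (evX r0 vr); last exact: bdM.
by rewrite (evM r0 vr) // ev_C (evB r0 vr) // !(ev_var r0 vr).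
Qed.

Lemma quad_set_param v : rho_fixed k Rs v -> quad_set (fun l => ev v (qPI l)).
Proof.
move=> hv j; have [-> ->] := ev_qPI v; congr (_ ^+ 2); rewrite (ev_qPI v).1.
have := @zf_quad_real _ idfun (@conjc R) (fun c => erefl) (@conjcK R) v j hv.
by rewrite /zf /= => ->.
Qed.

Lemma quad_set_lift z : quad_set z -> exists v, [/\ rho_fixed k Rs v, forall l, ev v (qPI l) = z l &
  forall c, v c = ev (csplit z (fun l => conjc (z l))) (qell c)].
Proof.
move=> hz; pose x j := z (lsh j); pose y j := conjc (z (lsh (st j))).
pose v := solve idfun x y : 'I_(p + p) -> C; exists v.
have vz j : zf idfun v j = x j by exact: (zf_solve idfun).
split.
- exact: (@solve_real _ idfun (@conjc R) (fun c => erefl) (@conjcK R) x).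
- apply: all_split => j; first by rewrite (ev_qPI v).1 -[RHS]vz.
  rewrite (ev_qPI v).2 hz; congr (_ ^+ 2).
  have vy : yf idfun v j = y j by exact: (yf_solve idfun).
  by rewrite -[LHS](quad_form idfun) vz vy.
set w := csplit z _; have [r r0 wr] := pdisc_ex w.
have bv i := @bd_var R ((p + p) + (p + p)) r r0 i; have bc d := @bd_C R ((p + p) + (p + p)) r d.
pose fx j := Y (lshift _ (lsh j)); pose fy j := Y (rshift _ (lsh (st j))).
have evCM c b : bd r b -> ev w (fps_C c * b) = c * ev w b.
  by move=> bb; rewrite (evM r0 wr (bc c) bb) ev_C.
have exj j : ev w (fps_C (sg j)^-1 * fx j) = (sg j)^-1 * x j.
  by rewrite evCM; [rewrite /fx (ev_var r0 wr) /w csplitE|exact: bv].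
have eyj j : ev w (fps_C (ta j)^-1 * fy j) = (ta j)^-1 * y j.
  by rewrite evCM; [rewrite /fy (ev_var r0 wr) /w csplitE|exact: bv].
have bx j : bd r (fps_C (sg j)^-1 * fx j) by apply: bdM; [|exact: bc|exact: bv].
have by_ j : bd r (fps_C (ta j)^-1 * fy j) by apply: bdM; [|exact: bc|exact: bv].
have be j : bd r (eta_of fps_C fx fy j) /\ ev w (eta_of fps_C fx fy j) = eta_of idfun x y j.
  have b1 : bd r (- (fps_C (ta j)^-1 * fy j)) by exact: bdN.
  have b3 : bd r (- (fps_C (ta j)^-1 * fy j) - fps_C (sg j)^-1 * fx j) by apply: bdD => //; exact: bdN.
  rewrite /eta_of !mulNr; split; first by apply: bdM; [|exact: bc|exact: b3].
  rewrite [LHS](evCM _ _ b3); congr (_ * _).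
  by rewrite (evB r0 wr b1 (bx j)) (evN_ r0 wr (by_ j)) exj eyj.
elim/all_split => j; rewrite /v /qell /solve !csplitE; last exact/esym/(be j).2.
by rewrite [RHS](evB r0 wr (bx j) (be j).1) exj (be j).2.
Qed.

Lemma cvgt_qell c : cvgt (qell c).
Proof.
have ce j : cvgt (eta_of fps_C (fun j => Y (lshift _ (lsh j))) (fun j => Y (rshift _ (lsh (st j)))) j).
  apply: cvgtM; first exact: cvgt_C; rewrite mulNr; apply: cvgtB; first apply: cvgtN;
    by apply: cvgtM; [exact: cvgt_C|exact: cvgt_var].
elim/all_split: c => j; rewrite /qell /solve csplitE //; apply: cvgtB => //.
by apply: cvgtM; [exact: cvgt_C|exact: cvgt_var].
Qed.

End Series.
End Quad.

Lemma near0_and (K : numFieldType) m (P Q : 'rV[K]_m -> Prop) : near0 P -> near0 Q ->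
  near0 (fun x => P x /\ Q x).
Proof. exact: (@filterI _ (nbhs (0 : 'rV[K]_m)) _ P Q). Qed.

Lemma near0W (K : numFieldType) m (P Q : 'rV[K]_m -> Prop) : (forall x, P x -> Q x) ->
  near0 P -> near0 Q.
Proof. by move=> PQ; exact: (@filterS _ (nbhs (0 : 'rV[K]_m)) _ P Q). Qed.

Section Chart.
Context {R : realType} {n d : nat}.
Local Notation C := R[i].
Local Notation Ci := (Complex 0 1 : C).
Variables (S : set 'rV[R]_(n + n)) (Phi Psi : 'rV[R]_(n + n) -> 'rV[R]_(n + n)).
Variables (phi psi : 'I_(n + n) -> fps C (n + n)).
Hypothesis dm : (d <= n + n)%N.
Hypotheses (phi0 : nc phi) (psi0 : nc psi) (cphi : forall i, cvgt (phi i)) (cpsi : forall i, cvgt (psi i)).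
Hypothesis ephi : nearR (fun t => forall j, ev (toC t) (phi j) = ((Phi (\row_i t i) 0 j)%:C)%C).
Hypothesis epsi : nearR (fun t => forall j, ev (toC t) (psi j) = ((Psi (\row_i t i) 0 j)%:C)%C).
Hypotheses (PsiPhi : near0 (fun x => Psi (Phi x) = x)) (PhiPsi : near0 (fun y => Phi (Psi y) = y)).
Hypothesis hS : near0 (fun x => S x <-> forall i : 'I_(n + n), (d <= i)%N -> Phi x 0 i = 0).

Definition ext (t : 'I_d -> R) : 'rV[R]_(n + n) :=
  \row_j if insub (j : nat) is Some i then t i else 0.

Lemma nearR_ext (P : 'rV[R]_(n + n) -> Prop) : near0 P -> nearR (fun t => P (ext t)).
Proof.
move=> /near0P[e e0 h]; exists e => // t te; apply: h => j; rewrite mxE.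
by case: insub => [i|]; [exact: te|rewrite normr0].
Qed.

Lemma ext_id (y : 'rV[R]_(n + n)) : (forall i : 'I_(n + n), (d <= i)%N -> y 0 i = 0) ->
  ext (fun i => y 0 (widen_ord dm i)) = y.
Proof.
move=> hy; apply/rowP => j; rewrite mxE; case: insubP => [i id ij|].
  by congr (y _ _); apply: val_inj.
by rewrite -leqNgt => /hy ->.
Qed.

Lemma ext_vanish t (i : 'I_(n + n)) : (d <= i)%N -> ext t 0 i = 0.
Proof. by move=> di; rewrite mxE insubF // ltnNge di. Qed.

Lemma near0_row (P : 'rV[R]_(n + n) -> Prop) : nearR (fun t => P (\row_i t i)) -> near0 P.
Proof. by move/near0_nearR. Qed.

Lemma ev_incl t j : ev (toC t) (@cincl R n d j) = ((ext t 0 j)%:C)%C.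
Proof.
rewrite mxE /cincl; case: insub => [i|]; first exact: ev_mid.
by have [r r0 xr] := pdisc_ex (toC t); rewrite -(rmorph0 fps_C) ev_C.
Qed.

Lemma cvgt_incl j : cvgt (@cincl R n d j).
Proof. by rewrite /cincl; case: insub => [i|]; [exact: cvgt_var|exact: cvgt0]. Qed.

Lemma near_Psi_small e : 0 < e -> near0 (fun y => forall i, `|Psi y 0 i| < e).
Proof.
move=> e0; apply: near0_row; apply: nearRW (nearR_and (nearCR (near_ev_small cpsi psi0 e0)) epsi).
by move=> t [h1 h2] i; have := h1 i; rewrite h2 cabs_real.
Qed.

Lemma near_Phi_small e : 0 < e -> near0 (fun y => forall i, `|Phi y 0 i| < e).
Proof.
move=> e0; apply: near0_row; apply: nearRW (nearR_and (nearCR (near_ev_small cphi phi0 e0)) ephi).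
by move=> t [h1 h2] i; have := h1 i; rewrite h2 cabs_real.
Qed.

Lemma chart_mem : near0 (fun y => (forall i : 'I_(n + n), (d <= i)%N -> y 0 i = 0) -> S (Psi y)).
Proof.
move: (hS) => /near0P[e e0 he]; apply: near0_row.
have [e1 e10 h1] := (near0_nearR _).1 (near_Psi_small e0).
have [e2 e20 h2] := (near0_nearR _).1 PhiPsi.
exists (Num.min e1 e2) => [|t te hy]; first by rewrite lt_min e10.
have te1 i : `|t i| < e1 by have := te i; rewrite lt_min => /andP[].
have te2 i : `|t i| < e2 by have := te i; rewrite lt_min => /andP[].
by apply/he; [exact: h1|rewrite (h2 t te2)].
Qed.

Let W := mcomp (fun l : 'I_n => cx (lshift n l)) (mcomp psi (@cincl R n d)).

Lemma chart_points : nearR (fun t => [/\ S (Psi (ext t)),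
  forall j, ev (toC t) (mcomp psi cincl j) = ((Psi (ext t) 0 j)%:C)%C &
  forall l, ev (toC t) (W l) = complexify (Psi (ext t)) 0 l]).
Proof.
have in0 := @incl_nc R n d; have pi0 : nc (mcomp psi (@cincl R n d)) by exact: mcomp_nc.
have cpi := cvgt_mcomp cpsi cvgt_incl in0.
have h1 := nearCR (near_ev_mcomp cpsi cvgt_incl in0).
have h2 := nearCR (near_ev_mcomp (fun l : 'I_n => @cvgt_cx R n (lshift n l)) cpi pi0).
have h3 : nearR (fun t : 'I_d -> R => forall j, ev (toC (fun i => ext t 0 i)) (psi j) = ((Psi (ext t) 0 j)%:C)%C).
  have := nearR_ext ((near0_nearR (fun y => forall j, ev (vR y) (psi j) = ((Psi y 0 j)%:C)%C)).2 _).
  by apply; apply: nearRW epsi => t h j; rewrite vR_row.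
have h4 := nearR_ext chart_mem.
apply: nearRW (nearR_and (nearR_and h1 h2) (nearR_and h3 h4)) => t [[e1 e2] [e3 e4]].
have epi j : ev (toC t) (mcomp psi cincl j) = ((Psi (ext t) 0 j)%:C)%C.
  rewrite e1 -e3; congr (ev _ _); apply/funext => i; exact: ev_incl.
split=> [||l]; [by apply: e4 => i; exact: ext_vanish|exact: epi|].
rewrite e2 ev_cx csplitE !epi mxE.
by apply/eqP; rewrite eq_complex /=; apply/andP; split; apply/eqP; ring.
Qed.

Lemma chart_inverse : near0 (fun x => S x -> exists t, [/\ ext t = Phi x, Psi (ext t) = x &
  forall i, t i = Phi x 0 (widen_ord dm i)]).
Proof.
apply: near0W (near0_and PsiPhi hS) => x [h1 h2] /h2 h3.
by exists (fun i => Phi x 0 (widen_ord dm i)); split=> //; rewrite ext_id.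
Qed.

End Chart.

Section NearTools.
Context {R : realType}.
Local Notation C := R[i].

Lemma nearC_conj m (P : ('I_m -> C) -> Prop) : nearC P -> nearC (fun v => P (fun i => conjc (v i))).
Proof. by move=> [e e0 h]; exists e => // x xe; apply: h => i; rewrite cabs_conj. Qed.

Lemma nearC_conj_split m (P : ('I_(m + m) -> C) -> Prop) : nearC P ->
  nearC (fun v : 'I_m -> C => P (csplit v (fun i => conjc (v i)))).
Proof.
by move=> [e e0 h]; exists e => // x xe; apply: h; apply: all_split => i; rewrite csplitE // cabs_conj.
Qed.

Lemma nearC_real m (P : ('I_m -> R) -> Prop) : nearR P -> nearC (fun y => forall t, y = toC t -> P t).
Proof.
move=> [e e0 h]; exists e => // y ye t yt; apply: h => i.
by have := ye i; rewrite yt cabs_real.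
Qed.

Lemma near0_nearC m (P : ('I_m -> C) -> Prop) : nearC P -> near0 (fun z : 'rV[C]_m => P (fun i => z 0 i)).
Proof. by move=> [e e0 h]; apply/near0CP; exists e => // z ze; exact: h. Qed.

Lemma real_toC m (y : 'I_m -> C) : (forall i, conjc (y i) = y i) -> exists t, y = toC t.
Proof.
move=> h; exists (fun i => complex.Re (y i)); apply/funext => i; have := h i.
rewrite /toC; case: (y i) => a b [hb]; have -> : b = 0 by lra.
by [].
Qed.

Lemma ev_plin m (k : 'I_m -> C) s v c : ev v (plin k s c) = k c * v (s c).
Proof.
have [r r0 vr] := pdisc_ex v; rewrite /plin (evM r0 vr) ?ev_C ?(ev_var r0 vr) //; [exact: bd_C|exact: bd_var].
Qed.

Lemma near_ev_CM m (c : C) (b : fps C m) : cvgt b -> nearC (fun x => ev x (fps_C c * b) = c * ev x b).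
Proof.
move=> /cvgt_bd[r r0 rb]; exists (2^-1 * r) => [|x xr]; first by rewrite mulr_gt0.
have xp := small_pdisc xr; rewrite (evM (ltW r0) xp) // ?ev_C //; exact: bd_C.
Qed.

Lemma near_ev_twisted m (k : 'I_m -> C) s (a : fps C m) : cvgt a ->
  nearC (fun v => rho_fixed k s v -> ev v (fconj (fps_comp a (plin k s))) = conjc (ev v a)).
Proof.
move=> ca; have k0 := @plin_nc _ C k s; have ck := @cvgt_plin R m k s.
pose f := fps_comp a (plin k s); have cf : cvgt f by exact: cvgt_comp.
have h1 : nearC (fun v => ev v (fconj f) = conjc (ev (fun i => conjc (v i)) f)).
  apply: nearCW (nearC_conj (near_ev_conj cf)) => v.
  by have -> : (fun i => conjc (conjc (v i))) = v by apply/funext => i; rewrite conjcK.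
have h2 : nearC (fun v => ev (fun i => conjc (v i)) f = ev (fun c => k c * conjc (v (s c))) a).
  apply: nearCW (nearC_conj (near_ev_comp ca ck k0)) => v ->.
  by congr (ev _ a); apply/funext => c; rewrite ev_plin.
apply: nearCW (nearC_and h1 h2) => v [e1 e2] hv; rewrite e1 e2; congr (conjc (ev _ a)).
by apply/funext => c; rewrite -hv.
Qed.

End NearTools.

Section RealImage.
Context {R : realType} {q : nat}.
Local Notation C := R[i].
Variables (k : 'I_q -> C) (Rs : 'S_q) (T Ti : 'I_q -> fps C q).
Hypothesis kR : mcomp (plin k Rs) (mconj (plin k Rs)) = @mid C q.
Hypotheses (T0 : nc T) (Ti0 : nc Ti) (cT : forall i, cvgt (T i)) (cTi : forall i, cvgt (Ti i)).
Hypotheses (TTi : mcomp T Ti = @mid C q) (TiT : mcomp Ti T = @mid C q).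
Hypothesis TR : mcomp T (plin k Rs) = mconj T.

Lemma real_image : nearC (fun v => rho_fixed k Rs v -> exists t, (fun c => ev v (T c)) = toC t).
Proof.
have h c := near_ev_twisted k Rs (cT c).
apply: nearCW (nearC_all h) => v hv vR; apply: real_toC => c.
rewrite -(hv c vR); congr (ev v _).
by rewrite -[fps_comp _ _]/(mcomp T _ c) TR /mconj fconjK.
Qed.

Lemma inverse_real : mcomp (plin k Rs) (mconj Ti) = Ti.
Proof.
have k0 := @plin_nc _ C k Rs; have cTi0 := mconj_nc Ti0; have cT0 := mconj_nc T0.
have kTi0 : nc (mcomp (plin k Rs) (mconj Ti)) by exact: mcomp_nc.
rewrite -[LHS](mcomp1l kTi0) -TiT (mcompA Ti T0 kTi0) -(mcompA T k0 cTi0) TR.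
by rewrite -(mconj_comp _ Ti0) TTi mconj_mid mcomp1r.
Qed.

Lemma fixed_preimage : nearR (fun t => rho_fixed k Rs (fun c => ev (toC t) (Ti c))).
Proof.
have h c := nearC_and (near_ev_conj (cTi (Rs c))) (near_ev_CM (k c) (cvgt_conj (cTi (Rs c)))).
apply: nearRW (nearCR (nearC_all h)) => t ht c.
have et : (fun i => conjc (toC t i)) = toC t by apply/funext => i; exact: conjc_real.
have e : Ti c = fps_C (k c) * fconj (Ti (Rs c)).
  rewrite -[in LHS]inverse_real /mcomp /plin fps_comp_CM fps_comp_var //; exact: mconj_nc.
by have [] := ht c; rewrite et => e1 e2; rewrite [in LHS]e e2 e1.
Qed.

End RealImage.

Section Realify.
Context {R : realType} {n : nat}.
Local Notation C := R[i].

Definition realify (z : 'rV[C]_n) : 'rV[R]_(n + n) :=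
  \row_j csplit (fun l => complex.Re (z 0 l)) (fun l => complex.Im (z 0 l)) j.

Lemma realifyK z : complexify (realify z) = z.
Proof.
by apply/rowP => l; rewrite !mxE !csplitE; case: (z 0 l).
Qed.

Lemma near0_realify (P : 'rV[R]_(n + n) -> Prop) : near0 P -> near0 (fun z => P (realify z)).
Proof.
move=> /near0P[e e0 h]; apply/near0CP; exists e => // z ze; apply: h => j.
rewrite mxE; elim/all_split: j => l; rewrite csplitE; apply: le_lt_trans (ze l).
  exact: cabs_Re.
exact: cabs_Im.
Qed.

End Realify.

Section EvRx.
Context {R : realType} {n : nat}.
Local Notation C := R[i].
Local Notation Ci := (Complex 0 1 : C).

Lemma ev_rx (w : 'I_(n + n) -> C) j : ev w (rx j) =
  csplit (fun l => 2^-1 * (w (lshift n l) + w (rshift n l)))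
         (fun l => (2 * Ci)^-1 * (w (lshift n l) - w (rshift n l))) j.
Proof.
have [r r0 wr] := pdisc_ex w; have bv i := @bd_var R (n + n) r r0 i; have bc := @bd_C R (n + n) r.
have bs l : bd r (fps_var (lshift n l) + fps_var (rshift n l)) by apply: bdD; [|exact: bv|exact: bv].
have bm l : bd r (fps_var (lshift n l) - fps_var (rshift n l)).
  by apply: bdD => //; apply: bdN; exact: bv.
elim/all_split: j => l; rewrite /rx !csplitE.
  by rewrite (evM r0 wr (bc _) (bs l)) ev_C (evD r0 wr) ?(ev_var r0 wr).
by rewrite (evM r0 wr (bc _) (bm l)) ev_C (evB r0 wr) ?(ev_var r0 wr).
Qed.

Lemma ev_rx_conj (z : 'I_n -> C) j : ev (csplit z (fun l => conjc (z l))) (rx j) =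
  ((csplit (fun l => complex.Re (z l)) (fun l => complex.Im (z l)) j)%:C)%C.
Proof.
rewrite ev_rx; elim/all_split: j => l; rewrite !csplitE.
  have -> : z l + conjc (z l) = 2 * ((complex.Re (z l))%:C)%C.
    by case: (z l) => x y; apply/eqP; rewrite eq_complex /=; apply/andP; split; apply/eqP; ring.
  by rewrite mulKf ?two_neq0.
have -> : z l - conjc (z l) = (2 * Ci) * ((complex.Im (z l))%:C)%C.
  by case: (z l) => x y; apply/eqP; rewrite eq_complex /=; apply/andP; split; apply/eqP; ring.
by rewrite mulKf // mulf_neq0 ?two_neq0 ?Ci_neq0.
Qed.

End EvRx.

Section FormalIdeals.
Context {R : realType} {p : nat}.
Local Notation C := R[i].
Local Notation n := (p + p)%N.
Variables (lam a sg : 'I_p -> C) (st : 'I_p -> 'I_p) (Rs : 'S_(p + p)).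
Hypothesis Q : quad_data lam a sg st Rs.
Local Notation k := (klam lam).
Local Notation PI := (qPI lam sg).
Local Notation PIc := (qPIc lam sg Rs).
Variables (QS : set 'rV[C]_n) (M : set 'rV[C]_n).
Hypothesis hQ : forall z, QS z <-> quad_set a st (fun l => z 0 l).
Let Q' := (@complexify R n @^-1` QS)%classic.
Let M' := (@complexify R n @^-1` M)%classic.

Lemma quad_points : nearC (fun v => rho_fixed k Rs v ->
  exists2 x : 'rV[R]_(n + n), Q' x & forall j, ev v (mcomp rx (csplit PI PIc) j) = ((x 0 j)%:C)%C).
Proof.
have P0 := @qPI_nc _ _ lam sg; have Pc0 := @qPIc_nc _ _ lam sg Rs; have PQ0 := csplit_nc P0 Pc0.
have cP := @cvgt_qPI _ _ lam sg; have cPc := @cvgt_qPIc _ _ lam sg Rs.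
have cPQ := csplit_cvgt cP cPc.
have h1 := near_ev_mcomp (@cvgt_rx R n) cPQ PQ0.
have h2 := nearC_all (fun l => near_ev_twisted k Rs (cP l)).
apply: nearCW (nearC_and h1 h2) => v [e1 e2] hv.
pose z l := ev v (PI l); exists (realify (\row_l z l)).
  rewrite /Q' /preimage /= realifyK; apply/hQ; rewrite (_ : (fun l => _) = z).
    exact: (quad_set_param Q hv).
  by apply/funext => l; rewrite mxE.
move=> j; rewrite e1 mxE.
have -> : (fun i => ev v (csplit PI PIc i)) = csplit z (fun l => conjc (z l)).
  apply/funext; apply: all_split => l; rewrite !csplitE //; exact: e2.
rewrite ev_rx_conj; congr (((csplit _ _ _)%:C)%C); apply/funext => l; rewrite mxE //.
Qed.

Lemma realification_nc (F : 'I_n -> fps C n) : nc F -> nc (realification F).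
Proof. by move=> F0 j; apply: real_complex_inj; exact: creal_nc F0 j. Qed.

Lemma quad_ideal_pull (b : fps R (n + n)) (G : 'I_n -> fps C n) : nc G ->
  formal_ideal Q' (fps_comp b (realification G)) ->
  fps_comp (cfps b) (mcomp rx (mcomp (dbl G) (csplit PI PIc))) = 0.
Proof.
move=> G0 hb; have P0 := @qPI_nc _ _ lam sg; have Pc0 := @qPIc_nc _ _ lam sg Rs.
have PQ0 := csplit_nc P0 Pc0; have rPQ0 := mcomp_nc (@rx_nc R n) PQ0.
have cPQ := csplit_cvgt (@cvgt_qPI _ _ lam sg) (@cvgt_qPIc _ _ lam sg Rs).
have := formal_ideal_twisted (qd_Rs2 Q) (qd_kk Q) hb rPQ0 (cvgt_mcomp (@cvgt_rx R n) cPQ PQ0) quad_points.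
have RG0 := creal_nc G0; rewrite cfps_comp; last exact: realification_nc.
rewrite -/(creal G) (fps_compA _ RG0 rPQ0); congr (fps_comp _ _ = 0).
have dG0 := dbl_nc G0; have c0 := @cx_nc R n; have dc0 := mcomp_nc dG0 c0.
rewrite (creal_rx G0) (mcompA rx dc0 rPQ0) (mcompA (dbl G) c0 rPQ0).
by rewrite (cxrx PQ0).
Qed.

Lemma near0_vR m (P : ('I_m -> C) -> Prop) : nearC P -> near0 (fun x : 'rV[R]_m => P (vR x)).
Proof. by move=> /nearCR h; apply/near0_nearR; apply: nearRW h => t; rewrite vR_row. Qed.

Lemma quad_relation d (F : 'I_n -> fps C n) (g : 'I_(n + n) -> fps C d) (W : 'I_n -> fps C d) :
  nc F -> nc g -> (forall i, cvgt (g i)) -> nc W -> mcomp cx g = csplit W (mconj W) ->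
  nearR (fun t => exists2 x, M' x & forall j, ev (toC t) (g j) = ((x 0 j)%:C)%C) ->
  (forall a, formal_ideal Q' a -> formal_ideal M' (fps_comp a (realification F))) ->
  forall j, mcomp F W (rshift p j) =
    (mcomp F W (lshift p j) + fps_C (2 * a j) * fconj (mcomp F W (lshift p (st j)))) ^+ 2.
Proof.
move=> F0 g0 cg W0 gW hM idQ j.
have RF0 := creal_nc F0; have rF0 := realification_nc F0; have c0 := @cx_nc R n.
have cW0 := mconj_nc W0; have cF0 := mconj_nc F0.
pose h := fps_comp (qrel a st j) cx.
have ch : cvgt h by apply: cvgt_comp => //; [exact: cvgt_qrel|exact: cvgt_cx].
have hv : near0 (fun x => Q' x -> ev (vR x) h = 0).
  have := near0_vR (near_ev_comp (cvgt_qrel a st j) (@cvgt_cx R n) c0).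
  apply: near0W => x e Qx; rewrite [LHS]e ev_qrel !ev_cx !csplitE.
  have /hQ/(_ j) := Qx; rewrite !mxE => hz.
  have cE l : vR x (lshift n l) + Complex 0 1 * vR x (rshift n l) = Complex (x 0 (lshift n l)) (x 0 (rshift n l)).
    by apply/eqP; rewrite eq_complex /=; apply/andP; split; apply/eqP; ring.
  have cE' l : vR x (lshift n l) - Complex 0 1 * vR x (rshift n l) = conjc (Complex (x 0 (lshift n l)) (x 0 (rshift n l))).
    by apply/eqP; rewrite eq_complex /=; apply/andP; split; apply/eqP; ring.
  by rewrite !cE cE' hz subrr.
have [h1 h2] := ideal_ReIm ch hv.
have pull b : formal_ideal Q' b -> fps_comp (fps_comp (cfps b) (creal F)) g = 0.
  move=> hb; have := formal_ideal_comp (idQ _ hb) g0 cg hM.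
  by rewrite cfps_comp.
have : fps_comp (fps_comp h (creal F)) g = 0.
  rewrite -(fps_ReIm h) fps_compD fps_comp_CM fps_compD fps_comp_CM.
  by rewrite (pull _ h1) (pull _ h2) mulr0 addr0.
have cRF0 := mcomp_nc c0 RF0; have FW0 := mcomp_nc F0 W0.
have q := @qrel_comp R p a st d (mcomp F W) (mconj (mcomp F W)) j FW0 (mconj_nc FW0).
rewrite /h (fps_compA _ c0 RF0) (crealE F0).
have dF0 := dbl_nc F0; rewrite (fps_compA _ (mcomp_nc dF0 c0) g0) (mcompA (dbl F) c0 g0) gW.
by rewrite (dbl_comp F W0 cW0) -(mconj_comp F W0).
Qed.

End FormalIdeals.

Lemma mcomp_mid_unit (K : fieldType) m (A B : 'I_m -> fps K m) : nc A -> nc B ->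
  mcomp A B = @mid K m -> jac B \in unitmx.
Proof.
move=> A0 B0 AB; have := congr1 (@jac _ _ _) AB.
by rewrite (jac_comp A0 B0) jac_mid => /mulmx1_unit[].
Qed.

Section Equivalence.
Context {R : realType} {p : nat}.
Local Notation C := R[i].
Local Notation n := (p + p)%N.
Variables (lam a sg : 'I_p -> C) (st : 'I_p -> 'I_p) (Rs : 'S_(p + p)).
Hypothesis Q : quad_data lam a sg st Rs.
Local Notation k := (klam lam).
Local Notation PI := (qPI lam sg).
Hypothesis RsG : forall g, g \in @swp_group p -> (Rs * g * Rs)%g \in @swp_group p.
Hypothesis lam_sd : forall j, cabs (lam j) = 1 ->
  is_root_of_unity (lam j ^+ 2) \/ brjuno (lam j ^+ 2).
Variables (QS : set 'rV[C]_n) (M : set 'rV[C]_n).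
Hypothesis hQ : forall z, QS z <-> quad_set a st (fun l => z 0 l).

Lemma series_map_aut (H Hi : 'I_n -> fps C n) : nc H -> nc Hi -> (forall i, cvgt (H i)) ->
  (forall i, cvgt (Hi i)) -> mcomp H Hi = @mid C n ->
  [/\ analytic_at0 (fun z : 'rV[C]_n => \row_j ev (fun i => z 0 i) (H j)),
      \row_j ev (fun i => (0 : 'rV[C]_n) 0 i) (H j) = 0 :> 'rV[C]_n &
      nearC (fun z => forall j, ev (fun i => ev z (Hi i)) (H j) = z j)].
Proof.
move=> H0 Hi0 cH cHi HHi; split.
- move=> j; exists (H j).
  have -> : (fun z : 'rV[C]_n => (\row_j ev (fun i => z 0 i) (H j)) 0 j) = (fun z => ev (fun i => z 0 i) (H j)).
    by apply/funext => z; rewrite mxE.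
  exact: expands_complex.
- apply/rowP => j; rewrite !mxE (_ : (fun i => _) = fun=> 0) ?ev_at0 //.
  by apply/funext => i; rewrite mxE.
- have := near_ev_mcomp cH cHi Hi0; apply: nearCW => z hz j.
  by rewrite -hz HHi ev_mid.
Qed.

Lemma equivalence_from_series (E : ('I_n -> R) -> 'rV[C]_n) (W S Si H Hi : 'I_n -> fps C n) :
  (forall l, cvgt (W l)) -> nc S -> nc Si -> nc H -> nc Hi ->
  (forall i, cvgt (S i)) -> (forall i, cvgt (Si i)) -> (forall i, cvgt (H i)) -> (forall i, cvgt (Hi i)) ->
  mcomp S Si = @mid C n -> mcomp Si S = @mid C n -> mcomp H Hi = @mid C n -> mcomp Hi H = @mid C n ->
  mcomp S (plin k Rs) = mconj S -> mcomp W S = mcomp H PI ->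
  nearR (fun t => M (E t) /\ forall l, ev (toC t) (W l) = E t 0 l) ->
  (forall e : R, 0 < e -> near0 (fun z => M z -> exists2 t, E t = z & forall i, `|t i| < e)) ->
  holomorphically_equivalent M QS.
Proof.
move=> cW S0 Si0 H0 Hi0 cS cSi cH cHi SSi SiS HHi HiH SR WS hE hM.
have P0 := @qPI_nc _ _ lam sg; have cP := @cvgt_qPI _ _ lam sg; have kR := plin_conjK Q.
have [aH H00 A1] := series_map_aut H0 Hi0 cH cHi HHi.
have [aHi Hi00 A2] := series_map_aut Hi0 H0 cHi cH HiH.
have [_ _ B3] := series_map_aut S0 Si0 cS cSi SSi.
have B1 := near_ev_mcomp cW cS S0; have B2 := near_ev_mcomp cH cP P0.
have B4 := near_pull cP P0 A2.
have val v w : (forall l, ev v (mcomp W S l) = ev (fun i => ev v (S i)) (W l)) ->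
    (forall l, ev v (mcomp H PI l) = ev (fun i => ev v (PI i)) (H l)) ->
    (forall l, ev v (PI l) = w l) -> forall l, ev (fun i => ev v (S i)) (W l) = ev w (H l).
  move=> e1 e2 e3 l; rewrite -e1 WS e2; congr (ev _ _); apply/funext => i; exact: e3.
exists (fun z : 'rV[C]_n => \row_j ev (fun i => z 0 i) (Hi j)).
exists (fun z : 'rV[C]_n => \row_j ev (fun i => z 0 i) (H j)).
split; first split; first split=> //.
  split.
    apply: near0W (near0_nearC A1) => z hz; apply/rowP => j; rewrite mxE -[RHS]hz.
    by congr (ev _ _); apply/funext => i; rewrite mxE.
  apply: near0W (near0_nearC A2) => z hz; apply/rowP => j; rewrite mxE -[RHS]hz.
  by congr (ev _ _); apply/funext => i; rewrite mxE.
pose Fw (z : 'I_n -> C) : 'rV[C]_n := \row_j ev z (Hi j).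
have fwd : nearR (fun t => QS (Fw (fun l => E t 0 l))).
  have h1 := nearCR (near_pull cSi Si0 (nearC_and B1 (nearC_and B2 B4))).
  have h2 := nearR_and (nearCR B3) (fixed_preimage S0 Si0 cSi SSi SiS SR).
  apply: nearRW (nearR_and (nearR_and h1 h2) hE) => t [[[e1 [e2 e4]] [e3 vR]] [_ eE]].
  have [v vE] : exists v, v = (fun c => ev (toC t) (Si c)) by eexists.
  rewrite -vE in e1 e2 e3 e4 vR.
  have [w wE] : exists w, w = (fun l => ev v (PI l)) by eexists.
  have vS : (fun i => ev v (S i)) = toC t by apply/funext => i; exact: e3.
  have vw l : ev v (PI l) = w l by rewrite wE.
  have zw l : E t 0 l = ev w (H l) by rewrite -eE -vS; exact: (val v w e1 e2 vw l).
  have -> : Fw (fun l => E t 0 l) = \row_l w l.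
    apply/rowP => j; rewrite !mxE -vw -e4 -wE; congr (ev _ (Hi j)); apply/funext => i; exact: zw.
  apply/hQ; rewrite (_ : (fun l => _) = w); last by apply/funext => l; rewrite mxE.
  by rewrite wE; exact: (quad_set_param Q vR).
have bwd : nearC (fun w : 'I_n -> C => quad_set a st w -> M (\row_l ev w (H l))).
  have h1 := near_pull cS S0 (nearC_real hE).
  have h2 := real_image cS SR.
  have K : nearC (fun v => rho_fixed k Rs v -> forall w, (forall l, ev v (PI l) = w l) -> M (\row_l ev w (H l))).
    apply: nearCW (nearC_and (nearC_and B1 B2) (nearC_and h1 h2)) => v [[e1 e2] [e3 e4]] vR w vw.
    have [t vt] := e4 vR; have [Mt Et] := e3 t vt.
    rewrite (_ : \row_l _ = E t) //; apply/rowP => l; rewrite mxE -Et -vt.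
    exact/esym/(val v w e1 e2 vw).
  have := nearC_conj_split (near_pull (@cvgt_qell _ _ lam a sg st) (@qell_nc _ _ lam a sg st) K).
  apply: nearCW => w hK wQ; have [v [vR vw ve]] := quad_set_lift Q wQ.
  have ev_ : v = (fun c => ev (csplit w (fun l => conjc (w l))) (qell lam a sg st c)).
    by apply/funext => c; exact: ve.
  by rewrite -ev_ in hK; exact: hK vR w vw.
have [e e0 he] := fwd.
have := near0_nearC (nearC_and A1 (near_pull cHi Hi0 bwd)).
move=> hz; apply: near0W (near0_and hz (hM e e0)) => z [[zA zB] zM]; split.
  move=> /zM[t <- te]; exact: he.
move=> /hQ; rewrite (_ : (fun l => _) = (fun i => ev (fun i => z 0 i) (Hi i))); last first.
  by apply/funext => l; rewrite mxE.
move=> /zB; rewrite (_ : \row_l _ = z) //; apply/rowP => l; rewrite mxE; exact: zA.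
Qed.

Lemma quad_equivalence : analytic_submanifold_germ M -> formally_equivalent M QS ->
  holomorphically_equivalent M QS.
Proof.
move=> [d [dm [Phi [Psi [[[aPhi aPsi Phi0 Psi0] [PsiPhi PhiPsi]] hM]]]]].
move=> [F [G [[F0 G0 FG GF] idQ idM]]].
have [phiR [xphi phi0 cphi ephi]] := analytic_series aPhi Phi0.
have [psiR [xpsi psi0 cpsi epsi]] := analytic_series aPsi Psi0.
pose phi i := cfps (phiR i); pose psi i := cfps (psiR i).
have phipsi := series_comp_id phi0 psi0 cphi cpsi ephi epsi PhiPsi.
have psiphi := series_comp_id psi0 phi0 cpsi cphi epsi ephi PsiPhi.
have phiR' : mconj phi = phi by apply/funext => i; exact: fconj_cfps.
have psiR' : mconj psi = psi by apply/funext => i; exact: fconj_cfps.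
have FG' : mcomp F G = @mid C n by apply/funext => i; apply/funext => u; exact: FG.
have GF' : mcomp G F = @mid C n by apply/funext => i; apply/funext => u; exact: GF.
have P0 := @qPI_nc _ _ lam sg; have Pc0 := @qPIc_nc _ _ lam sg Rs.
have phiQ (i : 'I_(n + n)) : (d <= i)%N ->
    fps_comp (phi i) (mcomp rx (mcomp (dbl G) (csplit PI (qPIc lam sg Rs)))) = 0.
  move=> di; apply: (quad_ideal_pull Q hQ G0); apply: idM; exists 1%N, (fun=> 1), (fun=> phiR i).
  split=> [_|u]; last by rewrite big_ord1 -[fps_mul _ _]/(1 * phiR i) mul1r.
  exists (fun x => Phi x 0 i); split; first exact: xphi.
  by apply: near0W hM => x h /h; exact.
have hpts := chart_points psi0 cpsi epsi PhiPsi hM.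
pose W := mcomp (fun l : 'I_n => cx (lshift n l)) (mcomp psi (@cincl R n d)).
have in0 := @incl_nc R n d; have pi0 := mcomp_nc psi0 in0.
have W0 : nc W by apply: mcomp_nc => // l; exact: cx_nc.
have cpi := cvgt_mcomp cpsi (@cvgt_incl R n d) in0.
have cW : forall l, cvgt (W l) := cvgt_mcomp (fun l => @cvgt_cx R n (lshift n l)) cpi pi0.
have rel := quad_relation hQ F0 pi0 cpi W0 (cx_psi psi0 psiR')
   (nearRW (fun t h => let: And3 h1 h2 _ := h in ex_intro2 _ _ _ h1 h2) hpts) idQ.
have FW0 := mcomp_nc F0 W0; have PQal := PQ_ell Q FW0 rel.
rewrite (mconj_comp F W0) in PQal.
have ell0 := @qell_nc _ _ lam a sg st.
have ed := param_dim phi0 psi0 F0 G0 phipsi psiphi psiR' FG' GF' dm P0 Pc0 ell0 (ellPQ Q) phiQ PQal.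
have alp := al_param phi0 psi0 F0 G0 psiphi psiR' FG' dm P0 Pc0 (ellPQ Q) phiQ.
have WP := W_param phi0 psi0 G0 psiphi dm P0 Pc0 phiQ.
have Pr := param_real phi0 G0 phiR' dm P0 Pc0 (@qPIR _ _ lam sg Rs) (qPIcR Q).
have Th0 := param_nc phi0 G0 dm P0 Pc0.
have al0 := mcomp_nc ell0 (csplit_nc FW0 (mcomp_nc (mconj_nc F0) (mconj_nc W0))).
have [Th [Thn [al aln alTh] ThR WTh]] : exists Th : 'I_d -> fps C n, [/\ nc Th,
    (exists2 al : 'I_n -> fps C d, nc al & mcomp al Th = @mid C n),
    mcomp Th (plin k Rs) = mconj Th & mcomp W Th = mcomp G PI].
  exists (param phi G dm PI (qPIc lam sg Rs)).
  by split; [exact: Th0|exists (mcomp (qell lam a sg st) (csplit (mcomp F W) (mcomp (mconj F) (mconj W)))); [exact: al0|exact: alp]|exact: Pr|exact: WP].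
clear alp Th0 Pr WP al0 PQal rel phiQ; subst d.
have uTh := mcomp_mid_unit aln Thn alTh.
have uG : jac G \in unitmx.
  exact: mcomp_mid_unit F0 G0 FG'.
have lsd j : cabs (lam j) = 1 -> lam j ^+ 2 != 1 /\ (is_root_of_unity (lam j ^+ 2) \/ brjuno (lam j ^+ 2)).
  by move=> l1; split; [exact: qd_mu1 Q j|exact: lam_sd].
rewrite qPI_lin in WTh.
have [S [Si [H [Hi [[S0 Si0 H0 Hi0] [cS cSi cH cHi] [SSi SiS HHi HiH] [SR WS]]]]]] :=
  analytic_from_formal (qd_lam0 Q) lsd (qd_Rs2 Q) RsG (qd_kk Q) (qD_unit Q) W0 cW Thn uTh ThR G0 uG WTh.
rewrite -qPI_lin in WS.
apply: (equivalence_from_series (E := fun t => complexify (Psi (ext t))) cW S0 Si0 H0 Hi0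
  cS cSi cH cHi SSi SiS HHi HiH SR WS).
  by apply: nearRW hpts => t [h1 _ h3].
move=> e e0; have h1 := near0_realify (near_Phi_small phi0 cphi ephi e0).
have h2 := near0_realify (chart_inverse dm PsiPhi hM).
apply: near0W (near0_and h1 h2) => z [z1 z2] Mz.
have [|t [_ t2 t3]] := z2; first by rewrite /preimage /= realifyK.
exists t => [|i]; first by rewrite t2 realifyK.
by rewrite t3.
Qed.

End Equivalence.

(** * The product quadric *)

Section ProductQuadric.
Context {R : realType} {es hs ss : nat}.
Local Notation C := R[i].
Local Notation p := (es + hs + (ss + ss))%N.
Variables (ge : 'I_es -> R) (gh : 'I_hs -> R) (gs : 'I_ss -> C).
Variables (le : 'I_es -> R) (lh : 'I_hs -> C) (ls : 'I_ss -> C).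
Hypothesis le_gt1 : forall e, 1 < le e.
Hypothesis geE : forall e, ge e = (le e + (le e)^-1)^-1.
Hypothesis lh1 : forall h, `|lh h| = 1.
Hypothesis gh0 : forall h, 0 < gh h.
Hypothesis ghE : forall h, ((gh h)%:C)%C = (lh h + conjc (lh h))^-1.
Hypothesis ls_gt1 : forall s, 1 < `|ls s|.
Hypothesis gs0 : forall s, gs s != 0.
Hypothesis gsE : forall s, gs s = (1 + (ls s) ^- 2)^-1.
Hypothesis distinct : distinct_eigenvalues le lh ls.

Local Notation ie := (@idx_e es hs ss).
Local Notation ih := (@idx_h es hs ss).
Local Notation is_ := (@idx_s es hs ss).
Local Notation it_ := (@idx_t es hs ss).

Definition quadc (T : Type) (fe : 'I_es -> T) (fh : 'I_hs -> T) (fs ft : 'I_ss -> T) : 'I_p -> T :=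
  csplit (csplit fe fh) (csplit fs ft).

Lemma all_quadc (P : 'I_p -> Prop) : (forall e, P (ie e)) -> (forall h, P (ih h)) ->
  (forall s, P (is_ s)) -> (forall s, P (it_ s)) -> forall j, P j.
Proof. by move=> h1 h2 h3 h4; apply: all_split; apply: all_split. Qed.

Lemma quadc_e T fe fh fs ft e : @quadc T fe fh fs ft (ie e) = fe e.
Proof. by rewrite /quadc /idx_e !csplitE. Qed.
Lemma quadc_h T fe fh fs ft h : @quadc T fe fh fs ft (ih h) = fh h.
Proof. by rewrite /quadc /idx_h !csplitE. Qed.
Lemma quadc_s T fe fh fs ft s : @quadc T fe fh fs ft (is_ s) = fs s.
Proof. by rewrite /quadc /idx_s !csplitE. Qed.
Lemma quadc_t T fe fh fs ft s : @quadc T fe fh fs ft (it_ s) = ft s.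
Proof. by rewrite /quadc /idx_t !csplitE. Qed.
Definition quadcE := (quadc_e, quadc_h, quadc_s, quadc_t).

Definition lamq : 'I_p -> C := quadc (fun e => ((le e)%:C)%C) lh ls (fun s => (conjc (ls s))^-1).
Definition aq : 'I_p -> C := quadc (fun e => ((ge e)%:C)%C) (fun h => ((gh h)%:C)%C) gs (fun s => 1 - conjc (gs s)).
Definition sgq : 'I_p -> C := quadc (fun=> 1) (fun=> 1) (fun=> 1) (fun s => (conjc (ls s))^-1).
Definition stq : 'I_p -> 'I_p := quadc ie ih it_ is_.

Local Notation lsh := (@lshift p p).
Local Notation rsh := (@rshift p p).

Definition Rsf : 'I_(p + p) -> 'I_(p + p) :=
  csplit (quadc (fun e => rsh (ie e)) (fun h => lsh (ih h)) (fun s => lsh (it_ s)) (fun s => lsh (is_ s)))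
         (quadc (fun e => lsh (ie e)) (fun h => rsh (ih h)) (fun s => rsh (it_ s)) (fun s => rsh (is_ s))).

Lemma RsfK : involutive Rsf.
Proof.
by apply: all_split; apply: all_quadc => i; rewrite /Rsf !(csplitE, quadcE).
Qed.

Definition Rsq : 'S_(p + p) := perm (inv_inj RsfK).

Lemma RsqE c : Rsq c = Rsf c.
Proof. exact: permE. Qed.

Lemma RsE : ((forall e, Rsq (lsh (ie e)) = rsh (ie e)) * (forall e, Rsq (rsh (ie e)) = lsh (ie e)) *
  (forall h, Rsq (lsh (ih h)) = lsh (ih h)) * (forall h, Rsq (rsh (ih h)) = rsh (ih h)) *
  (forall s, Rsq (lsh (is_ s)) = lsh (it_ s)) * (forall s, Rsq (rsh (is_ s)) = rsh (it_ s)) *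
  (forall s, Rsq (lsh (it_ s)) = lsh (is_ s)) * (forall s, Rsq (rsh (it_ s)) = rsh (is_ s)))%type.
Proof. by do !split=> *; rewrite RsqE /Rsf !(csplitE, quadcE). Qed.

Lemma Rsq2 : (Rsq * Rsq = 1)%g.
Proof. by apply/permP => c; rewrite permM perm1 !RsqE RsfK. Qed.

Lemma Rsq_swp g : g \in @swp_group p -> (Rsq * g * Rsq)%g \in @swp_group p.
Proof.
move=> /swp_groupP[A ->]; apply/swp_groupP; exists [set j | stq j \in A]%SET.
apply/permP; apply: all_split; apply: all_quadc => i; rewrite !permM !RsE !swpE inE /stq !quadcE;
  by case: ifP; rewrite !RsE.
Qed.

Lemma lamqE j : quadric_lambda le lh ls 0 j = lamq j.
Proof.
elim/all_quadc: j => i; rewrite /quadric_lambda /idx_e /idx_h /idx_s /idx_t /lamq /quadc;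
  by rewrite ?row_mxEl ?row_mxEr ?row_mxEl ?row_mxEr mxE !csplitE.
Qed.

Lemma lh_conj h : lh h * conjc (lh h) = 1.
Proof. by rewrite -sqr_normc lh1 expr1n. Qed.

Lemma lh_neq0 h : lh h != 0.
Proof. by rewrite -normr_eq0 lh1 oner_eq0. Qed.

Lemma le_neq0 e : ((le e)%:C)%C != 0 :> C.
Proof. by apply/eqP => -[/eqP]; rewrite gt_eqF // (lt_trans ltr01). Qed.

Lemma ls_neq0 s : ls s != 0.
Proof. by rewrite -normr_gt0 (lt_trans ltr01). Qed.

Lemma conj_ls_neq0 s : conjc (ls s) != 0.
Proof. by rewrite conjc_eq0 ls_neq0. Qed.

Lemma lamq0 j : lamq j != 0.
Proof.
elim/all_quadc: j => i; rewrite /lamq quadcE; [exact: le_neq0|exact: lh_neq0|exact: ls_neq0|].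
by rewrite invr_eq0 conj_ls_neq0.
Qed.

Lemma sgq0 j : sgq j != 0.
Proof.
elim/all_quadc: j => i; rewrite /sgq quadcE ?oner_neq0 //.
by rewrite invr_eq0 conj_ls_neq0.
Qed.

Lemma ls_mup s : 1 + ls s ^+ 2 != 0.
Proof.
have := gs0 s; rewrite gsE invr_eq0; apply: contra => /eqP h.
have -> : 1 + ls s ^- 2 = (1 + ls s ^+ 2) * ls s ^- 2.
  by rewrite mulrDl mul1r mulfV ?expf_neq0 ?ls_neq0 // addrC.
by rewrite h mul0r.
Qed.

Lemma lamq_mup j : 1 + lamq j ^+ 2 != 0.
Proof.
elim/all_quadc: j => i; rewrite /lamq quadcE.
- rewrite -rmorphXn -[1](rmorph1 (@real_complex R)) -rmorphD; apply/eqP => -[/eqP].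
  by rewrite gt_eqF // ltr_wpDr ?sqr_ge0.
- have h0 : lh i + conjc (lh i) != 0.
    by rewrite -invr_eq0 -ghE; apply/eqP => -[/eqP]; rewrite gt_eqF.
  by rewrite -(lh_conj i) expr2 -mulrDr mulf_neq0 ?lh_neq0 // addrC.
- exact: ls_mup.
- have -> : 1 + (conjc (ls i))^-1 ^+ 2 = conjc (1 + ls i ^+ 2) * (conjc (ls i)) ^- 2.
    rewrite rmorphD rmorph1 rmorphXn mulrDl mul1r mulfV ?expf_neq0 ?conj_ls_neq0 //.
    by rewrite exprVn addrC.
  by rewrite mulf_neq0 ?invr_eq0 ?expf_neq0 ?conj_ls_neq0 // conjc_eq0 ls_mup.
Qed.

Lemma lamq_mu1 j : lamq j ^+ 2 != 1.
Proof.
apply/eqP => h; have := @distinct (lsh j) (rsh j).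
rewrite /quadric_eigenvalues row_mxEl row_mxEr [map_mx GRing.inv _ 0 j]mxE.
rewrite [map_mx _ _ 0 j]mxE lamqE h invr1 => /(_ erefl) /eqP.
by rewrite eq_lrshift.
Qed.

Lemma aqE j : aq j = quadc (fun e => ((le e)%:C)%C) lh (fun s => ls s ^+ 2)
    (fun s => (conjc (ls s))^-1 ^+ 2) j / (1 + lamq j ^+ 2).
Proof.
have mup := lamq_mup j; elim/all_quadc: j mup => i; rewrite /aq /lamq !quadcE => mup.
- have l0 : le i != 0 by rewrite gt_eqF // (lt_trans ltr01).
  have l2 : 1 + le i ^+ 2 != 0 by rewrite gt_eqF // ltr_wpDr ?sqr_ge0.
  have -> : ge i = le i / (1 + le i ^+ 2) by rewrite geE; field; rewrite ?l0 ?l2 ?[_ + 1]addrC ?l2 ?andbT.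
  by rewrite fmorph_div rmorphD rmorph1 rmorphXn.
- apply: (mulIf mup); rewrite mulfVK // ghE.
  have e : 1 + lh i ^+ 2 = (lh i + conjc (lh i)) * lh i by rewrite mulrDl [conjc _ * _]mulrC lh_conj expr2 addrC.
  rewrite e mulKf //; apply: contraNneq mup; rewrite e => ->; by rewrite mul0r.
- rewrite gsE; have l0 := ls_neq0 i; field; rewrite l0 mup /=.
  by move: mup; rewrite addrC.
- have c0 := conj_ls_neq0 i; have mup' := ls_mup i.
  have e : conjc (gs i) = (1 + (conjc (ls i)) ^- 2)^-1.
    by rewrite gsE fmorphV rmorphD rmorph1 fmorphV rmorphXn.
  have m2 : 1 + conjc (ls i) ^+ 2 != 0.
    by rewrite -[1](rmorph1 (@conjc R)) -rmorphXn -rmorphD conjc_eq0.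
  rewrite e; field; rewrite ?c0 ?m2 ?[_ + 1]addrC ?m2 ?andbT //.
Qed.

Lemma aq0 j : aq j != 0.
Proof.
rewrite aqE mulf_neq0 ?invr_eq0 ?lamq_mup //; elim/all_quadc: j => i; rewrite quadcE.
- exact: le_neq0.
- exact: lh_neq0.
- by rewrite expf_neq0 ?ls_neq0.
- by rewrite expf_neq0 // invr_eq0 conj_ls_neq0.
Qed.

Lemma tauq j : qta lamq aq sgq j = sgq j / quadc (fun e => ((le e)%:C)%C) lh (fun s => ls s ^+ 2)
    (fun s => (conjc (ls s))^-1 ^+ 2) j.
Proof. by rewrite /qta /qmu aqE divfK ?lamq_mup. Qed.

Lemma klamE : ((forall j, klam lamq (lsh j) = - lamq j) * (forall j, klam lamq (rsh j) = - (lamq j)^-1))%type.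
Proof. by split=> j; rewrite /klam csplitE. Qed.

Lemma conj_real (x : R) : conjc ((x%:C)%C) = (x%:C)%C.
Proof. exact: conjc_real. Qed.

Lemma conjN (x : C) : conjc (- x) = - conjc x.
Proof. exact: rmorphN. Qed.

Lemma conj_lh h : conjc (lh h) = (lh h)^-1.
Proof. by apply: (mulfI (lh_neq0 h)); rewrite lh_conj mulfV ?lh_neq0. Qed.

Lemma kkq c : klam lamq c * conjc (klam lamq (Rsq c)) = 1.
Proof.
elim/all_split: c; elim/all_quadc => i; rewrite !RsE !klamE /lamq !quadcE conjN mulrNN.
- by rewrite conjc_inv conj_real mulfV ?le_neq0.
- exact: lh_conj.
- by rewrite conjc_inv conjcK mulfV ?ls_neq0.
- by rewrite mulVf ?conj_ls_neq0.
- by rewrite conj_real mulVf ?le_neq0.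
- by rewrite conjc_inv conj_lh invrK mulVf ?lh_neq0.
- by rewrite invrK conjcK mulVf ?ls_neq0.
- by rewrite invrK conjc_inv mulfV ?conj_ls_neq0.
Qed.

Lemma quad_data_product : quad_data lamq aq sgq stq Rsq.
Proof.
split; [exact: lamq0|exact: aq0|exact: sgq0|exact: lamq_mu1|exact: lamq_mup| |exact: Rsq2|exact: kkq|].
  by apply: all_quadc => i; rewrite /stq !quadcE.
apply: all_quadc => i; rewrite /stq !quadcE !RsE !klamE tauq /qmu /lamq /sgq !quadcE !conjN.
- right; split=> //; have l0 := le_neq0 i.
    by rewrite rmorph1 mul1r conj_real; field.
  by rewrite rmorph1 mul1r conjc_inv conj_real; field.
- left; split=> //; have l0 := lh_neq0 i.
    by rewrite rmorph1 mul1r conj_lh; field.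
  by rewrite rmorph1 mul1r conjc_inv conj_lh invrK; field.
- left; split=> //; have l0 := ls_neq0 i.
    by rewrite conjc_inv conjcK; field.
  by rewrite !conjc_inv conjcK invrK; field.
- left; split=> //; have l0 := conj_ls_neq0 i.
    by rewrite rmorph1 mul1r; field.
  by rewrite rmorph1 mul1r conjc_inv; field.
Qed.

Lemma product_quadricE z : product_quadric ge gh gs z <-> quad_set aq stq (fun l => z 0 l).
Proof.
split=> [[h1 h2 h3 h4]|h].
  by apply: all_quadc => i; rewrite /stq /aq !quadcE.
by split=> i; have := h (_ i); [move=> /(_ ie)|move=> /(_ ih)|move=> /(_ is_)|move=> /(_ it_)]; rewrite /stq /aq !quadcE.
Qed.

End ProductQuadric.

Local Open Scope complex_scope.

Theorem theorem1p10 (R : realType) (es hs ss : nat)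
  (gamma_e : 'I_es -> R) (gamma_h : 'I_hs -> R) (gamma_s : 'I_ss -> R[i])
  (lambda_e : 'I_es -> R) (lambda_h : 'I_hs -> R[i]) (lambda_s : 'I_ss -> R[i])
  (M : set 'rV[R[i]]_((es + hs + (ss + ss)) + (es + hs + (ss + ss))))
  (gamma_eP : forall e, 0 < gamma_e e < 1 / 2)
  (gamma_hP : forall h, 1 / 2 < gamma_h h)
  (gamma_sP : forall s, 1 / 2 < complex.Re (gamma_s s) /\ 0 < complex.Im (gamma_s s))
  (lambda_eP : forall e, 1 < lambda_e e /\
     gamma_e e = (lambda_e e + (lambda_e e)^-1)^-1)
  (lambda_hP : forall h, [/\ `|lambda_h h| = 1, arg_in_0_pi2 (lambda_h h)
     & (gamma_h h)%:C = (lambda_h h + conjc (lambda_h h))^-1])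
  (lambda_sP : forall s, [/\ 1 < `|lambda_s s|, arg_in_0_pi2 (lambda_s s)
     & gamma_s s = (1 + (lambda_s s) ^- 2)^-1])
  (M_submanifold : analytic_submanifold_germ M)
  (M_formal : formally_equivalent M (product_quadric gamma_e gamma_h gamma_s))
  (distinct : distinct_eigenvalues lambda_e lambda_h lambda_s)
  (small_divisors : forall h, is_root_of_unity (lambda_h h ^+ 2) \/
     brjuno (lambda_h h ^+ 2)) :
  holomorphically_equivalent M (product_quadric gamma_e gamma_h gamma_s).
Proof.
have le1 e := (lambda_eP e).1; have geE e := (lambda_eP e).2.
have lh1 h : `|lambda_h h| = 1 by case: (lambda_hP h).
have ghE h : ((gamma_h h)%:C)%C = (lambda_h h + conjc (lambda_h h))^-1 by case: (lambda_hP h).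
have gh0 h : 0 < gamma_h h by apply: lt_trans (gamma_hP h); rewrite divr_gt0.
have ls1 s : 1 < `|lambda_s s| by case: (lambda_sP s).
have gsE s : gamma_s s = (1 + (lambda_s s) ^- 2)^-1 by case: (lambda_sP s).
have gs0 s : gamma_s s != 0.
  by apply/eqP => h; have [] := gamma_sP s; rewrite h /=; lra.
have cabs1 (z : R[i]) : cabs z = 1 -> `|z| = 1 by rewrite cabsE => ->.
have Q := quad_data_product le1 geE lh1 gh0 ghE ls1 gs0 gsE distinct.
apply: (quad_equivalence Q (@Rsq_swp es hs ss) _ (product_quadricE _ _ _)) => //.
apply: all_quadc => i; rewrite /lamq quadcE.
- by rewrite cabs_real gtr0_norm ?(lt_trans ltr01) // => h; have := le1 i; rewrite h ltxx.
- by move=> _; exact: small_divisors.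
- by move=> /cabs1 h; have := ls1 i; rewrite h ltxx.
- by move=> /cabs1; rewrite normfV normcJ => h; have := ls1 i; rewrite -[`|_|]invrK h invr1 ltxx.
Qed.
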